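(* Let $\Omega\subset\mathbb{R}^N$, $N\ge 2$, be a bounded domain with $\partial\Omega$ of class $\mathcal{C}^{0,1}$, let $d,h\in L^q(\Omega)$ for some $q>N/2$, let $\mu>0$ be a constant and assume $d\ge 0$ a.e. in $\Omega$. Then the boundary value problem $$-\Delta u=-d(x)u+\mu|\nabla u|^2+h(x),\qquad u\in H_0^1(\Omega)\cap L^\infty(\Omega),$$ has a solution if, and only if, $m_d>0$.
   Context: $\|w\|:=\left(\int_\Omega|\nabla w|^2\,dx\right)^{1/2}$ is the norm of $H_0^1(\Omega)$. Define $$W_d:=\{w\in H_0^1(\Omega): d(x)w(x)=0 \text{ a.e. in }\Omega,\ \|w\|=1\},$$ $$m_d:=\inf_{u\in W_d}\int_\Omega\big(|\nabla u|^2-\mu h(x)u^2\big)\,dx \ \text{ if } W_d\ne\emptyset,\qquad m_d:=+\infty\ \text{ if } W_d=\emptyset.$$ A solution is a function $u\in H_0^1(\Omega)\cap L^\infty(\Omega)$ satisfying the equation in the weak sense, i.e. $\int_\Omega\nabla u\cdot\nabla\varphi\,dx=\int_\Omega(-d u+\mu|\nabla u|^2+h)\varphi\,dx$ for all $\varphi\in H_0^1(\Omega)\cap L^\infty(\Omega)$. *)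

(* Defs.v *)
From HB Require Import structures.
From mathcomp Require Import all_boot all_order all_algebra.
From mathcomp Require Import all_classical all_reals all_analysis.

Set Implicit Arguments.
Unset Strict Implicit.
Unset Printing Implicit Defensive.
Import Order.TTheory GRing.Theory Num.Theory.
Import numFieldNormedType.Exports.

Local Open Scope classical_set_scope.
Local Open Scope ring_scope.

(* The product sigma-algebra on R^n (built as for n.-tuple in the library);
   since R is second countable it is the Borel sigma-algebra of 'rV[R]_n. *)
Definition measure_rV_display : measure_display -> measure_display.
Proof. exact. Qed.

Section measurable_rV.
Context {R : realType} (n : nat).

Let coord : 'I_n -> 'rV[R]_n -> R := fun i x => x 0 i.

Let rV_set0 : g_sigma_preimage coord set0.
Proof. exact: sigma_algebra0. Qed.

Let rV_setC A : g_sigma_preimage coord A -> g_sigma_preimage coord (~` A).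
Proof. exact: sigma_algebraC. Qed.

Let rV_bigcup (F : _^nat) : (forall i, g_sigma_preimage coord (F i)) ->
  g_sigma_preimage coord (\bigcup_i (F i)).
Proof. exact: sigma_algebra_bigcup. Qed.

HB.instance Definition _ :=
  @isMeasurable.Build (measure_rV_display default_measure_display)
    'rV[R]_n (g_sigma_preimage coord) rV_set0 rV_setC rV_bigcup.

End measurable_rV.

Lemma measurable_coord (R : realType) n (i : 'I_n) :
  measurable_fun [set: 'rV[R]_n] (fun x : 'rV[R]_n => x 0 i).
Proof.
move=> _ Y mY; rewrite setTI; apply: sub_sigma_algebra => /=.
rewrite -bigcup_seq/=; exists i => /=; first by rewrite mem_index_enum.
by exists Y => //; rewrite setTI.
Qed.

Lemma measurable_fun_rV d (T : measurableType d) (R : realType) n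
    (f : T -> 'rV[R]_n) :
  (forall i, measurable_fun [set: T] (fun x => f x 0 i)) ->
  measurable_fun [set: T] f.
Proof.
move=> mf; suff : g_sigma_preimage (fun i x => f x 0 i) `<=` measurable.
  rewrite (g_sigma_preimage_comp (fun i (x : 'rV[R]_n) => x 0 i) f) => sub.
  by move=> _ A mA; apply: sub; exists A.
apply: smallest_sub; first exact: sigma_algebra_measurable.
rewrite -bigcup_seq; apply: bigcup_sub => i _ A [B mB <-].
exact: mf.
Qed.

(* Lebesgue measure on R^n by iterated products, through R x R^n = R^(n+1). *)
Definition rV_cons (R : realType) n (p : R * 'rV[R]_n) : 'rV[R]_n.+1 :=
  \row_i (if unlift ord0 i is Some j then p.2 0 j else p.1).

Definition rV_uncons (R : realType) n (x : 'rV[R]_n.+1) : R * 'rV[R]_n :=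
  (x 0 ord0, \row_j x 0 (lift ord0 j)).

Lemma rV_consK (R : realType) n : cancel (@rV_cons R n) (@rV_uncons R n).
Proof.
move=> [a x]; rewrite /rV_uncons mxE unlift_none; congr pair.
by apply/rowP => j; rewrite !mxE liftK.
Qed.

Lemma rV_unconsK (R : realType) n : cancel (@rV_uncons R n) (@rV_cons R n).
Proof.
move=> x; apply/rowP => i; rewrite mxE.
by case: unliftP => [j ->|->] /=; rewrite ?mxE.
Qed.

Lemma measurable_rV_cons (R : realType) n :
  measurable_fun [set: R * 'rV[R]_n] (@rV_cons R n).
Proof.
apply: measurable_fun_rV => i; case: (unliftP ord0 i) => [j ->|->].
  under eq_fun do rewrite mxE liftK.
  exact: (measurableT_comp (@measurable_coord R n j) measurable_snd).
under eq_fun do rewrite mxE unlift_none.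
  exact: measurable_fst.
Qed.

Lemma measurable_rV_uncons (R : realType) n :
  measurable_fun [set: 'rV[R]_n.+1] (@rV_uncons R n).
Proof.
apply: measurable_fun_pair; first exact: measurable_coord.
apply: measurable_fun_rV => j; under eq_fun do rewrite mxE.
exact: measurable_coord.
Qed.

Section lebesgue_rV_step.
Local Open Scope ereal_scope.
Context {R : realType} (n : nat).
Variable m : {sigma_finite_measure set 'rV[R]_n -> \bar R}.


Definition lebesgue_rVS : set 'rV[R]_n.+1 -> \bar R :=
  pushforward (@lebesgue_measure R \x m) (@rV_cons R n).

Let lebesgue_rVS0 : lebesgue_rVS set0 = 0.
Proof. by rewrite /lebesgue_rVS /pushforward preimage_set0 measure0. Qed.

Let lebesgue_rVS_ge0 A : 0 <= lebesgue_rVS A.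
Proof. by apply: integral_ge0 => x _; exact: measure_ge0. Qed.

Let lebesgue_rVS_sigma_additive : semi_sigma_additive lebesgue_rVS.
Proof.
move=> F mF tF mUF; rewrite /lebesgue_rVS /pushforward preimage_bigcup.
have mcons A : measurable A -> measurable (@rV_cons R n @^-1` A).
  by move=> mA; rewrite -[X in measurable X]setTI; exact: measurable_rV_cons.
apply: measure_semi_sigma_additive => [k||]; first exact: mcons.
  apply/trivIsetP => i j _ _ ij; rewrite -preimage_setI.
  by move/trivIsetP : tF => /(_ _ _ _ _ ij) ->//; rewrite preimage_set0.
by rewrite -preimage_bigcup; exact: mcons.
Qed.

HB.instance Definition _ := isMeasure.Build _ _ _ lebesgue_rVS
  lebesgue_rVS0 lebesgue_rVS_ge0 lebesgue_rVS_sigma_additive.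

Let lebesgue_rVS_sigma_finite : sigma_finite setT lebesgue_rVS.
Proof.
have /sigma_finiteP[F [FT ndF Foo]] := sigma_finiteT (@lebesgue_measure R).
have /sigma_finiteP[G [GT ndG Goo]] := sigma_finiteT m.
pose H k := F k `*` G k.
have HT : \bigcup_k H k = setT.
  apply/seteqP; split=> // -[a x] _.
  have [i _ Fa] : (\bigcup_k F k) a by rewrite -FT.
  have [j _ Gx] : (\bigcup_k G k) x by rewrite -GT.
  exists (maxn i j) => //; split => /=.
    by move: Fa; exact/subsetPset/ndF/leq_maxl.
  by move: Gx; exact/subsetPset/ndG/leq_maxr.
have Hoo k : measurable (H k) /\ (@lebesgue_measure R \x m) (H k) < +oo.
  have [mF Fk] := Foo k; have [mG Gk] := Goo k.
  split; first exact: measurableX.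
  by rewrite product_measure1E// lte_mul_pinfty// ge0_fin_numE.
exists (fun k => @rV_uncons R n @^-1` H k) => [|k].
  by rewrite -preimage_bigcup HT preimage_setT.
have [mH Hk] := Hoo k; split.
  by rewrite -[X in measurable X]setTI; exact: measurable_rV_uncons.
rewrite /lebesgue_rVS /pushforward -comp_preimage.
rewrite (_ : _ \o _ = id) ?preimage_id//.
by apply/funext => p; exact: rV_consK.
Qed.

HB.instance Definition _ := Measure_isSigmaFinite.Build _ _ _ lebesgue_rVS
  lebesgue_rVS_sigma_finite.

End lebesgue_rV_step.

Fixpoint lebesgue_rV (R : realType) (n : nat) :
    {sigma_finite_measure set 'rV[R]_n -> \bar R} :=
  if n is k.+1 then lebesgue_rVS (lebesgue_rV R k) else \d_(0 : 'rV[R]_0).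

Lemma lebesgue_rV_box (R : realType) n (A : 'I_n -> set R) :
  (forall i, measurable (A i)) ->
  (lebesgue_rV R n [set x : 'rV[R]_n | forall i, A i (x 0%R i)] =
   \prod_(i < n) lebesgue_measure (A i))%E.
Proof.
elim: n A => [|n IHn] A mA.
  rewrite big_ord0 /= diracE (_ : [set _ | _] = setT) ?in_setT//.
  by apply/seteqP; split=> // x _ [].
rewrite big_ord_recl -IHn//= /lebesgue_rVS /pushforward.
rewrite -product_measure1E//; last first.
  rewrite (_ : mkset _ = \bigcap_i
      (if insub i is Some j then (fun x : 'rV[R]_n => x 0 j) @^-1` A (lift ord0 j)
       else setT)).
    apply: bigcap_measurable => // i _; case: insubP => // j _ _.
    by rewrite -[X in measurable X]setTI; exact: measurable_coord.
  apply/seteqP; split=> [x Ax i _|x Ax j]; first by case: insubP => [j _ _|_]; [exact: Ax|].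
  by have := Ax j I; rewrite valK.
  exact: mA.
congr (_ _); apply/seteqP; split=> [p Ap|p [Ap1 Ap2] i] /=.
  split=> [|j] /=; first by have := Ap ord0; rewrite mxE unlift_none.
  by have := Ap (lift ord0 j); rewrite mxE liftK.
by rewrite mxE; case: unliftP => [j ->|->]//; exact: Ap2.
Qed.

Section sobolev.
Context {R : realType} {N : nat}.
Implicit Types (Omega : set 'rV[R]_N) (u w f phi : 'rV[R]_N -> R).

Local Notation leb := (lebesgue_rV R N).

Definition e_ (i : 'I_N) : 'rV[R]_N := delta_mx 0 i.

Definition dotp (v w : 'rV[R]_N) : R := \sum_i v 0 i * w 0 i.

(* Functions on Omega are represented by total functions on R^N of which only
   the values on Omega matter. *)
Definition Lp (Omega : set 'rV[R]_N) (p : \bar R) : set ('rV[R]_N -> R) :=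
  [set f | f \_ Omega \in Lfun leb p].

Fixpoint Ck (k : nat) f : Prop :=
  continuous f /\
  if k is k'.+1 then
    forall i, (forall x, derivable f x (e_ i)) /\ Ck k' ('D_(e_ i) f)
  else True.

Definition Cc_infty Omega : set ('rV[R]_N -> R) := [set phi |
  [/\ forall k, Ck k phi,
      compact (closure [set x | phi x != 0]) &
      closure [set x | phi x != 0] `<=` Omega]].

Definition grad phi (x : 'rV[R]_N) : 'rV[R]_N := \row_i 'D_(e_ i) phi x.

Definition is_weak_grad Omega u (g : 'rV[R]_N -> 'rV[R]_N) : Prop :=
  forall i, Lp Omega 2%:E (fun x => g x 0 i) /\
    forall phi, Cc_infty Omega phi ->
      \int[leb]_(x in Omega) (u x * 'D_(e_ i) phi x) =
      - \int[leb]_(x in Omega) (g x 0 i * phi x).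

(* Meaningful on H1 Omega, where the weak gradient is unique a.e. in Omega. *)
Definition wgrad Omega u : 'rV[R]_N -> 'rV[R]_N :=
  xget (cst 0) (is_weak_grad Omega u).

Definition H1 Omega : set ('rV[R]_N -> R) :=
  [set u | Lp Omega 2%:E u /\ exists g, is_weak_grad Omega u g].

(* Closure of Cc_infty Omega in H1 Omega. *)
Definition H10 Omega : set ('rV[R]_N -> R) := [set u | H1 Omega u /\
  exists phi : nat -> 'rV[R]_N -> R, (forall n, Cc_infty Omega (phi n)) /\
    (fun n => \int[leb]_(x in Omega)
       ((u x - phi n x) ^+ 2 +
        dotp (wgrad Omega u x - grad (phi n) x)
             (wgrad Omega u x - grad (phi n) x))%:E)%E @ \oo --> 0%E].

Definition H10_norm Omega w : R :=
  Num.sqrt (\int[leb]_(x in Omega) dotp (wgrad Omega w x) (wgrad Omega w x)).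

Definition domain Omega : Prop := [/\ Omega !=set0, open Omega & connected Omega].

(* Near each boundary point, after an orthogonal change of coordinates (the
   matrix A), Omega is the strict epigraph, in the direction of the k-th new
   coordinate, of a Lipschitz function of the N - 1 remaining ones. *)
Definition boundary_C01 Omega : Prop :=
  forall x0, (closure Omega `\` interior Omega) x0 ->
  exists (r : R) (A : 'M[R]_N) (k : 'I_N) (gamma : 'rV[R]_N.-1 -> R),
    [/\ 0 < r, A *m A^T = 1%:M, lipschitz gamma &
        Omega `&` ball x0 r =
        [set x | gamma (col' k (x *m A)) < (x *m A) 0 k] `&` ball x0 r].

Definition W_ Omega (d : 'rV[R]_N -> R) : set ('rV[R]_N -> R) := [set w |
  [/\ H10 Omega w,
      {ae leb, forall x, Omega x -> d x * w x = 0} &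
      H10_norm Omega w = 1]].

(* The infimum of the empty set in \bar R is +oo. *)
Definition m_ Omega (d h : 'rV[R]_N -> R) (mu : R) : \bar R :=
  ereal_inf [set (\int[leb]_(x in Omega)
      (dotp (wgrad Omega u x) (wgrad Omega u x) - mu * h x * u x ^+ 2)%:E)%E
    | u in W_ Omega d].

Definition is_solution Omega (d h : 'rV[R]_N -> R) (mu : R) u : Prop :=
  [/\ H10 Omega u, Lp Omega +oo%E u &
    forall phi, H10 Omega phi -> Lp Omega +oo%E phi ->
      \int[leb]_(x in Omega) dotp (wgrad Omega u x) (wgrad Omega phi x) =
      \int[leb]_(x in Omega)
        ((- d x * u x + mu * dotp (wgrad Omega u x) (wgrad Omega u x) + h x)
         * phi x)].

End sobolev.

(* Main.v *)
(* Write y = e^(mu u): the equation becomes - Lap y = mu h y - d y ln y, the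
   Euler-Lagrange equation of
     J(y) = int |grad y|^2 - mu h y^2 + 2 d G(y),   G' (s) = s ln |s|,
   on 1 + H_0^1. If m_d > 0, a compactness argument shows that
   int |grad w|^2 - mu h w^2 + l d w^2 is coercive for some l; as G grows faster
   than any multiple of s^2, J is coercive and has a nonnegative minimiser. De
   Giorgi's iteration bounds it from above and, applied to - ln y, away from zero,
   and u = ln y / mu is a bounded solution. Conversely, if u is a bounded solution
   and d w = 0, testing with w^2 and completing the square gives
     int |grad w|^2 - mu h w^2 = int |grad w - mu w grad u|^2
       = int e^(2 mu u) |grad (e^(- mu u) w)|^2 >= c int w^2,
   which the smallness of the weight h with respect to the gradient improves to
   a bound by c' int |grad w|^2, so that m_d >= c' > 0.
   Only two facts about the domain enter: a Sobolev inequality with weight |h| + d,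
   where q > N / 2 is used, and Rellich's theorem. Both hold on H_0^1 of any
   bounded open set. *)
Require Import Defs.
From mathcomp Require Import all_boot all_order all_algebra.
From mathcomp Require Import all_classical all_reals all_analysis.
From mathcomp Require Import measurable_realfun ess_sup_inf ring lra.
Import Order.TTheory GRing.Theory Num.Theory.
Import numFieldNormedType.Exports.
Local Open Scope classical_set_scope.
Local Open Scope ring_scope.

Set Implicit Arguments.
Unset Strict Implicit.
Unset Printing Implicit Defensive.

(** * Real-valued integrals *)

(** The analysis takes place in an abstract space [H0]: the closure in L2 x L2 of the pairs (test
    function, gradient), where the second component need not be determined by the first. The domain
    is seen only through [energy_core], [rellich] and [sobolev_weight], which concern test pairs
    alone and pass to the closure. Two standard tools are avoided. Truncations and the chain rule
    need no mollification: smooth test functions are stable under softplus, and everything else is a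
    limit of such compositions. Weak compactness is replaced by a minimal energy argument with the
    parallelogram law, [H0_lsc], which produces a gradient for an L2 limit of functions of bounded
    energy. That a gradient is determined by its function is needed only to identify [H0] with
    [H10]; it follows from the fundamental lemma of the calculus of variations. In the minimisation,
    the entropy term need not be integrable and is only lower semicontinuous. Hence the class [adm],
    the bounded test functions in the Euler equation, and the truncations wherever a natural test
    function is unbounded. *)

Lemma cvg_sqr (R : realType) (u : nat -> R) (l : R) :
  u @ \oo --> l -> (fun n => u n ^+ 2) @ \oo --> l ^+ 2.
Proof. by move=> ul; rewrite expr2; apply: cvgM. Qed.

Lemma cvg_sqr0 (R : realType) (u : nat -> R) (l : R) :
  (fun n => (l - u n) ^+ 2) @ \oo --> (0 : R) -> u @ \oo --> l.
Proof.
move=> /(continuous_cvg _ (@sqrt_continuous R 0)); rewrite sqrtr0 => h.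
apply/cvgrPdist_le => e e0; move/cvgrPdist_le : h => /(_ e e0).
by apply: filterS => n; rewrite sub0r normrN /= sqrtr_sqr normr_id.
Qed.

Lemma cvg_norm_le (R : realType) (u : nat -> R) (l A : R) :
  u @ \oo --> l -> (forall n, `|u n| <= A) -> `|l| <= A.
Proof.
move=> ul uA; have h : (fun n => `|u n|) @ \oo --> `|l| by exact: cvg_norm.
by apply: (cvgr_to_le h); exact: nearW.
Qed.

Lemma cvg_fsum (R : realType) (I : finType) (F : I -> nat -> R) (l : I -> R) :
  (forall i, F i @ \oo --> l i) -> (fun n => \sum_i F i n) @ \oo --> \sum_i l i.
Proof.
move=> Fl; elim: (index_enum I) => [|i r IHr].
  rewrite big_nil (_ : (fun n => _) = fun=> 0); first exact: cvg_cst.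
  by apply/funext => n; rewrite big_nil.
rewrite big_cons (_ : (fun n => _) = fun n => F i n + \sum_(j <- r) F j n).
  exact: cvgD.
by apply/funext => n; rewrite big_cons.
Qed.

Lemma cvg_geom0 (R : realType) (q : R) : 0 <= q < 1 -> (fun n => q ^+ n) @ \oo --> (0 : R).
Proof. by move=> /andP[q0 q1]; apply: cvg_expr; rewrite ger0_norm. Qed.

Lemma geom_sum_le (R : realType) (q : R) n : 0 <= q < 1 ->
  \sum_(0 <= i < n) q ^+ i <= (1 - q)^-1.
Proof.
move=> /andP[q0 q1]; have q1' : 1 - q != 0 by rewrite subr_eq0 gt_eqF.
have -> : \sum_(0 <= i < n) q ^+ i = (1 - q)^-1 - (1 - q)^-1 * q ^+ n.
  elim: n => [|n IHn]; first by rewrite big_nil expr0 mulr1 subrr.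
  by rewrite big_nat_recr//= IHn exprS; field.
by rewrite gerBl mulr_ge0 ?exprn_ge0// invr_ge0 subr_ge0 ltW.
Qed.

Lemma half_ge0_lt1 (R : realType) : 0 <= (2^-1 : R) < 1.
Proof. by rewrite invr_ge0 ler0n invf_lt1// ltr1n. Qed.

Section integral_calculus.
Context d (T : measurableType d) (R : realType).
Variable nu : {measure set T -> \bar R}.
Implicit Types (f g : T -> R).

Local Notation meas := (measurable_fun [set: T]).

Definition ig (f : T -> R) := nu.-integrable setT (EFin \o f).
Definition RI (f : T -> R) : R := \int[nu]_x f x.

Lemma ig_def f : ig f = nu.-integrable setT (EFin \o f). Proof. by []. Qed.
Lemma RI_def f : RI f = \int[nu]_x f x. Proof. by []. Qed.

Lemma ig_meas f : ig f -> meas f.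
Proof. by move=> /measurable_int/measurable_EFinP. Qed.

Lemma ig_eq f g : f =1 g -> ig f -> ig g.
Proof. by move=> /funext ->. Qed.

Lemma RI_eq f g : f =1 g -> RI f = RI g.
Proof. by move=> /funext ->. Qed.

Lemma igD f g : ig f -> ig g -> ig (fun x => f x + g x).
Proof. by move=> fi gi; exact: (integrableD measurableT fi gi). Qed.

Lemma igB f g : ig f -> ig g -> ig (fun x => f x - g x).
Proof. by move=> fi gi; exact: (integrableB measurableT fi gi). Qed.

Lemma igZ k f : ig f -> ig (fun x => k * f x).
Proof. by move=> fi; exact: (integrableZl measurableT k fi). Qed.

Lemma igN f : ig f -> ig (fun x => - f x).
Proof. by move=> fi; exact: (integrableN fi). Qed.

Lemma ig0 : ig (fun _ => 0).
Proof. exact: integrable0. Qed.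

Lemma ig_le f g : meas f -> (forall x, `|f x| <= g x) -> ig g -> ig f.
Proof.
move=> mf fg; apply: le_integrable => //; first exact/measurable_EFinP.
by move=> x _ /=; rewrite lee_fin (le_trans (fg x))// ler_norm.
Qed.

Lemma ig_norm f : ig f -> ig (fun x => `|f x|).
Proof. by move=> *; exact: integrable_norm. Qed.

Lemma ig_ae f g : meas g -> {ae nu, forall x, f x = g x} -> ig f -> ig g.
Proof.
move=> mg fg /integrableP[mf foo]; apply/integrableP; split.
  exact/measurable_EFinP.
rewrite -(_ : \int[nu]_x `|(EFin \o f) x| = \int[nu]_x `|(EFin \o g) x|)%E//.
apply: ge0_ae_eq_integral => //.
- exact: measurableT_comp.
- by apply: measurableT_comp => //; exact/measurable_EFinP.
- by apply: filterS fg => x fgx _ /=; rewrite fgx.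
Qed.

Lemma RI_ae f g : meas f -> meas g -> {ae nu, forall x, f x = g x} -> RI f = RI g.
Proof.
move=> mf mg fg; congr fine; apply: ae_eq_integral => //.
- exact/measurable_EFinP.
- exact/measurable_EFinP.
- by apply: filterS fg => x fgx _ /=; rewrite fgx.
Qed.

Lemma RIE f : ig f -> (RI f)%:E = (\int[nu]_x (f x)%:E)%E.
Proof. by move=> fi; rewrite /RI /Rintegral fineK//; exact: integrable_fin_num. Qed.

Lemma RID f g : ig f -> ig g -> RI (fun x => f x + g x) = RI f + RI g.
Proof. by move=> *; exact: RintegralD. Qed.

Lemma RIB f g : ig f -> ig g -> RI (fun x => f x - g x) = RI f - RI g.
Proof. by move=> *; exact: RintegralB. Qed.

Lemma RIZ k f : ig f -> RI (fun x => k * f x) = k * RI f.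
Proof. by move=> *; exact: RintegralZl. Qed.

Lemma RIN f : ig f -> RI (fun x => - f x) = - RI f.
Proof.
by move=> fi; rewrite -mulN1r -RIZ//; apply: RI_eq => x; rewrite mulN1r.
Qed.

Lemma RI0 : RI (fun _ => 0) = 0.
Proof. by rewrite /RI /Rintegral integral0. Qed.

Lemma RI_ge0 f : (forall x, 0 <= f x) -> 0 <= RI f.
Proof. by move=> f0; exact: Rintegral_ge0. Qed.

Lemma RI_le f g : ig f -> ig g -> (forall x, f x <= g x) -> RI f <= RI g.
Proof. by move=> fi gi fg; apply: le_Rintegral. Qed.

Lemma RI_norm f : ig f -> `|RI f| <= RI (fun x => `|f x|).
Proof. by move=> fi; apply: le_normr_Rintegral. Qed.

Lemma RI_eq0 f : (forall x, 0 <= f x) -> ig f -> RI f = 0 ->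
  {ae nu, forall x, f x = 0}.
Proof.
move=> f0 fi RI0f.
have : (\int[nu]_x `|(EFin \o f) x| = 0)%E.
  under eq_integral do rewrite /= ger0_norm//.
  by rewrite -RIE// RI0f.
move/(ae_eq_integral_abs nu measurableT (measurable_int _ fi)).1.
by apply: filterS => x /(_ I)[].
Qed.

Lemma igRI_of_lty f : meas f -> (forall x, 0 <= f x) ->
  (\int[nu]_x (f x)%:E < +oo)%E -> ig f.
Proof.
move=> mf f0 foo; apply/integrableP; split; first exact/measurable_EFinP.
by under eq_integral do rewrite /= ger0_norm//.
Qed.

Lemma cvg_EFinn (u : nat -> R) l : u @ \oo --> l -> (fun n => (u n)%:E) @ \oo --> l%:E.
Proof. by move=> ul; apply: cvg_EFin => //; exact: nearW. Qed.

(** Fatou's lemma in the form used throughout: the bounds [a_] may vary with n, and integrability of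
    the limit is concluded rather than assumed, since both come from the same estimate. *)
Lemma RI_fatou (f_ : nat -> T -> R) f (a_ : nat -> R) (a : R) :
  meas f -> (forall x, 0 <= f x) -> (forall n, ig (f_ n)) ->
  (forall n x, 0 <= f_ n x) ->
  {ae nu, forall x, f_ ^~ x @ \oo --> f x} ->
  (forall n, RI (f_ n) <= a_ n) -> a_ @ \oo --> a ->
  ig f /\ RI f <= a.
Proof.
move=> mf f0 fi fn0 fnf fa aa.
have mf_ n : measurable_fun [set: T] (fun x => (f_ n x)%:E).
  by apply/measurable_EFinP; exact: ig_meas.
have h0 x : (0 <= limn_einf (fun n => (f_ n x)%:E))%E.
  rewrite limn_einf_lim; apply: lime_ge; first exact: is_cvg_einfs.
  by apply: nearW => n; apply: le_ereal_inf_tmp => _ [m _ <-]; rewrite lee_fin fn0.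
have key : (\int[nu]_x (f x)%:E <= a%:E)%E.
  rewrite (_ : \int[nu]_x (f x)%:E =
               \int[nu]_x limn_einf (fun n => (f_ n x)%:E))%E; last first.
    apply: ge0_ae_eq_integral => //.
    - exact/measurable_EFinP.
    - apply: measurableT_comp => //; apply: measurable_fun_limn_esup => n.
      exact: measurableT_comp.
    - by move=> x _; rewrite lee_fin.
    - apply: filterS fnf => x fx _; apply/esym.
      by have [] := cvg_limn_einf_sup (cvg_EFinn fx).
  apply: le_trans.
    apply: (@fatou _ _ _ nu _ measurableT (fun n x => (f_ n x)%:E)) => //.
    by move=> n x _; rewrite lee_fin.
  have -> : a%:E = limn_einf (fun n => (a_ n)%:E).
    by have [] := cvg_limn_einf_sup (cvg_EFinn aa).
  rewrite !limn_einf_lim; apply: lee_lim; [exact: is_cvg_einfs..|].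
  apply: nearW => n; apply: le_ereal_inf_tmp => _ [m nm <-].
  apply: (@le_trans _ _ (\int[nu]_x (f_ m x)%:E)%E).
    by apply: ereal_inf_lbound; exists m.
  by rewrite -RIE// lee_fin.
have fi' : ig f by apply: igRI_of_lty => //; rewrite (le_lt_trans key)// ltry.
by split => //; rewrite -lee_fin RIE.
Qed.

Lemma RI_dct (f_ : nat -> T -> R) f g :
  (forall n, meas (f_ n)) -> meas f ->
  {ae nu, forall x, f_ ^~ x @ \oo --> f x} -> ig g ->
  (forall n x, `|f_ n x| <= g x) ->
  ig f /\ (fun n => RI (f_ n)) @ \oo --> RI f.
Proof.
move=> mf_ mf ff gi fg.
have [] := @dominated_convergence _ _ _ nu _ measurableT
  (fun n => EFin \o f_ n) (EFin \o f) (EFin \o g).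
- by move=> n; exact/measurable_EFinP.
- exact/measurable_EFinP.
- by apply: filterS ff => x fx _; exact: cvg_EFinn.
- exact: gi.
- by apply: aeW => x n _; rewrite lee_fin.
move=> fi _ h2; split => //.
apply: (@fine_cvg _ _ _ _ (fun n => \int[nu]_x (f_ n x)%:E)%E).
by rewrite RIE.
Qed.

Lemma RI_dct0 (f_ : nat -> T -> R) g :
  (forall n, meas (f_ n)) -> {ae nu, forall x, f_ ^~ x @ \oo --> (0 : R)} -> ig g ->
  (forall n x, `|f_ n x| <= g x) -> (fun n => RI (f_ n)) @ \oo --> (0 : R).
Proof.
move=> mf_ ff gi fg; rewrite -RI0.
by have [] := @RI_dct f_ (fun=> 0) g mf_ (@measurable_cst _ _ T R setT 0) ff gi fg.
Qed.

Definition L2 f := meas f /\ ig (fun x => f x ^+ 2).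

Lemma L2_ext f g : f =1 g -> L2 f -> L2 g.
Proof. by move=> /funext ->. Qed.

Lemma L2_mul f g : L2 f -> L2 g -> ig (fun x => f x * g x).
Proof.
move=> [mf fi] [mg gi]; apply: ig_le (igD fi gi); first exact: measurable_funM.
move=> x; rewrite normrM.
have := sqr_ge0 (`|f x| - `|g x|); have := sqr_ge0 (f x); have := sqr_ge0 (g x).
rewrite -(real_normK (num_real (f x))) -(real_normK (num_real (g x))); nra.
Qed.

Lemma L2Z k f : L2 f -> L2 (fun x => k * f x).
Proof.
move=> [mf fi]; split; first exact: measurable_funM.
by apply: ig_eq (igZ (k ^+ 2) fi) => x; rewrite exprMn.
Qed.

Lemma L2D f g : L2 f -> L2 g -> L2 (fun x => f x + g x).
Proof.
move=> f2 g2; have fg := L2_mul f2 g2; case: f2 => mf fi; case: g2 => mg gi.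
split; first exact: measurable_funD.
by apply: ig_eq (igD (igD fi gi) (igZ 2 fg)) => x; ring.
Qed.

Lemma L2N f : L2 f -> L2 (fun x => - f x).
Proof. by move=> /(L2Z (-1)); apply: L2_ext => x; rewrite mulN1r. Qed.

Lemma L2B f g : L2 f -> L2 g -> L2 (fun x => f x - g x).
Proof. by move=> f2 g2; apply: L2D f2 (L2N g2). Qed.

Lemma L2_le f g : meas f -> (forall x, `|f x| <= `|g x|) -> L2 g -> L2 f.
Proof.
move=> mf fg [mg gi]; split => //; apply: ig_le gi; first exact: measurable_funX.
move=> x; rewrite normrX -[leRHS]real_normK ?num_real//.
by rewrite ler_sqr ?nnegrE.
Qed.

Lemma L2_bM (M : R) f (b : T -> R) : meas b -> (forall x, `|b x| <= M) -> L2 f ->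
  L2 (fun x => b x * f x).
Proof.
move=> mb bM f2; have /(L2_le _ _) : L2 (fun x => M * f x) by exact: L2Z.
apply; first by apply: measurable_funM => //; case: f2.
move=> x; rewrite !normrM ler_pM//; exact: le_trans (ler_norm _).
Qed.

Lemma L2_norm f : L2 f -> L2 (fun x => `|f x|).
Proof.
move=> f2; apply: L2_le (f2); last by move=> x; rewrite normr_id.
by apply: measurableT_comp => //; case: f2.
Qed.

Lemma L2_ae f g : meas g -> {ae nu, forall x, f x = g x} -> L2 f -> L2 g.
Proof.
move=> mg fg [mf fi]; split => //; apply: ig_ae fi.
  exact: measurable_funX.
by apply: filterS fg => x ->.
Qed.

Lemma RI_sqrD f g : L2 f -> L2 g ->
  RI (fun x => (f x + g x) ^+ 2) <=
  2 * RI (fun x => f x ^+ 2) + 2 * RI (fun x => g x ^+ 2).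
Proof.
move=> f2 g2; have [_ fgi] := L2D f2 g2; case: f2 => _ fi; case: g2 => _ gi.
rewrite -!RIZ// -RID; [|exact: igZ..].
apply: RI_le => //; first by apply: igD; exact: igZ.
by move=> x; have := sqr_ge0 (f x - g x); nra.
Qed.

(** By monotone convergence the sum of the series has a finite integral, so it is finite almost
    everywhere. *)
Lemma ae_summable (s : nat -> T -> R) (C : R) :
  (forall n, ig (s n)) -> (forall n x, 0 <= s n x) ->
  (forall n, \sum_(0 <= i < n) RI (s i) <= C) ->
  {ae nu, forall x, exists M, forall n, \sum_(0 <= i < n) s i x <= M}.
Proof.
move=> si s0' sC.
have s0 n x : (0 <= (s n x)%:E)%E by rewrite lee_fin.
have ms n : measurable_fun [set: T] (fun x => (s n x)%:E).
  by apply/measurable_EFinP; exact: ig_meas.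
pose S x := (\sum_(n <oo) (s n x)%:E)%E.
have S0 x : (0 <= S x)%E by apply: nneseries_ge0.
have mS : measurable_fun [set: T] S.
  by apply: ge0_emeasurable_sum => // k x _ _.
have tot : (\int[nu]_x S x < +oo)%E.
  rewrite integral_nneseries//.
  apply: (@le_lt_trans _ _ C%:E); last exact: ltry.
  apply: lime_le; first by apply: is_cvg_nneseries => n _ _; exact: integral_ge0.
  apply: nearW => n; rewrite (eq_bigr (fun i => (RI (s i))%:E)); last first.
    by move=> k _; rewrite RIE.
  by rewrite sumEFin lee_fin.
have Sfin : {ae nu, forall x, S x \is a fin_num}.
  have /(integrable_ae measurableT) : nu.-integrable setT S.
    apply/integrableP; split => //.
    by under eq_integral do rewrite gee0_abs//.
  by apply: filterS => x /(_ I).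
apply: filterS Sfin => x Sx; exists (fine (S x)) => n.
rewrite -lee_fin fineK// -sumEFin.
exact: nneseries_lim_ge.
Qed.

(** The rate 8^-n leaves room for the weight 2^n: the weighted integrals are at most 4^-n, and the
    bound on the sums then makes the squares decay pointwise like 2^-n. *)
Lemma ae_summable_fast (f_ : nat -> T -> R) :
  (forall n, L2 (f_ n)) ->
  (forall n, RI (fun x => f_ n x ^+ 2) <= 8^-1 ^+ n) ->
  {ae nu, forall x, exists M, forall n, \sum_(0 <= i < n) 2 ^+ i * f_ i x ^+ 2 <= M}.
Proof.
move=> f2 fast; apply: (@ae_summable (fun i x => 2 ^+ i * f_ i x ^+ 2) (1 - 4^-1)^-1).
- by move=> n; apply: igZ; have [] := f2 n.
- by move=> n x; rewrite mulr_ge0 ?sqr_ge0 ?exprn_ge0.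
move=> n; apply: le_trans (_ : \sum_(0 <= i < n) (4^-1 : R) ^+ i <= _); last first.
  by rewrite geom_sum_le// invr_ge0 ler0n invf_lt1// ltr1n.
apply: ler_sum => k _; rewrite RIZ; last by have [] := f2 k.
apply: le_trans (ler_wpM2l (exprn_ge0 _ _) (fast k)) _ => //.
by rewrite -exprMn (_ : 2 / 8 = 4^-1 :> R)//; field.
Qed.

Lemma ae_cvg_of_fast0 (f_ : nat -> T -> R) f :
  (forall n, L2 (fun x => f x - f_ n x)) ->
  (forall n, RI (fun x => (f x - f_ n x) ^+ 2) <= 8^-1 ^+ n) ->
  {ae nu, forall x, f_ ^~ x @ \oo --> f x}.
Proof.
move=> f2 fast; have := ae_summable_fast f2 fast.
apply: filterS => x [M bM].
have bnd n : (f x - f_ n x) ^+ 2 <= M * 2^-1 ^+ n.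
  rewrite exprVn ler_pdivlMr ?exprn_gt0// mulrC.
  apply: le_trans (bM n.+1); rewrite big_nat_recr//= lerDr.
  by apply: sumr_ge0 => i _; rewrite mulr_ge0 ?sqr_ge0 ?exprn_ge0.
have : (fun n => (f x - f_ n x) ^+ 2) @ \oo --> (0 : R).
  apply: (@squeeze_cvgr _ _ _ _ (fun=> 0) (fun n => M * 2^-1 ^+ n)).
  - by apply: nearW => n; rewrite bnd sqr_ge0.
  - exact: cvg_cst.
  - rewrite -(mulr0 M); apply: cvgMr; exact: cvg_geom0 (half_ge0_lt1 R).
exact: cvg_sqr0.
Qed.

Lemma ae_cvg_of_fast (f_ : nat -> T -> R) :
  (forall n, L2 (f_ n)) ->
  (forall n, RI (fun x => (f_ n.+1 x - f_ n x) ^+ 2) <= 8^-1 ^+ n) ->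
  {ae nu, forall x, cvg (f_ ^~ x @ \oo)}.
Proof.
move=> f2 fast.
have := ae_summable_fast (fun n => L2B (f2 n.+1) (f2 n)) fast.
apply: filterS => x [M bM].
pose u (k : nat) := f_ k.+1 x - f_ k x.
have : cvgn (series u).
  apply: normed_cvg; apply: nondecreasing_is_cvgn.
    apply: nondecreasing_series => k _ _; exact: normr_ge0.
  exists (M + (1 - 2^-1)^-1) => _ [n _ <-].
  rewrite /series/=.
  (* Since 2^i (|u_i| - 2^-i)^2 >= 0, each |u_i| is at most 2^i u_i^2 + 2^-i, and both parts have
     bounded sums. *)
  apply: le_trans (_ : \sum_(0 <= i < n) (2 ^+ i * u i ^+ 2 + 2^-1 ^+ i) <= _); last first.
    rewrite big_split/=; apply: lerD => //; apply: geom_sum_le.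
    exact: half_ge0_lt1.
  apply: ler_sum => k _.
  have e : (2 : R) ^+ k * 2^-1 ^+ k = 1 by rewrite -exprMn divff// expr1n.
  rewrite -(real_normK (num_real (u k))).
  have b0 : 0 <= (2^-1 : R) ^+ k by rewrite exprn_ge0.
  have c0 : 0 <= (2 : R) ^+ k by rewrite exprn_ge0.
  have a0 := normr_ge0 (u k).
  set a := `|u k| in a0 *; set b := 2^-1 ^+ k in b0 e *; set c := 2 ^+ k in c0 e *.
  have : 0 <= c * (a - b) ^+ 2 by rewrite mulr_ge0// sqr_ge0.
  have -> : c * (a - b) ^+ 2 = c * a ^+ 2 - 2 * a * (c * b) + b * (c * b) by ring.
  by rewrite e !mulr1; clear -a0 b0 c0 e; nra.
move=> /cvg_ex[l ul]; apply/cvg_ex; exists (l + f_ 0%N x).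
rewrite (_ : (fun n => f_ n x) = (fun n => series u n + f_ 0%N x)); last first.
  by apply/funext => n; rewrite /series/= telescope_sumr// subrK.
by apply: cvgD => //; exact: cvg_cst.
Qed.

(** Riesz-Fischer for a sequence that is already Cauchy at the rate 8^-n; Fatou's lemma along the
    tail transfers the rate to the limit. *)
Lemma L2_complete_fast (f_ : nat -> T -> R) :
  (forall n, L2 (f_ n)) ->
  (forall n m, (n <= m)%N -> RI (fun x => (f_ m x - f_ n x) ^+ 2) <= 8^-1 ^+ n) ->
  exists f, [/\ L2 f, {ae nu, forall x, f_ ^~ x @ \oo --> f x} &
    forall n, RI (fun x => (f x - f_ n x) ^+ 2) <= 8^-1 ^+ n].
Proof.
move=> f2 fast.
have aecv := ae_cvg_of_fast f2 (fun n => fast n n.+1 (leqnSn n)).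
(* The upper limit is measurable on the whole space, without an exceptional set, and it is the limit
   wherever the latter exists. *)
pose f x := fine (limn_esup (fun n => (f_ n x)%:E)).
have fE : {ae nu, forall x, f_ ^~ x @ \oo --> f x}.
  apply: filterS aecv => x /cvg_ex[l fl].
  by rewrite /f; have [_ ->] := cvg_limn_einf_sup (cvg_EFinn fl).
have mf : meas f.
  apply: measurableT_comp => //; apply: measurable_fun_limn_esup => n.
  by apply/measurable_EFinP; case: (f2 n).
have main n : ig (fun x => (f x - f_ n x) ^+ 2) /\
    RI (fun x => (f x - f_ n x) ^+ 2) <= 8^-1 ^+ n.
  have := (@RI_fatou (fun k x => (f_ (n + k)%N x - f_ n x) ^+ 2)
    (fun x => (f x - f_ n x) ^+ 2) (fun=> 8^-1 ^+ n) (8^-1 ^+ n)); apply.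
  - by apply: measurable_funX; apply: measurable_funB => //; case: (f2 n).
  - by move=> x; exact: sqr_ge0.
  - by move=> k; have [] := L2B (f2 (n + k)%N) (f2 n).
  - by move=> k x; exact: sqr_ge0.
  - apply: filterS fE => x fx; apply: cvg_sqr; apply: cvgB; last exact: cvg_cst.
    rewrite (_ : (fun k => _) = (fun k => f_ (k + n)%N x)); last first.
      by apply/funext => k; rewrite addnC.
    by move: fx; rewrite -(cvg_shiftn n).
  - by move=> k; apply: fast; rewrite leq_addr.
  - exact: cvg_cst.
exists f; split => //; last by move=> n; have [] := main n.
have /(L2D (f2 0%N)) : L2 (fun x => f x - f_ 0%N x).
  split; last by have [] := main 0%N.
  by apply: measurable_funB => //; case: (f2 0%N).
by apply: L2_ext => x; rewrite addrC subrK.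
Qed.

Lemma RI_CS f g : L2 f -> L2 g ->
  RI (fun x => f x * g x) ^+ 2 <= RI (fun x => f x ^+ 2) * RI (fun x => g x ^+ 2).
Proof.
move=> f2 g2; have fg := L2_mul f2 g2.
have fi := f2.2; have gi := g2.2.
have q t : 0 <= RI (fun x => f x ^+ 2) + 2 * t * RI (fun x => f x * g x) +
    t ^+ 2 * RI (fun x => g x ^+ 2).
  rewrite -!RIZ// -!RID//; try (repeat (first [exact: fi|exact: gi|exact: fg|apply: igD|apply: igZ])).
  by apply: RI_ge0 => x; have := sqr_ge0 (f x + t * g x); nra.
have A0 : 0 <= RI (fun x => f x ^+ 2) by apply: RI_ge0 => x; exact: sqr_ge0.
have B0 : 0 <= RI (fun x => g x ^+ 2) by apply: RI_ge0 => x; exact: sqr_ge0.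
move: q A0 B0; set A := RI _; set B := RI (fun x => g x ^+ 2); set C := RI _.
move=> q A0 B0; have [B00|Bn0] := eqVneq B 0.
  rewrite B00 mulr0; have [->|C0] := eqVneq C 0; first by rewrite expr0n.
  (* With B = 0 the polynomial is affine in t; at this t its value is -1. *)
  have := q (- (A + 1) / (2 * C)); rewrite B00 mulr0 addr0.
  have -> : 2 * (- (A + 1) / (2 * C)) * C = - (A + 1) by field.
  lra.
have := q (- C / B).
have -> : A + 2 * (- C / B) * C + (- C / B) ^+ 2 * B = (A * B - C ^+ 2) / B.
  by field.
by rewrite pmulr_lge0 ?invr_gt0 ?lt_def ?Bn0// subr_ge0.
Qed.

End integral_calculus.

(** * Energy spaces *)

Section dotp_theory.
Context (R : realType) (N : nat).
Implicit Types (v w z : 'rV[R]_N).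

Lemma dotpC v w : dotp v w = dotp w v.
Proof. by apply: eq_bigr => i _; rewrite mulrC. Qed.

Lemma dotpDl v w z : dotp (v + w) z = dotp v z + dotp w z.
Proof. by rewrite -big_split; apply: eq_bigr => i _; rewrite mxE mulrDl. Qed.

Lemma dotpZl a v w : dotp (a *: v) w = a * dotp v w.
Proof. by rewrite mulr_sumr; apply: eq_bigr => i _; rewrite mxE mulrA. Qed.

Lemma dotpDr v w z : dotp z (v + w) = dotp z v + dotp z w.
Proof. by rewrite dotpC dotpDl !(dotpC z). Qed.

Lemma dotpZr a v w : dotp w (a *: v) = a * dotp w v.
Proof. by rewrite dotpC dotpZl dotpC. Qed.

Lemma dotpNl v w : dotp (- v) w = - dotp v w.
Proof. by rewrite -scaleN1r dotpZl mulN1r. Qed.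

Lemma dotpNr v w : dotp w (- v) = - dotp w v.
Proof. by rewrite dotpC dotpNl dotpC. Qed.

Definition dotpE := (dotpDl, dotpDr, dotpNl, dotpNr, dotpZl, dotpZr).

Lemma dotp_ge0 v : 0 <= dotp v v.
Proof. by apply: sumr_ge0 => i _; rewrite -expr2 sqr_ge0. Qed.

Lemma dotp_coord v i : v 0 i ^+ 2 <= dotp v v.
Proof.
rewrite /dotp (bigD1 i)//= -expr2 lerDl.
by apply: sumr_ge0 => j _; rewrite -expr2 sqr_ge0.
Qed.

Lemma dotp0l v : dotp 0 v = 0.
Proof. by rewrite -(scale0r 0) dotpZl mul0r. Qed.

Lemma dotpD_le v w : dotp (v + w) (v + w) <= 2 * dotp v v + 2 * dotp w w.
Proof.
have := dotp_ge0 (v - w); rewrite !dotpE (dotpC w v); lra.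
Qed.

End dotp_theory.

Section vector_L2.
Context d (X : measurableType d) (R : realType) (N : nat).
Variable nu : {measure set X -> \bar R}.
Implicit Types (u v b : X -> R) (g h : X -> 'rV[R]_N).

Local Notation L2 := (L2 nu).
Local Notation ig := (ig nu).
Local Notation RI := (RI nu).

Definition L2v g := forall i, L2 (fun x => g x 0 i).

Lemma ig_sum (I : finType) (F : I -> X -> R) :
  (forall i, ig (F i)) -> ig (fun x => \sum_i F i x).
Proof.
move=> iF; pose s := enum I.
suff : ig (fun x => \sum_(i <- index_enum I) F i x) by [].
elim: (index_enum I) => [|i r IHr].
  by apply: ig_eq (ig0 nu) => x; rewrite big_nil.
by apply: ig_eq (igD (iF i) IHr) => x; rewrite big_cons.
Qed.

Lemma RI_sum (I : finType) (F : I -> X -> R) :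
  (forall i, ig (F i)) -> RI (fun x => \sum_i F i x) = \sum_i RI (F i).
Proof.
move=> iF.
suff [] : ig (fun x => \sum_(i <- index_enum I) F i x) /\
  RI (fun x => \sum_(i <- index_enum I) F i x) = \sum_(i <- index_enum I) RI (F i) by [].
elim: (index_enum I) => [|i r [IHr IHr']].
  split; first by apply: ig_eq (ig0 nu) => x; rewrite big_nil.
  by rewrite big_nil -[RHS](RI0 nu); apply: RI_eq => x; rewrite big_nil.
split; first by apply: ig_eq (igD (iF i) IHr) => x; rewrite big_cons.
rewrite big_cons -IHr' -RID//; apply: RI_eq => x; by rewrite big_cons.
Qed.

Lemma L2v_dot g h : L2v g -> L2v h -> ig (fun x => dotp (g x) (h x)).
Proof. by move=> g2 h2; apply: ig_sum => i; exact: L2_mul. Qed.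

Lemma L2vD g h : L2v g -> L2v h -> L2v (fun x => g x + h x).
Proof. by move=> g2 h2 i; apply: L2_ext (L2D (g2 i) (h2 i)) => x; rewrite mxE. Qed.

Lemma L2vZ a g : L2v g -> L2v (fun x => a *: g x).
Proof. by move=> g2 i; apply: L2_ext (L2Z a (g2 i)) => x; rewrite mxE. Qed.

Lemma L2vN g : L2v g -> L2v (fun x => - g x).
Proof. by move=> g2 i; apply: L2_ext (L2N (g2 i)) => x; rewrite mxE. Qed.

Lemma L2vB g h : L2v g -> L2v h -> L2v (fun x => g x - h x).
Proof. by move=> g2 h2; apply: L2vD g2 (L2vN h2). Qed.

Lemma L2v_bM (M : R) b g : measurable_fun setT b -> (forall x, `|b x| <= M) ->
  L2v g -> L2v (fun x => b x *: g x).
Proof.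
by move=> mb bM g2 i; apply: L2_ext (L2_bM mb bM (g2 i)) => x; rewrite mxE.
Qed.

Lemma L2v_ae g h : (forall i, measurable_fun setT (fun x => h x 0 i)) ->
  {ae nu, forall x, g x = h x} -> L2v g -> L2v h.
Proof.
by move=> mh gh g2 i; apply: L2_ae (g2 i) => //; apply: filterS gh => x ->.
Qed.

Lemma meas_dot g h : (forall i, measurable_fun setT (fun x => g x 0 i)) ->
  (forall i, measurable_fun setT (fun x => h x 0 i)) ->
  measurable_fun setT (fun x => dotp (g x) (h x)).
Proof.
by move=> mg mh; apply: measurable_sum => i; exact: measurable_funM.
Qed.

Lemma L2v_meas g : L2v g -> forall i, measurable_fun setT (fun x => g x 0 i).
Proof. by move=> g2 i; case: (g2 i). Qed.

Definition nrm2 g := RI (fun x => dotp (g x) (g x)).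
Definition dist2 u g v h := RI (fun x => (u x - v x) ^+ 2) + nrm2 (fun x => g x - h x).

Lemma nrm2_def g : nrm2 g = RI (fun x => dotp (g x) (g x)). Proof. by []. Qed.

Lemma nrm2_ge0 g : 0 <= nrm2 g.
Proof. by apply: RI_ge0 => x; exact: dotp_ge0. Qed.

Lemma RI_sqr_ge0 u : 0 <= RI (fun x => u x ^+ 2).
Proof. by apply: RI_ge0 => x; exact: sqr_ge0. Qed.

Lemma nrm2D_le g h : L2v g -> L2v h ->
  nrm2 (fun x => g x + h x) <= 2 * nrm2 g + 2 * nrm2 h.
Proof.
move=> g2 h2; have gi := L2v_dot g2 g2; have hi := L2v_dot h2 h2.
rewrite /nrm2 -!RIZ// -RID; try exact: igZ.
apply: RI_le; first by apply: L2v_dot; exact: L2vD.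
  by apply: igD; exact: igZ.
by move=> x; exact: dotpD_le.
Qed.

Lemma nrm2Z a g : L2v g -> nrm2 (fun x => a *: g x) = a ^+ 2 * nrm2 g.
Proof.
move=> g2; rewrite /nrm2 -RIZ; last exact: L2v_dot.
by apply: RI_eq => x; rewrite !dotpE; ring.
Qed.

Lemma nrm2N g : nrm2 (fun x => - g x) = nrm2 g.
Proof. by apply: RI_eq => x; rewrite !dotpE opprK. Qed.

Lemma nrm2_parallelogram g h : L2v g -> L2v h ->
  nrm2 (fun x => g x - h x) =
  2 * nrm2 g + 2 * nrm2 h - 4 * nrm2 (fun x => 2^-1 *: (g x + h x)).
Proof.
move=> g2 h2; have gi := L2v_dot g2 g2; have hi := L2v_dot h2 h2.
have si := L2v_dot (L2vZ 2^-1 (L2vD g2 h2)) (L2vZ 2^-1 (L2vD g2 h2)).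
rewrite /nrm2 -!RIZ// -RID; try exact: igZ.
rewrite -RIB; try (repeat (first [assumption|apply: igD|apply: igZ])).
by apply: RI_eq => x; rewrite !dotpE (dotpC (h x)); field.
Qed.

Lemma dist2_ge0 u g v h : 0 <= dist2 u g v h.
Proof. by rewrite addr_ge0 ?nrm2_ge0 ?RI_sqr_ge0. Qed.

Lemma dist2_trans u g v h w k : L2 u -> L2 v -> L2 w -> L2v g -> L2v h -> L2v k ->
  dist2 u g w k <= 2 * dist2 u g v h + 2 * dist2 v h w k.
Proof.
move=> u2 v2 w2 g2 h2 k2.
have := RI_sqrD (L2B u2 v2) (L2B v2 w2).
have := nrm2D_le (L2vB g2 h2) (L2vB h2 k2).
rewrite /dist2.
have -> : RI (fun x => (u x - v x + (v x - w x)) ^+ 2) = RI (fun x => (u x - w x) ^+ 2).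
  by apply: RI_eq => x; congr (_ ^+ 2); ring.
have -> : nrm2 (fun x => g x - h x + (h x - k x)) = nrm2 (fun x => g x - k x).
  by apply: RI_eq => x; rewrite addrA subrK.
lra.
Qed.

End vector_L2.

(** * Smooth approximations of the positive part *)

Section softplus.
Context (R : realType).
Implicit Types (k s t : R).

(* As n grows, the slope tends to the indicator of s > k, also at s = k,
   because the kink sits at k + 1 / (n + 1). *)
Definition kink (n : nat) k s : R := n.+1%:R ^+ 2 * (s - k) - n.+1%:R.
Definition softplus (n : nat) k s : R :=
  (ln (1 + expR (kink n k s)) - ln (1 + expR (kink n k 0))) / n.+1%:R ^+ 2.
Definition logistic (n : nat) k s : R := (1 + expR (- kink n k s))^-1.
(** The constant makes it vanish at 0 also for negative [k], so that composition with it preserves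
    zero boundary values. *)
Definition relu k s : R := Num.max (s - k) 0 - Num.max (- k) 0.

Lemma ln1pexp_lip s t : `|ln (1 + expR s) - ln (1 + expR t)| <= `|s - t|.
Proof.
wlog st : s t / s <= t.
  move=> H; have [/H//|/ltW/H] := leP s t.
  by rewrite distrC (distrC t).
have h : ln (1 + expR s) <= ln (1 + expR t).
  by rewrite ler_ln ?posrE ?addr_gt0 ?expR_gt0// lerD2l ler_expR.
rewrite distrC ger0_norm ?subr_ge0// distrC ger0_norm ?subr_ge0//.
rewrite lerBlDr -[t - s]expRK -lnM ?posrE ?addr_gt0 ?expR_gt0//.
rewrite ler_ln ?posrE ?mulr_gt0 ?addr_gt0 ?expR_gt0//.
rewrite mulrDr mulr1 -expRD subrK lerD2r.
by rewrite -expR0 ler_expR subr_ge0.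
Qed.

Lemma ln1pexp_max t : `|ln (1 + expR t) - Num.max t 0| <= 1.
Proof.
have e1 : 2 <= expR (1 : R) by have := @expR_ge1Dx R 1.
have [t0|t0] := leP t 0.
  have h : 0 <= ln (1 + expR t) by rewrite ln_ge0// lerDl expR_ge0.
  rewrite subr0 ger0_norm// -[leRHS]expRK ler_ln ?posrE ?addr_gt0 ?expR_gt0//.
  apply: le_trans e1; rewrite (_ : 2 = 1 + 1)// lerD2l -[leRHS]expR0 ler_expR//.
have h : t <= ln (1 + expR t).
  by rewrite -{1}[t]expRK ler_ln ?posrE ?addr_gt0 ?expR_gt0// lerDr.
rewrite ger0_norm ?subr_ge0// lerBlDr -[leRHS]expRK ler_ln ?posrE ?addr_gt0 ?expR_gt0//.
rewrite expRD; have : 1 <= expR t by rewrite -expR0 ler_expR ltW.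
have := expR_gt0 t; nra.
Qed.

Lemma n1sq_gt0 (n : nat) : 0 < n.+1%:R ^+ 2 :> R.
Proof. by rewrite exprn_gt0. Qed.

Lemma softplus_lip n k s t : `|softplus n k s - softplus n k t| <= `|s - t|.
Proof.
rewrite /softplus -mulrBl opprB addrA subrK normrM.
rewrite [X in _ * X]ger0_norm ?invr_ge0 ?(ltW (n1sq_gt0 n))//.
rewrite ler_pdivrMr ?n1sq_gt0//; apply: le_trans (ln1pexp_lip _ _) _.
rewrite /kink (_ : _ - _ = (s - t) * n.+1%:R ^+ 2); last by ring.
by rewrite normrM (ger0_norm (ltW (n1sq_gt0 n))).
Qed.

Lemma softplus0 n k : softplus n k 0 = 0.
Proof. by rewrite /softplus subrr mul0r. Qed.

Lemma softplus_le n k s : `|softplus n k s| <= `|s|.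
Proof. by have := softplus_lip n k s 0; rewrite softplus0 !subr0. Qed.

Lemma logistic_gt0 n k s : 0 < logistic n k s.
Proof. by rewrite invr_gt0 addr_gt0 ?expR_gt0. Qed.

Lemma logistic_le1 n k s : `|logistic n k s| <= 1.
Proof.
rewrite ger0_norm ?(ltW (logistic_gt0 _ _ _))// invf_le1 ?addr_gt0 ?expR_gt0//.
by rewrite lerDl expR_ge0.
Qed.

Lemma continuous_logistic n k : continuous (logistic n k).
Proof.
move=> s; apply: cvgV; first by rewrite gt_eqF// addr_gt0 ?expR_gt0.
apply: cvgD; first exact: cvg_cst.
apply: continuous_cvg; first exact: continuous_expR.
apply: cvgN; apply: cvgB; last exact: cvg_cst.
apply: cvgMr; apply: cvgB; [exact: cvg_id|exact: cvg_cst].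
Qed.

Lemma max0_lip s t : `|Num.max s 0 - Num.max t 0| <= `|s - t|.
Proof.
rewrite ler_norml; have := ler_norm (s - t); have := ler_norm (- (s - t)).
rewrite normrN; have := normr_ge0 (s - t).
by case: (leP s 0) => ?; case: (leP t 0) => ?; move=> *; apply/andP; split; lra.
Qed.

Lemma relu_lip k s t : `|relu k s - relu k t| <= `|s - t|.
Proof.
rewrite /relu opprB addrA subrK; apply: le_trans (max0_lip _ _) _.
by rewrite (_ : _ - _ = s - t)//; ring.
Qed.

Lemma cvg_inv_nat : (fun n => n.+1%:R^-1) @ \oo --> (0 : R).
Proof. exact: cvg_harmonic. Qed.

Lemma cvg_softplus k s : (fun n => softplus n k s) @ \oo --> relu k s.
Proof.
(* At one point, moving the kink costs 1 / (n + 1), and the error of [ln1pexp_max], divided by (n +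
   1)^2, costs at most 1 / (n + 1). The two points [s] and 0 give the factor 4. *)
have key n : `|relu k s - softplus n k s| <= 4 * n.+1%:R^-1.
  pose a : R := n.+1%:R; have a1 : 1 <= a by rewrite ler1n.
  have a0 : 0 < a by lra.
  have mx t : Num.max (kink n k t) 0 = a ^+ 2 * Num.max (t - k - a^-1) 0.
    rewrite maxr_pMr ?exprn_ge0// ?(ltW a0)// mulr0; congr Num.max.
    by rewrite /kink -/a; field; rewrite gt_eqF.
  have d t : `|ln (1 + expR (kink n k t)) / a ^+ 2 - Num.max (t - k) 0| <= 2 * a^-1.
    have h1 := ln1pexp_max (kink n k t); rewrite mx in h1.
    have h2 := max0_lip (t - k - a^-1) (t - k).
    rewrite (_ : t - k - a^-1 - (t - k) = - a^-1) in h2; last by ring.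
    rewrite normrN (ger0_norm (_ : 0 <= a^-1)) ?invr_ge0 ?(ltW a0)// in h2.
    have h3 : `|ln (1 + expR (kink n k t)) / a ^+ 2 - Num.max (t - k - a^-1) 0| <= a^-1.
      have -> : ln (1 + expR (kink n k t)) / a ^+ 2 - Num.max (t - k - a^-1) 0 =
        (ln (1 + expR (kink n k t)) - a ^+ 2 * Num.max (t - k - a^-1) 0) / a ^+ 2.
        by field; rewrite gt_eqF.
      rewrite normrM [X in _ * X]ger0_norm ?invr_ge0 ?exprn_ge0 ?(ltW a0)//.
      rewrite ler_pdivrMr ?exprn_gt0//; apply: le_trans h1 _.
      by rewrite expr2 mulrA mulVf ?gt_eqF// mul1r.
    have := ler_distD (Num.max (t - k - a^-1) 0) (ln (1 + expR (kink n k t)) / a ^+ 2) (Num.max (t - k) 0).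
    by move=> /le_trans; apply; rewrite mulr_natl mulr2n; exact: lerD.
  have := d s; have := d 0; rewrite sub0r => d0 ds.
  rewrite /softplus /relu -/a mulrBl.
  set A := ln (1 + expR (kink n k s)) / _ in ds *.
  set B := ln (1 + expR (kink n k 0)) / _ in d0 *.
  have -> : Num.max (s - k) 0 - Num.max (- k) 0 - (A - B) =
    (B - Num.max (- k) 0) - (A - Num.max (s - k) 0) by ring.
  apply: le_trans (ler_normB _ _) _; apply: le_trans (lerD d0 ds) _.
  by rewrite -mulrDl -natrD.
apply/cvgrPdist_le => e e0.
have : (fun n => 4 * n.+1%:R^-1) @ \oo --> (0 : R).
  by rewrite -(mulr0 4); apply: cvgMr; exact: cvg_inv_nat.
move/cvgrPdist_le => /(_ _ e0); apply: filterS => n.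
rewrite sub0r normrN => h; apply: le_trans (key n) _.
by apply: le_trans h; exact: ler_norm.
Qed.

Lemma cvg_logistic k s : (fun n => logistic n k s) @ \oo --> ((k < s)%R%:R : R).
Proof.
have e1 (t : R) : 0 <= t -> (1 + expR t)^-1 <= (1 + t)^-1.
  move=> t0; rewrite lef_pV2 ?posrE ?(ltr_pwDl ltr01 t0) ?addr_gt0 ?expR_gt0//.
  by apply: le_trans (expR_ge1Dx _) _; rewrite lerDr.
have [ks|sk] := ltP k s.
  (* From this n on, (n + 1)^2 (s - k) is at least 2 (n + 1), so the argument of the exponential is
     at least n + 1. *)
  have key n : 2 / (s - k) <= n.+1%:R -> `|1 - logistic n k s| <= n.+1%:R^-1.
    move=> hn; pose a : R := n.+1%:R; have a0 : 0 < a by [].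
    have ak : a <= kink n k s.
      rewrite /kink -/a; rewrite ler_pdivrMr ?subr_gt0// -/a in hn; nra.
    have -> : 1 - logistic n k s = (1 + expR (kink n k s))^-1.
      rewrite /logistic expRN; have := expR_gt0 (kink n k s) => E.
      by field; rewrite !gt_eqF// addr_gt0.
    rewrite ger0_norm ?invr_ge0 ?addr_ge0 ?expR_ge0//.
    apply: le_trans (e1 _ _) _; first by rewrite (le_trans (ltW a0)).
    by rewrite lef_pV2 ?posrE//; lra.
  apply/cvgrPdist_le => e e0; near=> n; apply: le_trans (key n _) _.
    near: n; apply: filterS (nbhs_infty_ger (2 / (s - k))) => n /le_trans; apply.
    by rewrite ler_nat.
  near: n; have /cvgrPdist_le/(_ _ e0) := cvg_inv_nat.
  by apply: filterS => n; rewrite sub0r normrN => /(le_trans (ler_norm _)).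
(* The shift of the kink makes its argument at most - (n + 1) even for s = k. *)
have key n : `|0 - logistic n k s| <= n.+1%:R^-1.
  pose a : R := n.+1%:R; have a0 : 0 < a by [].
  have ak : a <= - kink n k s.
    by rewrite /kink -/a opprB lerBrDl gerDr pmulr_rle0 ?exprn_gt0// subr_le0.
  rewrite sub0r normrN ger0_norm ?(ltW (logistic_gt0 _ _ _))//.
  apply: le_trans (e1 _ _) _; first by rewrite (le_trans (ltW a0)).
  by rewrite lef_pV2 ?posrE//; lra.
apply/cvgrPdist_le => e e0; near=> n; apply: le_trans (key n) _.
near: n; have /cvgrPdist_le/(_ _ e0) := cvg_inv_nat.
by apply: filterS => n; rewrite sub0r normrN => /(le_trans (ler_norm _)).
Unshelve. all: by end_near. Qed.

End softplus.

(** * The closure of the test pairs *)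

Section energy_space.
Context d (X : measurableType d) (R : realType) (N : nat).
Variable nu : {measure set X -> \bar R}.
Variable T0 : (X -> R) -> (X -> 'rV[R]_N) -> Prop.
Implicit Types (u v b phi : X -> R) (g h psi : X -> 'rV[R]_N).

Local Notation meas := (measurable_fun [set: X]).
Local Notation L2 := (L2 nu).
Local Notation L2v := (L2v nu).
Local Notation ig := (ig nu).
Local Notation RI := (RI nu).
Local Notation nrm2 := (nrm2 nu).
Local Notation dist2 := (dist2 nu).

(* T0 plays the role of the pairs (phi, grad phi) with phi a test function.
   H0 is its closure in L2 x L2; nothing abstract forces g to be determined by u. *)
Definition H0 u g := [/\ L2 u, L2v g &
  forall e : R, 0 < e -> exists phi psi, T0 phi psi /\ dist2 u g phi psi <= e].

Lemma H0_L2 u g : H0 u g -> L2 u. Proof. by case. Qed.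
Lemma H0_L2v u g : H0 u g -> L2v g. Proof. by case. Qed.

(* Stability under the smooth functions softplus n k is the only chain rule
   assumed; all the others are obtained from it by passing to the limit. *)
Record energy_core := EnergyCore {
  core_L2 : forall phi psi, T0 phi psi -> L2 phi /\ L2v psi ;
  core_lin : forall (a : R) phi psi phi' psi', T0 phi psi -> T0 phi' psi' ->
    T0 (fun x => phi x + a * phi' x) (fun x => psi x + a *: psi' x) ;
  core_0 : T0 (fun=> 0) (fun=> 0) ;
  core_softplus : forall (n : nat) (k : R) phi psi, T0 phi psi ->
    T0 (fun x => softplus n k (phi x)) (fun x => logistic n k (phi x) *: psi x) }.

Hypothesis core : energy_core.
Let T0_L2 := core_L2 core.
Let T0_lin := core_lin core.
Lemma H0_T0 phi psi : T0 phi psi -> H0 phi psi.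
Proof.
move=> h; have [? ?] := T0_L2 h; split => // e e0; exists phi, psi; split => //.
rewrite /dist2 (_ : RI _ = 0) ?add0r; last first.
  by rewrite -(RI0 nu); apply: RI_eq => x; rewrite subrr expr0n.
rewrite (_ : nrm2 _ = 0) ?ltW//.
by rewrite -(RI0 nu); apply: RI_eq => x; rewrite subrr dotp0l.
Qed.

Lemma H0_closed u g : L2 u -> L2v g ->
  (forall e : R, 0 < e -> exists v h, H0 v h /\ dist2 u g v h <= e) -> H0 u g.
Proof.
move=> u2 g2 H; split => // e e0.
have e40 : 0 < e / 4 by rewrite divr_gt0.
have [v [h [[v2 h2 /(_ _ e40)[phi [psi [T le1]]]] le2]]] := H _ e40.
exists phi, psi; split => //; have [? ?] := T0_L2 T.
apply: le_trans (dist2_trans (v := v) (h := h) _ _ _ _ _ _) _ => //; lra.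
Qed.

Lemma H0_closed_seq u g (v_ : nat -> X -> R) (h_ : nat -> X -> 'rV[R]_N) :
  L2 u -> L2v g -> (forall n, H0 (v_ n) (h_ n)) ->
  (fun n => dist2 u g (v_ n) (h_ n)) @ \oo --> (0 : R) -> H0 u g.
Proof.
move=> u2 g2 vh c; apply: H0_closed => // e e0.
move/cvgrPdist_le : c => /(_ _ e0)[n _ /(_ n (leqnn n))] H.
exists (v_ n), (h_ n); split => //.
by rewrite sub0r normrN in H; exact: le_trans (ler_norm _) H.
Qed.

Lemma dist2_lin a u g v h u' g' v' h' :
  L2 u -> L2v g -> L2 v -> L2v h -> L2 u' -> L2v g' -> L2 v' -> L2v h' ->
  dist2 (fun x => u x + a * u' x) (fun x => g x + a *: g' x)
        (fun x => v x + a * v' x) (fun x => h x + a *: h' x) <=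
  2 * dist2 u g v h + 2 * a ^+ 2 * dist2 u' g' v' h'.
Proof.
move=> u2 g2 v2 h2 u2' g2' v2' h2'.
have := RI_sqrD (L2B u2 v2) (L2Z a (L2B u2' v2')).
have := nrm2D_le (L2vB g2 h2) (L2vZ a (L2vB g2' h2')).
rewrite nrm2Z; last exact: L2vB.
rewrite (_ : RI (fun x => (a * (u' x - v' x)) ^+ 2) =
  a ^+ 2 * RI (fun x => (u' x - v' x) ^+ 2)); last first.
  by rewrite -RIZ; [apply: RI_eq => x; ring|case: (L2B u2' v2')].
rewrite /dist2.
have -> : RI (fun x => (u x - v x + a * (u' x - v' x)) ^+ 2) =
  RI (fun x => (u x + a * u' x - (v x + a * v' x)) ^+ 2).
  by apply: RI_eq => x; congr (_ ^+ 2); ring.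
have -> : nrm2 (fun x => g x - h x + a *: (g' x - h' x)) =
  nrm2 (fun x => g x + a *: g' x - (h x + a *: h' x)).
  apply: RI_eq => x; rewrite scalerBr.
  by congr (dotp _ _); rewrite opprD addrACA.
lra.
Qed.

Lemma H0_lin a u g v h : H0 u g -> H0 v h ->
  H0 (fun x => u x + a * v x) (fun x => g x + a *: h x).
Proof.
move=> [u2 g2 ug] [v2 h2 vh]; split; [exact: L2D (L2Z _ _)|exact: L2vD (L2vZ _ _)|].
move=> e e0.
have e40 : 0 < e / 4 by rewrite divr_gt0.
have e50 : 0 < e / (4 * (a ^+ 2 + 1)).
  by rewrite divr_gt0// mulr_gt0// ltr_wpDl// sqr_ge0.
have [p [q [pq H1]]] := ug _ e40; have [p' [q' [pq' H2]]] := vh _ e50.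
exists (fun x => p x + a * p' x), (fun x => q x + a *: q' x); split; first exact: T0_lin.
have [? ?] := T0_L2 pq; have [? ?] := T0_L2 pq'.
apply: le_trans (dist2_lin _ _ _ _ _ _ _ _ _) _ => //.
move: H1 H2; set A := dist2 _ _ _ _; set B := dist2 _ _ _ _; move=> H1 H2.
have : 2 * a ^+ 2 * B <= e / 2.
  have a20 := sqr_ge0 a.
  apply: le_trans (ler_wpM2l _ H2) _; first by rewrite mulr_ge0.
  have -> : 2 * a ^+ 2 * (e / (4 * (a ^+ 2 + 1))) = e / 2 * (a ^+ 2 / (a ^+ 2 + 1)).
    by field; rewrite gt_eqF// ltr_wpDl.
  rewrite ler_piMr ?divr_ge0 ?(ltW e0)// ler_pdivrMr ?mul1r ?ltr_wpDl//; lra.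
lra.
Qed.

Lemma H0_0 : H0 (fun=> 0) (fun=> 0).
Proof. exact: H0_T0 (core_0 core). Qed.

Lemma H0_Z a u g : H0 u g -> H0 (fun x => a * u x) (fun x => a *: g x).
Proof.
move=> /(H0_lin a H0_0).
by rewrite (_ : (fun x => 0 + a * u x) = (fun x => a * u x));
  [rewrite (_ : (fun x => 0 + a *: g x) = (fun x => a *: g x))|];
  by [|apply/funext => x; rewrite add0r].
Qed.

Lemma H0_D u g v h : H0 u g -> H0 v h ->
  H0 (fun x => u x + v x) (fun x => g x + h x).
Proof.
move=> ug /(H0_lin 1 ug).
by rewrite (_ : (fun x => u x + 1 * v x) = (fun x => u x + v x));
  [rewrite (_ : (fun x => g x + 1 *: h x) = (fun x => g x + h x))|];
  by [|apply/funext => x; rewrite ?mul1r ?scale1r].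
Qed.

Lemma H0_B u g v h : H0 u g -> H0 v h ->
  H0 (fun x => u x - v x) (fun x => g x - h x).
Proof.
move=> ug /(H0_lin (-1) ug).
by rewrite (_ : (fun x => u x + -1 * v x) = (fun x => u x - v x));
  [rewrite (_ : (fun x => g x + -1 *: h x) = (fun x => g x - h x))|];
  by [|apply/funext => x; rewrite ?mulN1r ?scaleN1r].
Qed.

Lemma H0_ae u g v h : meas v -> (forall i, meas (fun x => h x 0 i)) ->
  {ae nu, forall x, u x = v x} -> {ae nu, forall x, g x = h x} ->
  H0 u g -> H0 v h.
Proof.
move=> mv mh uv gh [u2 g2 ug].
have v2 := L2_ae mv uv u2; have h2 := L2v_ae mh gh g2.
split => // e e0; have [p [q [pq H]]] := ug _ e0; exists p, q; split => //.
have [p2 q2] := T0_L2 pq.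
rewrite (_ : dist2 v h p q = dist2 u g p q)//; congr (_ + _).
  apply: RI_ae; [exact: (ig_meas (L2B v2 p2).2)|exact: (ig_meas (L2B u2 p2).2)|].
  by apply: filterS uv => x ->.
apply: RI_ae; [exact: ig_meas (L2v_dot (L2vB h2 q2) (L2vB h2 q2))|
               exact: ig_meas (L2v_dot (L2vB g2 q2) (L2vB g2 q2))|].
by apply: filterS gh => x ->.
Qed.

Lemma H0_approx u g : H0 u g -> exists (phi_ : nat -> X -> R) (psi_ : nat -> X -> 'rV[R]_N),
  [/\ forall n, T0 (phi_ n) (psi_ n),
      forall n, dist2 u g (phi_ n) (psi_ n) <= 8^-1 ^+ n &
      {ae nu, forall x, phi_ ^~ x @ \oo --> u x}].
Proof.
move=> ug; case: (ug) => u2 g2 H.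
have /choice[F HF] (n : nat) : exists pq : (X -> R) * (X -> 'rV[R]_N),
    T0 pq.1 pq.2 /\ dist2 u g pq.1 pq.2 <= 8^-1 ^+ n.
  have [|p [q ?]] := H (8^-1 ^+ n); first by rewrite exprn_gt0// invr_gt0.
  by exists (p, q).
exists (fun n => (F n).1), (fun n => (F n).2); split => [n|n|].
- by case: (HF n).
- by case: (HF n).
apply: (ae_cvg_of_fast0 (nu := nu)) => n; have [T le] := HF n; have [p2 q2] := T0_L2 T.
  exact: L2B.
by apply: le_trans le; rewrite lerDl nrm2_ge0.
Qed.

(** The gradients are multiples of one fixed [g], so that no limit of gradients has to be
    constructed: dominated convergence applies to the functions and to the multipliers
    separately. *)
Lemma H0_dominated (L : R) u g (v_ : nat -> X -> R) (b_ : nat -> X -> R) (A v b : X -> R) :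
  L2 A -> L2v g ->
  (forall n, H0 (v_ n) (fun x => b_ n x *: g x)) ->
  (forall n, meas (b_ n)) ->
  (forall x, v_ ^~ x @ \oo --> v x) -> (forall x, b_ ^~ x @ \oo --> b x) ->
  (forall n x, `|v_ n x| <= A x) -> (forall n x, `|b_ n x| <= L) ->
  H0 v (fun x => b x *: g x).
Proof.
move=> A2 g2 vb mb_ vv bb vA bL.
have mv : meas v.
  apply: (measurable_fun_cvg (h := v_)) => // n.
  by have [[]] := vb n.
have mb : meas b by exact: (measurable_fun_cvg (h := b_)).
have vA' x : `|v x| <= A x.
  exact: (cvg_norm_le (vv x)).
have bL' x : `|b x| <= L.
  exact: (cvg_norm_le (bb x)).
have v2 : L2 v.
  apply: L2_le A2 => // x; apply: le_trans (vA' x) _; exact: ler_norm.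
have bg2 : L2v (fun x => b x *: g x) by exact: L2v_bM g2.
apply: (H0_closed_seq v2 bg2 vb); rewrite -[0]addr0; apply: cvgD.
  apply: (@RI_dct0 _ _ _ nu (fun n x => (v x - v_ n x) ^+ 2)
    (fun x => 4 * A x ^+ 2)).
  - by move=> n; have [[] ] := vb n => *; apply: measurable_funX; exact: measurable_funB.
  - apply: aeW => x; rewrite -[0](expr0n _ 2) -[X in X ^+ 2](subrr (v x)).
    by apply: cvg_sqr; apply: cvgB => //; exact: cvg_cst.
  - by apply: igZ; case: A2.
  - move=> n x; rewrite ger0_norm ?sqr_ge0//.
    rewrite -(real_normK (num_real _)).
    have h1 := ler_normB (v x) (v_ n x); have h2 := vA' x; have h3 := vA n x.
    have := normr_ge0 (v x - v_ n x); nra.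
have h := @RI_dct0 _ _ _ nu (fun n x => (b x - b_ n x) ^+ 2 * dotp (g x) (g x))
    (fun x => 4 * L ^+ 2 * dotp (g x) (g x)).
rewrite (_ : (fun n => _) = (fun n => RI (fun x => (b x - b_ n x) ^+ 2 * dotp (g x) (g x)))).
  apply: h => //.
  - move=> n; apply: measurable_funM; last exact: ig_meas (L2v_dot g2 g2).
    by apply: measurable_funX; exact: measurable_funB.
  - apply: aeW => x; rewrite -(mul0r (dotp (g x) (g x))); apply: cvgMl.
    rewrite -[0](expr0n _ 2) -[X in X ^+ 2](subrr (b x)).
    by apply: cvg_sqr; apply: cvgB => //; exact: cvg_cst.
  - by apply: igZ; exact: L2v_dot.
  - move=> n x; rewrite normrM (ger0_norm (dotp_ge0 _)) ger0_norm ?sqr_ge0//.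
    apply: ler_wpM2r; first exact: dotp_ge0.
    rewrite -(real_normK (num_real _)).
    have h1 := ler_normB (b x) (b_ n x); have h2 := bL' x; have h3 := bL n x.
    have := normr_ge0 (b x - b_ n x); nra.
apply/funext => n; apply: RI_eq => x; rewrite -scalerBl !dotpE; ring.
Qed.

(** For test pairs (p_n, q_n) tending to (u, g), the gradient error splits as (f(u) - f(p_n)) g +
    f(p_n) (g - q_n). The second term is controlled by |f| <= 1, the first by dominated convergence,
    using that p_n tends to u almost everywhere and that f is continuous. *)
Lemma H0_core_comp (F f : R -> R) :
  (forall phi psi, T0 phi psi ->
     T0 (fun x => F (phi x)) (fun x => f (phi x) *: psi x)) ->
  (forall s t, `|F s - F t| <= `|s - t|) -> F 0 = 0 ->
  continuous f -> (forall s, `|f s| <= 1) ->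
  forall u g, H0 u g -> H0 (fun x => F (u x)) (fun x => f (u x) *: g x).
Proof.
move=> TF Flip F0 fc f1 u g ug; have u2 := H0_L2 ug; have g2 := H0_L2v ug.
have [p [q [pq dpq paE]]] := H0_approx ug.
have mf : measurable_fun setT f by exact: continuous_measurable_fun.
have mF : measurable_fun setT F.
  apply: continuous_measurable_fun => s; apply/cvgrPdist_le => e e0.
  near=> t; apply: le_trans (Flip s t) _; near: t.
  by move: e e0; apply/cvgrPdist_le; exact: cvg_id.
have Fle s : `|F s| <= `|s| by have := Flip s 0; rewrite F0 !subr0.
have Fu2 : L2 (fun x => F (u x)).
  by apply: L2_le u2 => //; apply: measurableT_comp => //; case: (H0_L2 ug).
have mfu : meas (fun x => f (u x)) by apply: measurableT_comp => //; case: u2.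
have fg2 : L2v (fun x => f (u x) *: g x) by exact: (L2v_bM (M := 1)).
apply: (H0_closed_seq Fu2 fg2 (v_ := fun n x => F (p n x))
  (h_ := fun n x => f (p n x) *: q n x)); first by move=> n; apply/H0_T0/TF.
have p2 n : L2 (p n) by have [] := T0_L2 (pq n).
have q2 n : L2v (q n) by have [] := T0_L2 (pq n).
have mfp n : meas (fun x => f (p n x)) by apply: measurableT_comp => //; case: (p2 n).
(* The only part of the error that tends to 0 without a rate. *)
pose W n := RI (fun x => (f (u x) - f (p n x)) ^+ 2 * dotp (g x) (g x)).
have W0 : W @ \oo --> (0 : R).
  apply: (@RI_dct0 _ _ _ nu
    (fun n x => (f (u x) - f (p n x)) ^+ 2 * dotp (g x) (g x))
    (fun x => 4 * dotp (g x) (g x))).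
  - move=> n; apply: measurable_funM; last exact: ig_meas (L2v_dot g2 g2).
    by apply: measurable_funX; exact: measurable_funB.
  - apply: filterS paE => x px; rewrite -(mul0r (dotp (g x) (g x))); apply: cvgMl.
    rewrite -[0](expr0n _ 2) -[X in X ^+ 2](subrr (f (u x))).
    apply: cvg_sqr; apply: cvgB; first exact: cvg_cst.
    by apply: continuous_cvg => //; exact: fc.
  - by apply: igZ; exact: L2v_dot.
  - move=> n x; rewrite normrM (ger0_norm (dotp_ge0 _)) ger0_norm ?sqr_ge0//.
    apply: ler_wpM2r; first exact: dotp_ge0.
    rewrite -(real_normK (num_real _)).
    have h1 := ler_normB (f (u x)) (f (p n x)); have h2 := f1 (u x); have h3 := f1 (p n x).
    have := normr_ge0 (f (u x) - f (p n x)); nra.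
apply: (@squeeze_cvgr _ _ _ _ (fun=> 0) (fun n => 2 * W n + 3 * 8^-1 ^+ n)).
- apply: nearW => n; rewrite dist2_ge0/=.
  have h1 : RI (fun x => (F (u x) - F (p n x)) ^+ 2) <= RI (fun x => (u x - p n x) ^+ 2).
    apply: RI_le.
    + apply: (ig_le _ _ (L2B u2 (p2 n)).2).
        apply: measurable_funX; apply: measurable_funB; first by case: Fu2.
        by apply: measurableT_comp => //; case: (p2 n).
      move=> x; rewrite ger0_norm ?sqr_ge0//.
      by rewrite -(real_normK (num_real _)) -[leRHS](real_normK (num_real _)) ler_sqr ?nnegrE.
    + by case: (L2B u2 (p2 n)).
    + move=> x.
      by rewrite -(real_normK (num_real _)) -[leRHS](real_normK (num_real _)) ler_sqr ?nnegrE.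
  have h2 : nrm2 (fun x => f (u x) *: g x - f (p n x) *: q n x) <=
      2 * W n + 2 * nrm2 (fun x => g x - q n x).
    have A2 : L2v (fun x => (f (u x) - f (p n x)) *: g x).
      apply: (L2v_bM (M := 2)) => //; first exact: measurable_funB.
      move=> x; apply: le_trans (ler_normB _ _) _.
      by rewrite (_ : 2 = 1 + 1)//; apply: lerD.
    have B2 : L2v (fun x => f (p n x) *: (g x - q n x)).
      by apply: (L2v_bM (M := 1)) => //; exact: L2vB.
    have := nrm2D_le A2 B2.
    rewrite (_ : nrm2 (fun x => _ + _) = nrm2 (fun x => f (u x) *: g x - f (p n x) *: q n x)); last first.
      by apply: RI_eq => x; rewrite scalerBl scalerBr addrA subrK.
    move=> /le_trans; apply; apply: lerD.
      rewrite ler_pM2l// /nrm2 /W; apply: RI_le; first exact: L2v_dot.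
        by apply: ig_eq (L2v_dot A2 A2) => x; rewrite !dotpE mulrA.
      by move=> x; rewrite !dotpE mulrA.
    rewrite ler_pM2l//; apply: RI_le; [exact: L2v_dot|exact: L2v_dot (L2vB g2 (q2 n)) (L2vB g2 (q2 n))|].
    move=> x; rewrite dotpZl dotpZr mulrA -expr2 ler_piMl ?dotp_ge0//.
    by rewrite -(real_normK (num_real _)) expr_le1.
  have := dpq n; rewrite /dist2.
  have := nrm2_ge0 nu (fun x => g x - q n x).
  have := RI_sqr_ge0 nu (fun x => u x - p n x); lra.
- exact: cvg_cst.
- rewrite -[0]addr0; apply: cvgD.
    by rewrite -(mulr0 2); apply: cvgMr.
  rewrite -(mulr0 3); apply: cvgMr; apply: cvg_geom0.
  by rewrite invr_ge0 ler0n invf_lt1// ltr1n.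
Unshelve. all: by end_near. Qed.

(** Composition with [softplus] is available by [H0_core_comp]; in the limit n to infinity only the
    multiplier of [g] moves. *)
Lemma H0_relu k u g : H0 u g ->
  H0 (fun x => relu k (u x)) (fun x => (k < u x)%R%:R *: g x).
Proof.
move=> ug; have u2 := H0_L2 ug.
apply: (@H0_dominated 1 u g (fun n x => softplus n k (u x))
  (fun n x => logistic n k (u x)) (fun x => `|u x|)).
- exact: L2_norm.
- exact: H0_L2v ug.
- move=> n; apply: H0_core_comp => //.
  + by move=> phi psi; exact: core_softplus.
  + exact: softplus_lip.
  + exact: softplus0.
  + exact: continuous_logistic.
  + exact: logistic_le1.
- move=> n; apply: measurableT_comp; last by case: u2.
  by apply: continuous_measurable_fun; exact: continuous_logistic.
- by move=> x; exact: cvg_softplus.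
- by move=> x; exact: cvg_logistic.
- by move=> n x; exact: softplus_le.
- by move=> n x; exact: logistic_le1.
Qed.

(** Lower semicontinuity of the energy without weak limits. Let a_n be the infimum of the energies
    of the pairs within 8^-n of [w] in squared L2 norm. These infima increase to some A <= l. The
    midpoint of almost minimisers at levels m >= n still competes at level n, so by the
    parallelogram law their gradients differ by at most 2 (A - a_n) + 4 8^-n: they form a Cauchy
    sequence, and its limit is a gradient for [w]. *)
Lemma H0_lsc w l : L2 w ->
  (forall e : R, 0 < e -> exists v h,
    [/\ H0 v h, RI (fun x => (w x - v x) ^+ 2) <= e & nrm2 h <= l + e]) ->
  exists g, H0 w g /\ nrm2 g <= l.
Proof.
move=> w2 Hw.
have q8 n : 0 < (8^-1 : R) ^+ n by rewrite exprn_gt0// invr_gt0.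
pose K n := [set t : R | exists v h,
  [/\ H0 v h, RI (fun x => (w x - v x) ^+ 2) <= 8^-1 ^+ n & nrm2 h = t]].
pose a n := inf (K n).
have lbK n : has_lbound (K n).
  by exists 0 => _ [v [h [_ _ <-]]]; exact: nrm2_ge0.
have infK n : has_inf (K n).
  split => //; have [v [h [vh le _]]] := Hw _ (q8 n).
  by exists (nrm2 h), v, h.
have al n : a n <= l.
  apply/ler_addgt0Pr => e e0.
  have [|v [h [vh le le']]] := Hw (Num.min e (8^-1 ^+ n)); first by rewrite lt_min e0 q8.
  apply: (@le_trans _ _ (nrm2 h)).
    apply: (ge_inf (lbK n)); exists v, h; split => //.
    by apply: le_trans le _; rewrite ge_min lexx orbT.
  by apply: le_trans le' _; rewrite lerD2l ge_min lexx.
have amono n m : (n <= m)%N -> a n <= a m.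
  move=> nm; apply: lb_le_inf; first by have [] := infK m.
  move=> _ [v [h [vh le <-]]]; apply: (ge_inf (lbK n)); exists v, h; split => //.
  apply: le_trans le _; rewrite ler_wiXn2l// ?invr_ge0// invf_le1// ler1n.
  by [].
have /choice[F HF] (n : nat) : exists vh : (X -> R) * (X -> 'rV[R]_N),
   [/\ H0 vh.1 vh.2, RI (fun x => (w x - vh.1 x) ^+ 2) <= 8^-1 ^+ n &
       nrm2 vh.2 <= a n + 8^-1 ^+ n].
  have [_ [v [h [vh le <-]]] lt] := inf_adherent (q8 n) (infK n).
  by exists (v, h); split => //; exact: ltW.
have hasA : has_sup (range a).
  by split; [exists (a 0%N), 0%N|exists l => _ [n _ <-]].
pose A := sup (range a).
have aA n : a n <= A by apply: (ub_le_sup hasA.2); exists n.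
have bound n m : (n <= m)%N ->
    nrm2 (fun x => (F m).2 x - (F n).2 x) <= 2 * (A - a n) + 4 * 8^-1 ^+ n.
  move=> nm; have [H1 le1 le1'] := HF n; have [H2 le2 le2'] := HF m.
  rewrite nrm2_parallelogram; [|exact: H0_L2v H2|exact: H0_L2v H1].
  have le2'' : RI (fun x => (w x - (F m).1 x) ^+ 2) <= 8^-1 ^+ n.
    apply: le_trans le2 _; rewrite ler_wiXn2l// ?invr_ge0// invf_le1// ler1n//.
  (* The ball around [w] is convex, so the midpoint is admissible at level n. *)
  have mid : a n <= nrm2 (fun x => 2^-1 *: ((F m).2 x + (F n).2 x)).
    apply: (ge_inf (lbK n)); exists (fun x => 2^-1 * ((F m).1 x + (F n).1 x)).
    exists (fun x => 2^-1 *: ((F m).2 x + (F n).2 x)); split => //.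
      by apply: H0_Z; exact: H0_D.
    have i1 := (L2B w2 (H0_L2 H1)).2; have i2 := (L2B w2 (H0_L2 H2)).2.
    have i3 := (L2B w2 (L2Z 2^-1 (L2D (H0_L2 H2) (H0_L2 H1)))).2.
    apply: (@le_trans _ _ (2^-1 * RI (fun x => (w x - (F m).1 x) ^+ 2) +
        2^-1 * RI (fun x => (w x - (F n).1 x) ^+ 2))); last by lra.
    rewrite -!RIZ// -RID; try exact: igZ.
    apply: RI_le => //; first by apply: igD; exact: igZ.
    move=> x /=; have := sqr_ge0 ((F m).1 x - (F n).1 x).
    set y := w x; set s := (F m).1 x; set t := (F n).1 x => hst.
    have -> : (y - 2^-1 * (s + t)) ^+ 2 =
      2^-1 * (y - s) ^+ 2 + 2^-1 * (y - t) ^+ 2 - 4^-1 * (s - t) ^+ 2 by field.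
    lra.
  have := aA m; have : (8^-1 : R) ^+ m <= 8^-1 ^+ n.
    rewrite ler_wiXn2l// ?invr_ge0// invf_le1// ler1n//.
  lra.
(* The bound on the difference of gradients becomes at most 8^-j: one half comes from 2 (A - a_n),
   the other from 4 8^-n with n > j. *)
have /choice[s Hs] (j : nat) : exists n, (j < n)%N /\ A - a n <= 8^-1 ^+ j / 4.
  have [|_ [n _ <-] lt] := sup_adherent (_ : 0 < 8^-1 ^+ j / 4) hasA.
    by rewrite divr_gt0.
  exists (maxn n j.+1); split; first by rewrite leq_max ltnSn orbT.
  have := amono n (maxn n j.+1) (leq_maxl _ _); rewrite -/A in lt; lra.
have q8S j n : (j < n)%N -> 8 * 8^-1 ^+ n <= 8^-1 ^+ j :> R.
  move=> jn; apply: (@le_trans _ _ (8 * 8^-1 ^+ j.+1)).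
    by rewrite ler_pM2l// ler_wiXn2l// ?invr_ge0// invf_le1// ler1n.
  by rewrite exprS mulrA divff// mul1r.
have fast j i : (j <= i)%N ->
    nrm2 (fun x => (F (s i)).2 x - (F (s j)).2 x) <= 8^-1 ^+ j.
  move=> ji; have [sj1 sj2] := Hs j; have [si1 si2] := Hs i.
  have ij8 : (8^-1 : R) ^+ i <= 8^-1 ^+ j.
    rewrite ler_wiXn2l// ?invr_ge0// invf_le1// ler1n//.
  have hj := q8S _ _ sj1; have hi := q8S _ _ si1.
  (* The selection [s] need not be monotone, and [bound] requires ordered indices. *)
  have [le|/ltnW le] := leqP (s j) (s i).
    by have := bound _ _ le; lra.
  have := bound _ _ le.
  rewrite -nrm2N (_ : nrm2 (fun x => - _) = nrm2 (fun x => (F (s i)).2 x - (F (s j)).2 x)).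
    lra.
  by apply: RI_eq => x; rewrite opprB.
have h2 j : L2v (F (s j)).2 by have [/H0_L2v] := HF (s j).
(* Completeness of L2 is used for each coordinate of the gradients. *)
have /choice[G HG] (i : 'I_N) : exists Gi, [/\ L2 Gi,
    {ae nu, forall x, (fun j => (F (s j)).2 x 0 i) @ \oo --> Gi x} &
    forall n, RI (fun x => (Gi x - (F (s n)).2 x 0 i) ^+ 2) <= 8^-1 ^+ n].
  apply: (@L2_complete_fast _ _ _ nu (fun j x => (F (s j)).2 x 0 i)) => [j|j k jk].
    exact: h2.
  apply: le_trans (fast _ _ jk); apply: RI_le.
  - by case: (L2B (h2 k i) (h2 j i)).
  - exact: L2v_dot (L2vB (h2 k) (h2 j)) (L2vB (h2 k) (h2 j)).
  - by move=> x; have := dotp_coord ((F (s k)).2 x - (F (s j)).2 x) i; rewrite !mxE.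
pose gam x : 'rV[R]_N := \row_i G i x.
have gE x i : gam x 0 i = G i x by rewrite mxE.
have gam2 : L2v gam by move=> i; have [Gi _ _] := HG i; apply: L2_ext Gi => x; rewrite mxE.
exists gam; split.
  apply: (H0_closed_seq w2 gam2 (v_ := fun j => (F (s j)).1) (h_ := fun j => (F (s j)).2)).
    by move=> n; have [] := HF (s n).
  apply: (@squeeze_cvgr _ _ _ _ (fun=> 0) (fun n => (1 + N%:R) * 8^-1 ^+ n)).
  - apply: nearW => n; rewrite dist2_ge0/= mulrDl mul1r; apply: lerD.
      have [_ le _] := HF (s n); apply: le_trans le _.
      have [sn _] := Hs n; rewrite ler_wiXn2l// ?invr_ge0// ?invf_le1// ?ler1n// ltnW//.
    rewrite /nrm2 /dotp RI_sum; last first.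
      by move=> i; have := L2_mul (L2vB gam2 (h2 n) i) (L2vB gam2 (h2 n) i).
    apply: (@le_trans _ _ (\sum_(i < N) 8^-1 ^+ n)); last first.
      by rewrite sumr_const card_ord mulr_natl.
    apply: ler_sum => i _; have [_ _ /(_ n)] := HG i.
    rewrite (_ : RI (fun x => (G i x - _) ^+ 2) = RI (fun x => (gam x - (F (s n)).2 x) 0 i * (gam x - (F (s n)).2 x) 0 i))//.
    by apply: RI_eq => x; rewrite !mxE expr2.
  - exact: cvg_cst.
  - rewrite -(mulr0 (1 + N%:R)); apply: cvgMr; apply: cvg_geom0.
    by rewrite invr_ge0 ler0n invf_lt1// ltr1n.
have [] := @RI_fatou _ _ _ nu (fun j x => dotp ((F (s j)).2 x) ((F (s j)).2 x))
   (fun x => dotp (gam x) (gam x)) (fun j => l + 8^-1 ^+ j) l _ _ _ _ _ _ _ => //.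
- by apply: meas_dot; exact: L2v_meas.
- by move=> x; exact: dotp_ge0.
- by move=> n; exact: L2v_dot.
- by move=> n x; exact: dotp_ge0.
- have : {ae nu, forall x, forall i, (fun j => (F (s j)).2 x 0 i) @ \oo --> G i x}.
    have : forall i : 'I_N, {ae nu, forall x, (fun j => (F (s j)).2 x 0 i) @ \oo --> G i x}.
      by move=> i; have [] := HG i.
    exact: filter_forall.
  apply: filterS => x Hx; apply: cvg_fsum => i; rewrite mxE; exact: cvgM.
- move=> n; have [_ _ le] := HF (s n); apply: le_trans le _; apply: lerD => //.
  have [sn _] := Hs n; rewrite ler_wiXn2l// ?invr_ge0// ?invf_le1// ?ler1n// ltnW//.
- rewrite -[X in _ --> X]addr0; apply: cvgD; first exact: cvg_cst.
  by apply: cvg_geom0; rewrite invr_ge0 ler0n invf_lt1// ltr1n.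
Qed.

End energy_space.

(** * Chain rule *)

Lemma is_derive_eps (R : realType) (F : R -> R) (s l : R) : is_derive s 1 F l ->
  forall e : R, 0 < e -> exists2 r : R, 0 < r & forall t, `|t - s| < r ->
    `|F t - F s - l * (t - s)| <= e * `|t - s|.
Proof.
move=> [dF Fl] e e0.
have : (fun h => h^-1 *: (F (h *: 1 + s) - F s)) @ 0^' --> l by rewrite -Fl.
move/cvgrPdist_le => /(_ _ e0)/nbhs_ballP[r r0 rP].
exists r => // t ts; have [->|tns] := eqVneq t s; first by rewrite !subrr mulr0 subr0 normr0 mulr0.
have ts0 : t - s != 0 by rewrite subr_eq0.
have := rP (t - s); rewrite /ball/= sub0r normrN => /(_ ts ts0).
rewrite -[_ *: 1]/((t - s) * 1) mulr1 subrK => H.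
have -> : F t - F s - l * (t - s) = - ((l - (t - s)^-1 * (F t - F s)) * (t - s)).
  by field.
by rewrite normrN normrM ler_wpM2r.
Qed.

(** * Piecewise linear interpolation on a uniform grid *)

Section piecewise_linear.
Context (R : realType) (F : R -> R) (a w L : R) (n : nat).
Hypothesis (w0 : 0 < w) (L0 : 0 <= L).
Let node (j : nat) := a + j%:R * w.
Definition pl_slope (j : nat) := (F (node j.+1) - F (node j)) / w.
(** On the grid this is the linear interpolant of [F] at the nodes, up to the constant that makes it
    vanish at 0. The form with [relu] is the one whose composition with a function of [H0] is known;
    [pl_step] is the corresponding multiplier of the gradient. *)
Definition pl_fun (m : nat) s :=
  \sum_(j < m) pl_slope j * (relu (node j) s - relu (node j.+1) s).
Definition pl_step (m : nat) s :=
  \sum_(j < m) pl_slope j * (((node j < s)%R)%:R - ((node j.+1 < s)%R)%:R).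

Hypothesis Flip : forall s t, a <= s <= node n -> a <= t <= node n ->
  `|F s - F t| <= L * `|s - t|.

Let nodeS j : node j.+1 = node j + w.
Proof. by rewrite /node -natr1 mulrDl mul1r addrA. Qed.

Let node_ge j : a <= node j.
Proof. by rewrite lerDl mulr_ge0// ltW. Qed.

Let node_le j m : (j <= m)%N -> node j <= node m.
Proof. by move=> jm; rewrite lerD2l ler_wpM2r ?ler_nat// ltW. Qed.

Lemma pl_slope_le j : (j < n)%N -> `|pl_slope j| <= L.
Proof.
move=> jn; rewrite normrM normfV (gtr0_norm w0) ler_pdivrMr//.
apply: le_trans (Flip _ _) _; rewrite ?node_ge ?node_le//; first exact: ltnW.
by rewrite nodeS addrAC subrr add0r (gtr0_norm w0).
Qed.

Let P m s := \sum_(j < m) pl_slope j * (Num.max (s - node j) 0 - Num.max (s - node j.+1) 0).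

Lemma pl_funE m s : pl_fun m s = P m s - P m 0.
Proof.
rewrite -sumrB; apply: eq_bigr => j _; rewrite -mulrBr /relu !sub0r.
by congr (_ * _); ring.
Qed.

(** The exact value to the right of the last node is what carries the induction into the next cell;
    inside a cell the chord and [F] each vary by at most L w. *)
Let PP m s : (m <= n)%N ->
  (node m <= s -> P m s = F (node m) - F a) /\
  (a <= s <= node m -> `|P m s - (F s - F a)| <= 2 * L * w).
Proof.
elim: m => [_|m IHm mn].
  have n0 : node 0 = a by rewrite /node mul0r addr0.
  split; rewrite /P big_ord0 n0; first by rewrite subrr.
  move=> /andP[sa as_]; have -> : s = a by apply/eqP; rewrite eq_le sa as_.
  rewrite subrr subr0 normr0.
  by rewrite !mulr_ge0// ltW.
have [IH1 IH2] := IHm (ltnW mn).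
have E : P m.+1 s = P m s + pl_slope m * (Num.max (s - node m) 0 - Num.max (s - node m.+1) 0).
  by rewrite /P big_ord_recr.
have sw : pl_slope m * w = F (node m.+1) - F (node m) by rewrite /pl_slope mulfVK ?gt_eqF.
have Lw : 0 <= L * w.
  by rewrite mulr_ge0 ?(ltW w0).
split.
  move=> ms; have ms' : node m <= s by apply: le_trans ms; exact: node_le.
  rewrite E IH1// !max_l ?subr_ge0//.
  rewrite (_ : s - _ - _ = w); last by rewrite nodeS; ring.
  by rewrite sw; ring.
move=> /andP[as_ sm]; rewrite E.
rewrite [X in _ * (_ - X)]max_r ?subr_le0// subr0.
have [sm'|/ltW ms] := leP s (node m).
  by rewrite max_r ?subr_le0// mulr0 addr0 IH2// as_.
rewrite max_l ?subr_ge0// IH1//.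
have -> : F (node m) - F a + pl_slope m * (s - node m) - (F s - F a) =
  pl_slope m * (s - node m) - (F s - F (node m)) by ring.
have swm : `|s - node m| <= w by rewrite ger0_norm ?subr_ge0// lerBlDl -nodeS.
apply: le_trans (ler_normB _ _) _; rewrite -mulrA mulr_natl mulr2n.
apply: lerD.
  by rewrite normrM; apply: ler_pM => //; exact: pl_slope_le.
apply: le_trans (Flip _ _) _.
- by rewrite as_ (le_trans sm)// node_le.
- by rewrite node_ge node_le// ltnW.
- by rewrite ler_wpM2l.
Qed.

Lemma pl_fun_near s : a <= s <= node n -> a <= 0 <= node n ->
  `|pl_fun n s - (F s - F 0)| <= 4 * L * w.
Proof.
move=> /(PP _ (leqnn n)).2 h1 /(PP _ (leqnn n)).2 h2; rewrite pl_funE.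
have -> : P n s - P n 0 - (F s - F 0) =
  (P n s - (F s - F a)) - (P n 0 - (F 0 - F a)) by ring.
apply: le_trans (ler_normB _ _) _; lra.
Qed.

Lemma pl_stepP m s : a < s <= node m ->
  exists i, [/\ (i < m)%N, node i < s <= node i.+1 & pl_step m s = pl_slope i].
Proof.
suff : (a < s <= node m -> exists i,
    [/\ (i < m)%N, node i < s <= node i.+1 & pl_step m s = pl_slope i]) /\
    (node m < s -> pl_step m s = 0) by case.
elim: m => [|m [IH1 IH2]].
  have n0 : node 0 = a by rewrite /node mul0r addr0.
  split; rewrite n0; first by move=> /andP[/lt_le_trans h /h]; rewrite ltxx.
  by rewrite /pl_step big_ord0.
have E : pl_step m.+1 s = pl_step m s +
    pl_slope m * (((node m < s)%R)%:R - ((node m.+1 < s)%R)%:R).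
  by rewrite /pl_step big_ord_recr.
split.
  move=> /andP[as_ sm]; rewrite E [node m.+1 < s]ltNge sm subr0.
  have [sm'|ms] := leP s (node m).
    rewrite mulr0 addr0; have [|i [im h1 h2]] := IH1; first by rewrite as_.
    by exists i; split => //; exact: ltnW.
  by rewrite mulr1 IH2// add0r; exists m; rewrite ms sm.
move=> ms; have ms' : node m < s by apply: le_lt_trans ms; exact: node_le.
by rewrite E IH2// ms ms' subrr mulr0 addr0.
Qed.

(** The slope at [s] is that of the chord over the cell containing [s]. The distances from [s] to
    the two ends add up to [w], so the errors of the first order expansions there add up to e w. *)
Lemma pl_step_near (s l e r : R) : is_derive s 1 F l ->
  (forall t, `|t - s| < r -> `|F t - F s - l * (t - s)| <= e * `|t - s|) -> w < r ->
  a < s <= node n -> `|l - pl_step n s| <= e.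
Proof.
move=> dF Fe wr /pl_stepP[i [_ /andP[is_ si] ->]].
have h1 : `|node i.+1 - s| < r.
  apply: le_lt_trans wr; rewrite ger0_norm ?subr_ge0// nodeS; lra.
have h2 : `|node i - s| < r.
  rewrite distrC; apply: le_lt_trans wr; rewrite ger0_norm ?subr_ge0 ?(ltW is_)//.
  by rewrite lerBlDl -nodeS.
have := Fe _ h1; have := Fe _ h2.
rewrite distrC [`|node i.+1 - s|]ger0_norm ?subr_ge0// => A B.
rewrite -(ler_pM2r w0) -{1}(gtr0_norm w0) -normrM /pl_slope.
have -> : (l - (F (node i.+1) - F (node i)) / w) * w =
   (l * (node i - s) - (F (node i) - F s)) * -1 - (F (node i.+1) - F s - l * (node i.+1 - s)).
  by rewrite nodeS; field; rewrite gt_eqF.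
apply: le_trans (ler_normB _ _) _; rewrite normrM normrN1 mulr1.
apply: le_trans (lerD A B) _; rewrite -mulrDr [X in e * X](_ : _ = w)//.
rewrite distrC ger0_norm ?subr_ge0 ?ltW//.
by rewrite nodeS; ring.
Qed.

End piecewise_linear.

Section chain_rule.
Context d (X : measurableType d) (R : realType) (N : nat).
Variable nu : {finite_measure set X -> \bar R}.
Variable T0 : (X -> R) -> (X -> 'rV[R]_N) -> Prop.
Implicit Types (u v b phi : X -> R) (g h psi : X -> 'rV[R]_N).
Hypothesis core : energy_core nu T0.

Local Notation meas := (measurable_fun [set: X]).
Local Notation H0 := (H0 nu T0).

Lemma ig_cst c : ig nu (fun=> c).
Proof. exact: finite_measure_integrable_cst. Qed.

Lemma L2_bounded (M : R) u : meas u -> (forall x, `|u x| <= M) -> L2 nu u.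
Proof.
move=> mu uM; split => //; apply: (ig_le _ _ (ig_cst (M ^+ 2))).
  exact: measurable_funX.
move=> x; rewrite normrX ler_sqr ?nnegrE//.
exact: le_trans (uM x).
Qed.

Lemma H0_pl (F : R -> R) (a w : R) m u g : H0 u g ->
  H0 (fun x => pl_fun F a w m (u x)) (fun x => pl_step F a w m (u x) *: g x).
Proof.
move=> ug; elim: m => [|m IHm].
  rewrite (_ : (fun x => _) = fun=> 0); last first.
    by apply/funext => x; rewrite /pl_fun big_ord0.
  rewrite (_ : (fun x => _ *: _) = fun=> 0); last first.
    by apply/funext => x; rewrite /pl_step big_ord0 scale0r.
  exact: H0_0.
have := H0_lin core (pl_slope F a w m) IHm
  (H0_B core (H0_relu core (a + m%:R * w) ug) (H0_relu core (a + m.+1%:R * w) ug)).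
rewrite (_ : (fun x => _ + _) = (fun x => pl_fun F a w m.+1 (u x))); last first.
  by apply/funext => x; rewrite /pl_fun big_ord_recr.
rewrite (_ : (fun x => _ + _) = (fun x => pl_step F a w m.+1 (u x) *: g x))//.
apply/funext => x; rewrite /pl_step big_ord_recr/= scalerDl -scalerBl scalerA.
by [].
Qed.

Lemma measurable_pl_step (F : R -> R) (a w : R) m :
  measurable_fun setT (pl_step F a w m).
Proof.
rewrite /pl_step; apply: measurable_sum => j; apply: measurable_funM => //.
have mi (c : R) : measurable_fun setT (fun s : R => ((c < s)%R)%:R : R).
  rewrite (_ : (fun s => _) = \1_[set` `]c, +oo[]); first exact: measurable_indic.
  apply/funext => s; rewrite indicE; congr (_%:R).
  by rewrite mem_setE in_itv/= andbT.
exact: measurable_funB.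
Qed.

(* F is approximated by piecewise linear functions, that is by combinations of
   the relu k. The values of u avoid the left end point a because pl_step jumps
   just after each node. *)
Lemma H0_chain (F f : R -> R) (a b L : R) u g :
  a < b -> a <= 0 <= b -> F 0 = 0 ->
  (forall s, a <= s <= b -> is_derive s 1 F (f s)) ->
  (forall s, a <= s <= b -> `|f s| <= L) ->
  H0 u g -> (forall x, a < u x <= b) ->
  H0 (fun x => F (u x)) (fun x => f (u x) *: g x).
Proof.
move=> ab ab0 F0 dF fL ug uab.
have L0 : 0 <= L by apply: le_trans (fL a _); rewrite // lexx ltW.
have Flt s t : a <= s -> s < t -> t <= b -> `|F s - F t| <= L * `|s - t|.
  move=> as_ st tb.
  have st_ab c : c \in `[s, t] -> a <= c <= b.
    by rewrite in_itv/= => /andP[sc ct]; rewrite (le_trans as_ sc) (le_trans ct tb).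
  rewrite distrC (distrC s); have [c cst ->] : exists2 c, c \in `]s, t[ & F t - F s = f c * (t - s).
    apply: MVT => // [c cst|].
      by apply: dF; apply: st_ab; exact: subset_itv_oo_cc.
    apply: derivable_within_continuous => c cst.
    by have /dF[] := st_ab _ cst.
  by rewrite normrM ler_wpM2r// fL// st_ab//; exact: subset_itv_oo_cc.
have Flip s t : a <= s <= b -> a <= t <= b -> `|F s - F t| <= L * `|s - t|.
  move=> /andP[as_ sb] /andP[at_ tb]; have [st|ts|->] := ltgtP s t; first exact: Flt.
    by rewrite distrC (distrC s); exact: Flt.
  by rewrite !subrr normr0 mulr0.
pose w n : R := (b - a) / n.+1%:R.
have w0 n : 0 < w n by rewrite divr_gt0// subr_gt0.
have nodeb n : a + n.+1%:R * w n = b.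
  by rewrite /w mulrCA divff ?mulr1// ?pnatr_eq0// addrC subrK.
have wba n : w n <= b - a.
  by rewrite ler_pdivrMr// ler_peMr ?subr_ge0 ?(ltW ab)// ler1n.
have wcvg : w @ \oo --> (0 : R).
  by rewrite -(mulr0 (b - a)); apply: cvgMr; exact: cvg_inv_nat.
have Flipn n s t : a <= s <= a + n.+1%:R * w n -> a <= t <= a + n.+1%:R * w n ->
  `|F s - F t| <= L * `|s - t| by rewrite nodeb; exact: Flip.
have ub x : a <= u x <= b by have /andP[h1 ->] := uab x; rewrite (ltW h1).
have near_ n x : `|pl_fun F a (w n) n.+1 (u x) - F (u x)| <= 4 * L * w n.
  have := @pl_fun_near R F a (w n) L n.+1 (w0 n) L0 (Flipn n) (u x).
  by rewrite nodeb F0 subr0; apply.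
(* The dominating constant is L (b - a) for [F] plus 4 L (b - a) for the interpolation error on the
   coarsest grid. *)
apply: (@H0_dominated _ _ _ _ nu T0 core L u g (fun n x => pl_fun F a (w n) n.+1 (u x))
  (fun n x => pl_step F a (w n) n.+1 (u x)) (fun=> 5 * L * (b - a))).
- by apply: (@L2_bounded `|5 * L * (b - a)|).
- exact: H0_L2v ug.
- by move=> n; exact: H0_pl.
- move=> n; apply: measurableT_comp; first exact: measurable_pl_step.
  by case: (H0_L2 ug).
- move=> x; apply/cvgrPdist_le => e e0.
  have : (fun n => 4 * L * w n) @ \oo --> (0 : R).
    by rewrite -(mulr0 (4 * L)); apply: cvgMr.
  move/cvgrPdist_le => /(_ _ e0); apply: filterS => n.
  rewrite sub0r normrN => h; rewrite distrC; apply: le_trans (near_ n x) _.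
  by apply: le_trans h; exact: ler_norm.
- move=> x; apply/cvgrPdist_le => e e0.
  have [r r0 Hr] := is_derive_eps (dF _ (ub x)) e0.
  have /cvgrPdist_lt/(_ _ r0) := wcvg; apply: filterS => n.
  rewrite sub0r normrN => h.
  apply: (pl_step_near (w0 n) (dF _ (ub x)) Hr).
    exact: le_lt_trans (ler_norm _) h.
  by rewrite nodeb.
- move=> n x; have h1 := near_ n x.
  have h2 : `|F (u x)| <= L * (b - a).
    rewrite -(subr0 (F _)) -{1}F0; apply: le_trans (Flip _ _ (ub x) ab0) _.
    rewrite ler_wpM2l// subr0 ler_norml.
    by have /andP[? ?] := ub x; have /andP[? ?] := ab0; apply/andP; split; lra.
  rewrite -[pl_fun _ _ _ _ _](subrK (F (u x))); apply: le_trans (ler_normD _ _) _.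
  have : 4 * L * w n <= 4 * L * (b - a) by rewrite ler_wpM2l// mulr_ge0.
  lra.
- move=> n x.
  have [|i [im _ ->]] := @pl_stepP R F a (w n) (w0 n) n.+1 (u x).
    by rewrite nodeb.
  exact: (pl_slope_le (w0 n) (Flipn n)).
Qed.

Lemma is_derive_sqr (s : R) : is_derive s 1 (fun t : R => t ^+ 2) (2 * s).
Proof.
rewrite (_ : (fun t => t ^+ 2) = (id : R -> R) * id); last by apply/funext.
apply: is_derive_eq; rewrite /GRing.scale/=; ring.
Qed.

(** Polarisation reduces the product to the squares of u + v and u - v, to which the chain rule
    applies on an interval slightly larger than [- 2 M, 2 M]. *)
Lemma H0_mul (M : R) u g v h : 0 <= M -> H0 u g -> H0 v h ->
  (forall x, `|u x| <= M) -> (forall x, `|v x| <= M) ->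
  H0 (fun x => u x * v x) (fun x => u x *: h x + v x *: g x).
Proof.
move=> M0 ug vh uM vM.
have sq w k : H0 w k -> (forall x, `|w x| <= 2 * M) ->
    H0 (fun x => w x ^+ 2) (fun x => (2 * w x) *: k x).
  move=> wk wM.
  apply: (@H0_chain (fun s => s ^+ 2) (fun s => 2 * s) (- (2 * M + 1)) (2 * M + 1) (2 * (2 * M + 1))) => //.
  - lra.
  - apply/andP; split; lra.
  - by rewrite expr0n.
  - by move=> s _; exact: is_derive_sqr.
  - by move=> s sM; rewrite normrM ger0_norm// ler_pM2l// ler_norml.
  - by move=> x; have := wM x; rewrite ler_norml => /andP[h1 h2]; apply/andP; split; lra.
have s1 := sq _ _ (H0_D core ug vh) _; have s2 := sq _ _ (H0_B core ug vh) _.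
have b1 x : `|u x + v x| <= 2 * M.
  by rewrite mulr_natl mulr2n; apply: le_trans (ler_normD _ _) _; exact: lerD.
have b2 x : `|u x - v x| <= 2 * M.
  by rewrite mulr_natl mulr2n; apply: le_trans (ler_normB _ _) _; exact: lerD.
have := H0_Z core (4^-1) (H0_B core (s1 b1) (s2 b2)).
rewrite (_ : (fun x => _ * (_ - _)) = fun x => u x * v x); last first.
  by apply/funext => x; field.
rewrite (_ : (fun x => _ *: (_ - _)) = fun x => u x *: h x + v x *: g x)//.
apply/funext => x; apply/rowP => i; rewrite !mxE; field.
by [].
Qed.

End chain_rule.

(** * Compactness and weights *)

Section compactness.
Context d (X : measurableType d) (R : realType) (N : nat).
Variable nu : {finite_measure set X -> \bar R}.
Variable T0 : (X -> R) -> (X -> 'rV[R]_N) -> Prop.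
Implicit Types (u v b phi : X -> R) (g h psi : X -> 'rV[R]_N).
Hypothesis core : energy_core nu T0.

Local Notation meas := (measurable_fun [set: X]).
Local Notation H0 := (H0 nu T0).
Local Notation RI := (RI nu).
Local Notation ig := (ig nu).
Local Notation L2 := (L2 nu).
Local Notation nrm2 := (nrm2 nu).

(* The compact embedding into L2 in a form that passes to the limit: up to e
   times the energy, the L2 norm is controlled by finitely many linear forms. *)
Definition rellich := forall e : R, 0 < e ->
  exists (m : nat) (E : 'I_m -> X -> R) (C : R),
    [/\ 0 <= C, forall k, L2 (E k) & forall phi psi, T0 phi psi ->
     RI (fun x => phi x ^+ 2) <=
       e * nrm2 psi + C * \sum_k RI (fun x => phi x * E k x) ^+ 2].

Hypothesis rel : rellich.

Lemma rellich_H0 (e : R) : 0 < e ->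
  exists (m : nat) (E : 'I_m -> X -> R) (C : R),
    [/\ 0 <= C, forall k, L2 (E k) & forall u g, H0 u g ->
     RI (fun x => u x ^+ 2) <=
       e * nrm2 g + C * \sum_k RI (fun x => u x * E k x) ^+ 2].
Proof.
move=> e0; have e40 : 0 < e / 4 by rewrite divr_gt0.
have [m [E [C [C0 E2 HE]]]] := rel e40.
exists m, E, (4 * C); split => //; first by rewrite mulr_ge0.
move=> u g ug; have u2 := H0_L2 ug; have g2 := H0_L2v ug.
(* The total coefficient of the approximation error [del] in the estimates below, so that the error
   of size t / K contributes exactly t. *)
pose K := 2 + e + 4 * C * \sum_k RI (fun x => E k x ^+ 2).
have S0 : 0 <= \sum_k RI (fun x => E k x ^+ 2).
  by apply: sumr_ge0 => k _; exact: RI_sqr_ge0.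
have K0 : 0 < K by rewrite /K ltr_wpDr ?mulr_ge0//; lra.
apply/ler_addgt0Pr => t t0.
have [_ _ /(_ (t / K))[|phi [psi [T le]]]] := ug; first by rewrite divr_gt0.
have [p2 q2] := core_L2 core T.
have A0 := RI_sqr_ge0 nu (fun x => u x - phi x).
have B0 := nrm2_ge0 nu (fun x => g x - psi x).
set del := t / K in le.
have dK : del * K = t by rewrite /del mulfVK ?gt_eqF.
have leA : RI (fun x => (u x - phi x) ^+ 2) <= del by move: le; rewrite /dist2; lra.
have leB : nrm2 (fun x => g x - psi x) <= del by move: le; rewrite /dist2; lra.
have h1 : RI (fun x => u x ^+ 2) <= 2 * del + 2 * RI (fun x => phi x ^+ 2).
  have := RI_sqrD (L2B u2 p2) p2.
  rewrite (_ : RI (fun x => (u x - phi x + phi x) ^+ 2) = RI (fun x => u x ^+ 2)); last first.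
    by apply: RI_eq => x; rewrite subrK.
  lra.
have h2 : nrm2 psi <= 2 * nrm2 g + 2 * del.
  have := nrm2D_le (L2vN (L2vB g2 q2)) g2; rewrite nrm2N.
  rewrite (_ : nrm2 (fun x => - (g x - psi x) + g x) = nrm2 psi); last first.
    by apply: RI_eq => x; rewrite opprB subrK.
  lra.
have h3 k : RI (fun x => phi x * E k x) ^+ 2 <=
    2 * RI (fun x => u x * E k x) ^+ 2 + 2 * (del * RI (fun x => E k x ^+ 2)).
  have cs := RI_CS (L2B u2 p2) (E2 k).
  have := RIB (L2_mul u2 (E2 k)) (L2_mul (L2B u2 p2) (E2 k)).
  rewrite (_ : RI (fun x => _ - _) = RI (fun x => phi x * E k x)); last first.
    by apply: RI_eq => x; ring.
  move=> ->; have E0 := RI_sqr_ge0 nu (E k).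
  have : RI (fun x => (u x - phi x) ^+ 2) * RI (fun x => E k x ^+ 2) <= del * RI (fun x => E k x ^+ 2).
    by rewrite ler_wpM2r.
  move: cs; set a := RI (fun x => u x * _); set b := RI (fun x => _ * E k x).
  have := sqr_ge0 (a + b); nra.
have h4 : \sum_k RI (fun x => phi x * E k x) ^+ 2 <=
    2 * (\sum_k RI (fun x => u x * E k x) ^+ 2) + 2 * (del * \sum_k RI (fun x => E k x ^+ 2)).
  by rewrite !mulr_sumr -big_split/=; apply: ler_sum => k _.
have := HE _ _ T.
have h5 : C * \sum_k RI (fun x => phi x * E k x) ^+ 2 <= C *
    (2 * (\sum_k RI (fun x => u x * E k x) ^+ 2) + 2 * (del * \sum_k RI (fun x => E k x ^+ 2))).
  by rewrite ler_wpM2l.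
have h6 : e / 4 * nrm2 psi <= e / 4 * (2 * nrm2 g + 2 * del) by rewrite ler_wpM2l// ltW.
have g0 := nrm2_ge0 nu g.
have eg0 : 0 <= e * nrm2 g by rewrite mulr_ge0// ltW.
rewrite -dK /K; move: h1 h5 h6; set S := \sum_k RI (fun x => E k x ^+ 2).
set Q := \sum_k RI (fun x => u x * _) ^+ 2; set P := \sum_k _.
move=> h1 h5 h6 h7; nra.
Qed.

(** Along an ultrafilter refining \oo every bounded sequence of numbers converges, hence all linear
    forms of [rellich_H0] at once. So for each e some set of the ultrafilter contains only functions
    within e of each other in squared L2 norm. This replaces a diagonal extraction. *)
Lemma H0_subseq (w_ : nat -> X -> R) (g_ : nat -> X -> 'rV[R]_N) (M : R) :
  (forall n, H0 (w_ n) (g_ n)) -> (forall n, nrm2 (g_ n) <= M) ->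
  (forall n, RI (fun x => w_ n x ^+ 2) <= M) ->
  exists s : nat -> nat, (forall j, (j <= s j)%N) /\
    forall i j, (j <= i)%N -> RI (fun x => (w_ (s i) x - w_ (s j) x) ^+ 2) <= 8^-1 ^+ j.
Proof.
move=> wg gM wM.
have M0 : 0 <= M by apply: le_trans (gM 0%N); exact: nrm2_ge0.
have [U [UU ooU]] := ultraFilterLemma (F := \oo) _.
have w2 n := H0_L2 (wg n); have g2 n := H0_L2v (wg n).
have lim (E : X -> R) : L2 E -> exists c : R, (fun n => RI (fun x => w_ n x * E x)) @ U --> c.
  move=> E2; pose B := M + RI (fun x => E x ^+ 2).
  have bnd n : RI (fun x => w_ n x * E x) \in `[- B, B].
    rewrite in_itv/= -ler_norml.
    apply: le_trans (RI_norm (L2_mul (w2 n) E2)) _.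
    apply: (@le_trans _ _ (RI (fun x => w_ n x ^+ 2) + RI (fun x => E x ^+ 2))); last by rewrite lerD2r.
    rewrite -RID; [|by case: (w2 n)|by case: E2].
    apply: RI_le; [exact/ig_norm/L2_mul|by apply: igD; [case: (w2 n)|case: E2]|].
    move=> x; rewrite normrM; have := sqr_ge0 (`|w_ n x| - `|E x|).
    rewrite -(real_normK (num_real (w_ n x))) -(real_normK (num_real (E x))).
    have := normr_ge0 (w_ n x); have := normr_ge0 (E x); nra.
  pose f n := RI (fun x => w_ n x * E x).
  have [|c [_ cc]] := @segment_compact R (- B) B (f @ U) _.
    by apply: (@filterS _ U _ setT) => [n _|]; [exact: bnd|exact: filterT].
  exists c => V Vc; have [//|UV] := in_ultra_setVsetC (f @^-1` V) UU.
  have [t [VCt Vt]] := cc (~` V) V UV Vc.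
  by case: VCt.
have small (e : R) : 0 < e -> exists A : set nat, U A /\ forall n m, A n -> A m ->
    RI (fun x => (w_ n x - w_ m x) ^+ 2) <= e.
  move=> e0.
  have [|m [E [C [C0 E2 HE]]]] := @rellich_H0 (e / (8 * (M + 1))).
    by rewrite divr_gt0// mulr_gt0// ltr_wpDl.
  have /choice[c Hc] k := lim (E k) (E2 k).
  (* The bound by 1 replaces t^2 by t; the other bound makes the m linear forms contribute at most e
     / 2. *)
  pose t := Num.min 1 (e / (8 * (C * m%:R + 1))).
  have Cm0 : 0 <= C * m%:R by rewrite mulr_ge0.
  have t0 : 0 < t by rewrite lt_min ltr01 divr_gt0// mulr_gt0// ltr_wpDl.
  have tt : t ^+ 2 <= t.
    by rewrite expr2 ler_piMl// ?(ltW t0)// ge_min lexx.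
  have tC : C * m%:R * t <= e / 8.
    apply: (@le_trans _ _ (C * m%:R * (e / (8 * (C * m%:R + 1))))).
      by rewrite ler_wpM2l// ge_min lexx orbT.
    have -> : C * m%:R * (e / (8 * (C * m%:R + 1))) = e / 8 * (C * m%:R / (C * m%:R + 1)).
      by field; rewrite gt_eqF// ltr_wpDl.
    by rewrite ler_piMr ?divr_ge0 ?(ltW e0)// ler_pdivrMr ?mul1r ?ltr_wpDl//; lra.
  exists [set n | forall k, `|c k - RI (fun x => w_ n x * E k x)| <= t]; split.
    by apply: filter_forall => k; have /cvgrPdist_le/(_ _ t0) := Hc k.
  move=> n p An Ap; apply: le_trans (HE _ _ (H0_B core (wg n) (wg p))) _.
  have h1 : nrm2 (fun x => g_ n x - g_ p x) <= 4 * M.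
    have := nrm2D_le (g2 n) (L2vN (g2 p)); rewrite nrm2N.
    have := gM n; have := gM p; lra.
  have h2 k : RI (fun x => (w_ n x - w_ p x) * E k x) ^+ 2 <= 4 * t.
    rewrite (_ : RI _ = RI (fun x => w_ n x * E k x) - RI (fun x => w_ p x * E k x)); last first.
      by rewrite -RIB; [apply: RI_eq => x; ring|exact: L2_mul..].
    have := An k; have := Ap k; rewrite !ler_norml.
    set a := RI _; set b := RI _ => /andP[? ?] /andP[? ?].
    apply: le_trans (_ : 4 * t ^+ 2 <= _); last by rewrite ler_pM2l.
    have : `|b - a| <= 2 * t by rewrite ler_norml; apply/andP; split; lra.
    rewrite -(real_normK (num_real (b - a))) => h.
    have -> : 4 * t ^+ 2 = (2 * t) ^+ 2 by ring.
    by rewrite ler_sqr ?nnegrE// mulr_ge0 ?ltW.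
  have h3 : C * \sum_k RI (fun x => (w_ n x - w_ p x) * E k x) ^+ 2 <= e / 2.
    apply: (@le_trans _ _ (C * \sum_(k < m) (4 * t))).
      by rewrite ler_wpM2l//; apply: ler_sum => k _.
    rewrite sumr_const card_ord -mulr_natl; move: tC; nra.
  have h4 : e / (8 * (M + 1)) * nrm2 (fun x => g_ n x - g_ p x) <= e / 2.
    apply: (@le_trans _ _ (e / (8 * (M + 1)) * (4 * M))).
      by rewrite ler_wpM2l// divr_ge0 ?(ltW e0)// mulr_ge0// addr_ge0.
    have -> : e / (8 * (M + 1)) * (4 * M) = e / 2 * (M / (M + 1)).
      by field; rewrite gt_eqF// ltr_wpDl.
    by rewrite ler_piMr ?divr_ge0 ?(ltW e0)// ler_pdivrMr ?mul1r ?ltr_wpDl//; lra.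
  lra.
have /choice[A HA] (j : nat) : exists A : set nat, U A /\ forall n m, A n -> A m ->
    RI (fun x => (w_ n x - w_ m x) ^+ 2) <= 8^-1 ^+ j.
  by apply: small; rewrite exprn_gt0// invr_gt0.
(* The index s j lies in the first j + 1 sets, so for j <= i both s i and s j lie in A j. A set of
   the ultrafilter is nonempty. *)
have /choice[s Hs] (j : nat) : exists n, (j <= n)%N /\ forall i : 'I_j.+1, A i n.
  have : U [set n | (j <= n)%N /\ forall i : 'I_j.+1, A i n].
    apply: filterI; first by apply: ooU; exists j.
    by apply: filter_forall => i; case: (HA i).
  by move=> /filter_ex[n]; exists n.
exists s; split; first by move=> j; case: (Hs j).
move=> i j ji; have [_] := HA j; apply.
  by have [_ /(_ (Ordinal (ji : (j < i.+1)%N)))] := Hs i.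
by have [_ /(_ ord_max)] := Hs j.
Qed.

(** The gradient of the limit is left open: each convergent bound on the energies yields a gradient
    obeying it. A crude bound first places [w] in [H0]; a sharp one, available only once [w] is
    known, is used afterwards. *)
Lemma H0_compact (w_ : nat -> X -> R) (g_ : nat -> X -> 'rV[R]_N) (M : R) :
  (forall n, H0 (w_ n) (g_ n)) -> (forall n, nrm2 (g_ n) <= M) ->
  (forall n, RI (fun x => w_ n x ^+ 2) <= M) ->
  exists (s : nat -> nat) (w : X -> R),
   [/\ forall j, (j <= s j)%N, L2 w,
     {ae nu, forall x, (fun j => w_ (s j) x) @ \oo --> w x},
     forall j, RI (fun x => (w x - w_ (s j) x) ^+ 2) <= 8^-1 ^+ j &
     forall (l_ : nat -> R) l, l_ @ \oo --> l -> (forall j, nrm2 (g_ (s j)) <= l_ j) ->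
       exists g, H0 w g /\ nrm2 g <= l].
Proof.
move=> wg gM wM; have [s [sj sw]] := H0_subseq wg gM wM.
have [|i j ij|w [w2 wae ww]] := @L2_complete_fast _ _ _ nu (fun j => w_ (s j)).
- by move=> n; exact: H0_L2 (wg _).
- exact: sw.
exists s, w; split => // l_ l ll gl; apply: (H0_lsc core w2) => e e0.
near \oo => j.
exists (w_ (s j)), (g_ (s j)); split => //.
  apply: le_trans (ww j) _; near: j.
  have /cvg_geom0/cvgrPdist_le/(_ _ e0) : 0 <= (8^-1 : R) < 1.
    by rewrite invr_ge0 ler0n invf_lt1// ltr1n.
  by apply: filterS => n; rewrite sub0r normrN => /(le_trans (ler_norm _)).
apply: le_trans (gl j) _; near: j; move/cvgrPdist_le : ll => /(_ _ e0).
by apply: filterS => n; rewrite distrC ler_norml => /andP[_]; rewrite lerBlDl.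
Unshelve. all: by end_near. Qed.

End compactness.

(** * Weights with a Sobolev inequality *)

Section weights.
Context d (X : measurableType d) (R : realType) (N : nat).
Variable nu : {finite_measure set X -> \bar R}.
Variable T0 : (X -> R) -> (X -> 'rV[R]_N) -> Prop.
Implicit Types (u v b phi : X -> R) (g h psi : X -> 'rV[R]_N).
Hypothesis core : energy_core nu T0.

Local Notation meas := (measurable_fun [set: X]).
Local Notation H0 := (H0 nu T0).
Local Notation RI := (RI nu).
Local Notation ig := (ig nu).
Local Notation L2 := (L2 nu).
Local Notation nrm2 := (nrm2 nu).

Lemma measurable_gt u (c : R) : meas u -> measurable [set x | c < u x].
Proof.
move=> mu_; have := mu_ measurableT _ (measurable_itv `]c, +oo[).
rewrite setTI (_ : u @^-1` _ = [set x | c < u x])//.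
by apply/seteqP; split => x; rewrite /= in_itv/= andbT.
Qed.

Definition mass (A : set X) : R := fine (nu A).

Lemma mass_ge0 A : 0 <= mass A.
Proof. exact: fine_ge0. Qed.

Lemma RI_indic (A : set X) : measurable A -> RI (\1_A) = mass A.
Proof.
by move=> mA; rewrite RI_def /Rintegral integral_indic// setIT.
Qed.

Lemma ig_indic (A : set X) : measurable A -> ig (\1_A).
Proof.
move=> mA; apply: (ig_le _ _ (ig_cst nu 1)); first exact: measurable_indic.
by move=> x; rewrite indicE; case: (x \in A); rewrite ?normr1 ?normr0.
Qed.

Lemma ig_indicM (A : set X) u : measurable A -> ig u -> ig (fun x => \1_A x * u x).
Proof.
move=> mA ui; apply: (ig_le _ _ (ig_norm ui)).
  by apply: measurable_funM; [exact: measurable_indic|exact: ig_meas ui].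
by move=> x; rewrite normrM indicE; case: (x \in A);
  rewrite ?normr1 ?normr0 ?mul1r ?mul0r.
Qed.

Variables (V : X -> R) (sigma C : R).

(* The power of the mass of A, which comes from q > N / 2, is what makes the
   De Giorgi iteration superlinear. *)
Definition sobolev_weight := forall A, measurable A -> forall phi psi, T0 phi psi ->
  ig (fun x => V x * phi x ^+ 2) /\
  RI (fun x => \1_A x * (V x * phi x ^+ 2)) <= C * mass A `^ sigma * nrm2 psi.

Hypotheses (sw : sobolev_weight) (V1 : forall x, 1 <= V x) (iV : ig V) (C0 : 0 <= C)
  (sigma0 : 0 < sigma).

Let V0 x : 0 <= V x. Proof. exact: le_trans (V1 x). Qed.

Let Vle x : `|V x| <= V x. Proof. by rewrite ger0_norm. Qed.

(** Fatou's lemma along test pairs converging almost everywhere; the factor 2 is lost in comparing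
    the energies of the approximations with that of [g]. *)
Lemma sobolev_H0 (A : set X) u g : measurable A -> H0 u g ->
  ig (fun x => V x * u x ^+ 2) /\
  RI (fun x => \1_A x * (V x * u x ^+ 2)) <= 2 * C * mass A `^ sigma * nrm2 g.
Proof.
have mV := ig_meas iV.
suff key B : measurable B -> H0 u g -> ig (fun x => \1_B x * (V x * u x ^+ 2)) /\
  RI (fun x => \1_B x * (V x * u x ^+ 2)) <= 2 * C * mass B `^ sigma * nrm2 g.
  move=> mA ug; split; last by have [] := key A mA ug.
  have [h _] := key setT measurableT ug; apply: ig_eq h => x.
  by rewrite indicT mul1r.
move=> mB ug; have [p [q [pq dpq pae]]] := H0_approx core ug.
have mu_ : meas u by case: (H0_L2 ug).
pose a n := C * mass B `^ sigma * (2 * nrm2 g + 2 * 8^-1 ^+ n).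
apply: (@RI_fatou _ _ _ nu (fun n x => \1_B x * (V x * p n x ^+ 2)) _ a).
- apply: measurable_funM; first exact: measurable_indic.
  by apply: measurable_funM => //; exact: measurable_funX.
- by move=> x; rewrite mulr_ge0 ?indicE ?ler0n// mulr_ge0 ?sqr_ge0.
- by move=> n; apply: ig_indicM => //; have [] := sw mB (pq n).
- by move=> n x; rewrite mulr_ge0 ?indicE ?ler0n// mulr_ge0 ?sqr_ge0.
- by apply: filterS pae => x px; apply: cvgMr; apply: cvgMr; exact: cvg_sqr.
- move=> n; have [_ le] := sw mB (pq n); apply: le_trans le _.
  rewrite ler_wpM2l ?mulr_ge0 ?powR_ge0//.
  have [p2 q2] := core_L2 core (pq n).
  have := nrm2D_le (L2vN (L2vB (H0_L2v ug) q2)) (H0_L2v ug); rewrite nrm2N.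
  rewrite (_ : nrm2 (fun x => - (g x - q n x) + g x) = nrm2 (q n)); last first.
    by apply: RI_eq => x; rewrite opprB subrK.
  have := dpq n; rewrite /dist2; have := RI_sqr_ge0 nu (fun x => u x - p n x); lra.
- rewrite (_ : 2 * C * _ * _ = C * mass B `^ sigma * (2 * nrm2 g + 2 * 0)); last by ring.
  apply: cvgMr; apply: cvgD; first exact: cvg_cst.
  by apply: cvgMr; apply: cvg_geom0; rewrite invr_ge0 ler0n invf_lt1// ltr1n.
Qed.

Definition L2w u := meas u /\ ig (fun x => V x * u x ^+ 2).

Lemma H0_L2w u g : H0 u g -> L2w u.
Proof.
move=> ug; split; first by case: (H0_L2 ug).
by have [] := sobolev_H0 measurableT ug.
Qed.

Lemma L2w_bounded (M : R) u : meas u -> (forall x, `|u x| <= M) -> L2w u.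
Proof.
move=> mu_ uM; split => //; apply: (ig_le _ _ (igZ (M ^+ 2) iV)).
  by apply: measurable_funM; [exact: ig_meas iV|exact: measurable_funX].
move=> x; rewrite normrM normrX (ger0_norm (V0 x)) mulrC ler_wpM2r//.
by rewrite ler_sqr ?nnegrE// (le_trans _ (uM x)).
Qed.

Lemma L2w_mul (a : X -> R) u v : meas a -> (forall x, `|a x| <= V x) -> L2w u -> L2w v ->
  ig (fun x => a x * (u x * v x)).
Proof.
move=> ma aV [mu_ ui] [mv vi]; apply: (ig_le _ _ (igD ui vi)).
  by apply: measurable_funM => //; exact: measurable_funM.
move=> x; rewrite !normrM -mulrDr; apply: ler_pM => //.
have := sqr_ge0 (`|u x| - `|v x|).
rewrite -(real_normK (num_real (u x))) -(real_normK (num_real (v x))).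
have := normr_ge0 (u x); have := normr_ge0 (v x); nra.
Qed.

Lemma L2w_le u v : meas u -> (forall x, `|u x| <= `|v x|) -> L2w v -> L2w u.
Proof.
move=> mu_ uv [mv vi]; split => //; apply: (ig_le _ _ vi).
  by apply: measurable_funM; [exact: ig_meas iV|exact: measurable_funX].
move=> x; rewrite normrM (ger0_norm (V0 x)) ler_wpM2l// normrX.
by rewrite -[leRHS](real_normK (num_real _)) ler_sqr ?nnegrE.
Qed.

Lemma L2wD u v : L2w u -> L2w v -> L2w (fun x => u x + v x).
Proof.
move=> u2 v2; have uv := L2w_mul (ig_meas iV) Vle u2 v2.
case: u2 => mu_ ui; case: v2 => mv vi.
split; first exact: measurable_funD.
by apply: ig_eq (igD (igD ui vi) (igZ 2 uv)) => x; ring.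
Qed.

Lemma L2w_ig u : L2w u -> ig (fun x => V x * u x).
Proof.
move=> u2; have c1 : L2w (fun=> 1) by apply: (L2w_bounded (M := 1)) => // x; rewrite normr1.
by have := L2w_mul (ig_meas iV) Vle u2 c1; apply: ig_eq => x; rewrite mulr1.
Qed.

Lemma poincare_H0 : exists2 K : R, 0 < K & forall u g, H0 u g ->
  RI (fun x => V x * u x ^+ 2) <= K * nrm2 g /\ RI (fun x => u x ^+ 2) <= K * nrm2 g.
Proof.
exists (2 * C * mass setT `^ sigma + 1); first by rewrite ltr_wpDl// !mulr_ge0// powR_ge0.
move=> u g ug; have [ui le] := sobolev_H0 measurableT ug.
have h : RI (fun x => V x * u x ^+ 2) <= (2 * C * mass setT `^ sigma + 1) * nrm2 g.
  rewrite mulrDl mul1r; apply: (@le_trans _ _ (2 * C * mass setT `^ sigma * nrm2 g)).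
    by apply: le_trans le; rewrite le_eqVlt; apply/orP; left; apply/eqP/RI_eq => x; rewrite indicT mul1r.
  by rewrite lerDl nrm2_ge0.
split => //; apply: le_trans h; apply: RI_le => //; first by case: (H0_L2 ug).
by move=> x; rewrite ler_peMl ?sqr_ge0.
Qed.

(** On the set V > M the Sobolev inequality has a small constant, because its mass tends to 0 by
    Chebyshev's inequality; on the complement the weight is at most M. *)
Lemma weight_small (e : R) : 0 < e -> exists2 M : R, 0 <= M & forall u g, H0 u g ->
  RI (fun x => V x * u x ^+ 2) <= e * nrm2 g + M * RI (fun x => u x ^+ 2).
Proof.
(* A mass at most t gives the constant 2 C t^sigma, which is below e; M is then dictated by
   Chebyshev's inequality. *)
move=> e0; pose t := (e / (2 * C + 1)) `^ sigma^-1.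
have Cp : 0 < 2 * C + 1 by rewrite ltr_wpDl ?mulr_ge0.
have t0 : 0 < t by rewrite powR_gt0// divr_gt0.
have IV0 : 0 <= RI V by apply: RI_ge0.
pose M := (RI V + 1) / t; have M0 : 0 < M by rewrite divr_gt0// ltr_wpDl.
exists M => [|u g ug]; first exact: ltW.
pose A := [set x | M < V x].
have mA : measurable A by exact: measurable_gt (ig_meas iV).
have mass_le : mass A <= t.
  have : M * mass A <= RI V.
    rewrite -RI_indic// -RIZ; last exact: ig_indic.
    apply: RI_le => //; first by apply: igZ; exact: ig_indic.
    move=> x; rewrite indicE; case: (boolP (x \in A)) => [|_]; last by rewrite mulr0.
    by rewrite inE mulr1 => /ltW.
  rewrite /M mulrAC ler_pdivrMr// => h.
  have := mass_ge0 A; nra.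
have [ui le] := sobolev_H0 mA ug.
have split_ : RI (fun x => V x * u x ^+ 2) <=
    RI (fun x => \1_A x * (V x * u x ^+ 2)) + M * RI (fun x => u x ^+ 2).
  have u2i : ig (fun x => u x ^+ 2) by case: (H0_L2 ug).
  rewrite -RIZ// -RID; [|exact: ig_indicM|exact: igZ].
  apply: RI_le => //; first by apply: igD; [exact: ig_indicM|exact: igZ].
  move=> x; rewrite indicE; case: (boolP (x \in A)) => [_|].
    by rewrite mul1r lerDl mulr_ge0 ?sqr_ge0// ltW.
  rewrite notin_setE /A/= => /negP; rewrite -leNgt => VM.
  by rewrite mul0r add0r ler_wpM2r ?sqr_ge0.
apply: le_trans split_ _; rewrite lerD2r; apply: le_trans le _.
rewrite ler_wpM2r ?nrm2_ge0//.
have h : mass A `^ sigma <= e / (2 * C + 1).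
  have -> : e / (2 * C + 1) = t `^ sigma.
    by rewrite /t -powRrM mulVf ?gt_eqF// powRr1// divr_ge0 ?ltW.
  by apply: ge0_ler_powR; rewrite ?nnegrE ?mass_ge0 ?(ltW t0) ?(ltW sigma0).
apply: le_trans (ler_wpM2l _ h) _; first by rewrite mulr_ge0.
rewrite mulrCA ler_piMr ?(ltW e0)// ler_pdivrMr// mul1r; lra.
Qed.

End weights.

(** * Necessity of coercivity, De Giorgi iteration *)

Section real_functions.
Context (R : realType).
Implicit Types (s k m : R).

Definition clamp (a b s : R) := Num.min (Num.max s a) b.

Lemma clampE a b s : a <= b -> clamp a b s = a + Num.max (s - a) 0 - Num.max (s - b) 0.
Proof.
move=> ab; rewrite /clamp; have [sa|/ltW as_] := leP s a.
  by rewrite min_l// !max_r ?subr_le0 ?addr0 ?subr0// (le_trans sa).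
rewrite (max_l (_ : 0 <= s - a)) ?subr_ge0//.
have [sb|/ltW bs] := leP s b; first by rewrite max_r ?subr_le0// subr0 addrC subrK.
by rewrite max_l ?subr_ge0//; ring.
Qed.

Lemma clamp_relu a b s : a <= b -> clamp a b s = relu a s - relu b s + clamp a b 0.
Proof. by move=> ab; rewrite !clampE// /relu !sub0r; ring. Qed.

Lemma clamp_itv a b s : a <= b -> a <= clamp a b s <= b.
Proof. by move=> ab; rewrite /clamp le_min le_max lexx orbT ab ge_min lexx orbT. Qed.

Lemma quad_disc (A B D : R) : 0 <= A -> 0 <= B ->
  (forall t, 0 <= A + 2 * t * D + t ^+ 2 * B) -> D ^+ 2 <= A * B.
Proof.
move=> A0 B0 q; have [B00|Bn0] := eqVneq B 0.
  rewrite B00 mulr0; have [->|D0] := eqVneq D 0; first by rewrite expr0n.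
  have := q (- (A + 1) / (2 * D)); rewrite B00 mulr0 addr0.
  have -> : 2 * (- (A + 1) / (2 * D)) * D = - (A + 1) by field.
  lra.
have := q (- D / B).
have -> : A + 2 * (- D / B) * D + (- D / B) ^+ 2 * B = (A * B - D ^+ 2) / B by field.
by rewrite pmulr_lge0 ?invr_gt0 ?lt_def ?Bn0// subr_ge0.
Qed.

(* In terms of r = s^2 this is (r ln r - r + 1) / 4, a primitive of s ln |s|. *)
Definition entropy s : R := (s ^+ 2 * ln (s ^+ 2) - s ^+ 2 + 1) / 4.
Definition entropy' s : R := s * ln (s ^+ 2) / 2.

Lemma ln_le_sub1 (x : R) : 0 < x -> ln x <= x - 1.
Proof.
move=> x0; have := @expR_ge1Dx R (ln x); rewrite lnK//; lra.
Qed.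

Lemma ln_ge_1subV (x : R) : 0 < x -> 1 - x^-1 <= ln x.
Proof.
move=> x0; have := ln_le_sub1 (_ : 0 < x^-1); rewrite invr_gt0 => /(_ x0).
rewrite lnV//; lra.
Qed.

Lemma entropy_ge0 s : 0 <= entropy s.
Proof.
rewrite divr_ge0//; have [->|s0] := eqVneq s 0; first by rewrite expr0n/= mul0r subr0 add0r.
have r0 : 0 < s ^+ 2 by rewrite exprn_even_gt0.
have := ler_wpM2l (ltW r0) (ln_ge_1subV r0); rewrite mulrBr mulr1 divff ?gt_eqF//; lra.
Qed.

Lemma entropy_norm s : entropy `|s| = entropy s.
Proof. by rewrite /entropy real_normK ?num_real. Qed.

(** As soon as ln s^2 reaches 4 l + 1 the entropy is at least l s^2; before that the left-hand side
    is nonpositive. *)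
Lemma entropy_lower (l s : R) : 0 <= l -> l * s ^+ 2 - l * expR (4 * l + 1) <= entropy s.
Proof.
move=> l0; have [sl|ls] := leP (s ^+ 2) (expR (4 * l + 1)).
  by apply: le_trans (entropy_ge0 s); rewrite -mulrBr mulr_ge0_le0// subr_le0.
have r0 : 0 < s ^+ 2 by apply: lt_trans ls; exact: expR_gt0.
have : 4 * l + 1 <= ln (s ^+ 2).
  by rewrite -ler_expR lnK// ltW.
move=> h; have := ler_wpM2l (ltW r0) h; have := mulr_ge0 l0 (expR_ge0 (4 * l + 1)).
rewrite /entropy; lra.
Qed.

Lemma entropy'_le s : `|entropy' s| <= 1 + s ^+ 2.
Proof.
have [->|s0] := eqVneq s 0; first by rewrite /entropy' !mul0r normr0 expr0n addr0.
have a0 : 0 < `|s| by rewrite normr_gt0.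
have -> : `|entropy' s| = `|s| * `|ln `|s| |.
  rewrite -normrM; congr `|_|; rewrite /entropy' -(real_normK (num_real s)) lnXn// mulr2n.
  by field.
rewrite -(real_normK (num_real s)); set a := `|s| in a0 *.
have h1 := ln_le_sub1 a0; have h2 := ln_ge_1subV a0.
have h3 := ler_wpM2l (ltW a0) h1; have h4 := ler_wpM2l (ltW a0) h2.
rewrite mulrBr mulr1 divff ?gt_eqF// in h4.
rewrite -{1}(gtr0_norm a0) -normrM ler_norml; apply/andP; split; nra.
Qed.

(** Only 0 needs care, where the convention ln 0 = 0 makes both functions continuous. There ln q >=
    1 - 1 / q with q = sqrt |h| bounds the difference quotient by |h| + sqrt |h|. *)
Lemma is_derive_entropy s : is_derive s 1 entropy (entropy' s).
Proof.
have [->|s0] := eqVneq s 0; last first.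
  have r0 : 0 < s ^+ 2 by rewrite exprn_even_gt0.
  have d1 : is_derive s 1 (fun t : R => t ^+ 2) (2 * s).
    rewrite (_ : (fun t => t ^+ 2) = (id : R -> R) * id); last by apply/funext.
    by apply: is_derive_eq; rewrite /GRing.scale/=; ring.
  have d2 : is_derive s 1 (fun t : R => ln (t ^+ 2)) (2 * s / s ^+ 2).
    have := @is_derive1_comp R (@ln R) (fun t => t ^+ 2) s _ _ (is_derive1_ln r0) d1.
    by rewrite mulrC.
  rewrite /entropy (_ : (fun t => _) = (fun t => 4^-1 * (t ^+ 2 * ln (t ^+ 2) - t ^+ 2 + 1))); last first.
    by apply/funext => t; rewrite mulrC.
  have d3 : is_derive s 1 ((fun t : R => t ^+ 2) * (fun t : R => ln (t ^+ 2)))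
     (s ^+ 2 *: (2 * s / s ^+ 2) + ln (s ^+ 2) *: (2 * s)) by exact: is_deriveM.
  have d4 := is_deriveZ 4^-1 (is_deriveD (is_deriveB d3 d1) (is_derive_cst (1 : R) s 1)).
  apply: is_derive_eq.
  rewrite /entropy' /GRing.scale/=; field.
  by [].
have key (h : R) : `|h| <= 1 -> `|entropy h - entropy 0| <= `|h| * (`|h| + Num.sqrt `|h|).
  move=> h1; have [->|h0] := eqVneq h 0; first by rewrite subrr normr0 mul0r.
  have a0 : 0 < `|h| by rewrite normr_gt0.
  have -> : entropy h - entropy 0 = (2 * `|h| ^+ 2 * ln `|h| - `|h| ^+ 2) / 4.
    by rewrite /entropy expr0n/= -(real_normK (num_real h)) lnXn// mulr2n; field.
  set a := `|h| in a0 h1 *; set q := Num.sqrt a.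
  have q0 : 0 < q by rewrite sqrtr_gt0.
  have aq : a = q ^+ 2 by rewrite sqr_sqrtr// ltW.
  have la : ln a = 2 * ln q by rewrite aq lnXn// mulr2n; ring.
  have h2 := ln_ge_1subV q0; have h3 : ln a <= 0 by rewrite ln_le0.
  have h4 := ler_wpM2l (ltW q0) h2; rewrite mulrBr mulr1 divff ?gt_eqF// in h4.
  have h5 : - a * ln a <= 2 * q.
    have -> : - a * ln a = q * (- 2 * (q * ln q)) by rewrite la aq; ring.
    by rewrite [leRHS]mulrC ler_wpM2l ?(ltW q0)//; have := ltW q0; lra.
  have h6 : 0 <= - a * ln a by rewrite mulNr oppr_ge0 mulr_ge0_le0// ltW.
  rewrite normrM (ger0_norm (_ : 0 <= 4^-1 :> R))// ler_pdivrMr//.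
  have -> : 2 * a ^+ 2 * ln a - a ^+ 2 = - (a * (2 * (- a * ln a) + a)) by ring.
  have h7 : 0 <= 2 * (- a * ln a) + a by lra.
  rewrite normrN (ger0_norm (mulr_ge0 (ltW a0) h7)).
  rewrite -mulrA ler_wpM2l ?(ltW a0)//; lra.
rewrite /entropy' mul0r mul0r.
have cv : (fun h => h^-1 *: (entropy (h *: 1 + 0) - entropy 0)) @ 0^' --> (0 : R).
  have small : (fun h : R => `|h| + Num.sqrt `|h|) @ 0^' --> (0 : R).
    have n0 : (fun h : R => `|h|) @ 0^' --> (0 : R).
      by apply: cvg_within_filter; have := @norm_continuous R R 0; rewrite /continuous_at normr0.
    have := cvgD n0 (continuous_cvg _ (@sqrt_continuous R _) n0).
    by rewrite sqrtr0 addr0; apply; exact: _.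
  apply/cvgrPdist_le => e e0; move/cvgrPdist_le : small => /(_ _ e0).
  have n1 : \forall h \near (0 : R)^', `|h| <= 1.
    apply: nbhs_dnbhs; apply/nbhs_ballP; exists 1 => //= h.
    by rewrite /ball/= sub0r normrN => /ltW.
  have nz : \forall h \near (0 : R)^', h != 0 by exact: nbhs_dnbhs_neq.
  apply: filterS3 n1 nz => h h1 h0.
  rewrite !sub0r !normrN => le; apply: le_trans (le_trans (ler_norm _) le).
  rewrite -[_ *: 1]/(h * 1) mulr1 addr0 normrZ normfV ler_pdivrMl ?normr_gt0//.
  exact: key.
split; first exact: (cvgP _ cv).
exact: (cvg_lim _ cv).
Qed.

Lemma measurable_entropy : measurable_fun setT entropy.
Proof.
have m2 : measurable_fun setT (fun s : R => s ^+ 2) by exact: measurable_funX.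
have ml : measurable_fun setT (fun s : R => ln (s ^+ 2)) by apply: measurableT_comp.
apply: measurable_funM => //; apply: measurable_funD => //; apply: measurable_funB => //.
exact: measurable_funM.
Qed.

(** This dominates the difference quotients of the entropy by a quadratic function, which the weight
    can integrate. *)
Lemma entropy_lip s t : `|entropy (s + t) - entropy s| <= `|t| * (1 + (`|s| + `|t|) ^+ 2).
Proof.
have bnd a b : a < b -> `|entropy b - entropy a| <= `|b - a| * (1 + Num.max `|a| `|b| ^+ 2).
  move=> ab; have [c cab ->] : exists2 c, c \in `]a, b[ & entropy b - entropy a = entropy' c * (b - a).
    apply: MVT => // [c _|]; first exact: is_derive_entropy.
    by apply: derivable_within_continuous => c _; have [] := is_derive_entropy c.
  rewrite normrM mulrC ler_wpM2l//; apply: le_trans (entropy'_le c) _.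
  rewrite lerD2l -(real_normK (num_real c)) ler_sqr ?nnegrE ?le_max ?normr_ge0//.
  move: cab; rewrite in_itv/= => /andP[ac cb].
  have := ler_norm b; have := ler_norm (- a); rewrite normrN => ha hb.
  have [c0|c0] := ger0P c; apply/orP; [right|left]; lra.
have h (x : R) : 0 <= x -> x <= `|s| + `|t| ->
   `|t| * (1 + x ^+ 2) <= `|t| * (1 + (`|s| + `|t|) ^+ 2).
  by move=> x0 xl; rewrite ler_wpM2l// lerD2l ler_sqr ?nnegrE// addr_ge0.
have mx : Num.max `|s| `|s + t| <= `|s| + `|t|.
  by rewrite ge_max ler_normD andbT lerDl.
have m0 : 0 <= Num.max `|s| `|s + t| by rewrite le_max normr_ge0.
have [t0|t0|->] := ltgtP t 0; last by rewrite addr0 subrr !normr0 mul0r.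
  have := bnd (s + t) s; rewrite gtrDl => /(_ t0).
  rewrite distrC (_ : s - (s + t) = - t); last by ring.
  rewrite normrN maxC => /le_trans; apply; exact: h.
have := bnd s (s + t); rewrite ltrDl => /(_ t0).
rewrite (_ : s + t - s = t); last by ring.
move=> /le_trans; apply; exact: h.
Qed.

End real_functions.

Section elliptic.
Context d (X : measurableType d) (R : realType) (N : nat).
Variable nu : {finite_measure set X -> \bar R}.
Variable T0 : (X -> R) -> (X -> 'rV[R]_N) -> Prop.
Implicit Types (u v w b phi : X -> R) (g h psi eta : X -> 'rV[R]_N).
Hypothesis core : energy_core nu T0.

Local Notation meas := (measurable_fun [set: X]).
Local Notation H0 := (H0 nu T0).
Local Notation RI := (RI nu).
Local Notation ig := (ig nu).
Local Notation L2 := (L2 nu).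
Local Notation nrm2 := (nrm2 nu).
Local Notation L2v := (L2v nu).

Variables (V hh dd : X -> R) (sigma C mu : R).
Hypotheses (sw : sobolev_weight nu T0 V sigma C) (V1 : forall x, 1 <= V x)
  (iV : ig V) (C0 : 0 <= C) (sigma0 : 0 < sigma) (mu0 : 0 < mu).
Hypotheses (mh : meas hh) (hV : forall x, `|hh x| <= V x).
Hypotheses (md : meas dd) (d0 : forall x, 0 <= dd x) (dV : forall x, dd x <= V x).

Local Notation L2w := (L2w nu V).

Let V0 x : 0 <= V x. Proof. exact: le_trans (V1 x). Qed.
Let Vle x : `|V x| <= V x. Proof. by rewrite ger0_norm. Qed.
Let dVn x : `|dd x| <= V x. Proof. by rewrite ger0_norm. Qed.

Definition bounded_by (M : R) u := forall x, `|u x| <= M.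

(** Bounds are required at every point, not almost everywhere, so that the chain rule and the
    product rule apply directly; suitable representatives are supplied by truncation. *)
Definition weak_sol u g := [/\ H0 u g, (exists M, bounded_by M u) &
  forall phi eta, H0 phi eta -> (exists M, bounded_by M phi) ->
    RI (fun x => dotp (g x) (eta x)) =
    RI (fun x => (- dd x * u x + mu * dotp (g x) (g x) + hh x) * phi x)].

Lemma ig_bM (M : R) b u : meas b -> bounded_by M b -> ig u -> ig (fun x => b x * u x).
Proof.
move=> mb bM ui; apply: (ig_le _ _ (igZ M (ig_norm ui))).
  by apply: measurable_funM => //; exact: ig_meas ui.
by move=> x; rewrite normrM ler_wpM2r.
Qed.

Lemma H0_meas u g : H0 u g -> meas u.
Proof. by move=> /H0_L2[]. Qed.

Lemma measurable_ltind u (c : R) : meas u -> meas (fun x => ((c < u x)%R)%:R : R).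
Proof.
move=> mu_; rewrite (_ : (fun x => _) = \1_[set x | c < u x]).
  exact: measurable_indic (measurable_gt _ mu_).
apply/funext => x; rewrite indicE.
by have -> : (x \in [set x | c < u x]) = (c < u x) by apply/idP/idP; rewrite inE.
Qed.

Lemma H0_clamp (a b : R) u g : a <= b -> H0 u g ->
  H0 (fun x => clamp a b (u x) - clamp a b 0)
     (fun x => (((a < u x)%R)%:R - ((b < u x)%R)%:R) *: g x).
Proof.
move=> ab ug; have := H0_B core (H0_relu core a ug) (H0_relu core b ug).
rewrite (_ : (fun x => _ - _) = (fun x => clamp a b (u x) - clamp a b 0)); last first.
  by apply/funext => x; rewrite (clamp_relu (u x) ab) addrK.
by rewrite (_ : (fun x => _ *: _ - _) = (fun x => (((a < u x)%R)%:R - ((b < u x)%R)%:R) *: g x))//;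
  apply/funext => x; rewrite scalerBl.
Qed.

Lemma ind_diff_le1 (p q : bool) : `|(p%:R - q%:R : R)| <= 1.
Proof. by case: p; case: q; rewrite ?subrr ?subr0 ?sub0r ?normrN ?normr0 ?normr1. Qed.

(* Testing the equation with w^2 turns the quadratic form of w into the integral
   of |gam - mu w g|^2, which is e^(2 mu u) times the square of the gradient of
   z = e^(- mu u) w; Poincare's inequality for z gives the bound. *)
Lemma weak_sol_coercive_bounded (M n K : R) u g w gam :
  0 < K -> (forall u g, H0 u g -> RI (fun x => u x ^+ 2) <= K * nrm2 g) ->
  weak_sol u g -> bounded_by M u -> H0 w gam -> 0 <= n -> bounded_by n w ->
  {ae nu, forall x, dd x * w x = 0} ->
  RI (fun x => w x ^+ 2) <= expR (4 * mu * M) * K *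
     (nrm2 gam - mu * RI (fun x => hh x * w x ^+ 2)).
Proof.
move=> K0 HK [ug _ ueq] uM wg n0 wn dw0.
have w2 := H0_L2 wg; have g2 := H0_L2v ug; have gam2 := H0_L2v wg.
have mw := H0_meas wg; have mu_ := H0_meas ug.
have gg := L2v_dot g2 g2.
have mw2 : meas (fun x => w x ^+ 2) by exact: measurable_funX.
have w2b : bounded_by (n ^+ 2) (fun x => w x ^+ 2).
  by move=> x; rewrite normrX ler_sqr ?nnegrE.
have iggw : ig (fun x => w x ^+ 2 * dotp (g x) (g x)) by exact: ig_bM gg.
have ihw : ig (fun x => hh x * w x ^+ 2).
  have wW := H0_L2w core sw V1 iV C0 wg.
  by have := L2w_mul mh hV wW wW; apply: ig_eq => x; rewrite expr2.
have igw : ig (fun x => w x * dotp (g x) (gam x)) by apply: (ig_bM (M := n)) => //; exact: L2v_dot.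
have eq1 : 2 * RI (fun x => w x * dotp (g x) (gam x)) =
    mu * RI (fun x => w x ^+ 2 * dotp (g x) (g x)) + RI (fun x => hh x * w x ^+ 2).
  have := ueq _ _ (H0_mul core n0 wg wg wn wn).
  have -> : (fun x => w x * w x) = (fun x => w x ^+ 2) by apply/funext => x; rewrite expr2.
  move=> /(_ (ex_intro (fun M => bounded_by M _) _ w2b)).
  rewrite (_ : RI (fun x => dotp (g x) _) = 2 * RI (fun x => w x * dotp (g x) (gam x))); last first.
    by rewrite -RIZ//; apply: RI_eq => x; rewrite !dotpE; ring.
  move=> ->; rewrite -RIZ// -RID//; last exact: igZ.
  apply: RI_ae.
  - apply: measurable_funM => //; apply: measurable_funD => //; apply: measurable_funD.
      by apply: measurable_funM => //; exact: measurable_funN.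
    by apply: measurable_funM => //; exact: ig_meas gg.
  - exact: ig_meas (igD (igZ mu iggw) ihw).
  apply: filterS dw0 => x /= dw.
  have -> : (- dd x * u x + mu * dotp (g x) (g x) + hh x) * w x ^+ 2 =
    - (u x * w x) * (dd x * w x) + (mu * (w x ^+ 2 * dotp (g x) (g x)) + hh x * w x ^+ 2) by ring.
  by rewrite dw mulr0 add0r.
have mf (k : R) : meas (fun x => expR (k * u x)).
  by apply: measurableT_comp => //; exact: measurable_funM.
have W2 : L2v (fun x => (mu * w x) *: g x).
  apply: (L2v_bM (M := mu * n)) => //; first exact: measurable_funM.
  by move=> x; rewrite normrM gtr0_norm// ler_pM2l.
have D2 : L2v (fun x => gam x - (mu * w x) *: g x) by exact: L2vB.
have eq2 : nrm2 gam - mu * RI (fun x => hh x * w x ^+ 2) =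
    nrm2 (fun x => gam x - (mu * w x) *: g x).
  have -> : nrm2 (fun x => gam x - (mu * w x) *: g x) =
      nrm2 gam - 2 * mu * RI (fun x => w x * dotp (g x) (gam x)) +
      mu ^+ 2 * RI (fun x => w x ^+ 2 * dotp (g x) (g x)).
    have gam2i := L2v_dot gam2 gam2.
    rewrite !nrm2_def -!RIZ// -RIB//; last exact: igZ.
    rewrite -RID; [|by apply: igB => //; exact: igZ|exact: igZ].
    by apply: RI_eq => x; rewrite !dotpE (dotpC (gam x)); ring.
  move: eq1; set a := RI _; set b := RI _; set c := RI _ => eq1.
  have -> : nrm2 gam - 2 * mu * a + mu ^+ 2 * b = nrm2 gam - mu * (2 * a) + mu ^+ 2 * b by ring.
  by rewrite eq1; ring.
rewrite eq2.
have M0 (x : X) : 0 <= M by apply: le_trans (uM x).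
(* On an empty space [bounded_by M u] says nothing about the sign of M. *)
have [[x0 _]|XE] := pselect ([set: X] !=set0); last first.
  have noX (x : X) : False by apply: XE; exists x.
  have -> : RI (fun x => w x ^+ 2) = 0 by rewrite -(RI0 nu); apply: RI_eq => x; case: (noX x).
  by rewrite !mulr_ge0 ?expR_ge0 ?nrm2_ge0// ltW.
have {}M0 := M0 x0.
have eM k : `|k| <= M -> expR (- mu * k) <= expR (mu * M).
  move=> kM; rewrite ler_expR mulNr lerNl -mulrN ler_pM2l//.
  by move: kM; rewrite ler_norml => /andP[].
have e1 : 1 <= expR (mu * (M + 1)).
  by rewrite -expR0 ler_expR mulr_ge0 ?addr_ge0// ltW.
(* The chain rule asks for a function vanishing at 0; the product with [w] then lacks one copy of
   [w], which is added back in [zH]. *)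
have EH : H0 (fun x => expR (- mu * u x) - 1) (fun x => (- mu * expR (- mu * u x)) *: g x).
  apply: (@H0_chain _ _ _ _ nu T0 core (fun s => expR (- mu * s) - 1)
    (fun s => - mu * expR (- mu * s)) (- (M + 1)) (M + 1) (mu * expR (mu * (M + 1)))) => //.
  - lra.
  - apply/andP; split; lra.
  - by rewrite mulr0 expR0 subrr.
  - move=> s _.
    have h1 : is_derive s 1 (fun t : R => - mu * t) (- mu).
      by apply: is_derive_eq; rewrite /GRing.scale/= mulr1.
    have h2 := is_derive1_comp (is_derive_expR (- mu * s)) h1.
    apply: is_derive_eq; rewrite subr0 /GRing.scale/=; ring.
  - move=> s sM; rewrite normrM normrN (gtr0_norm mu0) ler_pM2l// gtr0_norm ?expR_gt0//.
    rewrite ler_expR mulNr lerNl -mulrN ler_pM2l//; by case/andP: sM.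
  - by move=> x; have := uM x; rewrite ler_norml => /andP[? ?]; apply/andP; split; lra.
pose B := n + expR (mu * M) + 1.
have B0 : 0 <= B by rewrite !addr_ge0 ?expR_ge0.
have zH : H0 (fun x => expR (- mu * u x) * w x)
    (fun x => expR (- mu * u x) *: (gam x - (mu * w x) *: g x)).
  have b1 : bounded_by B (fun x => expR (- mu * u x) - 1).
    move=> x; apply: le_trans (ler_normB _ _) _; rewrite normr1 gtr0_norm ?expR_gt0//.
    by rewrite /B lerD2r; have := eM _ (uM x); lra.
  have b2 : bounded_by B w.
    by move=> x; apply: le_trans (wn x) _; rewrite /B -addrA lerDl addr_ge0 ?expR_ge0.
  have := H0_D core (H0_mul core B0 EH wg b1 b2) wg.
  rewrite (_ : (fun x => _ + _) = (fun x => expR (- mu * u x) * w x)); last first.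
    by apply/funext => x; ring.
  rewrite (_ : (fun x => _ + _) = (fun x => expR (- mu * u x) *: (gam x - (mu * w x) *: g x)))//.
  by apply/funext => x; apply/rowP => i; rewrite !mxE; ring.
have le := HK _ _ zH.
have e2 k : `|k| <= M -> 1 <= expR (2 * mu * M) * expR (- mu * k) ^+ 2.
  move=> kM; rewrite expr2 -!expRD -[leLHS]expR0 ler_expR.
  move: kM; rewrite ler_norml => /andP[_ kM].
  by have := mulr_ge0 (ltW mu0) (_ : 0 <= M - k); rewrite subr_ge0 => /(_ kM); lra.
have l1 : RI (fun x => w x ^+ 2) <= expR (2 * mu * M) * RI (fun x => (expR (- mu * u x) * w x) ^+ 2).
  rewrite -RIZ; last by case: (H0_L2 zH).
  apply: RI_le; [by case: w2|by apply: igZ; case: (H0_L2 zH)|].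
  by move=> x; rewrite exprMn mulrA ler_peMl ?sqr_ge0// e2.
have l2 : nrm2 (fun x => expR (- mu * u x) *: (gam x - (mu * w x) *: g x)) <=
    expR (2 * mu * M) * nrm2 (fun x => gam x - (mu * w x) *: g x).
  rewrite !nrm2_def -RIZ; last exact: L2v_dot.
  apply: RI_le.
  - by have z2 := H0_L2v zH; exact: L2v_dot.
  - by apply: igZ; exact: L2v_dot.
  move=> x; rewrite dotpZl dotpZr mulrA ler_wpM2r ?dotp_ge0// -expRD ler_expR.
  have := uM x; rewrite ler_norml => /andP[uM' _].
  by have := mulr_ge0 (ltW mu0) (_ : 0 <= u x + M); rewrite -lerBlDr sub0r => /(_ uM'); lra.
apply: le_trans l1 _.
have -> : 4 * mu * M = 2 * mu * M + 2 * mu * M by ring.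
rewrite expRD -!mulrA ler_pM2l ?expR_gt0//; apply: le_trans le _.
have e4 : 2 * mu * M = 2 * (mu * M) by rewrite mulrA.
by rewrite mulrCA ler_pM2l// -e4.
Qed.

(** Truncation at height n reduces to bounded [w], with constants independent of n. Write q for the
    energy and r for the integral of h w^2. Smallness of the weight gives mu r <= q / 2 + mu M'
    |w|^2, and the L2 bound gives |w|^2 <= A (q - mu r); together q <= 2 (1 + mu M' A) (q - mu
    r). *)
Lemma weak_sol_coercive u g : weak_sol u g -> exists2 c : R, 0 < c &
  forall w gam, H0 w gam -> {ae nu, forall x, dd x * w x = 0} ->
    c * nrm2 gam <= nrm2 gam - mu * RI (fun x => hh x * w x ^+ 2).
Proof.
move=> sol; have [ug [M uM] _] := sol.
have [K K0 HK] := poincare_H0 core sw V1 iV C0.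
have HK' u' g' : H0 u' g' -> RI (fun x => u' x ^+ 2) <= K * nrm2 g' by move=> /HK[].
set A := expR (4 * mu * M) * K.
have A0 : 0 < A by rewrite mulr_gt0 ?expR_gt0.
have [|M' M'0 HM'] := @weight_small _ _ _ _ _ _ core _ _ _ sw V1 iV C0 sigma0 (2 * mu)^-1.
  by rewrite invr_gt0 mulr_gt0.
pose B := 1 + mu * M' * A; have B0 : 0 < B by rewrite ltr_pwDl// !mulr_ge0// ltW.
exists (2 * B)^-1 => [|w gam wg dw0]; first by rewrite invr_gt0 mulr_gt0.
have mw := H0_meas wg; have w2 := H0_L2w core sw V1 iV C0 wg; have gam2 := H0_L2v wg.
pose wn (n : nat) x := clamp (- n%:R) n%:R (w x) - clamp (- n%:R) n%:R 0.
pose bn (n : nat) x : R := ((- n%:R < w x)%R)%:R - ((n%:R < w x)%R)%:R.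
have nn (n : nat) : - n%:R <= n%:R :> R by rewrite -subr_ge0 opprK addr_ge0.
have wng n : H0 (wn n) (fun x => bn n x *: gam x) by exact: H0_clamp.
have clamp0 (n : nat) : clamp (- n%:R) n%:R (0 : R) = 0.
  by rewrite /clamp max_l ?oppr_le0// min_l.
have wnE n x : wn n x = clamp (- n%:R) n%:R (w x) by rewrite /wn clamp0 subr0.
have wnb n : bounded_by n%:R (wn n).
  by move=> x; rewrite wnE ler_norml; exact: clamp_itv.
have wnw n x : `|wn n x| <= `|w x|.
  rewrite wnE /clamp ler_norml le_min ge_min le_max.
  have h0 : (0 : R) <= n%:R by []; have := ler_norm (w x); have := ler_norm (- w x).
  rewrite normrN => h1 h2; apply/andP; split.
    by apply/andP; split; [apply/orP; left|]; have := normr_ge0 (w x); lra.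
  have [h3|h3] := leP (- n%:R) (w x); first by rewrite h2.
  by apply/orP; left; have := normr_ge0 (w x); lra.
have dwn n : {ae nu, forall x, dd x * wn n x = 0}.
  apply: filterS dw0 => x /eqP; rewrite mulf_eq0 => /orP[/eqP ->|/eqP wx0].
    by rewrite mul0r.
  by rewrite wnE wx0 clamp0 mulr0.
have bn1 n x : `|bn n x| <= 1 by exact: ind_diff_le1.
have near_ x : \forall n \near \oo, wn n x = w x /\ bn n x = 1.
  have := nbhs_infty_ger (`|w x| + 1); apply: filterS => n hn.
  have h1 := ler_norm (w x); have h2 := ler_norm (- w x); rewrite normrN in h2.
  have lo : - n%:R < w x by lra.
  have hi : w x < n%:R by lra.
  by rewrite wnE /clamp /bn lo (lt_gtF hi) subr0 max_l ?ltW// min_l// ltW.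
have mbn n : meas (bn n) by apply: measurable_funB; exact: measurable_ltind.
have c1 : (fun n => nrm2 (fun x => bn n x *: gam x)) @ \oo --> nrm2 gam.
  have gi := L2v_dot gam2 gam2.
  have [] := @RI_dct _ _ _ nu (fun n x => dotp (bn n x *: gam x) (bn n x *: gam x))
    (fun x => dotp (gam x) (gam x)) (fun x => dotp (gam x) (gam x)) => //.
  - by move=> n; have g2 := H0_L2v (wng n); apply: ig_meas (L2v_dot g2 g2).
  - exact: ig_meas gi.
  - apply: aeW => x; apply: cvg_near_cst; apply: filterS (near_ x) => n [_ ->].
    by rewrite scale1r.
  - move=> n x; rewrite ger0_norm ?dotp_ge0// dotpZl dotpZr mulrA ler_piMl ?dotp_ge0//.
    by rewrite -expr2 -(real_normK (num_real _)) expr_le1.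
have ihw : ig (fun x => hh x * w x ^+ 2).
  by have := L2w_mul mh hV w2 w2; apply: ig_eq => x; rewrite expr2.
have c2 : (fun n => RI (fun x => hh x * wn n x ^+ 2)) @ \oo --> RI (fun x => hh x * w x ^+ 2).
  have [] := @RI_dct _ _ _ nu (fun n x => hh x * wn n x ^+ 2)
    (fun x => hh x * w x ^+ 2) (fun x => `|hh x * w x ^+ 2|) => //.
  - move=> n; apply: measurable_funM => //; apply: measurable_funX; exact: H0_meas (wng n).
  - exact: ig_meas ihw.
  - by apply: aeW => x; apply: cvg_near_cst; apply: filterS (near_ x) => n [-> _].
  - exact: ig_norm.
  - move=> n x; rewrite normrM [leRHS]normrM ler_wpM2l// !normrX ler_sqr ?nnegrE//.
have step n : (2 * B)^-1 * nrm2 (fun x => bn n x *: gam x) <=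
    nrm2 (fun x => bn n x *: gam x) - mu * RI (fun x => hh x * wn n x ^+ 2).
  have h1 := weak_sol_coercive_bounded K0 HK' sol uM (wng n) (ler0n _ n) (wnb n) (dwn n).
  have h2 := HM' _ _ (wng n).
  have wn2 := H0_L2w core sw V1 iV C0 (wng n).
  have h3 : RI (fun x => hh x * wn n x ^+ 2) <= RI (fun x => V x * wn n x ^+ 2).
    apply: RI_le; [|by case: wn2|].
      by have := L2w_mul mh hV wn2 wn2; apply: ig_eq => x; rewrite expr2.
    by move=> x; rewrite ler_wpM2r ?sqr_ge0// (le_trans (ler_norm _)).
  rewrite -/A in h1.
  set q := nrm2 _ in h1 h2 *; set r := RI (fun x => hh x * _) in h1 h3 *.
  set t := RI (fun x => wn n x ^+ 2) in h1 h2; set z := RI (fun x => V x * _) in h2 h3.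
  have h4 : mu * r <= q / 2 + mu * M' * t.
    apply: (@le_trans _ _ (mu * ((2 * mu)^-1 * q + M' * t))).
      by rewrite ler_pM2l//; lra.
    have -> : mu * ((2 * mu)^-1 * q + M' * t) = q / 2 + mu * M' * t by field; rewrite gt_eqF.
    by [].
  have h5 : mu * M' * t <= mu * M' * (A * (q - mu * r)) by rewrite ler_wpM2l// mulr_ge0// ltW.
  rewrite ler_pdivrMl ?mulr_gt0// /B; lra.
have c3 : (fun n => nrm2 (fun x => bn n x *: gam x) - mu * RI (fun x => hh x * wn n x ^+ 2))
    @ \oo --> nrm2 gam - mu * RI (fun x => hh x * w x ^+ 2).
  by apply: cvgB => //; apply: cvgMr.
have c4 : (fun n => (2 * B)^-1 * nrm2 (fun x => bn n x *: gam x)) @ \oo --> (2 * B)^-1 * nrm2 gam.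
  exact: cvgMr.
by apply: (ler_cvg_to c4 c3); exact: nearW.
Qed.

Local Notation pos k f := (fun x : X => Num.max ((f : X -> R) x - k) 0).

(** For f > l one has f <= l (f - k) / (l - k). Thus the factor f, which is not small, is traded for
    the excess over a lower level. *)
Lemma posM_le (k l f : R) : 0 <= k -> k < l -> 1 <= l ->
  f * Num.max (f - l) 0 <= l / (l - k) * (((l < f)%R)%:R * Num.max (f - k) 0 ^+ 2).
Proof.
move=> k0 kl l1; have [lf|fl] := ltP l f; last by rewrite max_r ?subr_le0// mulr0 mul0r mulr0.
have kf : k < f by exact: lt_trans lf.
rewrite !max_l ?subr_ge0 ?(ltW lf) ?(ltW kf)// mul1r mulrAC ler_pdivlMr ?subr_gt0//.
have h1 : f * (l - k) <= l * (f - k).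
  by have := mulr_ge0 k0 (_ : 0 <= f - l); rewrite subr_ge0 (ltW lf) => /(_ isT); lra.
have h3 : 0 <= l * (f - k) by rewrite mulr_ge0//; lra.
have h4 : 0 <= f - l by lra.
have h5 : f - l <= f - k by lra.
by rewrite mulrAC expr2 mulrA; apply: ler_pM => //; rewrite mulr_ge0//; lra.
Qed.

(** Nothing is assumed on [f] below level 1; where f > k >= 1 it equals (f - 1)^+ + 1, which is
    square integrable for the weight. *)
Lemma ig_posM (k : R) f gam gam1 : 1 <= k -> meas f -> H0 (pos 1 f) gam1 -> H0 (pos k f) gam ->
  ig (fun x => V x * (f x * Num.max (f x - k) 0)).
Proof.
move=> k1 mf H1 Hk.
have c1 : L2w (fun=> 1) by apply: (L2w_bounded V1 iV (M := 1)) => // x; rewrite normr1.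
have a1 := L2wD V1 iV (H0_L2w core sw V1 iV C0 H1) c1.
have := L2w_mul (ig_meas iV) Vle a1 (H0_L2w core sw V1 iV C0 Hk).
apply: ig_eq => x; congr (_ * _); have [fk|/ltW kf] := leP (f x - k) 0; first by rewrite !mulr0.
by rewrite max_l; [ring|lra].
Qed.

Lemma powRXn (a s : R) n : 0 <= a -> (a ^+ n) `^ s = (a `^ s) ^+ n.
Proof.
move=> a0; elim: n => [|n IHn]; first by rewrite !expr0 powR1.
by rewrite !exprS powRM ?exprn_ge0// IHn.
Qed.

(* The levels are K (2 - 2^-n). *)
Lemma de_giorgi (D A : R) : 0 <= D -> 0 <= A -> exists2 K : R, 1 <= K &
  forall (f : X -> R) (gam : R -> X -> 'rV[R]_N), meas f ->
    (forall k, 1 <= k -> [/\ H0 (pos k f) (gam k), nrm2 (gam k) <= A &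
      nrm2 (gam k) <= D * RI (fun x => V x * (f x * Num.max (f x - k) 0))]) ->
    {ae nu, forall x, f x <= K}.
Proof.
move=> D0 A0; have [P P0 HP] := poincare_H0 core sw V1 iV C0.
have half0 : 0 <= (2^-1 : R) by [].
(* The ratio of the geometric decay of the energies. One step of the iteration produces 4^n under
   the power sigma and 2^n outside; (4 th)^sigma = 1/2 cancels the growth of both. *)
pose th : R := 2^-1 `^ sigma^-1 / 4.
have th0 : 0 < th by rewrite divr_gt0// powR_gt0// invr_gt0.
have th4 : (4 * th) `^ sigma = 2^-1.
  rewrite /th mulrC divfK ?pnatr_eq0// -powRrM mulVf ?gt_eqF// powRr1//.
have th1 : th <= 4^-1.
  rewrite /th ler_pdivrMr// mulVf ?pnatr_eq0//.
  have e : 1 `^ sigma^-1 = 1 :> R by rewrite powR1.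
  rewrite -[leRHS]e; apply: ge0_ler_powR; rewrite ?nnegrE ?invr_ge0 ?(ltW sigma0)//.
  by rewrite invf_le1// ler1n.
(* With 8 D C tau^sigma <= th the recursion gains the factor th at each step; K is chosen so large
   that 4 P A / K^2 <= tau. *)
pose tau := (th / (8 * D * C + 1)) `^ sigma^-1.
have DC : 0 < 8 * D * C + 1 by rewrite ltr_wpDl// !mulr_ge0.
have tau0 : 0 < tau by rewrite powR_gt0// divr_gt0.
pose K := 1 + 4 * P * A / tau.
have PA : 0 <= 4 * P * A by rewrite !mulr_ge0// ltW.
have K1 : 1 <= K by rewrite lerDl divr_ge0// ltW.
have Ktau : 4 * P * A <= tau * K ^+ 2.
  have : 4 * P * A <= tau * K by rewrite [tau * K]mulrC -ler_pdivrMr// lerDr.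
  by move=> /le_trans; apply; rewrite ler_pM2l// expr2 ler_peMl//; lra.
exists (2 * K) => [|f gam mf Hf]; first lra.
pose k (n : nat) := K * (2 - 2^-1 ^+ n).
have q1 n : (2^-1 : R) ^+ n <= 1 by rewrite exprn_ile1// invf_le1// ler1n.
have q0 n : 0 < (2^-1 : R) ^+ n by rewrite exprn_gt0// invr_gt0.
have kK n : K <= k n by rewrite /k ler_peMr//; [lra|have := q1 n; lra].
have k1 n : 1 <= k n by exact: le_trans (kK n).
have k2 n : k n <= 2 * K by rewrite /k mulrC ler_pM2r; [have := q0 n; lra|lra].
have kS n : k n.+1 - k n = K * 2^-1 ^+ n.+1 by rewrite /k exprS; field.
pose E n := nrm2 (gam (k n)).
have [H1 _ _] := Hf 1 (lexx _).
have mpos l : meas (pos l f) by apply: measurable_maxr => //; exact: measurable_funB.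
(* The mass of f > k (n + 1) is bounded by Chebyshev's inequality applied to (f - k n)^+; the
   Sobolev inequality on this set then bounds the right-hand side of the energy estimate at level n
   + 1. *)
have step n : E n.+1 <= 8 * D * C * 2 ^+ n * (4 * P * 4 ^+ n / K ^+ 2 * E n) `^ sigma * E n.
  have [Hk _ _] := Hf _ (k1 n); have [Hl _ le] := Hf _ (k1 n.+1).
  have kl : k n < k n.+1 by rewrite -subr_gt0 kS mulr_gt0//; lra.
  pose B := [set x | k n.+1 < f x].
  have mB : measurable B by exact: measurable_gt.
  have [iu leu] := sobolev_H0 core sw V1 iV C0 mB Hk.
  have indB x : \1_B x = ((k n.+1 < f x)%R)%:R :> R.
    by rewrite indicE (_ : (x \in B) = (k n.+1 < f x))//; apply/idP/idP; rewrite inE.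
  have massB : mass nu B <= 4 * P * 4 ^+ n / K ^+ 2 * E n.
    have [_ l2] := HP _ _ Hk.
    have l3 : (K * 2^-1 ^+ n.+1) ^+ 2 * mass nu B <= RI (fun x => pos (k n) f x ^+ 2).
      rewrite -RI_indic// -RIZ; last exact: ig_indic.
      apply: RI_le; [by apply: igZ; exact: ig_indic|by case: (H0_L2 Hk)|].
      move=> x; rewrite indB; have [lf|_] := ltP; last by rewrite mulr0 sqr_ge0.
      rewrite mulr1 -kS ler_sqr ?nnegrE ?subr_ge0 ?(ltW kl)//.
        by rewrite le_max lerD2r (ltW lf).
      by rewrite le_max lexx orbT.
    have -> : 4 * P * 4 ^+ n / K ^+ 2 * E n = P * E n / (K * 2^-1 ^+ n.+1) ^+ 2.
      rewrite exprMn -exprM mulnC exprM exprVn (_ : 2 ^+ 2 = 4 :> R); last by ring.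
      rewrite exprVn (exprS 4 n); field.
      by rewrite !expf_neq0 ?gt_eqF//; lra.
    rewrite ler_pdivlMr ?exprn_gt0 ?mulr_gt0 ?q0//; last lra.
    by rewrite mulrC; apply: le_trans l3 _.
  have c1 : k n.+1 / (k n.+1 - k n) <= 4 * 2 ^+ n.
    rewrite kS ler_pdivrMr ?mulr_gt0 ?q0//; last lra.
    rewrite (_ : 4 * 2 ^+ n * (K * 2^-1 ^+ n.+1) = 2 * K); first exact: k2.
    have e : (2 : R) ^+ n * 2^-1 ^+ n = 1 by rewrite -exprMn divff// expr1n.
    rewrite exprS (_ : 4 * 2 ^+ n * (K * (2^-1 * 2^-1 ^+ n)) = 2 * K * (2 ^+ n * 2^-1 ^+ n)).
      by rewrite e mulr1.
    by field.
  have l4 : RI (fun x => V x * (f x * Num.max (f x - k n.+1) 0)) <=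
      4 * 2 ^+ n * RI (fun x => \1_B x * (V x * pos (k n) f x ^+ 2)).
    rewrite -RIZ; last exact: ig_indicM.
    apply: RI_le; [exact: ig_posM H1 Hl|by apply: igZ; exact: ig_indicM|].
    move=> x; rewrite indB; have k0 : 0 <= k n by apply: le_trans (k1 n).
    have h : f x * Num.max (f x - k n.+1) 0 <=
        4 * 2 ^+ n * (((k n.+1 < f x)%R)%:R * Num.max (f x - k n) 0 ^+ 2).
      apply: le_trans (posM_le (f x) k0 kl (k1 _)) _.
      by rewrite ler_wpM2r// mulr_ge0// sqr_ge0.
    by apply: le_trans (ler_wpM2l (V0 x) h) _; rewrite le_eqVlt; apply/orP; left; apply/eqP; ring.
  have l5 : RI (fun x => \1_B x * (V x * pos (k n) f x ^+ 2)) <=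
     2 * C * (4 * P * 4 ^+ n / K ^+ 2 * E n) `^ sigma * E n.
    apply: le_trans leu _; rewrite ler_wpM2r ?nrm2_ge0// ler_wpM2l ?mulr_ge0//.
    apply: ge0_ler_powR; rewrite ?nnegrE ?mass_ge0 ?(ltW sigma0)//.
    exact: le_trans (mass_ge0 _ _) massB.
  apply: le_trans le _; apply: le_trans (ler_wpM2l D0 l4) _.
  have c2 : 0 <= D * (4 * 2 ^+ n) by rewrite !mulr_ge0 ?exprn_ge0.
  have := ler_wpM2l c2 l5; rewrite -[X in X <= _]mulrA => /le_trans; apply.
  by rewrite le_eqVlt; apply/orP; left; apply/eqP; ring.
have decay n : E n <= A * th ^+ n.
  elim: n => [|n IHn]; first by rewrite expr0 mulr1; have [] := Hf _ (k1 0%N).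
  apply: le_trans (step n) _.
  have En0 : 0 <= E n by exact: nrm2_ge0.
  have K2 : 0 < K ^+ 2 by rewrite exprn_gt0//; lra.
  have b1 : 4 * P * 4 ^+ n / K ^+ 2 * E n <= tau * (4 * th) ^+ n.
    apply: (@le_trans _ _ (4 * P * 4 ^+ n / K ^+ 2 * (A * th ^+ n))).
      by rewrite ler_wpM2l// divr_ge0 ?mulr_ge0 ?exprn_ge0 ?ltW//; lra.
    have -> : 4 * P * 4 ^+ n / K ^+ 2 * (A * th ^+ n) = 4 * P * A / K ^+ 2 * (4 * th) ^+ n.
      rewrite (_ : (4 * th) ^+ n = 4 ^+ n * th ^+ n); last exact: exprMn.
      by field; rewrite gt_eqF//; lra.
    rewrite ler_wpM2r ?exprn_ge0 ?mulr_ge0 ?(ltW th0)//.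
    by rewrite ler_pdivrMr.
  have b2 : (4 * P * 4 ^+ n / K ^+ 2 * E n) `^ sigma <= th / (8 * D * C + 1) * 2^-1 ^+ n.
    apply: (@le_trans _ _ ((tau * (4 * th) ^+ n) `^ sigma)).
      apply: ge0_ler_powR; rewrite ?nnegrE ?(ltW sigma0)//.
      - by rewrite mulr_ge0// divr_ge0 ?mulr_ge0 ?exprn_ge0 ?ltW//; lra.
      - by rewrite mulr_ge0 ?exprn_ge0 ?mulr_ge0 ?ltW.
    rewrite powRM ?exprn_ge0 ?mulr_ge0 ?(ltW th0) ?(ltW tau0)// powRXn ?mulr_ge0 ?(ltW th0)//.
    rewrite th4 ler_wpM2r ?exprn_ge0// /tau -powRrM mulVf ?gt_eqF// powRr1//.
    by rewrite divr_ge0 ?ltW.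
  apply: (@le_trans _ _ (8 * D * C * 2 ^+ n * (th / (8 * D * C + 1) * 2^-1 ^+ n) * E n)).
    by rewrite ler_wpM2r// ler_wpM2l// !mulr_ge0 ?exprn_ge0.
  have -> : 8 * D * C * 2 ^+ n * (th / (8 * D * C + 1) * 2^-1 ^+ n) * E n =
      (2 ^+ n * 2^-1 ^+ n) * (8 * D * C / (8 * D * C + 1)) * (th * E n).
    by field; rewrite gt_eqF.
  have e : (2 : R) ^+ n * 2^-1 ^+ n = 1 by rewrite -exprMn divff// expr1n.
  rewrite e mul1r; apply: (@le_trans _ _ (th * E n)).
    rewrite ler_piMl ?mulr_ge0 ?(ltW th0)// ler_pdivrMr// mul1r; lra.
  by rewrite exprS mulrCA ler_wpM2l// ltW.
have [H2 _ _] := Hf (2 * K) (le_trans (k1 0%N) (k2 0%N)).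
have i2 : ig (fun x => pos (2 * K) f x ^+ 2) by case: (H0_L2 H2).
(* All levels stay below 2 K, so this integral is at most P E n for every n. *)
have z0 : RI (fun x => pos (2 * K) f x ^+ 2) = 0.
  apply/eqP; rewrite eq_le RI_sqr_ge0 andbT.
  have c : (fun n => P * (A * th ^+ n)) @ \oo --> (0 : R).
    rewrite -(mulr0 P) -(mulr0 A); apply: cvgMr; apply: cvgMr; apply: cvg_geom0.
    by rewrite (ltW th0)/= (le_lt_trans th1)// invf_lt1// ltr1n.
  apply: (cvgr_to_ge c); apply: nearW => n.
  have [Hk _ _] := Hf _ (k1 n); have [_ l] := HP _ _ Hk.
  apply: (@le_trans _ _ (P * E n)); last by rewrite ler_pM2l.
  apply: le_trans l; apply: RI_le => //; first by case: (H0_L2 Hk).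
  move=> x; have k2n := k2 n.
  have mm : Num.max (f x - 2 * K) 0 <= Num.max (f x - k n) 0.
    by rewrite ge_max !le_max lexx orbT andbT lerB.
  by rewrite ler_sqr // nnegrE le_max lexx orbT.
have := RI_eq0 _ i2 z0.
move=> /(_ (fun x => sqr_ge0 _)); apply: filterS => x /eqP.
rewrite sqrf_eq0 => /eqP h; rewrite -subr_le0 -h le_max lexx//.
Qed.

End elliptic.

(** * Minimisation *)

Section existence.
Context d (X : measurableType d) (R : realType) (N : nat).
Variable nu : {finite_measure set X -> \bar R}.
Variable T0 : (X -> R) -> (X -> 'rV[R]_N) -> Prop.
Implicit Types (u v w a b phi y : X -> R) (g h psi eta : X -> 'rV[R]_N).
Hypothesis core : energy_core nu T0.
Hypothesis rel : rellich nu T0.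

Local Notation meas := (measurable_fun [set: X]).
Local Notation H0 := (H0 nu T0).
Local Notation RI := (RI nu).
Local Notation ig := (ig nu).
Local Notation L2 := (L2 nu).
Local Notation nrm2 := (nrm2 nu).
Local Notation L2v := (L2v nu).

Variables (V hh dd : X -> R) (sigma C mu : R).
Hypotheses (sw : sobolev_weight nu T0 V sigma C) (V1 : forall x, 1 <= V x)
  (iV : ig V) (C0 : 0 <= C) (sigma0 : 0 < sigma) (mu0 : 0 < mu).
Hypotheses (mh : meas hh) (hV : forall x, `|hh x| <= V x).
Hypotheses (md : meas dd) (d0 : forall x, 0 <= dd x) (dV : forall x, dd x <= V x).
Hypothesis kernel_pos : forall w g, H0 w g -> {ae nu, forall x, dd x * w x = 0} ->
  0 < nrm2 g -> 0 < nrm2 g - mu * RI (fun x => hh x * w x ^+ 2).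

Local Notation L2w := (L2w nu V).

Let V0 x : 0 <= V x. Proof. exact: le_trans (V1 x). Qed.
Let Vle x : `|V x| <= V x. Proof. by rewrite ger0_norm. Qed.
Let dVn x : `|dd x| <= V x. Proof. by rewrite ger0_norm. Qed.
Let mV : meas V. Proof. exact: ig_meas iV. Qed.
Let H0w u g : H0 u g -> L2w u. Proof. by move=> ug; exact: (H0_L2w core sw V1 iV C0 ug). Qed.
Let L2w1 : L2w (fun=> 1).
Proof. by apply: (L2w_bounded V1 iV (M := 1)) => // x; rewrite normr1. Qed.

Lemma L2w_sq a u : meas a -> (forall x, `|a x| <= V x) -> L2w u -> ig (fun x => a x * u x ^+ 2).
Proof. by move=> ma aV u2; apply: ig_eq (L2w_mul ma aV u2 u2) => x; rewrite expr2. Qed.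

Lemma L2wN u : L2w u -> L2w (fun x => - u x).
Proof.
move=> u2; apply: (L2w_le V1 iV _ _ u2) => [|x]; last by rewrite normrN.
by apply: measurableT_comp => //; case: u2.
Qed.

Lemma L2wB u v : L2w u -> L2w v -> L2w (fun x => u x - v x).
Proof. by move=> u2 v2; exact: (L2wD V1 iV u2 (L2wN v2)). Qed.

Lemma RI_sq_weight_le a u : meas a -> (forall x, `|a x| <= V x) -> L2w u ->
  `|RI (fun x => a x * u x ^+ 2)| <= RI (fun x => V x * u x ^+ 2).
Proof.
move=> ma aV u2; apply: le_trans (RI_norm (L2w_sq ma aV u2)) _.
apply: RI_le; [exact/ig_norm/L2w_sq|by case: u2|].
by move=> x; rewrite normrM [`|u x ^+ 2|]ger0_norm ?sqr_ge0// ler_wpM2r ?sqr_ge0.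
Qed.

(** The weight [a] may change sign; the discriminant argument works because V dominates |a| in the
    quadratic polynomial. *)
Lemma weighted_CS a u v : meas a -> (forall x, `|a x| <= V x) -> L2w u -> L2w v ->
  RI (fun x => a x * (u x * v x)) ^+ 2 <=
  RI (fun x => V x * u x ^+ 2) * RI (fun x => V x * v x ^+ 2).
Proof.
move=> ma aV u2 v2; have [_ iu] := u2; have [_ iv] := v2.
have iuv := L2w_mul ma aV u2 v2.
have nn w : 0 <= RI (fun x => V x * w x ^+ 2) by apply: RI_ge0 => x; rewrite mulr_ge0 ?sqr_ge0.
apply: quad_disc => // t.
rewrite -(RIZ _ iuv) -(RIZ _ iv) -RID//; last exact: igZ.
rewrite -RID; [|by apply: igD => //; exact: igZ|exact: igZ].
apply: RI_ge0 => x.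
have h1 : `|a x * (t * v x) * u x| <= V x * (`|t * v x| * `|u x|).
  by rewrite !normrM -mulrA ler_wpM2r// -normrM mulr_ge0.
have h2 : 2 * (`|t * v x| * `|u x|) <= u x ^+ 2 + t ^+ 2 * v x ^+ 2.
  rewrite -exprMn -(real_normK (num_real (u x))) -[X in _ + X](real_normK (num_real _)).
  by have := sqr_ge0 (`|u x| - `|t * v x|); rewrite sqrrB; lra.
have h3 := ler_wpM2l (V0 x) h2; have := ler_norm (- (a x * (t * v x) * u x)).
rewrite normrN => h4.
have -> : V x * u x ^+ 2 + 2 * t * (a x * (u x * v x)) + t ^+ 2 * (V x * v x ^+ 2) =
  V x * (u x ^+ 2 + t ^+ 2 * v x ^+ 2) + 2 * (a x * (t * v x) * u x) by ring.
lra.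
Qed.

(** Expand the square around [y]; the cross term tends to 0 by [weighted_CS]. *)
Lemma cvg_weight a y (y_ : nat -> X -> R) : meas a -> (forall x, `|a x| <= V x) ->
  L2w y -> (forall n, L2w (y_ n)) ->
  (fun n => RI (fun x => V x * (y_ n x - y x) ^+ 2)) @ \oo --> (0 : R) ->
  (fun n => RI (fun x => a x * y_ n x ^+ 2)) @ \oo --> RI (fun x => a x * y x ^+ 2).
Proof.
move=> ma aV y2 yn2 z0; have zn2 n := L2wB (yn2 n) y2.
have e n : RI (fun x => a x * y_ n x ^+ 2) = RI (fun x => a x * y x ^+ 2) +
    (2 * RI (fun x => a x * ((y_ n x - y x) * y x)) + RI (fun x => a x * (y_ n x - y x) ^+ 2)).
  have i1 := L2w_mul ma aV (zn2 n) y2; have i2 := L2w_sq ma aV (zn2 n).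
  rewrite -RIZ// -RID//; last exact: igZ.
  rewrite -RID; [|exact: L2w_sq|by apply: igD => //; exact: igZ].
  by apply: RI_eq => x; ring.
set l := RI (fun x => a x * y x ^+ 2).
suff : (fun n => l + (2 * RI (fun x => a x * ((y_ n x - y x) * y x)) +
    RI (fun x => a x * (y_ n x - y x) ^+ 2))) @ \oo --> l + (0 + 0).
  by rewrite !addr0; under eq_fun do rewrite -e.
apply: cvgD; first exact: cvg_cst.
apply: cvgD.
  rewrite -(mulr0 2); apply: cvgMr; apply: cvg_sqr0; under eq_fun do rewrite sub0r sqrrN.
  apply: (@squeeze_cvgr _ _ _ _ (fun=> 0)
    (fun n => RI (fun x => V x * (y_ n x - y x) ^+ 2) * RI (fun x => V x * y x ^+ 2))).
  - by apply: nearW => n; rewrite sqr_ge0/= weighted_CS.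
  - exact: cvg_cst.
  - by rewrite -(mul0r (RI (fun x => V x * y x ^+ 2))); apply: cvgMl.
apply/norm_cvg0P; apply: (squeeze_cvgr (f := fun=> 0) _ _ z0); last exact: cvg_cst.
by apply: nearW => n; rewrite normr_ge0/= RI_sq_weight_le.
Qed.

(** Compactness also holds in the weighted space: by [weight_small] the weighted norm is an
    arbitrarily small multiple of the bounded energy plus a multiple of the L2 norm. *)
Lemma weight_cvg0 (w_ : nat -> X -> R) (g_ : nat -> X -> 'rV[R]_N) (M : R) w g :
  (forall n, H0 (w_ n) (g_ n)) -> (forall n, nrm2 (g_ n) <= M) -> H0 w g ->
  (fun n => RI (fun x => (w x - w_ n x) ^+ 2)) @ \oo --> (0 : R) ->
  (fun n => RI (fun x => V x * (w_ n x - w x) ^+ 2)) @ \oo --> (0 : R).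
Proof.
move=> wg gM Hw c0; apply/cvgrPdist_le => e e0.
pose A := 2 * M + 2 * nrm2 g + 1.
have A0 : 0 < A.
  have := nrm2_ge0 nu g; have := le_trans (nrm2_ge0 nu (g_ 0%N)) (gM 0%N); rewrite /A; lra.
have e1 : 0 < e / (2 * A) by rewrite divr_gt0// mulr_gt0.
have [P P0 HP] := @weight_small _ _ _ _ _ _ core _ _ _ sw V1 iV C0 sigma0 _ e1.
have e2 : 0 < e / (2 * (P + 1)) by rewrite divr_gt0// mulr_gt0//; lra.
move/cvgrPdist_le : c0 => /(_ _ e2); apply: filterS => n.
rewrite !sub0r !normrN => le.
rewrite ger0_norm; last by apply: RI_ge0 => x; rewrite mulr_ge0 ?sqr_ge0.
apply: le_trans (HP _ _ (H0_B core (wg n) Hw)) _.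
have h1 : nrm2 (fun x => g_ n x - g x) <= A.
  have := nrm2D_le (H0_L2v (wg n)) (L2vN (H0_L2v Hw)); rewrite nrm2N => h.
  by apply: le_trans h _; have := gM n; rewrite /A; lra.
have h2 : RI (fun x => (w_ n x - w x) ^+ 2) <= e / (2 * (P + 1)).
  apply: le_trans le; rewrite (_ : RI _ = RI (fun x => (w x - w_ n x) ^+ 2)) ?ler_norm//.
  by apply: RI_eq => x; ring.
have h3 := ler_wpM2l (ltW e1) h1; have h4 := ler_wpM2l P0 h2.
have h5 : P * (e / (2 * (P + 1))) <= e / 2.
  rewrite (_ : P * _ = P / (P + 1) * (e / 2)); last by field; lra.
  by rewrite ler_piMl ?divr_ge0 ?(ltW e0)// ler_pdivrMr; lra.
have h6 : e / (2 * A) * A = e / 2 by field; rewrite gt_eqF.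
lra.
Qed.

Lemma nrm2_unit w g : H0 w g -> 0 < nrm2 g -> exists a : R,
  0 < a /\ a ^+ 2 * nrm2 g = 1.
Proof.
move=> wg g0; exists (Num.sqrt (nrm2 g))^-1; rewrite invr_gt0 sqrtr_gt0; split => //.
by rewrite exprVn sqr_sqrtr ?(ltW g0)// mulVf// gt_eqF.
Qed.

Lemma cvg_inv_sub (s : nat -> nat) : (forall j, (j <= s j)%N) ->
  (fun j => (s j).+1%:R^-1) @ \oo --> (0 : R).
Proof.
move=> sj; apply: (@squeeze_cvgr _ _ _ _ (fun=> 0) (fun n => n.+1%:R^-1)).
- by apply: nearW => j; rewrite invr_ge0 ler0n/= lef_pV2 ?posrE// ler_nat ltnS.
- exact: cvg_cst.
- exact: cvg_inv_nat.
Qed.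

Lemma cvg_fast0 (f : nat -> R) : (forall j, 0 <= f j) -> (forall j, f j <= 8^-1 ^+ j) ->
  f @ \oo --> (0 : R).
Proof.
move=> f0 f8; apply: (@squeeze_cvgr _ _ _ _ (fun=> 0) (fun j => 8^-1 ^+ j)).
- by apply: nearW => j; rewrite f0 f8.
- exact: cvg_cst.
- by apply: cvg_geom0; rewrite invr_ge0 ler0n invf_lt1// ltr1n.
Qed.

(* Otherwise, normalising and extracting a limit produces a nonzero w with
   dd w = 0 on which the quadratic form is not positive. *)
Lemma penalised_coercive : exists (l c : R), [/\ 0 <= l, 0 < c & forall w g, H0 w g ->
  c * nrm2 g <= nrm2 g - mu * RI (fun x => hh x * w x ^+ 2) + l * RI (fun x => dd x * w x ^+ 2)].
Proof.
have [K K0 HK] := poincare_H0 core sw V1 iV C0.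
apply: contrapT => no.
have Vn w : 0 <= RI (fun x => V x * w x ^+ 2).
  by apply: RI_ge0 => x; rewrite mulr_ge0 ?sqr_ge0.
have dn w : 0 <= RI (fun x => dd x * w x ^+ 2).
  by apply: RI_ge0 => x; rewrite mulr_ge0 ?sqr_ge0.
have hle w g : H0 w g -> RI (fun x => hh x * w x ^+ 2) <= K * nrm2 g.
  move=> wg; have [h _] := HK _ _ wg; apply: le_trans h.
  by apply: le_trans (ler_norm _) _; exact: RI_sq_weight_le (H0w wg).
(* The negation is used with l = n and c = 1 / (n + 1). Homogeneity normalises the energy to 1; a
   pair of energy 0 satisfies the inequality by Poincare's inequality. *)
have /choice[p Hp] (n : nat) : exists p : (X -> R) * (X -> 'rV[R]_N),
    [/\ H0 p.1 p.2, nrm2 p.2 = 1 &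
      1 - mu * RI (fun x => hh x * p.1 x ^+ 2) + n%:R * RI (fun x => dd x * p.1 x ^+ 2) <=
      n.+1%:R^-1].
  apply: contrapT => nop; apply: no; exists n%:R, n.+1%:R^-1; split => // w g wg.
  have [g0|] := eqVneq (nrm2 g) 0.
    have := hle _ _ wg; rewrite g0 mulr0 mulr0 add0r => h.
    rewrite addrC subr_ge0; apply: (@le_trans _ _ 0); last by rewrite mulr_ge0.
    by rewrite pmulr_rle0.
  rewrite neq_lt ltNge nrm2_ge0/= => g0; rewrite leNgt; apply/negP => lt.
  have [a [a0 ag]] := nrm2_unit wg g0.
  apply: nop; exists (fun x => a * w x, fun x => a *: g x) => /=.
  have sc b : meas b -> (forall x, `|b x| <= V x) ->
      RI (fun x => b x * (a * w x) ^+ 2) = a ^+ 2 * RI (fun x => b x * w x ^+ 2).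
    move=> mb bV; rewrite -RIZ; last exact: L2w_sq (H0w wg).
    by apply: RI_eq => x; ring.
  split; [exact: H0_Z|by rewrite nrm2Z ?ag//; exact: H0_L2v wg|].
  rewrite !sc// -[X in X - _]ag.
  have a20 : 0 < a ^+ 2 by rewrite exprn_gt0.
  have /ltW := lt; rewrite -(ler_pM2l a20) => h; move: h ag.
  set q := nrm2 g; set r := RI _; set t := RI _ => h ag.
  have e : a ^+ 2 * (n.+1%:R^-1 * q) = n.+1%:R^-1 by rewrite mulrCA ag mulr1.
  by rewrite e in h; apply: le_trans h; rewrite le_eqVlt; apply/orP; left; apply/eqP; ring.
pose w_ n := (p n).1; pose g_ n := (p n).2.
have wg n : H0 (w_ n) (g_ n) by have [] := Hp n.
have g1 n : nrm2 (g_ n) = 1 by have [] := Hp n.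
have en n : 1 - mu * RI (fun x => hh x * w_ n x ^+ 2) +
   n%:R * RI (fun x => dd x * w_ n x ^+ 2) <= n.+1%:R^-1 by have [] := Hp n.
pose M := 1 + K.
have [n|n|s [w [sj w2 wae wf lsc]]] := @H0_compact _ _ _ _ _ _ core rel w_ g_ M wg.
- by rewrite g1 /M lerDl ltW.
- have [_] := HK _ _ (wg n); rewrite g1 mulr1 => h; apply: le_trans h _.
  by rewrite /M lerDr.
have [g [Hw gl]] : exists g, H0 w g /\ nrm2 g <= 1.
  by apply: (lsc (fun=> 1)) => [|j]; [exact: cvg_cst|rewrite g1].
have z0 : (fun j => RI (fun x => V x * (w_ (s j) x - w x) ^+ 2)) @ \oo --> (0 : R).
  apply: (weight_cvg0 (M := 1) (g_ := fun j => g_ (s j)) _ _ Hw) => // [n|]; first by rewrite g1.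
  by apply: cvg_fast0 => // j; exact: RI_sqr_ge0.
have ch := cvg_weight mh hV (H0w Hw) (fun j => H0w (wg (s j))) z0.
have cd := cvg_weight md dVn (H0w Hw) (fun j => H0w (wg (s j))) z0.
have ci := cvg_inv_sub sj.
have muh n : mu * RI (fun x => hh x * w_ n x ^+ 2) <= mu * K.
  by rewrite ler_pM2l//; have := hle _ _ (wg n); rewrite g1 mulr1.
(* Step n bounds n times this integral. One more copy, bounded through V, allows division by n + 1,
   also for n = 0. *)
have dw0 : RI (fun x => dd x * w x ^+ 2) = 0.
  apply/eqP; rewrite eq_le dn andbT.
  have c1 : (fun j => (s j).+1%:R^-1 * (1 + mu * K + RI (fun x => V x * w_ (s j) x ^+ 2)))
      @ \oo --> 0 * (1 + mu * K + RI (fun x => V x * w x ^+ 2)).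
    apply: cvgM => //; apply: cvgD; first exact: cvg_cst.
    exact: (cvg_weight mV Vle (H0w Hw) (fun j => H0w (wg (s j))) z0).
  rewrite mul0r in c1; apply: (ler_cvg_to cd c1); apply: nearW => j.
  rewrite ler_pdivlMl// -natr1 mulrDl mul1r.
  have arith (i m q r t k : R) :
    i <= 1 -> r <= t -> q <= k -> 1 - q + m <= i -> m + r <= 1 + k + t by lra.
  apply: arith (muh (s j)) (en (s j)); first by rewrite invf_le1// ler1n.
  by apply: le_trans (ler_norm _) _; exact: RI_sq_weight_le (H0w (wg _)).
have dwae : {ae nu, forall x, dd x * w x = 0}.
  have := RI_eq0 _ (L2w_sq md dVn (H0w Hw)) dw0 => /(_ (fun x => mulr_ge0 (d0 x) (sqr_ge0 _))).
  apply: filterS => x /eqP; rewrite mulf_eq0 sqrf_eq0 => /orP[]/eqP ->; by rewrite ?mulr0 ?mul0r.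
(* The normalisation survives here, since the term in [hh] converges, while the energy of the limit
   gradient may drop below 1. *)
have h1 : 1 <= mu * RI (fun x => hh x * w x ^+ 2).
  have c1 : (fun j => mu * RI (fun x => hh x * w_ (s j) x ^+ 2) + (s j).+1%:R^-1) @ \oo -->
     mu * RI (fun x => hh x * w x ^+ 2) + 0 by apply: cvgD => //; exact: cvgMr.
  rewrite addr0 in c1; apply: (cvgr_to_ge c1); apply: nearW => j.
  have arith (i m q : R) : 0 <= m -> 1 - q + m <= i -> 1 <= q + i by lra.
  by apply: arith (en (s j)); rewrite mulr_ge0.
have [g0|] := eqVneq (nrm2 g) 0.
  by have := hle _ _ Hw; rewrite g0 mulr0 -(ler_pM2l mu0) mulr0; lra.
rewrite neq_lt ltNge nrm2_ge0/= => g0.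
by have := kernel_pos Hw dwae g0; lra.
Qed.

(** The weight controls only quadratic expressions, so integrability of the entropy term is imposed;
    otherwise [RI] would read an infinite integral as 0. *)
Definition adm w g := H0 w g /\ ig (fun x => dd x * entropy (1 + w x)).

(* The minimisation is over y = 1 + w, where y = e^(mu u). *)
Definition energy w g := nrm2 g - mu * RI (fun x => hh x * (1 + w x) ^+ 2) +
  2 * RI (fun x => dd x * entropy (1 + w x)).

Lemma L2w_1D w : L2w w -> L2w (fun x => 1 + w x).
Proof. exact: L2wD L2w1. Qed.

Lemma entropy0 : entropy 1 = 0 :> R.
Proof. by rewrite /entropy expr1n ln1 mulr0 add0r addNr mul0r. Qed.

Lemma adm0 : adm (fun=> 0) (fun=> 0).
Proof.
split; first exact: H0_0.
by apply: ig_eq (ig0 nu) => x; rewrite addr0 entropy0 mulr0.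
Qed.

(** The entropy dominates l (1 + w)^2 up to a constant and so pays for the penalisation in
    [penalised_coercive]. The linear terms from expanding (1 + w)^2 are absorbed by Young's
    inequality, with e such that mu e K = c / 2. *)
Lemma energy_coercive : exists (c B : R), [/\ 0 < c, 0 <= B &
  forall w g, adm w g -> c * nrm2 g - B <= energy w g].
Proof.
have [K K0 HK] := poincare_H0 core sw V1 iV C0.
have [l [c [l0 c0 Hc]]] := penalised_coercive.
pose e := c / (2 * mu * K); have e0 : 0 < e by rewrite divr_gt0 ?mulr_gt0.
pose L := l * expR (4 * l + 1).
have L0 : 0 <= L by rewrite mulr_ge0 ?expR_ge0.
have IV0 : 0 <= RI V by apply: RI_ge0.
exists (c / 2), ((mu * (e^-1 + 1) + 2 * l + 2 * L) * RI V); split.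
- by rewrite divr_gt0.
- rewrite mulr_ge0// !addr_ge0 ?mulr_ge0 ?(ltW mu0)//.
  by rewrite addr_ge0 ?invr_ge0 ?(ltW e0).
move=> w g [wg iE]; have w2 := H0w wg; have [_ iw] := w2.
have [Kw _] := HK _ _ wg; have cw := Hc _ _ wg.
have ihw := L2w_sq mh hV w2; have idw := L2w_sq md dVn w2.
have h1 : RI (fun x => hh x * (1 + w x) ^+ 2) <=
    RI (fun x => hh x * w x ^+ 2) + (e * RI (fun x => V x * w x ^+ 2) + (e^-1 + 1) * RI V).
  rewrite -!RIZ// -RID; [|exact: igZ|exact: igZ].
  rewrite -RID//; last by apply: igD; exact: igZ.
  apply: RI_le; first exact: L2w_sq (L2w_1D w2).
    by apply: igD => //; apply: igD; exact: igZ.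
  move=> x; have a1 := ler_norm (hh x); have a2 := hV x.
  have a3 : 2 * (hh x * w x) <= e * (V x * w x ^+ 2) + e^-1 * V x.
    have b1 : hh x * w x <= V x * `|w x|.
      by apply: le_trans (ler_norm _) _; rewrite normrM ler_wpM2r.
    have b2 : 2 * `|w x| <= e * w x ^+ 2 + e^-1.
      rewrite -(real_normK (num_real (w x))).
      have := mulr_ge0 (ltW e0) (sqr_ge0 (`|w x| - e^-1)).
      have -> : e * (`|w x| - e^-1) ^+ 2 = e * `|w x| ^+ 2 + e^-1 - 2 * `|w x|.
        by field; rewrite gt_eqF.
      lra.
    by have b3 := ler_wpM2l (V0 x) b2; lra.
  have -> : hh x * (1 + w x) ^+ 2 = hh x * w x ^+ 2 + (2 * (hh x * w x) + hh x) by ring.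
  lra.
have h2 : l * RI (fun x => dd x * w x ^+ 2) <=
    2 * RI (fun x => dd x * entropy (1 + w x)) + (2 * l + 2 * L) * RI V.
  rewrite -!RIZ// -RID; [|exact: igZ|exact: igZ].
  apply: RI_le; [exact: igZ|by apply: igD; exact: igZ|].
  move=> x; have := entropy_lower (1 + w x) l0; rewrite -/L => b1.
  have b2 : l * w x ^+ 2 <= 2 * (l * (1 + w x) ^+ 2) + 2 * l.
    by have := mulr_ge0 l0 (sqr_ge0 (w x + 2)); rewrite !expr2; lra.
  have b3 : l * w x ^+ 2 <= 2 * entropy (1 + w x) + (2 * l + 2 * L) by lra.
  have b4 := ler_wpM2l (d0 x) b3.
  have b5 : dd x * (2 * l + 2 * L) <= V x * (2 * l + 2 * L).
    by rewrite ler_wpM2r// addr_ge0 ?mulr_ge0.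
  lra.
have h3 : mu * (e * RI (fun x => V x * w x ^+ 2)) <= c / 2 * nrm2 g.
  have -> : c / 2 * nrm2 g = mu * e * (K * nrm2 g).
    by rewrite /e; field; rewrite !gt_eqF.
  by rewrite mulrA ler_wpM2l// mulr_ge0 ?ltW.
have h4 := ler_wpM2l (ltW mu0) h1; rewrite /energy; lra.
Qed.

Lemma continuous_entropy : continuous (@entropy R).
Proof.
move=> s; apply: differentiable_continuous; apply/derivable1_diffP.
by have [] := is_derive_entropy s.
Qed.

(** The direct method. Along the subsequence the term in [hh] converges, whereas the entropy term is
    only lower semicontinuous; the gradient of the limit must come from [lsc], which requires a
    convergent bound on the energies of the gradients. *)
Lemma energy_min : exists w g, adm w g /\ forall v h, adm v h -> energy w g <= energy v h.
Proof.
have [c [B [c0 B0 HcB]]] := energy_coercive.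
have [K K0 HK] := poincare_H0 core sw V1 iV C0.
pose S : set R := [set r | exists w g, adm w g /\ r = energy w g].
have S0 : S !=set0 by exists (energy (fun=> 0) (fun=> 0)), (fun=> 0), (fun=> 0); split=> //; exact: adm0.
have lbS : has_lbound S.
  exists (- B) => _ [w [g [wg ->]]]; apply: le_trans (HcB _ _ wg).
  by rewrite lerDr mulr_ge0 ?(ltW c0)// nrm2_ge0.
have iS : has_inf S by [].
have lbE v h : adm v h -> inf S <= energy v h by move=> vh; apply: ge_inf => //; exists v, h.
have /choice[p Hp] (n : nat) : exists p : (X -> R) * (X -> 'rV[R]_N),
    adm p.1 p.2 /\ energy p.1 p.2 < inf S + n.+1%:R^-1.
  have i0 : 0 < n.+1%:R^-1 :> R by rewrite invr_gt0.
  have [_ [w [g [wg ->]]] lt] := inf_adherent i0 iS.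
  by exists (w, g).
pose w_ n := (p n).1; pose g_ n := (p n).2; pose e_ n := energy (w_ n) (g_ n).
have wg n : H0 (w_ n) (g_ n) by have [[]] := Hp n.
have iE n : ig (fun x => dd x * entropy (1 + w_ n x)) by have [[]] := Hp n.
have eI n : inf S <= e_ n <= inf S + n.+1%:R^-1.
  by have [ad lt] := Hp n; rewrite /e_ (lbE _ _ ad)/= ltW.
pose M0 := (inf S + 1 + B) / c.
have gM n : nrm2 (g_ n) <= M0.
  have [ad lt] := Hp n; rewrite ler_pdivlMr// mulrC -lerBlDr.
  apply: le_trans (HcB _ _ ad) _; apply: le_trans (ltW lt) _.
  by rewrite lerD2l invf_le1// ler1n.
have M00 : 0 <= M0 by apply: le_trans (gM 0%N); exact: nrm2_ge0.
pose M := M0 + K * M0.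
have [n|n|s [w [sj w2 wae wf lsc]]] := @H0_compact _ _ _ _ _ _ core rel w_ g_ M wg.
- by apply: le_trans (gM n) _; rewrite lerDl mulr_ge0// ltW.
- have [_ h] := HK _ _ (wg n); apply: le_trans h _.
  by apply: (@le_trans _ _ (K * M0)); rewrite ?ler_pM2l// lerDr.
(* A provisional gradient, used only to know that [w] belongs to [H0]. *)
have [g' [Hw' _]] : exists g, H0 w g /\ nrm2 g <= M0.
  by apply: (lsc (fun=> M0)) => [|j]; [exact: cvg_cst|exact: gM].
have z0 : (fun j => RI (fun x => V x * (w_ (s j) x - w x) ^+ 2)) @ \oo --> (0 : R).
  apply: (weight_cvg0 (M := M0) (g_ := fun j => g_ (s j)) _ _ Hw') => //.
  by apply: cvg_fast0 => // j; exact: RI_sqr_ge0.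
have ch : (fun j => RI (fun x => hh x * (1 + w_ (s j) x) ^+ 2)) @ \oo -->
    RI (fun x => hh x * (1 + w x) ^+ 2).
  apply: (cvg_weight mh hV (L2w_1D (H0w Hw')) (fun j => L2w_1D (H0w (wg (s j))))).
  rewrite (_ : (fun n => _) = (fun j => RI (fun x => V x * (w_ (s j) x - w x) ^+ 2)))//.
  by apply/funext => j; apply: RI_eq => x; ring.
pose f_ j x := dd x * entropy (1 + w_ (s j) x); pose f x := dd x * entropy (1 + w x).
have f0 x : 0 <= f x by rewrite mulr_ge0 ?entropy_ge0.
have fn0 j x : 0 <= f_ j x by rewrite mulr_ge0 ?entropy_ge0.
have mf : meas f.
  apply: measurable_funM => //; apply: (measurableT_comp (@measurable_entropy R)).
  by apply: measurable_funD => //; exact: (H0_meas Hw').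
have fae : {ae nu, forall x, f_ ^~ x @ \oo --> f x}.
  apply: filterS wae => x wx; apply: cvgMr.
  apply: (continuous_cvg _ (@continuous_entropy _)).
  by apply: cvgD => //; exact: cvg_cst.
have hM j : RI (fun x => hh x * (1 + w_ j x) ^+ 2) <= 2 * (K * M0) + 2 * RI V.
  have wj2 := H0w (wg j); have [_ iw] := wj2; have [Kw _] := HK _ _ (wg j).
  apply: (@le_trans _ _ (2 * RI (fun x => V x * w_ j x ^+ 2) + 2 * RI V)); last first.
    rewrite lerD2r ler_pM2l//; apply: le_trans Kw _; by rewrite ler_pM2l.
  rewrite -!RIZ// -RID; [|exact: igZ|exact: igZ].
  apply: RI_le; [exact: L2w_sq (L2w_1D wj2)|by apply: igD; exact: igZ|].
  move=> x; apply: (@le_trans _ _ (V x * (1 + w_ j x) ^+ 2)).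
    by rewrite ler_wpM2r ?sqr_ge0// (le_trans (ler_norm _)).
  have := mulr_ge0 (V0 x) (sqr_ge0 (1 - w_ j x)).
  have -> : V x * (1 - w_ j x) ^+ 2 = 2 * (V x * w_ j x ^+ 2) + 2 * V x - V x * (1 + w_ j x) ^+ 2 by ring.
  by rewrite subr_ge0.
have fM j : RI (f_ j) <= inf S + 1 + mu * (2 * (K * M0) + 2 * RI V).
  have /andP[_] := eI (s j); rewrite /e_ /energy -/(f_ j).
  have i1 : (s j).+1%:R^-1 <= 1 :> R by rewrite invf_le1// ler1n.
  have := ler_wpM2l (ltW mu0) (hM (s j)); have := nrm2_ge0 nu (g_ (s j)).
  have : 0 <= RI (f_ j) by apply: RI_ge0.
  move: i1; set i := _^-1; rewrite -[RI (fun x => dd x * _)]/(RI (f_ j)); lra.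
have [iF _] := RI_fatou mf f0 (fun j => iE (s j)) fn0 fae fM (@cvg_cst _ _ _ _ _).
(* Capping by the limit makes dominated convergence applicable: the capped integrals converge and
   stay below those of [f_ j], which provides the convergent bound for [lsc]. *)
have cm : (fun j => RI (fun x => Num.min (f_ j x) (f x))) @ \oo --> RI f.
  have [] := @RI_dct _ _ _ nu (fun j x => Num.min (f_ j x) (f x)) f f => //.
  - by move=> j; apply: measurable_minr => //; exact: ig_meas (iE (s j)).
  - apply: filterS fae => x fx.
    have : (fun j => (f_ j x + f x - `|f_ j x - f x|) / 2) @ \oo --> (f x + f x - `|f x - f x|) / 2.
      apply: cvgMl; apply: cvgB; first by apply: cvgD => //; exact: cvg_cst.
      by apply: cvg_norm; apply: cvgB => //; exact: cvg_cst.
    by rewrite -minr_absE minxx; under eq_fun do rewrite -minr_absE.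
  - by move=> j x; rewrite ger0_norm ?le_min ?fn0 ?f0// ge_min lexx orbT.
have [g [Hw gl]] : exists g, H0 w g /\ nrm2 g <=
    inf S + 0 + mu * RI (fun x => hh x * (1 + w x) ^+ 2) - 2 * RI f.
  apply: (lsc (fun j => inf S + (s j).+1%:R^-1 + mu * RI (fun x => hh x * (1 + w_ (s j) x) ^+ 2)
    - 2 * RI (fun x => Num.min (f_ j x) (f x)))) => [|j].
    apply: cvgB; last exact: cvgMr.
    apply: cvgD; last exact: cvgMr.
    by apply: cvgD; [exact: cvg_cst|exact: cvg_inv_sub].
  have /andP[_] := eI (s j); rewrite /e_ /energy -[RI (fun x => dd x * _)]/(RI (f_ j)).
  have : RI (fun x => Num.min (f_ j x) (f x)) <= RI (f_ j).
    apply: RI_le => //; [|exact: (iE (s j))|by move=> x; rewrite ge_min lexx].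
    apply: (ig_le _ _ iF); first by apply: measurable_minr => //; exact: ig_meas (iE (s j)).
    by move=> x; rewrite ger0_norm ?le_min ?fn0 ?f0// ge_min lexx orbT.
  set i := _^-1; lra.
exists w, g; split => // v h vh; apply: le_trans (lbE _ _ vh).
by rewrite /energy -[RI (fun x => dd x * _)]/(RI f); lra.
Qed.

(* Replacing 1 + w by its absolute value does not change the energy. *)
Lemma energy_min_ge0 : exists w g, [/\ adm w g, forall x, 0 <= 1 + w x &
  forall v h, adm v h -> energy w g <= energy v h].
Proof.
have [w [g [[wg iE] min]]] := energy_min.
pose w' x := 2 * relu (-1) (w x) - w x.
pose b x : R := 2 * ((-1 < w x)%R)%:R - 1.
have w'E x : 1 + w' x = `|1 + w x|.
  rewrite /w' /relu !opprK (max_l (ler01 : 0 <= 1 :> R)).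
  by have [h|h] := leP (w x + 1) 0; [rewrite ler0_norm; lra|rewrite gtr0_norm; lra].
have b2 x : b x * b x = 1 by rewrite /b; case: (_ < _)%R => /=; ring.
have Hw' : H0 w' (fun x => b x *: g x).
  apply: (H0_ae core _ _ _ _ (H0_B core (H0_Z core 2 (H0_relu core (-1) wg)) wg)).
  - apply: measurable_funB; last exact: H0_meas wg.
    by apply: measurable_funM => //; exact: (H0_meas (H0_relu core (-1) wg)).
  - move=> i; apply: L2v_meas; apply: (@L2v_bM _ _ _ _ _ 1); last exact: H0_L2v wg.
      apply: measurable_funB => //; apply: measurable_funM => //.
      by apply: measurable_ltind; exact: H0_meas wg.
    by move=> x; rewrite /b; case: (_ < _)%R; rewrite ?mulr1 ?mulr0 ?sub0r ?normrN1//;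
       rewrite (_ : 2 - 1 = 1 :> R) ?normr1//; ring.
  - exact: aeW.
  - by apply: aeW => x; rewrite /b scalerBl scale1r scalerA.
have en : energy w' (fun x => b x *: g x) = energy w g.
  congr (_ - mu * _ + 2 * _).
  - by apply: RI_eq => x; rewrite dotpZl dotpZr mulrA b2 mul1r.
  - by apply: RI_eq => x; rewrite w'E (real_normK (num_real _)).
  - by apply: RI_eq => x; rewrite w'E entropy_norm.
exists w', (fun x => b x *: g x); split.
- by split => //; apply: ig_eq iE => x; rewrite w'E entropy_norm.
- by move=> x; rewrite w'E.
- by move=> v h vh; rewrite en; exact: min.
Qed.

Lemma measurable_entropy' : measurable_fun setT (@entropy' R).
Proof.
apply: measurable_funM => //; apply: measurable_funM => //.
by apply: measurableT_comp.
Qed.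

Lemma ig_entropy' y : L2w y -> ig (fun x => dd x * entropy' (y x)).
Proof.
move=> [my iy]; apply: (ig_le _ _ (igD iV iy)).
  by apply: measurable_funM => //; exact: measurableT_comp measurable_entropy' my.
move=> x; rewrite normrM -{1}(mulr1 (V x)) -mulrDr; apply: ler_pM => //.
exact: entropy'_le.
Qed.

(** One-sided difference quotients of the energy with steps 1 / (n + 1), along phi and along - phi.
    Boundedness of phi dominates the quotients of the entropy, and for the same reason keeps the
    competitors in [adm]. *)
Lemma energy_euler w g : adm w g -> (forall v h, adm v h -> energy w g <= energy v h) ->
  forall phi eta, H0 phi eta -> (exists M, bounded_by M phi) ->
  RI (fun x => dotp (g x) (eta x)) =
  RI (fun x => (mu * hh x * (1 + w x) - dd x * entropy' (1 + w x)) * phi x).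
Proof.
move=> [wg iE] min.
suff key phi eta : H0 phi eta -> (exists M, bounded_by M phi) ->
    RI (fun x => (mu * hh x * (1 + w x) - dd x * entropy' (1 + w x)) * phi x) <=
    RI (fun x => dotp (g x) (eta x)).
  move=> phi eta He [M bM]; apply/eqP; rewrite eq_le; apply/andP; split; last first.
    by apply: key He _; exists M.
  have := key _ _ (H0_Z core (-1) He).
  rewrite (_ : RI (fun x => _ * (-1 * phi x)) = - RI (fun x => (mu * hh x * (1 + w x) - dd x * entropy' (1 + w x)) * phi x)).
    rewrite (_ : RI (fun x => dotp (g x) (-1 *: eta x)) = - RI (fun x => dotp (g x) (eta x))).
      rewrite lerN2; apply; exists M => x; by rewrite mulN1r normrN.
    rewrite -RIN; last exact: L2v_dot (H0_L2v wg) (H0_L2v He).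
    by apply: RI_eq => x; rewrite dotpZr mulN1r.
  have w2 := L2w_1D (H0w wg); have [mw _] := w2.
  have mphi := H0_meas He.
  rewrite -RIN; first by apply: RI_eq => x; ring.
  apply: (ig_eq (f := fun x => phi x * (mu * hh x * (1 + w x) - dd x * entropy' (1 + w x)))).
    by move=> x; rewrite mulrC.
  apply: (ig_bM mphi bM); apply: igB.
    apply: (ig_eq (f := fun x => mu * (hh x * ((1 + w x) * 1)))) => [x|]; first by ring.
    by apply: igZ; exact: L2w_mul mh hV w2 L2w1.
  exact: ig_entropy'.
move=> He [M0 bM0]; have [M M00 bM] : exists2 M : R, 0 <= M & forall x, `|phi x| <= M.
  by exists `|M0| => // x; apply: le_trans (bM0 x) (ler_norm _).
have w2 := L2w_1D (H0w wg); have [mw iw] := w2; have p2 := H0w He.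
set y := fun x => 1 + w x in mw iw w2 *.
pose t (n : nat) : R := n.+1%:R^-1.
have t0 n : 0 < t n by rewrite invr_gt0.
have t1 n : t n <= 1 by rewrite invf_le1// ler1n.
pose q n x := dd x * ((entropy (y x + t n * phi x) - entropy (y x)) / t n).
(* From [entropy_lip] with a step at most 1 and (|y| + M)^2 <= 2 (y^2 + M^2). *)
pose G x := V x * (M * (1 + 2 * (y x ^+ 2 + M ^+ 2))).
have iG : ig G.
  have := igD (igZ (M + 2 * M ^+ 3) iV) (igZ (2 * M) iw); by apply: ig_eq => x; rewrite /G /y; ring.
have qG n x : `|q n x| <= G x.
  rewrite normrM; apply: ler_pM => //; rewrite normrM normfV (gtr0_norm (t0 n)) ler_pdivrMr//.
  apply: le_trans (entropy_lip _ _) _; rewrite normrM (gtr0_norm (t0 n)) -[leRHS]mulrC -mulrA.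
  rewrite ler_pM2l//; apply: ler_pM => //; rewrite ?addr_ge0 ?sqr_ge0// lerD2l.
  have h : t n * `|phi x| <= M.
    by apply: le_trans (bM x); rewrite ler_piMl.
  have h0 : 0 <= t n * `|phi x| by rewrite mulr_ge0// ltW.
  apply: (@le_trans _ _ ((`|y x| + M) ^+ 2)).
    by rewrite ler_sqr ?nnegrE ?addr_ge0// lerD2l.
  by rewrite -(real_normK (num_real (y x))); have := sqr_ge0 (`|y x| - M); rewrite !expr2; lra.
have mphi := H0_meas He.
have ment := @measurable_entropy R.
have mq n : meas (q n).
  apply: measurable_funM => //; apply: measurable_funM => //; apply: measurable_funB.
    apply: (measurableT_comp ment); apply: measurable_funD => //; exact: measurable_funM.
  exact: measurableT_comp.
have cq : (fun n => RI (q n)) @ \oo --> RI (fun x => dd x * (entropy' (y x) * phi x)).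
  have [] := @RI_dct _ _ _ nu q (fun x => dd x * (entropy' (y x) * phi x)) G => //.
    apply: measurable_funM => //; apply: measurable_funM => //.
    exact: measurableT_comp measurable_entropy' mw.
  apply: aeW => x; apply: cvgMr; apply/cvgrPdist_le => e e0.
  have e1 : 0 < e / (M + 1) by rewrite divr_gt0//; lra.
  have [r r0 Hr] := is_derive_eps (is_derive_entropy (y x)) e1.
  have r1 : 0 < r / (M + 1) by rewrite divr_gt0//; lra.
  have := @cvg_inv_nat R => /cvgrPdist_lt/(_ _ r1); apply: filterS => n.
  rewrite sub0r normrN (gtr0_norm (t0 n)) ltr_pdivlMr => [tr|]; last lra.
  have tp : `|t n * phi x| <= t n * M by rewrite normrM (gtr0_norm (t0 n)) ler_pM2l.
  have := Hr (y x + t n * phi x); rewrite addrAC subrr add0r => /(_ _).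
  have lt : `|t n * phi x| < r by apply: le_lt_trans tp _; apply: le_lt_trans tr; rewrite ler_pM2l//; lra.
  move=> /(_ lt) le; rewrite distrC.
  have -> : (entropy (y x + t n * phi x) - entropy (y x)) / t n - entropy' (y x) * phi x =
    (entropy (y x + t n * phi x) - entropy (y x) - entropy' (y x) * (t n * phi x)) / t n.
    by field; rewrite gt_eqF.
  rewrite normrM normfV (gtr0_norm (t0 n)) ler_pdivrMr//; apply: le_trans le _.
  apply: (@le_trans _ _ (e / (M + 1) * (t n * M))); first by rewrite ler_pM2l.
  rewrite (_ : e / (M + 1) * (t n * M) = M / (M + 1) * (e * t n)); last by field; lra.
  by rewrite ler_piMl ?mulr_ge0 ?(ltW e0) ?(ltW (t0 n))// ler_pdivrMr; lra.
have iq n : ig (q n) by exact: ig_le (mq n) (qG n) iG.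
have [iq' _] : ig (fun x => dd x * (entropy' (y x) * phi x)) /\ True.
  split => //; apply: (ig_eq (f := fun x => phi x * (dd x * entropy' (y x)))) => [x|]; first by ring.
  by apply: (ig_bM mphi bM); exact: ig_entropy'.
have ihyp := L2w_mul mh hV w2 p2; have ihp := L2w_sq mh hV p2; have ihy := L2w_sq mh hV w2.
have ige := L2v_dot (H0_L2v wg) (H0_L2v He).
have igg := L2v_dot (H0_L2v wg) (H0_L2v wg); have iee := L2v_dot (H0_L2v He) (H0_L2v He).
have step n : 0 <= 2 * RI (fun x => dotp (g x) (eta x)) + t n * nrm2 eta
    - mu * (2 * RI (fun x => hh x * (y x * phi x)) + t n * RI (fun x => hh x * phi x ^+ 2)) + 2 * RI (q n).
  have Hv := H0_lin core (t n) wg He.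
  have eE x : dd x * entropy (1 + (w x + t n * phi x)) = dd x * entropy (y x) + t n * q n x.
    rewrite /q addrA -/(y x); field; by rewrite gt_eqF.
  have adv : adm (fun x => w x + t n * phi x) (fun x => g x + t n *: eta x).
    split => //; apply: (ig_eq (f := fun x => dd x * entropy (y x) + t n * q n x)) => [x|].
      by rewrite eE.
    by apply: igD => //; exact: igZ.
  have := min _ _ adv; rewrite /energy.
  have -> : nrm2 (fun x => g x + t n *: eta x) =
      nrm2 g + (2 * t n * RI (fun x => dotp (g x) (eta x)) + t n ^+ 2 * nrm2 eta).
    rewrite -!RIZ// -RID; [|exact: igZ|exact: igZ].
    rewrite -RID//; last by apply: igD; exact: igZ.
    by apply: RI_eq => x; rewrite !dotpE (dotpC (eta x) (g x)); ring.
  have -> : RI (fun x => hh x * (1 + (w x + t n * phi x)) ^+ 2) =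
      RI (fun x => hh x * y x ^+ 2) + (2 * t n * RI (fun x => hh x * (y x * phi x))
        + t n ^+ 2 * RI (fun x => hh x * phi x ^+ 2)).
    rewrite -!RIZ// -RID; [|exact: igZ|exact: igZ].
    rewrite -RID//; last by apply: igD; exact: igZ.
    by apply: RI_eq => x; rewrite /y; ring.
  have -> : RI (fun x => dd x * entropy (1 + (w x + t n * phi x))) =
      RI (fun x => dd x * entropy (y x)) + t n * RI (q n).
    rewrite -RIZ// -RID//; last exact: igZ.
    exact: RI_eq.
  rewrite -subr_ge0 => h; rewrite -(pmulr_rge0 _ (t0 n)); apply: le_trans h _.
  by rewrite le_eqVlt; apply/orP; left; apply/eqP; rewrite /y; ring.
have c0 : t @ \oo --> (0 : R) by exact: cvg_inv_nat.
have lim : (fun n => 2 * RI (fun x => dotp (g x) (eta x)) + t n * nrm2 eta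
    - mu * (2 * RI (fun x => hh x * (y x * phi x)) + t n * RI (fun x => hh x * phi x ^+ 2)) + 2 * RI (q n))
   @ \oo --> 2 * RI (fun x => dotp (g x) (eta x)) + 0 * nrm2 eta
    - mu * (2 * RI (fun x => hh x * (y x * phi x)) + 0 * RI (fun x => hh x * phi x ^+ 2)) +
    2 * RI (fun x => dd x * (entropy' (y x) * phi x)).
  apply: cvgD; last exact: cvgMr.
  apply: cvgB; first by apply: cvgD; [exact: cvg_cst|exact: cvgMl].
  by apply: cvgMr; apply: cvgD; [exact: cvg_cst|exact: cvgMl].
have : 0 <= 2 * RI (fun x => dotp (g x) (eta x)) + 0 * nrm2 eta
    - mu * (2 * RI (fun x => hh x * (y x * phi x)) + 0 * RI (fun x => hh x * phi x ^+ 2)) +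
    2 * RI (fun x => dd x * (entropy' (y x) * phi x)).
  by apply: (cvgr_to_ge lim); apply: nearW.
rewrite !mul0r !addr0 => h.
have -> : RI (fun x => (mu * hh x * (1 + w x) - dd x * entropy' (1 + w x)) * phi x) =
    mu * RI (fun x => hh x * (y x * phi x)) - RI (fun x => dd x * (entropy' (y x) * phi x)).
  rewrite -RIZ// -RIB//; last exact: igZ.
  by apply: RI_eq => x; rewrite /y; ring.
lra.
Qed.

End existence.

(** * From the minimiser to a bounded solution *)

Lemma entropy'_ge0 (R : realType) (s : R) : 1 <= s -> 0 <= entropy' s.
Proof.
move=> s1; rewrite divr_ge0// mulr_ge0//; first by apply: le_trans s1.
by rewrite ln_ge0// exprn_ege1.
Qed.

Lemma entropy'_le0 (R : realType) (s : R) : 0 <= s <= 1 -> entropy' s <= 0.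
Proof.
move=> /andP[s0 s1]; rewrite pmulr_lle0 ?invr_gt0// mulr_ge0_le0// ln_le0//.
exact: exprn_ile1.
Qed.

Lemma is_derive_shift (R : realType) (c s : R) : is_derive s 1 (fun t : R => c + t) 1.
Proof.
have -> : (fun t : R => c + t) = cst c + id by apply/funext.
by apply: is_derive_eq; rewrite add0r.
Qed.

Section euler_lagrange.
Context d (X : measurableType d) (R : realType) (N : nat).
Variable nu : {finite_measure set X -> \bar R}.
Variable T0 : (X -> R) -> (X -> 'rV[R]_N) -> Prop.
Implicit Types (u v a b phi y : X -> R) (h psi eta : X -> 'rV[R]_N).
Hypothesis core : energy_core nu T0.

Local Notation meas := (measurable_fun [set: X]).
Local Notation H0 := (H0 nu T0).
Local Notation RI := (RI nu).
Local Notation ig := (ig nu).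
Local Notation L2 := (L2 nu).
Local Notation nrm2 := (nrm2 nu).
Local Notation L2v := (L2v nu).

Variables (V hh dd : X -> R) (sigma C mu : R).
Hypotheses (sw : sobolev_weight nu T0 V sigma C) (V1 : forall x, 1 <= V x)
  (iV : ig V) (C0 : 0 <= C) (sigma0 : 0 < sigma) (mu0 : 0 < mu).
Hypotheses (mh : meas hh) (hV : forall x, `|hh x| <= V x).
Hypotheses (md : meas dd) (d0 : forall x, 0 <= dd x) (dV : forall x, dd x <= V x).

Local Notation L2w := (L2w nu V).

Let V0 x : 0 <= V x. Proof. exact: le_trans (V1 x). Qed.
Let H0w u h : H0 u h -> L2w u.
Proof. by move=> ug; exact: (H0_L2w core sw V1 iV C0 ug). Qed.

Variables (w : X -> R) (g : X -> 'rV[R]_N).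
Hypothesis Hw : H0 w g.
Hypothesis EL : forall phi eta, H0 phi eta -> (exists M, bounded_by M phi) ->
  RI (fun x => dotp (g x) (eta x)) =
  RI (fun x => (mu * hh x * (1 + w x) - dd x * entropy' (1 + w x)) * phi x).

Lemma ig_euler phi : meas phi -> (exists M, bounded_by M phi) ->
  ig (fun x => (mu * hh x * (1 + w x) - dd x * entropy' (1 + w x)) * phi x).
Proof.
move=> mphi [M bM]; have w2 := L2w_1D V1 iV (H0w Hw).
apply: (ig_eq (f := fun x => phi x * (mu * hh x * (1 + w x) - dd x * entropy' (1 + w x)))).
  by move=> x; rewrite mulrC.
apply: (ig_bM mphi bM); apply: igB.
  apply: (ig_eq (f := fun x => mu * (hh x * ((1 + w x) * 1)))) => [x|]; first by ring.
  apply: igZ; apply: L2w_mul mh hV w2 _.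
  by apply: (L2w_bounded V1 iV (M := 1)) => // x; rewrite normr1.
by apply: ig_entropy' w2.
Qed.

Hypothesis y0 : forall x, 0 <= 1 + w x.

(** The test function is (y - k)^+ with y = 1 + w: for k >= 1 the term in [dd] has a favourable sign
    and is dropped, which leaves the estimate needed by [de_giorgi]. Only bounded test functions are
    allowed, so it is first cut at height n. *)
Lemma euler_upper : exists2 K : R, 1 <= K & {ae nu, forall x, 1 + w x <= K}.
Proof.
have [K K1 HK] := de_giorgi core sw V1 iV C0 sigma0 (ltW mu0) (nrm2_ge0 nu g).
exists K => //; pose gam (k : R) x := ((k - 1 < w x)%R)%:R *: g x.
have mw := H0_meas Hw; have gg := L2v_dot (H0_L2v Hw) (H0_L2v Hw).
have posE (k : R) : 1 <= k -> (fun x => Num.max (1 + w x - k) 0) = (fun x => relu (k - 1) (w x)).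
  move=> k1; apply/funext => x; rewrite /relu (max_r (_ : - (k - 1) <= 0)) ?oppr_le0 ?subr_ge0//.
  by rewrite subr0; congr (Num.max _ _); ring.
have Hk (k : R) : 1 <= k -> H0 (fun x => Num.max (1 + w x - k) 0) (gam k).
  by move=> k1; rewrite posE//; exact: H0_relu.
have mf : meas (fun x => 1 + w x) by exact: measurable_funD.
have ind1 (c : bool) (s : R) : 0 <= s -> 0 <= c%:R * s <= s.
  by case: c; rewrite ?mul1r ?mul0r => s0; rewrite ?s0 lexx.
apply: (HK (fun x => 1 + w x) gam mf) => k k1; split; first exact: Hk.
  have igk := L2v_dot (H0_L2v (Hk _ k1)) (H0_L2v (Hk _ k1)).
  apply: RI_le => // x; rewrite /gam dotpZl dotpZr.
  have /andP[a1 a2] := ind1 (k - 1 < w x) _ (dotp_ge0 (g x)).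
  by have /andP[_] := ind1 (k - 1 < w x) _ a1 => /le_trans; apply.
pose D := mu * RI (fun x => V x * ((1 + w x) * Num.max (1 + w x - k) 0)).
(* The indicator of k < 1 + w <= k + n, where the cut test function has gradient [g]. *)
pose c (n : nat) x : R := ((k - 1 < w x)%R)%:R - ((k + n%:R - 1 < w x)%R)%:R.
have kn n : 1 <= k + n%:R by rewrite (le_trans k1)// lerDl.
have step n : RI (fun x => c n x * dotp (g x) (g x)) <= D.
  have HB := H0_B core (Hk _ k1) (Hk _ (kn n)).
  pose phi x := Num.max (1 + w x - k) 0 - Num.max (1 + w x - (k + n%:R)) 0.
  have n0 : (0 : R) <= n%:R by [].
  have phi0 x : 0 <= phi x <= Num.max (1 + w x - k) 0.
    rewrite /phi gerBl le_max lexx orbT andbT subr_ge0 ge_max !le_max lexx orbT andbT.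
    by apply/orP; left; lra.
  have bphi : bounded_by n%:R phi.
    move=> x; have /andP[p0 _] := phi0 x; rewrite ger0_norm// /phi.
    have [a|a] := leP (1 + w x - k) 0; have [b|b] := leP (1 + w x - (k + n%:R)) 0; lra.
  have bx : exists M, bounded_by M phi by exists n%:R.
  have := EL HB bx.
  have -> : RI (fun x => dotp (g x) (gam k x - gam (k + n%:R) x)) =
      RI (fun x => c n x * dotp (g x) (g x)).
    by apply: RI_eq => x; rewrite /gam !dotpE /c; ring.
  move=> ->; rewrite /D -RIZ; last first.
    exact: (ig_posM core sw V1 iV C0 k1 mf (Hk _ (lexx _)) (Hk _ k1)).
  apply: RI_le.
  - apply: ig_euler => //; exact: H0_meas HB.
  - by apply: igZ; exact: (ig_posM core sw V1 iV C0 k1 mf (Hk _ (lexx _)) (Hk _ k1)).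
  move=> x; have /andP[p0 p1] := phi0 x; rewrite -/(phi x).
  have [yk|ky] := leP (1 + w x) k.
    have e : Num.max (1 + w x - k) 0 = 0 by rewrite max_r// subr_le0.
    have -> : phi x = 0 by apply: le_anti; rewrite p0 andbT -e.
    by rewrite e !mulr0.
  have e0 : 0 <= dd x * entropy' (1 + w x).
    by rewrite mulr_ge0// entropy'_ge0// (le_trans k1)// ltW.
  apply: (@le_trans _ _ (mu * hh x * (1 + w x) * phi x)).
    by rewrite ler_wpM2r// gerBl.
  rewrite -!mulrA ler_pM2l//.
  apply: (@le_trans _ _ (V x * ((1 + w x) * phi x))).
    by rewrite ler_wpM2r ?mulr_ge0// (le_trans (ler_norm _)).
  by rewrite ler_wpM2l// ler_wpM2l.
have lim : (fun n => RI (fun x => c n x * dotp (g x) (g x))) @ \oo --> nrm2 (gam k).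
  have [] := @RI_dct _ _ _ nu (fun n x => c n x * dotp (g x) (g x))
    (fun x => dotp (gam k x) (gam k x)) (fun x => dotp (g x) (g x)) => //.
  - move=> n; apply: measurable_funM; last exact: ig_meas gg.
    by apply: measurable_funB; exact: measurable_ltind.
  - by have h := H0_L2v (Hk _ k1); exact: ig_meas (L2v_dot h h).
  - apply: aeW => x; apply: cvg_near_cst.
    have := nbhs_infty_ger (w x); apply: filterS => n hn.
    rewrite /c /gam !dotpE (_ : (k + n%:R - 1 < w x) = false).
      by rewrite subr0 mulrA; case: (_ < _)%R; rewrite ?mul1r ?mul0r.
    by apply/negbTE; rewrite -leNgt; lra.
  - move=> n x; rewrite normrM (ger0_norm (dotp_ge0 _)) ler_piMl ?dotp_ge0//.
    exact: ind_diff_le1.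
by apply: (cvgr_to_le lim); apply: nearW => n; exact: step.
Qed.

(* De Giorgi's lemma applied to f = - ln (max (1 + w) de), tested with
   (f - k)^+ / max (1 + w) de; the bounds it needs do not depend on de, so de can
   be chosen below the bound e^(-K) it yields. *)
Lemma euler_lower : exists2 K : R, 0 < K & {ae nu, forall x, K <= 1 + w x}.
Proof.
have [P P0 HP] := poincare_H0 core sw V1 iV C0.
have IV0 : 0 <= RI V by apply: RI_ge0.
pose A := mu ^+ 2 * P * RI V.
have A0 : 0 <= A by rewrite !mulr_ge0// ltW.
have [K K1 HK] := de_giorgi core sw V1 iV C0 sigma0 (ltW mu0) A0.
exists (expR (- K)); first exact: expR_gt0.
(* Smaller than e^(-K), so that f <= K rules out [de] as the value of the maximum. *)
pose de : R := expR (- K - 1); have de0 : 0 < de by exact: expR_gt0.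
have de1 : de < 1 by rewrite -expR0 ltr_expR; lra.
pose f x := - ln (Num.max (1 + w x) de).
have max0 x : 0 < Num.max (1 + w x) de by rewrite lt_max de0 orbT.
have mw := H0_meas Hw; have gg := L2v_dot (H0_L2v Hw) (H0_L2v Hw).
have mf : meas f.
  apply: measurableT_comp => //; apply: measurableT_comp => //.
  by apply: measurable_maxr => //; exact: measurable_funD.
pose b (k : R) x : R := ((de - 1 < w x)%R)%:R - ((expR (- k) - 1 < w x)%R)%:R.
pose r (k : R) x := 1 + clamp (de - 1) (expR (- k) - 1) (w x).
pose gam (k : R) x := if (de < expR (- k)) then - (r k x)^-1 *: (b k x *: g x) else 0.
suff Hk (k : R) : 1 <= k -> [/\ H0 (fun x => Num.max (f x - k) 0) (gam k), nrm2 (gam k) <= A &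
      nrm2 (gam k) <= mu * RI (fun x => V x * (f x * Num.max (f x - k) 0))].
  apply: filterS (HK _ _ mf Hk) => x; rewrite /f lerNl => h.
  have : expR (- K) <= Num.max (1 + w x) de by rewrite -(lnK (max0 x)) ler_expR.
  rewrite le_max => /orP[//|]; rewrite /de ler_expR; lra.
(* This linear bound suffices. Young's and Poincare's inequalities turn it into the bound [A] on the
   energy, whatever [de]; and since f > k >= 1 where (f - k)^+ is positive, it implies the estimate
   needed by [de_giorgi]. *)
move: k; suff Hk (k : R) : 1 <= k -> H0 (fun x => Num.max (f x - k) 0) (gam k) /\
    nrm2 (gam k) <= mu * RI (fun x => V x * Num.max (f x - k) 0).
  move=> k k1; have [Hz le] := Hk _ k1; have [H1 _] := Hk _ (lexx 1).
  have [z2 _] := HP _ _ Hz; have zw := H0w Hz; have [_ iz] := zw.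
  have izV := L2w_ig V1 iV zw.
  split => //.
    pose e := (mu * P)^-1; have e0 : 0 < e by rewrite invr_gt0 mulr_gt0.
    have h1 : 2 * RI (fun x => V x * Num.max (f x - k) 0) <=
        e * RI (fun x => V x * Num.max (f x - k) 0 ^+ 2) + e^-1 * RI V.
      rewrite -!RIZ// -RID; [|exact: igZ|exact: igZ].
      apply: RI_le; [exact: igZ|by apply: igD; exact: igZ|].
      move=> x; set z := Num.max _ _.
      have b2 : 2 * z <= e * z ^+ 2 + e^-1.
        have := mulr_ge0 (ltW e0) (sqr_ge0 (z - e^-1)).
        have -> : e * (z - e^-1) ^+ 2 = e * z ^+ 2 + e^-1 - 2 * z by field; rewrite gt_eqF.
        lra.
      by have := ler_wpM2l (V0 x) b2; lra.
    have h2 : mu * (e * RI (fun x => V x * Num.max (f x - k) 0 ^+ 2)) <= nrm2 (gam k).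
      have -> : mu * (e * RI (fun x => V x * Num.max (f x - k) 0 ^+ 2)) =
        P^-1 * RI (fun x => V x * Num.max (f x - k) 0 ^+ 2) by rewrite /e; field; rewrite !gt_eqF.
      by rewrite ler_pdivrMl.
    have h3 : mu * (e^-1 * RI V) = A by rewrite /e /A invrK; ring.
    have h4 := ler_wpM2l (ltW mu0) h1; lra.
  apply: le_trans le _; rewrite ler_pM2l//; apply: RI_le => //.
    exact: (ig_posM core sw V1 iV C0 k1 mf H1 Hz).
  move=> x; rewrite ler_wpM2l//; have [_|h] := leP (f x - k) 0; first by rewrite mulr0.
  by rewrite ler_peMl; lra.
move=> k1; set e : R := expR (- k); have e0 : 0 < e by exact: expR_gt0.
have e1 : e < 1 by rewrite -expR0 ltr_expR; lra.
have [ede|dee] := leP e de.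
  have E0 : (fun x => Num.max (f x - k) 0) = fun=> 0.
    apply/funext => x; rewrite max_r// subr_le0 /f lerNl -[leLHS]expRK ler_ln ?posrE ?expR_gt0//.
    by rewrite le_max ede orbT.
  have -> : gam k = fun=> 0 by apply/funext => x; rewrite /gam ltNge ede.
  rewrite E0; split; first exact: H0_0.
  rewrite (_ : nrm2 (fun=> 0) = 0).
    rewrite mulr_ge0 ?(ltW mu0)// RI_ge0// => x.
    by rewrite mulr_ge0// le_max lexx orbT.
  by rewrite -(RI0 nu); apply: RI_eq => x; rewrite dotp0l.
have gamE : gam k = fun x => - (r k x)^-1 *: (b k x *: g x).
  by apply/funext => x; rewrite /gam dee.
rewrite gamE {gamE}.
pose u x := clamp (de - 1) (e - 1) (w x) - clamp (de - 1) (e - 1) 0.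
have dele : de - 1 <= e - 1 by lra.
have Hu : H0 u (fun x => b k x *: g x) by exact: H0_clamp.
have c0 : clamp (de - 1) (e - 1) 0 = e - 1.
  by rewrite /clamp max_l; [rewrite min_r//; lra|lra].
have ur x : e + u x = r k x by rewrite /u c0 /r -/e; ring.
have rE x : r k x = Num.min (Num.max (1 + w x) de) e.
  rewrite /r /clamp -/e -{2}(subrK 1 e) addrC -[X in Num.max (1 + _) X](subrK 1 de).
  by rewrite [1 + w x]addrC -addr_maxl -addr_minl.
have r_lo x : de <= r k x by rewrite rE le_min le_max lexx orbT/= ltW.
have r_hi x : r k x <= e by rewrite rE ge_min lexx orbT.
have r0 x : 0 < r k x by exact: lt_le_trans (r_lo x).
have zE x : Num.max (f x - k) 0 = - ln (e + u x) - k.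
  rewrite ur rE /f; have [mle|elm] := leP (Num.max (1 + w x) de) e.
    rewrite max_l// subr_ge0 lerNr -[leRHS]expRK ler_ln ?posrE ?expR_gt0//.
  rewrite expRK opprK subrr max_r// subr_le0 lerNl -[leLHS]expRK ler_ln ?posrE ?expR_gt0//.
  exact: ltW.
have zE' : (fun x => Num.max (f x - k) 0) = fun x => - ln (e + u x) - k by apply/funext.
pose L := - ln (de / 2) - k.
(* F(u) is (f - k)^+ and G(u) is the test function. The variable is shifted by e = e^(-k) so that F
   and G vanish at 0, as the chain rule asks. *)
pose F (s : R) := - ln (e + s) - k; pose G (s : R) := F s / (e + s).
have a_lt x : de / 2 - e < u x <= 0.
  by have := r_lo x; have := r_hi x; rewrite -ur => h1 h2; apply/andP; split; lra.
have dd2 : 0 < de / 2 by rewrite divr_gt0.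
have pos (s : R) : de / 2 - e <= s <= 0 -> de / 2 <= e + s <= e.
  by move=> /andP[h1 h2]; apply/andP; split; lra.
have F0 (s : R) : de / 2 - e <= s <= 0 -> 0 <= F s <= L.
  move=> /pos/andP[h1 h2]; have h3 : 0 < e + s by lra.
  rewrite /F /L lerD2r lerN2 ler_ln ?posrE// h1 andbT subr_ge0 lerNr -[leRHS]expRK.
  by rewrite ler_ln ?posrE ?expR_gt0.
have dln (s : R) : 0 < e + s -> is_derive s 1 (fun t => ln (e + t)) (e + s)^-1.
  move=> h; have d1 : is_derive s 1 (fun t : R => e + t) 1.
    exact: is_derive_shift.
  have := @is_derive1_comp R (@ln R) (fun t => e + t) s _ _ (is_derive1_ln h) d1.
  by rewrite mulr1.
have dF (s : R) : 0 < e + s -> is_derive s 1 F (- (e + s)^-1).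
  move=> h; have := is_deriveB (is_deriveN (dln _ h)) (is_derive_cst k s 1).
  by rewrite subr0.
have dG (s : R) : 0 < e + s -> is_derive s 1 G (- (1 + F s) / (e + s) ^+ 2).
  move=> h; have d1 : is_derive s 1 (fun t : R => e + t) 1.
    exact: is_derive_shift.
  have nz : e + s != 0 by rewrite gt_eqF.
  have dm := is_deriveM (dF _ h) (is_deriveV nz d1).
  rewrite (_ : - (1 + F s) / (e + s) ^+ 2 =
    F s *: (- (e + s) ^- 2 *: (1 : R)) + (e + s)^-1 *: (- (e + s)^-1)); first exact: dm.
  by rewrite /GRing.scale/=; field.
have ab : de / 2 - e < 0 by lra.
have aib : (de / 2 - e <= 0) && ((0 : R) <= 0) by rewrite (ltW ab) lexx.
have FZ : F 0 = 0 by rewrite /F addr0 expRK opprK subrr.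
have L0 : 0 <= L by have /andP[] := F0 0 aib; rewrite FZ.
have HF : H0 (fun x => F (u x)) (fun x => - (e + u x)^-1 *: (b k x *: g x)).
  apply: (H0_chain core (f := fun s => - (e + s)^-1) (L := (de / 2)^-1) ab aib FZ _ _ Hu a_lt).
    by move=> s /pos/andP[h1 _]; apply: dF; lra.
  move=> s /pos/andP[h1 _]; have h2 : 0 < e + s by lra.
  by rewrite normrN gtr0_norm ?invr_gt0// lef_pV2 ?posrE.
have HG : H0 (fun x => G (u x)) (fun x => (- (1 + F (u x)) / (e + u x) ^+ 2) *: (b k x *: g x)).
  apply: (H0_chain core (f := fun s => - (1 + F s) / (e + s) ^+ 2)
    (L := (1 + L) * (de / 2) ^- 2) ab aib _ _ _ Hu a_lt).
  - by rewrite /G FZ mul0r.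
  - by move=> s /pos/andP[h1 _]; apply: dG; lra.
  move=> s hs; have /andP[h1 _] := pos _ hs; have /andP[F1 F2] := F0 _ hs.
  have h2 : 0 < e + s by lra.
  have F11 : 0 <= 1 + F s by lra.
  have s2 : 0 < (e + s) ^+ 2 by rewrite exprn_gt0.
  rewrite normrM normrN normfV (ger0_norm F11) (gtr0_norm s2).
  apply: ler_pM => //; rewrite ?invr_ge0 ?lerD2l ?(ltW s2)//.
  by rewrite lef_pV2 ?posrE ?exprn_gt0// ler_sqr ?nnegrE ?(ltW h2) ?(ltW dd2).
have Fu x : 0 <= F (u x) <= L.
  by apply: F0; have /andP[h1 h2] := a_lt x; rewrite h2 ltW.
have G0 x : 0 <= G (u x).
  by rewrite /G ur divr_ge0 ?(ltW (r0 x))//; have /andP[] := Fu x.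
have bG : exists M, bounded_by M (fun x => G (u x)).
  exists (L / de) => x; rewrite ger0_norm// /G ur; have /andP[F1 F2] := Fu x.
  by apply: ler_pM; rewrite ?invr_ge0 ?(ltW (r0 x))// lef_pV2 ?posrE.
have el := EL HG bG; have iel := ig_euler (H0_meas HG) bG.
have zw := H0w HF; have izV := L2w_ig V1 iV zw.
have HF' : H0 (fun x => Num.max (f x - k) 0) (fun x => - (r k x)^-1 *: (b k x *: g x)).
  rewrite zE'; suff -> : (fun x => - (r k x)^-1 *: (b k x *: g x)) =
      (fun x => - (e + u x)^-1 *: (b k x *: g x)) by exact: HF.
  by apply/funext => x; rewrite ur.
split => //.
have bb x : b k x * b k x = b k x.
  rewrite /b -/e; have [h1|h1] := ltP (de - 1) (w x); have [h2|h2] := ltP (e - 1) (w x) => /=.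
  - by rewrite subrr mulr0.
  - by rewrite subr0 mulr1.
  - by exfalso; lra.
  - by rewrite subr0 mulr0.
have b0 x : 0 <= b k x by rewrite -bb -expr2 sqr_ge0.
(* Because F >= 0, - G' = (1 + F) / (e + s)^2 is at least F'^2. *)
have h1 : nrm2 (fun x => - (r k x)^-1 *: (b k x *: g x)) <=
    - RI (fun x => dotp (g x) ((- (1 + F (u x)) / (e + u x) ^+ 2) *: (b k x *: g x))).
  have ie := L2v_dot (H0_L2v Hw) (H0_L2v HG).
  rewrite -RIN//; apply: RI_le; last 1 first.
  - move=> x; rewrite !dotpE ur; have /andP[F1 _] := Fu x.
    have -> : - (- (1 + F (u x)) / r k x ^+ 2 * (b k x * dotp (g x) (g x))) =
       (b k x * dotp (g x) (g x) / r k x ^+ 2) * (1 + F (u x)) by field; rewrite gt_eqF.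
    have -> : - (r k x)^-1 * (b k x * (- (r k x)^-1 * (b k x * dotp (g x) (g x)))) =
        (b k x * b k x) * dotp (g x) (g x) / r k x ^+ 2 by field; rewrite gt_eqF.
    rewrite bb ler_peMr ?lerDl//.
    by rewrite divr_ge0 ?sqr_ge0// mulr_ge0 ?dotp_ge0.
  - exact: L2v_dot (H0_L2v HF') (H0_L2v HF').
  - exact: igN.
apply: le_trans h1 _; rewrite el -RIN//.
have -> : RI (fun x => V x * Num.max (f x - k) 0) = RI (fun x => V x * F (u x)).
  by apply: RI_eq => x; rewrite zE.
rewrite -RIZ//; apply: RI_le.
- exact: igN.
- exact: igZ.
move=> x; rewrite -/(F (u x)); have /andP[F1 _] := Fu x.
have [Fz|Fn] := eqVneq (F (u x)) 0.
  by rewrite /G Fz mul0r !mulr0 oppr0.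
(* Where F(u) is nonzero the upper clamp is inactive. Hence 1 + w <= r k < 1: the entropy term has a
   favourable sign, and (1 + w) G(u) <= F(u). *)
have yr : 1 + w x <= r k x.
  rewrite rE; have [mle|elm] := leP (Num.max (1 + w x) de) e; first by rewrite le_max lexx.
  exfalso; move/eqP : Fn; apply; rewrite /F ur rE min_r ?(ltW elm)//.
  by rewrite expRK opprK subrr.
have ent : entropy' (1 + w x) <= 0.
  by apply: entropy'_le0; rewrite y0/=; have := r_hi x; lra.
have yG : (1 + w x) * G (u x) <= F (u x).
  rewrite /G ur mulrCA ler_piMr// ler_pdivrMr// mul1r.
  exact: yr.
have h2 : dd x * entropy' (1 + w x) * G (u x) <= 0.
  by rewrite mulr_le0_ge0// mulr_ge0_le0.
have h3 : - hh x * ((1 + w x) * G (u x)) <= V x * F (u x).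
  apply: (@le_trans _ _ (V x * ((1 + w x) * G (u x)))).
    rewrite (ler_wpM2r (mulr_ge0 (y0 x) (G0 x)))//; apply: le_trans (ler_norm _) _.
    by rewrite normrN.
  by rewrite ler_wpM2l.
have := ler_wpM2l (ltW mu0) h3; lra.
Qed.

Section exponential_substitution.
Variables (K1 K2 : R).
Hypotheses (K10 : 0 < K1) (K12 : K1 <= 1 <= K2) (yK : forall x, K1 <= 1 + w x <= K2).

(** The Euler equation is tested with phi / (1 + w), whose gradient produces the term phi |grad w|^2
    / (1 + w)^2, that is mu^2 phi |grad u|^2. The quotient is written phi + phi F(w) with F
    vanishing at 0. *)
Lemma log_weak_sol : weak_sol nu T0 hh dd mu (fun x => ln (1 + w x) / mu)
  (fun x => (mu * (1 + w x))^-1 *: g x).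
Proof.
have [K1le K2ge] := andP K12.
have y_gt0 x : 0 < 1 + w x by have /andP[h _] := yK x; exact: lt_le_trans h.
have inside (s : R) : K1 / 2 - 1 <= s <= K2 - 1 -> K1 / 2 <= 1 + s.
  by move=> /andP[h _]; lra.
have K1h : 0 < K1 / 2 by rewrite divr_gt0.
have ab : K1 / 2 - 1 < K2 - 1 by lra.
have aib : (K1 / 2 - 1 <= 0) && (0 <= K2 - 1) by apply/andP; split; lra.
(* The chain rule needs a strict inequality at the left end, hence K1 / 2 instead of K1. *)
have win x : K1 / 2 - 1 < w x <= K2 - 1.
  by have /andP[h1 h2] := yK x; apply/andP; split; lra.
have Hu : H0 (fun x => ln (1 + w x) / mu) (fun x => (mu * (1 + w x))^-1 *: g x).
  apply: (H0_chain core (F := fun s => ln (1 + s) / mu) (f := fun s => (mu * (1 + s))^-1)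
    (L := (mu * (K1 / 2))^-1) ab aib _ _ _ Hw win).
  - by rewrite addr0 ln1 mul0r.
  - move=> s /inside h; have h0 : 0 < 1 + s by lra.
    have d1 := @is_derive1_comp R (@ln R) (fun t => 1 + t) s _ _ (is_derive1_ln h0) (is_derive_shift 1 s).
    have d2 := is_deriveZ mu^-1 d1.
    rewrite (_ : (fun t => _) = mu^-1 \*: (@ln R \o (fun t : R => 1 + t))).
      by rewrite (_ : (mu * (1 + s))^-1 = mu^-1 *: ((1 + s)^-1 * 1))//; rewrite /GRing.scale/= mulr1 invfM.
    by apply/funext => t; rewrite /= mulrC.
  - move=> s /inside h; have h0 : 0 < 1 + s by lra.
    rewrite gtr0_norm ?invr_gt0 ?mulr_gt0// lef_pV2 ?posrE ?mulr_gt0//.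
    by rewrite ler_pM2l.
split => //.
  exists ((`|ln K1| + `|ln K2|) / mu) => x; have /andP[h1 h2] := yK x.
  rewrite normrM normfV (gtr0_norm mu0) ler_pM2r ?invr_gt0//.
  have l1 : ln K1 <= ln (1 + w x) by rewrite ler_ln ?posrE.
  have l2 : ln (1 + w x) <= ln K2 by rewrite ler_ln ?posrE//; lra.
  have := ler_norm (- ln K1); have := ler_norm (ln K2); rewrite normrN => b1 b2.
  by have := normr_ge0 (ln K1); have := normr_ge0 (ln K2); rewrite ler_norml; lra.
move=> phi eta He [M0 bM0]; pose F (s : R) := (1 + s)^-1 - 1.
have HF : H0 (fun x => F (w x)) (fun x => - (1 + w x) ^- 2 *: g x).
  apply: (H0_chain core (f := fun s => - (1 + s) ^- 2) (L := (K1 / 2) ^- 2) ab aib _ _ _ Hw win).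
  - by rewrite /F addr0 invr1 subrr.
  - move=> s /inside h; have h0 : 1 + s != 0 by rewrite gt_eqF//; lra.
    have := is_deriveB (is_deriveV h0 (is_derive_shift 1 s)) (is_derive_cst (1 : R) s 1).
    by rewrite subr0 /GRing.scale/= mulr1.
  - move=> s /inside h; have h0 : 0 < 1 + s by lra.
    rewrite normrN gtr0_norm ?invr_gt0 ?exprn_gt0// lef_pV2 ?posrE ?exprn_gt0//.
    by rewrite ler_sqr ?nnegrE ?(ltW K1h) ?(ltW h0).
pose M := `|M0| + (K1^-1 + 1).
have Ki0 : 0 < K1^-1 by rewrite invr_gt0.
have M00 : 0 <= M by rewrite /M addr_ge0// addr_ge0 ?(ltW Ki0).
have bphi x : `|phi x| <= M.
  by apply: le_trans (bM0 x) _; have := ler_norm M0; rewrite /M; lra.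
have bF x : `|F (w x)| <= M.
  have /andP[h1 h2] := yK x; apply: le_trans (ler_normB _ _) _.
  rewrite normr1 gtr0_norm ?invr_gt0//; have : (1 + w x)^-1 <= K1^-1 by rewrite lef_pV2 ?posrE.
  by have := normr_ge0 M0; rewrite /M; lra.
have HT := H0_D core He (H0_mul core M00 He HF bphi bF).
have bT : exists M', bounded_by M' (fun x => phi x + phi x * F (w x)).
  exists (M + M * M) => x; apply: le_trans (ler_normD _ _) _; rewrite lerD// normrM.
  exact: ler_pM.
have := EL HT bT.
have gp := L2v_dot (H0_L2v Hu) (H0_L2v He).
have ipp : ig (fun x => phi x * (mu ^+ 2 * dotp ((mu * (1 + w x))^-1 *: g x) ((mu * (1 + w x))^-1 *: g x))).
  apply: (ig_bM (H0_meas He) (M := M)) => //; apply: igZ.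
  exact: L2v_dot (H0_L2v Hu) (H0_L2v Hu).
have el : RI (fun x => dotp (g x) (eta x + (phi x *: (- (1 + w x) ^- 2 *: g x) + F (w x) *: eta x))) =
    mu * RI (fun x => dotp ((mu * (1 + w x))^-1 *: g x) (eta x)) -
    RI (fun x => phi x * (mu ^+ 2 * dotp ((mu * (1 + w x))^-1 *: g x) ((mu * (1 + w x))^-1 *: g x))).
  rewrite -RIZ// -RIB//; last exact: igZ.
  apply: RI_eq => x; rewrite !dotpE /F; field.
  by rewrite !gt_eqF.
have er : RI (fun x => (mu * hh x * (1 + w x) - dd x * entropy' (1 + w x)) *
      (phi x + phi x * F (w x))) =
    RI (fun x => mu * (- dd x * (ln (1 + w x) / mu) + hh x) * phi x).
  apply: RI_eq => x; rewrite /entropy' /F lnXn// mulr2n; field.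
  by rewrite !gt_eqF.
rewrite el er => h.
have ir : ig (fun x => mu * (- dd x * (ln (1 + w x) / mu) + hh x) * phi x).
  have := ig_euler (H0_meas HT) bT; apply: ig_eq => x; rewrite /entropy' /F lnXn// mulr2n; field.
  by rewrite !gt_eqF.
apply: (mulfI (_ : mu != 0)); first by rewrite gt_eqF.
have -> : mu * RI (fun x => dotp ((mu * (1 + w x))^-1 *: g x) (eta x)) =
    RI (fun x => mu * (- dd x * (ln (1 + w x) / mu) + hh x) * phi x) +
    RI (fun x => phi x * (mu ^+ 2 * dotp ((mu * (1 + w x))^-1 *: g x) ((mu * (1 + w x))^-1 *: g x))).
  by rewrite -h subrK.
rewrite -RID// -RIZ; first by apply: RI_eq => x; ring.
have := igZ mu^-1 (igD ir ipp); apply: ig_eq => x; field.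
by rewrite !gt_eqF.
Qed.

End exponential_substitution.

End euler_lagrange.

Section sufficiency.
Context d (X : measurableType d) (R : realType) (N : nat).
Variable nu : {finite_measure set X -> \bar R}.
Variable T0 : (X -> R) -> (X -> 'rV[R]_N) -> Prop.
Variables (V hh dd : X -> R) (sigma C mu : R).

Lemma weak_sol_of_kernel_pos :
  energy_core nu T0 -> rellich nu T0 -> sobolev_weight nu T0 V sigma C ->
  (forall x, 1 <= V x) -> ig nu V -> 0 <= C -> 0 < sigma -> 0 < mu ->
  measurable_fun setT hh -> (forall x, `|hh x| <= V x) ->
  measurable_fun setT dd -> (forall x, 0 <= dd x) -> (forall x, dd x <= V x) ->
  (forall w g, H0 nu T0 w g -> {ae nu, forall x, dd x * w x = 0} ->
    0 < nrm2 nu g -> 0 < nrm2 nu g - mu * RI nu (fun x => hh x * w x ^+ 2)) ->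
  exists u g, weak_sol nu T0 hh dd mu u g.
Proof.
move=> core rel sw V1 iV C0 s0 mu0 mh hV md d0 dV kp.
have [w [g [adw y0 min]]] := energy_min_ge0 core rel sw V1 iV C0 s0 mu0 mh hV md d0 dV kp.
have EL := energy_euler core sw V1 iV C0 mh hV md d0 dV adw min; have [Hw _] := adw.
have [K2 K21 up] := euler_upper core sw V1 iV C0 s0 mu0 mh hV md d0 dV Hw EL y0.
have [k k0 lo] := euler_lower core sw V1 iV C0 s0 mu0 mh hV md d0 dV Hw EL y0.
pose K1 := Num.min k 1.
have K10 : 0 < K1 by rewrite lt_min k0 ltr01.
have K11 : K1 <= 1 by rewrite ge_min lexx orbT.
have K12 : K1 - 1 <= K2 - 1 by rewrite lerD2r (le_trans K11).
(* The bounds on the minimiser hold almost everywhere; clamping makes them hold everywhere without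
   changing its class. *)
pose w' x := clamp (K1 - 1) (K2 - 1) (w x).
have wE : {ae nu, forall x, w x = w' x}.
  apply: filterS2 up lo => x h1 h2; rewrite /w' /clamp max_l; first by rewrite min_l//; lra.
  by rewrite lerBlDl; apply: le_trans h2; rewrite ge_min lexx.
have mw' : measurable_fun setT w'.
  apply: measurable_minr => //; apply: measurable_maxr => //; exact: H0_meas Hw.
have Hw' : H0 nu T0 w' g.
  apply: (H0_ae core mw' _ wE _ Hw); last exact: aeW.
  exact: L2v_meas (H0_L2v Hw).
have bw x : K1 <= 1 + w' x <= K2.
  by have := clamp_itv (w x) K12; rewrite -/(w' x) => /andP[h1 h2]; apply/andP; split; lra.
have y'0 x : 0 <= 1 + w' x by have /andP[h _] := bw x; apply: le_trans h; exact: ltW.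
have K1b : K1 <= 1 <= K2 by rewrite K11 K21.
have EL' phi eta : H0 nu T0 phi eta -> (exists M, bounded_by M phi) ->
  RI nu (fun x => dotp (g x) (eta x)) =
  RI nu (fun x => (mu * hh x * (1 + w' x) - dd x * entropy' (1 + w' x)) * phi x).
  move=> He bphi; rewrite (EL _ _ He bphi).
  have i1 := ig_euler core mu sw V1 iV C0 mh hV md d0 dV Hw (H0_meas He) bphi.
  have i2 := ig_euler core mu sw V1 iV C0 mh hV md d0 dV Hw' (H0_meas He) bphi.
  apply: RI_ae; [exact: ig_meas i1|exact: ig_meas i2|].
  by apply: filterS wE => x ->.
do 2 eexists; exact: (log_weak_sol core sw V1 iV C0 mu0 mh hV md d0 dV Hw' EL' K10 K1b bw).
Qed.

End sufficiency.

(** * Gagliardo-Nirenberg inequality *)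

Section interpolation.
Context d (T : measurableType d) (R : realType).
Variable nu : {measure set T -> \bar R}.
Implicit Types (f g : T -> R).

Local Notation meas := (measurable_fun [set: T]).
Local Notation ig := (ig nu).
Local Notation RI := (RI nu).

Lemma meas_powR f (p : R) : meas f -> meas (fun x => f x `^ p).
Proof. by move=> mf; apply: (measurableT_comp (measurable_powR p)). Qed.

Lemma young (a b t : R) : 0 < t < 1 -> 0 <= a -> 0 <= b ->
  a `^ t * b `^ (1 - t) <= t * a + (1 - t) * b.
Proof.
move=> /andP[t0 t1] a0 b0; have s0 : 0 < 1 - t by lra.
have := @conjugate_powR R (a `^ t) (b `^ (1 - t)) t^-1 (1 - t)^-1.
rewrite !invrK -!powRrM !mulfV ?gt_eqF// !powRr1// => h.
rewrite [t * a]mulrC [(1 - t) * b]mulrC; apply: h; rewrite ?powR_ge0 ?invr_gt0//; lra.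
Qed.

(** Hoelder's inequality: integrate Young's inequality for the functions divided by their integrals.
    If one of the integrals is 0, that function vanishes almost everywhere and so does the left-hand
    side. *)
Lemma RI_interp f g (t : R) : 0 < t < 1 -> (forall x, 0 <= f x) -> (forall x, 0 <= g x) ->
  ig f -> ig g -> ig (fun x => f x `^ t * g x `^ (1 - t)) /\
  RI (fun x => f x `^ t * g x `^ (1 - t)) <= RI f `^ t * RI g `^ (1 - t).
Proof.
move=> t01 f0 g0 fi gi; have /andP[t0 t1] := t01; have s0 : 0 < 1 - t by lra.
have mfg : meas (fun x => f x `^ t * g x `^ (1 - t)).
  by apply: measurable_funM; apply: meas_powR; [exact: ig_meas fi|exact: ig_meas gi].
have ifg : ig (fun x => f x `^ t * g x `^ (1 - t)).
  apply: (ig_le mfg _ (igD (igZ t fi) (igZ (1 - t) gi))) => x.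
  by rewrite ger0_norm ?mulr_ge0 ?powR_ge0// young.
split => //; have F0 : 0 <= RI f by exact: RI_ge0.
have G0 : 0 <= RI g by exact: RI_ge0.
have vanish : {ae nu, forall x, f x = 0} \/ {ae nu, forall x, g x = 0} ->
    RI (fun x => f x `^ t * g x `^ (1 - t)) <= RI f `^ t * RI g `^ (1 - t).
  move=> h; rewrite (RI_ae (g := fun=> 0)) ?RI0 ?mulr_ge0 ?powR_ge0//.
  by case: h => h; apply: filterS h => x ->; rewrite powR0 ?gt_eqF// ?mul0r ?mulr0.
have [Fz|Fz] := eqVneq (RI f) 0; first by apply: vanish; left; exact: RI_eq0.
have [Gz|Gz] := eqVneq (RI g) 0; first by apply: vanish; right; exact: RI_eq0.
have Fp : 0 < RI f by rewrite lt_def Fz.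
have Gp : 0 < RI g by rewrite lt_def Gz.
have Pp : 0 < RI f `^ t * RI g `^ (1 - t) by rewrite mulr_gt0// powR_gt0.
have ip (a s : R) : 0 < a -> a^-1 `^ s = (a `^ s)^-1.
  by move=> a0; rewrite -powR_inv1 ?(ltW a0)// -powRrM mulN1r powRN.
rewrite -[leRHS]mulr1 -ler_pdivrMl// -RIZ//.
apply: (@le_trans _ _ (RI (fun x => t / RI f * f x + (1 - t) / RI g * g x))).
  apply: RI_le; [exact: igZ|by apply: igD; exact: igZ|] => x.
  have := young t01 (divr_ge0 (f0 x) F0) (divr_ge0 (g0 x) G0).
  rewrite (powRM _ (f0 x)) ?invr_ge0// (powRM _ (g0 x)) ?invr_ge0// !ip// => h.
  apply: le_trans (le_trans _ h) _.
    by rewrite le_eqVlt; apply/orP; left; apply/eqP; field; rewrite !gt_eqF ?powR_gt0.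
  by rewrite le_eqVlt; apply/orP; left; apply/eqP; field; rewrite Fz Gz.
rewrite RID; [|exact: igZ|exact: igZ].
by rewrite !RIZ// -!mulrA !mulVf// !mulr1 subrKC.
Qed.

End interpolation.

(** * Bounded functions with support in a given set *)

Section bounded_support.
Context d (T : measurableType d) (R : realType).
Implicit Types (f g : T -> R) (B : set T).

Local Notation meas := (measurable_fun [set: T]).

(** A class stable under the products, powers, slices and partial integrals that occur below. On
    sets of finite measure its members are integrable, which settles all integrability conditions at
    once. *)
Definition bsup B f := meas f /\ exists2 M : R, 0 <= M & forall x, `|f x| <= M * \1_B x.

Lemma bsup_out B f x : bsup B f -> ~ B x -> f x = 0.
Proof.
move=> [_ [M _ h]] Bx; apply/eqP; rewrite -normr_le0; apply: le_trans (h x) _.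
by rewrite indicE memNset// mulr0.
Qed.

Lemma bsup_meas B f : bsup B f -> meas f. Proof. by case. Qed.

Lemma ig_bsup (nu : {measure set T -> \bar R}) B f : measurable B -> (nu B < +oo)%E ->
  bsup B f -> ig nu f.
Proof.
move=> mB Bfin [mf [M M0 h]]; apply: (ig_le mf h); apply: igZ.
apply/integrableP; split; first by apply/measurable_EFinP; exact: measurable_indic.
under eq_integral => x _ do rewrite /= ger0_norm//.
by rewrite integral_indic// setIT.
Qed.

Lemma bsupD B f g : bsup B f -> bsup B g -> bsup B (fun x => f x + g x).
Proof.
move=> [mf [M M0 hf]] [mg [K K0 hg]]; split; first exact: measurable_funD.
exists (M + K) => [|x]; first by rewrite addr_ge0.
by rewrite mulrDl (le_trans (ler_normD _ _))// lerD.
Qed.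

Lemma bsupM (K : R) B f g : bsup B f -> meas g -> (forall x, `|g x| <= K) ->
  bsup B (fun x => f x * g x).
Proof.
move=> [mf [M M0 hf]] mg hg; split; first exact: measurable_funM.
exists (M * `|K|) => [|x]; first by rewrite mulr_ge0.
rewrite normrM mulrAC; apply: ler_pM => //.
exact: le_trans (hg x) (ler_norm _).
Qed.

Lemma bsupMM B f g : bsup B f -> bsup B g -> bsup B (fun x => f x * g x).
Proof.
move=> bf [mg [K K0 hg]]; apply: (@bsupM K) => // x.
by apply: le_trans (hg x) _; rewrite ler_piMr// indicE; case: (_ \in _).
Qed.

Lemma bsupZ B f (k : R) : bsup B f -> bsup B (fun x => k * f x).
Proof.
move=> bf; have := @bsupM `|k| B f (fun=> k) bf => /(_ (measurable_cst _) (fun=> lexx _)).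
by rewrite (_ : (fun x => f x * k) = fun x => k * f x)//; apply/funext => x; rewrite mulrC.
Qed.

Lemma bsup_powR B f (p : R) : 0 < p -> (forall x, 0 <= f x) -> bsup B f ->
  bsup B (fun x => f x `^ p).
Proof.
move=> p0 f0 [mf [M M0 h]]; split; first exact: meas_powR.
exists (M `^ p) => [|x]; first exact: powR_ge0.
rewrite ger0_norm ?powR_ge0//; have := h x; rewrite ger0_norm// indicE.
case: (x \in B); rewrite ?mulr1 ?mulr0 => fx.
  by apply: ge0_ler_powR; rewrite ?nnegrE// ltW.
by rewrite (le_anti (introT andP (conj fx (f0 x)))) powR0 ?gt_eqF.
Qed.

Lemma bsup_norm B f : bsup B f -> bsup B (fun x => `|f x|).
Proof.
move=> [mf [M M0 h]]; split; first exact: measurableT_comp.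
by exists M => // x; rewrite normr_id.
Qed.

Lemma bsup_sqr B f : bsup B f -> bsup B (fun x => f x ^+ 2).
Proof.
by move=> bf; have := bsupMM bf bf; rewrite (_ : (fun x => f x * f x) = fun x => f x ^+ 2).
Qed.

Lemma bsup0 B : bsup B (fun=> 0).
Proof.
by split => //; exists 0 => // x; rewrite normr0 mul0r.
Qed.

Lemma bsup_sum (I : finType) B (F : I -> T -> R) : (forall i, bsup B (F i)) ->
  bsup B (fun x => \sum_i F i x).
Proof.
move=> bF; suff h (s : seq I) : bsup B (fun x => \sum_(i <- s) F i x) by exact: h.
elim: s => [|i s IHs].
  by rewrite (_ : (fun x => _) = fun=> 0); [exact: bsup0|apply/funext => x; rewrite big_nil].
rewrite (_ : (fun x => _) = fun x => F i x + \sum_(j <- s) F j x); first exact: bsupD.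
by apply/funext => x; rewrite big_cons.
Qed.

Lemma bsup_indic B A : measurable A -> measurable B -> bsup B (fun x => \1_(A `&` B) x : R).
Proof.
move=> mA mB; split; first exact/measurable_indic/measurableI.
exists 1 => // x; rewrite mul1r ger0_norm// indicI /= ler_piMl//.
Qed.

End bounded_support.

(** * Slicing, Fubini's theorem and the Gagliardo-Nirenberg induction *)

Section fubini_rV.
Context (R : realType).

Local Notation l1 := (@lebesgue_measure R).
Local Notation leb n := (lebesgue_rV R n).
Local Notation cons := (@rV_cons R _).

Definition ibox (L : R) : set R := `[- L, L]%classic.
Definition box n (L : R) : set 'rV[R]_n := [set x | forall i, ibox L (x 0 i)].

Lemma measurable_ibox L : measurable (ibox L).
Proof. exact: measurable_itv. Qed.

Lemma ibox_lty L : (l1 (ibox L) < +oo)%E.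
Proof. by rewrite /ibox lebesgue_measure_itv/=; case: ifP => // _; rewrite -EFinB ltry. Qed.

Lemma measurable_rect n (A : 'I_n -> set R) : (forall i, measurable (A i)) ->
  measurable [set x : 'rV[R]_n | forall i, A i (x 0 i)].
Proof.
move=> mA; have -> : [set x : 'rV[R]_n | forall i, A i (x 0 i)] =
    \bigcap_(i in [set: 'I_n]) [set x : 'rV[R]_n | A i (x 0 i)].
  by apply/seteqP; split => x /= h i; [move=> _|]; exact: h.
apply: fin_bigcap_measurable => // i _.
by rewrite -[X in measurable X]setTI; exact: measurable_coord.
Qed.

Lemma measurable_box n L : measurable (@box n L).
Proof. by apply: (@measurable_rect n (fun=> ibox L)) => i; exact: measurable_ibox. Qed.

Lemma box_lty n L : (leb n (@box n L) < +oo)%E.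
Proof.
have -> : (leb n (@box n L) = \prod_(i < n) l1 (ibox L))%E.
  by apply: (@lebesgue_rV_box R n (fun=> ibox L)) => i; exact: measurable_ibox.
have fin : l1 (ibox L) \is a fin_num by rewrite ge0_fin_numE// ibox_lty.
by rewrite -ge0_fin_numE; [apply: prode_fin_num => i _|apply: prode_ge0 => i _].
Qed.

Lemma box_cons n L (t : R) (y : 'rV[R]_n) : box L (cons (t, y)) <-> ibox L t /\ box L y.
Proof.
split=> [h|[ht hy] i].
  split=> [|i]; first by have := h ord0; rewrite mxE unlift_none.
  by have := h (lift ord0 i); rewrite mxE liftK.
by rewrite mxE; case: unliftP => [j _|_]; [exact: hy|exact: ht].
Qed.

Lemma indic_box_cons n L (t : R) (y : 'rV[R]_n) :
  \1_(@box n.+1 L) (cons (t, y)) = \1_(ibox L) t * \1_(@box n L) y :> R.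
Proof.
rewrite !indicE -natrM mulnb; congr (nat_of_bool _)%:R.
apply/idP/andP => [|[]]; rewrite !inE; first by move=> /box_cons[].
by move=> h1 h2; apply/box_cons.
Qed.

Lemma ig_ibox L f : bsup (ibox L) f -> ig l1 f.
Proof. by move=> h; exact: (@ig_bsup _ _ _ l1 _ _ (measurable_ibox L) (ibox_lty L) h). Qed.

Lemma ig_box n L f : bsup (@box n L) f -> ig (leb n) f.
Proof. by move=> h; exact: (@ig_bsup _ _ _ (leb n) _ _ (@measurable_box n L) (@box_lty n L) h). Qed.

Lemma meas_consl n (f : 'rV[R]_n.+1 -> R) (t : R) : measurable_fun setT f ->
  measurable_fun setT (fun y => f (cons (t, y))).
Proof.
move=> mf; apply: (measurableT_comp mf); apply: (measurableT_comp (@measurable_rV_cons R n)).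
exact: measurable_pair1.
Qed.

Lemma meas_consr n (f : 'rV[R]_n.+1 -> R) y : measurable_fun setT f ->
  measurable_fun setT (fun t => f (cons (t, y))).
Proof.
move=> mf; apply: (measurableT_comp mf); apply: (measurableT_comp (@measurable_rV_cons R n)).
exact: measurable_pair2.
Qed.

Lemma bsup_consl n L (f : 'rV[R]_n.+1 -> R) (t : R) : bsup (box L) f ->
  bsup (box L) (fun y => f (cons (t, y))).
Proof.
move=> [mf [M M0 h]]; split; first exact: meas_consl.
exists M => // y; apply: le_trans (h _) _; rewrite indic_box_cons ler_wpM2l// ler_piMl//.
Qed.

Lemma bsup_consr n L (f : 'rV[R]_n.+1 -> R) y : bsup (box L) f ->
  bsup (ibox L) (fun t => f (cons (t, y))).
Proof.
move=> [mf [M M0 h]]; split; first exact: meas_consr.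
exists M => // t; apply: le_trans (h _) _; rewrite indic_box_cons ler_wpM2l// ler_piMr//.
Qed.

(** Fubini's theorem in both orders, through the product measure whose image under [rV_cons] is the
    measure on R^(n+1). The partial integrals are again in [bsup], so it can be iterated. *)
Lemma RI_cons n L (f : 'rV[R]_n.+1 -> R) : bsup (box L) f ->
  [/\ bsup (ibox L) (fun t => RI (leb n) (fun y => f (cons (t, y)))),
      bsup (@box n L) (fun y => RI l1 (fun t => f (cons (t, y)))),
      RI (leb n.+1) f = RI l1 (fun t => RI (leb n) (fun y => f (cons (t, y)))) &
      RI (leb n.+1) f = RI (leb n) (fun y => RI l1 (fun t => f (cons (t, y))))].
Proof.
move=> bf; have [mf [M M0 h]] := bf; pose F (p : R * 'rV[R]_n) := (f (cons p))%:E.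
have mc : measurable_fun [set: g_sigma_algebraType (R.-ocitv.-measurable) * 'rV[R]_n]
  (@rV_cons R n) := @measurable_rV_cons R n.
have mF : measurable_fun setT F by apply/measurable_EFinP; exact: measurableT_comp.
have il1 t : ig (leb n) (fun y => f (cons (t, y))) by exact: ig_box (bsup_consl t bf).
have il2 y : ig l1 (fun t => f (cons (t, y))) by exact: ig_ibox (bsup_consr y bf).
have iF : (l1 \x leb n)%E.-integrable setT F.
  have /integrableP[_ h'] := ig_box bf; apply/integrableP; split => //.
  apply: le_lt_trans h'; rewrite le_eqVlt; apply/orP; left; apply/eqP; apply/esym.
  have mEf : measurable_fun setT (fun x => `|(f x)%:E|%E).
    by apply: measurableT_comp => //; exact/measurable_EFinP.
  have e := (@ge0_integral_pushforward _ _ _ _ _ _ mc (l1 \x leb n)%E setT _ measurableT mEf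
    (fun x _ => abse_ge0 _)).
  exact e.
have e0 : (RI (leb n.+1) f)%:E = (\int[(l1 \x leb n)%E]_p F p)%E.
  rewrite RIE; last exact: ig_box bf.
  have mEf : measurable_fun setT (EFin \o f) by exact/measurable_EFinP.
  exact: (integral_pushforward mc mEf iF measurableT).
have ind2 : ig (leb n) (fun y => \1_(@box n L) y).
  apply: (@ig_box _ L); split; first exact: (measurable_indic (@measurable_box n L)).
  by exists 1 => // y; rewrite mul1r ger0_norm.
have ind1 : ig l1 (fun t => \1_(ibox L) t).
  apply: (@ig_ibox L); split; first exact: (measurable_indic (measurable_ibox L)).
  by exists 1 => // y; rewrite mul1r ger0_norm.
have b1 : bsup (ibox L) (fun t => RI (leb n) (fun y => f (cons (t, y)))).
  split.
    exact: (measurableT_comp (fine_measurable measurableT) (measurable_fubini_F iF)).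
  exists (M * RI (leb n) (fun y => \1_(@box n L) y)) => [|t].
    by rewrite mulr_ge0// RI_ge0.
  apply: le_trans (RI_norm (il1 t)) _.
  rewrite mulrAC -RIZ//; apply: RI_le; [exact: ig_norm|exact: igZ|].
  by move=> y; apply: le_trans (h _) _; rewrite indic_box_cons mulrA.
have b2 : bsup (@box n L) (fun y => RI l1 (fun t => f (cons (t, y)))).
  split.
    exact: (measurableT_comp (fine_measurable measurableT) (measurable_fubini_G iF)).
  exists (M * RI l1 (fun t => \1_(ibox L) t)) => [|y].
    by rewrite mulr_ge0// RI_ge0.
  apply: le_trans (RI_norm (il2 y)) _.
  rewrite mulrAC -RIZ//; apply: RI_le; [exact: ig_norm|exact: igZ|].
  by move=> t; apply: le_trans (h _) _; rewrite indic_box_cons mulrA mulrAC.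
split => //; apply: EFin_inj; rewrite e0 RIE; [|exact: ig_ibox b1| |exact: ig_box b2].
- rewrite -integral12_prod_meas1//; apply: eq_integral => t _.
  by rewrite RIE.
- rewrite -integral21_prod_meas1//; apply: eq_integral => y _.
  by rewrite RIE.
Qed.

Lemma RI_cons_le n L (f : 'rV[R]_n.+1 -> R) (F : R -> R) : bsup (box L) f -> bsup (ibox L) F ->
  (forall t, RI (leb n) (fun y => f (cons (t, y))) <= F t) -> RI (leb n.+1) f <= RI l1 F.
Proof.
move=> bf bF le; have [b1 _ -> _] := RI_cons bf.
by apply: RI_le => //; [exact: ig_ibox b1|exact: ig_ibox bF].
Qed.

Lemma RI_rV0 (f : 'rV[R]_0 -> R) : RI (leb 0) f = f 0.
Proof.
have -> : f = cst (f 0) by apply/funext => x; congr f; apply/rowP => -[].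
by rewrite RI_def /Rintegral (eq_integral (cst (f 0)%:E))// integral_cst//= indicE in_setT mulr1.
Qed.

(* Along every line parallel to the i-th axis, the variation of phi is bounded by
   the integral of G i. *)
Fixpoint LW n : ('rV[R]_n -> R) -> ('I_n -> 'rV[R]_n -> R) -> Prop :=
  if n is n'.+1 then fun phi G =>
    (forall y s t, s <= t -> `|phi (cons (t, y)) - phi (cons (s, y))| <=
       RI l1 (fun r => \1_(`[s, t]%classic) r * G ord0 (cons (r, y)))) /\
    (forall t, LW (fun y => phi (cons (t, y))) (fun i y => G (lift ord0 i) (cons (t, y))))
  else fun _ _ => True.

Lemma bsup_itvM L (s t : R) (f : R -> R) : bsup (ibox L) f ->
  bsup (ibox L) (fun r => \1_(`[s, t]%classic) r * f r).
Proof.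
move=> bf; have -> : (fun r => \1_(`[s, t]%classic) r * f r) = fun r => f r * \1_(`[s, t]%classic) r.
  by apply/funext => r; rewrite mulrC.
apply: (bsupM (K := 1)) => // r.
by rewrite indicE; case: (_ \in _); rewrite ?normr1 ?normr0.
Qed.

(* Starting from -L - 1, where phi vanishes. *)
Lemma LW_le n L (phi : 'rV[R]_n.+1 -> R) G y t : bsup (box L) phi ->
  (forall i, bsup (box L) (G i)) -> (forall i x, 0 <= G i x) -> LW phi G ->
  `|phi (cons (t, y))| <= RI l1 (fun r => G ord0 (cons (r, y))).
Proof.
move=> bphi bG G0 [lw _]; have bG0 := bsup_consr y (bG ord0).
have I0 : 0 <= RI l1 (fun r => G ord0 (cons (r, y))) by apply: RI_ge0.
have out r : ~ ibox L r -> phi (cons (r, y)) = 0.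
  by move=> Lr; apply: (bsup_out bphi) => /box_cons[].
have [lt|tl] := leP (- L - 1) t; last first.
  by rewrite out ?normr0// /ibox/= in_itv/= => /andP[+ _]; lra.
have := lw y _ _ lt; rewrite (out (- L - 1)) ?subr0; last first.
  by rewrite /ibox/= in_itv/= => /andP[+ _]; lra.
move=> /le_trans; apply; apply: RI_le; [exact: ig_ibox (bsup_itvM _ _ bG0)|exact: ig_ibox bG0|].
by move=> r; rewrite ler_piMl// indicE; case: (_ \in _).
Qed.

Local Notation sumRI n G := (\sum_(i < n) RI (leb n) (G i)).

Lemma sumRI_cons n L (G : 'I_n.+1 -> 'rV[R]_n.+1 -> R) : (forall i, bsup (box L) (G i)) ->
  bsup (ibox L) (fun t => \sum_(i < n) RI (leb n) (fun y => G (lift ord0 i) (cons (t, y)))) /\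
  sumRI n.+1 G = RI (leb n) (fun y => RI l1 (fun t => G ord0 (cons (t, y)))) +
    RI l1 (fun t => \sum_(i < n) RI (leb n) (fun y => G (lift ord0 i) (cons (t, y)))).
Proof.
move=> bG; split; first by apply: bsup_sum => i; have [] := RI_cons (bG (lift ord0 i)).
rewrite big_ord_recl; have [_ _ _ ->] := RI_cons (bG ord0); congr (_ + _).
rewrite RI_sum; last by move=> i; have [b _ _ _] := RI_cons (bG (lift ord0 i)); exact: ig_ibox b.
by apply: eq_bigr => i _; have [_ _ -> _] := RI_cons (bG (lift ord0 i)).
Qed.

(** In dimension N = n + 2 this is N / (N - 1), the critical exponent for integrable gradients; in
    dimension N = n + 1 it is 1 + 1 / N. *)
Definition gn_exp (n : nat) : R := n.+2%:R / n.+1%:R.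

Lemma gn_exp_gt0 n : 0 < gn_exp n. Proof. by rewrite divr_gt0. Qed.

(* The first inequality in dimension n is what the induction needs to obtain the
   second one in dimension n + 1, by slicing. *)
Lemma gagliardo_nirenberg n L (phi : 'rV[R]_n.+1 -> R) G : 0 <= L ->
  bsup (box L) phi -> (forall x, 0 <= phi x) ->
  (forall i, bsup (box L) (G i)) -> (forall i x, 0 <= G i x) -> LW phi G ->
  RI (leb n.+1) (fun x => phi x `^ gn_exp n) <=
    RI (leb n.+1) phi `^ (n.+1%:R^-1) * sumRI n.+1 G /\
  (if n is m.+1 then RI (leb n.+1) (fun x => phi x `^ gn_exp m) <= sumRI n.+1 G `^ gn_exp m
   else True).
Proof.
move=> L0; elim: n phi G => [|n IHn] phi G bphi phi0 bG G0 lw.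
  split=> //; rewrite invr1 powRr1; last exact: RI_ge0.
  have -> : gn_exp 0 = 2 by rewrite /gn_exp divr1.
  rewrite big_ord1 mulrC -RIZ; last exact: ig_box bphi.
  have [_ _ _ ->] := RI_cons (bG ord0).
  have b2 : bsup (box L) (fun x => phi x `^ 2) by exact: bsup_powR.
  apply: RI_le; [exact: ig_box b2|by apply: igZ; exact: ig_box bphi|].
  move=> x; rewrite powR_mulrn// expr2 ler_wpM2r//.
  rewrite -[x]rV_unconsK; case: (rV_uncons x) => t y.
  have y0 : y = 0 by apply/rowP => -[].
  have := LW_le y t bphi bG G0 lw; rewrite ger0_norm// => /le_trans; apply.
  by rewrite RI_rV0 y0.
pose Gam0 := RI (leb n.+1) (fun y => RI l1 (fun t => G ord0 (cons (t, y)))).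
have Gam00 : 0 <= Gam0 by apply: RI_ge0 => y; exact: RI_ge0.
pose b t := \sum_(i < n.+1) RI (leb n.+1) (fun y => G (lift ord0 i) (cons (t, y))).
have [bb sE] := sumRI_cons bG.
have b0 t : 0 <= b t by apply: sumr_ge0 => i _; exact: RI_ge0.
have Gam'0 : 0 <= RI l1 b by apply: RI_ge0.
have S0 : 0 <= sumRI n.+2 G by apply: sumr_ge0 => i _; exact: RI_ge0.
have e0 := gn_exp_gt0 n.
(* The integral of phi over any slice is at most [Gam0], because phi at a point is bounded by the
   integral of [G ord0] along the line through it. *)
have slice t : RI (leb n.+1) (fun y => phi (cons (t, y)) `^ gn_exp n) <=
    Gam0 `^ (n.+1%:R^-1) * b t.
  have [_ lwt] := lw.
  have [le _] := IHn _ _ (bsup_consl t bphi) (fun y => phi0 _)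
    (fun i => bsup_consl t (bG (lift ord0 i))) (fun i y => G0 _ _) (lwt t).
  apply: le_trans le _; rewrite -/(b t); apply: ler_wpM2r; first exact: b0.
  apply: ge0_ler_powR; rewrite ?nnegrE ?RI_ge0 ?invr_ge0//.
    by move=> y; exact: RI_ge0.
  apply: RI_le; [exact: ig_box (bsup_consl t bphi)|by have [_ b1 _ _] := RI_cons (bG ord0); exact: ig_box b1|].
  by move=> y; have := LW_le y t bphi bG G0 lw; rewrite ger0_norm.
(* Integrate over the slices: [Gam0] and the integral of [b] are both at most the full sum, and the
   exponents 1 / (n + 1) and 1 add up to [gn_exp n]. *)
have gn : RI (leb n.+2) (fun x => phi x `^ gn_exp n) <= sumRI n.+2 G `^ gn_exp n.
  have bp : bsup (box L) (fun x => phi x `^ gn_exp n) by exact: bsup_powR.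
  have := RI_cons_le bp (bsupZ _ bb) slice; rewrite RIZ; last exact: ig_ibox bb.
  rewrite -/b => /le_trans; apply; rewrite sE -/b -/Gam0.
  have -> : gn_exp n = n.+1%:R^-1 + 1 by rewrite /gn_exp -natr1; field.
  have [/eqP z|ne] := eqVneq (Gam0 + RI l1 b) 0.
    move: z; rewrite paddr_eq0// => /andP[_ /eqP ->].
    by rewrite mulr0 powR_ge0.
  rewrite powRD ?ne ?implybT// powRr1 ?addr_ge0//.
  apply: ler_pM; rewrite ?powR_ge0// ?lerDr//.
  by apply: ge0_ler_powR; rewrite ?nnegrE ?addr_ge0 ?lerDl ?invr_ge0.
split => //.
(* Interpolation between the exponents 1 and [gn_exp n]: th + gn_exp n (1 - th) = gn_exp (n + 1),
   and gn_exp n (1 - th) = 1. *)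
pose th : R := n.+2%:R^-1.
have th01 : 0 < th < 1 by rewrite invr_gt0 ltr0n/= invf_lt1// ltr1n.
have bp : bsup (box L) (fun x => phi x `^ gn_exp n) by exact: bsup_powR.
have [_ le] := RI_interp th01 phi0 (fun x => powR_ge0 _ _) (ig_box bphi) (ig_box bp).
have e : th + gn_exp n * (1 - th) = gn_exp n.+1.
  by rewrite /th /gn_exp -!natr1; field; rewrite !natr1 !pnatr_eq0.
have -> : RI (leb n.+2) (fun x => phi x `^ gn_exp n.+1) =
    RI (leb n.+2) (fun x => phi x `^ th * (phi x `^ gn_exp n) `^ (1 - th)).
  apply: RI_eq => x; rewrite -powRrM -e.
  have [->|ne] := eqVneq (phi x) 0.
    have /andP[t0 _] := th01.
    rewrite e powR0 ?gt_eqF ?gn_exp_gt0// powR0 ?gt_eqF// mul0r//.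
  by rewrite powRD// ne implybT.
apply: le_trans le _; rewrite ler_wpM2l ?powR_ge0//.
have -> : sumRI n.+2 G = (sumRI n.+2 G `^ gn_exp n) `^ (1 - th).
  rewrite -powRrM (_ : gn_exp n * (1 - th) = 1) ?powRr1//.
  by rewrite /th /gn_exp -!natr1; field; rewrite !natr1 !pnatr_eq0.
apply: ge0_ler_powR; rewrite ?nnegrE ?powR_ge0 ?RI_ge0 ?subr_ge0//.
  by have /andP[_ /ltW] := th01.
by move=> x; exact: powR_ge0.
Qed.

End fubini_rV.

(** * Rellich inequality on a box *)

Section lines.
Context (R : realType).

Local Notation l1 := (@lebesgue_measure R).
Local Notation leb n := (lebesgue_rV R n).
Local Notation cons := (@rV_cons R _).

Lemma cons_line0 n (t : R) (y : 'rV[R]_n) : cons (t, y) = cons (0, y) + t *: e_ ord0.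
Proof.
apply/rowP => i; rewrite !mxE eqxx /=; case: unliftP => [j ->|->] /=.
  by rewrite mulr0 addr0.
by rewrite ?eqxx mulr1 add0r.
Qed.

Lemma cons_lineS n (r t : R) (y : 'rV[R]_n) j :
  cons (t, y + r *: e_ j) = cons (t, y) + r *: e_ (lift ord0 j).
Proof.
apply/rowP => i; rewrite !mxE eqxx /=; case: unliftP => [k ->|->] /=.
  by rewrite !mxE eqxx /= (inj_eq lift_inj).
by rewrite mulr0 addr0.
Qed.

Lemma LW_of_lines n (phi : 'rV[R]_n -> R) G :
  (forall i x s t, s <= t -> `|phi (x + t *: e_ i) - phi (x + s *: e_ i)| <=
     RI l1 (fun r => \1_(`[s, t]%classic) r * G i (x + r *: e_ i))) -> LW phi G.
Proof.
elim: n phi G => //= n IHn phi G h; split=> [y s t st|t].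
  have := h ord0 (cons (0, y)) s t st; rewrite -!cons_line0 => /le_trans; apply.
  rewrite le_eqVlt; apply/orP; left; apply/eqP; apply: RI_eq => r.
  by rewrite -cons_line0.
apply: IHn => i x s r sr; rewrite !cons_lineS; apply: le_trans (h _ _ _ _ sr) _.
rewrite le_eqVlt; apply/orP; left; apply/eqP; apply: RI_eq => v.
by rewrite cons_lineS.
Qed.

Lemma RI_zero_lines n L (f : 'rV[R]_n -> R) i : bsup (box L) f ->
  (forall x, RI l1 (fun r => f (x + r *: e_ i)) = 0) -> RI (leb n) f = 0.
Proof.
elim: n f i => [|n IHn] f i bf h; first by case: i h.
have [_ _ e1 e2] := RI_cons bf; case: (unliftP ord0 i) h => [j ->|->] h.
  rewrite e1 (RI_eq _ (g := fun=> 0)) ?RI0// => t.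
  apply: (IHn _ j) (bsup_consl t bf) _ => x; rewrite -(h (cons (t, x))).
  by apply: RI_eq => r; rewrite cons_lineS.
rewrite e2 (RI_eq _ (g := fun=> 0)) ?RI0// => y; rewrite -(h (cons (0, y))).
by apply: RI_eq => r; rewrite -cons_line0.
Qed.

Section partition.
Variables (a de : R) (m : nat).
Hypothesis de0 : 0 < de.

Let node (l : nat) := a + l%:R * de.
Let cell (l : nat) : set R := `[node l, node l.+1[%classic.

Let nodeS l : node l.+1 = node l + de.
Proof. by rewrite /node -natr1 mulrDl mul1r addrA. Qed.

Let cellE l t : \1_(cell l) t = ((node l <= t)%R)%:R - ((node l.+1 <= t)%R)%:R :> R.
Proof.
rewrite indicE (_ : (t \in cell l) = (node l <= t) && (t < node l.+1)).
  have [h1|h1] := leP (node l) t; have [h2|h2] := leP (node l.+1) t => /=; rewrite ?subrr ?subr0//.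
  by exfalso; move: h2; rewrite nodeS; have := de0; lra.
by apply/idP/idP; rewrite inE /cell/= in_itv.
Qed.

Lemma sum_cells t : \sum_(l < m) \1_(cell l) t = ((a <= t)%R)%:R - ((a + m%:R * de <= t)%R)%:R :> R.
Proof.
under eq_bigr do rewrite cellE.
have := @telescope_sumr R 0 m (fun l => - ((node l <= t)%R)%:R) (leq0n m).
rewrite big_mkord /node mul0r addr0 opprK addrC => <-.
by apply: eq_bigr => l _; rewrite opprK addrC.
Qed.

(** Within the cell, f differs from its mean by at most the integral of g over the cell, whose
    square is at most de times the integral of g^2 by the Cauchy-Schwarz inequality. *)
Lemma poincare_cell (l : nat) L (f g : R -> R) : bsup (ibox L) f -> bsup (ibox L) g ->
  (forall t, 0 <= g t) ->
  (forall s t, s <= t -> `|f t - f s| <= RI l1 (fun r => \1_(`[s, t]%classic) r * g r)) ->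
  RI l1 (fun t => \1_(cell l) t * f t ^+ 2) <=
  2 / de * RI l1 (fun t => \1_(cell l) t * f t) ^+ 2 +
  2 * de ^+ 2 * RI l1 (fun t => \1_(cell l) t * g t ^+ 2).
Proof.
move=> bf bg g0 lip.
have mc : measurable (cell l) by exact: measurable_itv.
pose c (t : R) : R := \1_(cell l) t.
have c01 t : c t = 0 \/ c t = 1 by rewrite /c indicE; case: (_ \in _); [right|left].
have c0 t : 0 <= c t by case: (c01 t) => ->.
have c1 t : c t <= 1 by case: (c01 t) => ->; rewrite ?ler01.
have cc t : c t * c t = c t by case: (c01 t) => ->; rewrite ?mulr0 ?mulr1.
have bM h : bsup (ibox L) h -> bsup (ibox L) (fun t => c t * h t).
  move=> bh; have cl t : `|c t| <= 1 by rewrite ger0_norm.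
  have := bsupM bh (measurable_indic mc : measurable_fun setT c) cl.
  by rewrite (_ : (fun x => h x * c x) = fun t => c t * h t)//; apply/funext => t; rewrite mulrC.
have lc : l1 (cell l) = de%:E.
  have := @lebesgue_measure_itv R `[node l, node l.+1[; rewrite /= lte_fin nodeS ltrDl de0.
  by rewrite -EFinD -nodeS (_ : node l.+1 - node l = de)// nodeS addrC addrA addNr add0r.
have ic : ig l1 c.
  apply/integrableP; split; first by apply/measurable_EFinP; exact: measurable_indic.
  under eq_integral => x _ do rewrite /= ger0_norm//.
  rewrite /c integral_indic// setIT; suff : (l1 (cell l) < +oo)%E by [].
  by rewrite lc ltry.
have Ic : RI l1 c = de.
  by rewrite RI_def /Rintegral /c integral_indic// setIT; exact: (congr1 fine lc).
pose gm := RI l1 (fun t => c t * g t); have icg := ig_ibox (bM _ bg).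
have gm0 : 0 <= gm by apply: RI_ge0 => t; rewrite mulr_ge0.
have icf := ig_ibox (bM _ bf); have icf2 := ig_ibox (bM _ (bsup_sqr bf)).
have icg2 := ig_ibox (bM _ (bsup_sqr bg)).
have osc s t : cell l s -> cell l t -> `|f t - f s| <= gm.
  wlog st : s t / s <= t => [hw cs ct|cs ct].
    by have [/hw|/ltW/hw] := leP s t; [exact|rewrite distrC; exact].
  apply: le_trans (lip _ _ st) _.
  apply: RI_le => //; first exact: ig_ibox (bsup_itvM _ _ bg).
  move=> r; rewrite ler_wpM2r// /c !indicE ler_nat; have [rst|//] := boolP (r \in `[s, t]%classic).
  rewrite (_ : r \in cell l)//; move: rst; rewrite !inE /cell/= !in_itv/= => /andP[sr rt].
  move: cs ct; rewrite /cell/= !in_itv/= => /andP[cs _] /andP[_ ct].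
  by rewrite (le_trans cs sr) (le_lt_trans rt ct).
pose A := RI l1 (fun t => c t * f t).
have avg t : cell l t -> `|de * f t - A| <= de * gm.
  move=> ct; have -> : de * f t - A = RI l1 (fun s => c s * (f t - f s)).
    rewrite -Ic mulrC -RIZ// -RIB//; last exact: igZ.
    by apply: RI_eq => s; ring.
  have ii : ig l1 (fun s => c s * (f t - f s)).
    have := igB (igZ (f t) ic) icf; apply: ig_eq => s; ring.
  apply: le_trans (RI_norm ii) _; rewrite -Ic mulrC -RIZ//; apply: RI_le; [exact: ig_norm|exact: igZ|].
  move=> s; rewrite normrM ger0_norm// mulrC; have [cs|cs] := boolP (s \in cell l).
    by rewrite ler_wpM2r// osc//; rewrite inE in cs.
  by rewrite /c indicE (negbTE cs) !mulr0.
have pt t : c t * f t ^+ 2 <= c t * (2 * (A / de) ^+ 2 + 2 * gm ^+ 2).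
  have [ct|ct] := boolP (t \in cell l); last by rewrite /c indicE (negbTE ct) !mul0r.
  rewrite ler_wpM2l//; rewrite inE in ct; have := avg _ ct.
  rewrite -ler_pdivrMl// -{1}(gtr0_norm de0) -normfV -normrM.
  rewrite (_ : de^-1 * (de * f t - A) = f t - A / de); last by field; rewrite gt_eqF.
  move=> h; have : (f t - A / de) ^+ 2 <= gm ^+ 2.
    by rewrite -(real_normK (num_real _)) ler_sqr ?nnegrE.
  by have := sqr_ge0 (f t - A / de - A / de); rewrite !expr2; lra.
have CS : gm ^+ 2 <= de * RI l1 (fun t => c t * g t ^+ 2).
  have := @RI_CS _ _ _ l1 c (fun t => c t * g t).
  have e1 : RI l1 (fun x => c x ^+ 2) = de by rewrite -Ic; apply: RI_eq => t; rewrite expr2 cc.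
  have e2 : RI l1 (fun x => (c x * g x) ^+ 2) = RI l1 (fun x => c x * g x ^+ 2).
    by apply: RI_eq => t; rewrite exprMn [c t ^+ 2]expr2 cc.
  have e3 : RI l1 (fun x => c x * (c x * g x)) = gm by apply: RI_eq => t; rewrite mulrA cc.
  rewrite e1 e2 e3; apply.
    split; first exact: measurable_indic.
    by apply: ig_eq ic => t; rewrite expr2 cc.
  split; first exact: bsup_meas (bM _ bg).
  by apply: ig_eq icg2 => t; rewrite exprMn [c t ^+ 2]expr2 cc.
apply: (@le_trans _ _ (RI l1 (fun t => (2 * (A / de) ^+ 2 + 2 * gm ^+ 2) * c t))).
  by apply: RI_le => //; [exact: igZ|move=> t; rewrite mulrC [leRHS]mulrC mulrC; exact: pt].
rewrite RIZ// Ic -/A.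
have -> : (2 * (A / de) ^+ 2 + 2 * gm ^+ 2) * de = 2 / de * A ^+ 2 + 2 * de * gm ^+ 2.
  by field; rewrite gt_eqF.
rewrite lerD2l (_ : 2 * de ^+ 2 * _ = 2 * de * (de * RI l1 (fun t => c t * g t ^+ 2))); last by rewrite expr2 !mulrA.
by rewrite ler_pM2l// mulr_gt0.
Qed.

End partition.

Definition tensor n (F : R -> R) (E : 'rV[R]_n -> R) (x : 'rV[R]_n.+1) :=
  F (rV_uncons x).1 * E (rV_uncons x).2.

Lemma tensorE n F (E : 'rV[R]_n -> R) t y : tensor F E (cons (t, y)) = F t * E y.
Proof. by rewrite /tensor rV_consK. Qed.

Lemma bsup_tensor n L (F : R -> R) (E : 'rV[R]_n -> R) : bsup (ibox L) F ->
  bsup (box L) E -> bsup (box L) (tensor F E).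
Proof.
move=> [mF [M M0 hF]] [mE [K K0 hE]]; split.
  have mu := @measurable_rV_uncons R n.
  apply: measurable_funM.
    by apply: (measurableT_comp mF); apply: (measurableT_comp measurable_fst mu).
  by apply: (measurableT_comp mE); apply: (measurableT_comp measurable_snd mu).
exists (M * K) => [|x]; first exact: mulr_ge0.
rewrite -(rV_unconsK x); case: (rV_uncons x) => t y.
rewrite tensorE indic_box_cons normrM mulrACA; exact: ler_pM.
Qed.

(** Cut the interval into cells so short that 2 de^2 <= e and sum the inequalities of
    [poincare_cell]; the linear forms are the integrals over the cells. *)
Lemma rellich_line L (e : R) : 0 <= L -> 0 < e ->
  exists (m : nat) (E : 'I_m -> R -> R) (C : R),
  [/\ 0 <= C, forall k, bsup (ibox L) (E k) & forall f g, bsup (ibox L) f -> bsup (ibox L) g ->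
    (forall t, 0 <= g t) ->
    (forall s t, s <= t -> `|f t - f s| <= RI l1 (fun r => \1_(`[s, t]%classic) r * g r)) ->
    RI l1 (fun t => f t ^+ 2) <= e * RI l1 (fun t => g t ^+ 2) +
      C * \sum_k RI l1 (fun t => f t * E k t) ^+ 2].
Proof.
(* More than the length of the interval, so that half-open cells also cover its right end. *)
move=> L0 e0; pose W := 2 * L + 1.
have W0 : 0 < W by rewrite /W; lra.
have [m0 Hm] : exists m0 : nat, 2 * W ^+ 2 / e + 1 < m0%:R.
  by exists (Num.bound (2 * W ^+ 2 / e + 1)); apply: archi_boundP; rewrite addr_ge0// divr_ge0 ?mulr_ge0 ?sqr_ge0 ?ltW.
have q0 : 0 <= 2 * W ^+ 2 / e by rewrite divr_ge0 ?mulr_ge0 ?sqr_ge0 ?ltW.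
have m0gt : 1 < m0%:R :> R by lra.
have m00 : 0 < m0%:R :> R by lra.
pose de := W / m0%:R; have de0 : 0 < de by rewrite divr_gt0.
have de2 : 2 * de ^+ 2 <= e.
  have h1 : 2 * W ^+ 2 / e <= m0%:R ^+ 2.
    have : m0%:R * 1 <= m0%:R * m0%:R :> R by rewrite ler_pM2l// ltW.
    by rewrite -expr2; lra.
  rewrite /de expr_div_n mulrA ler_pdivrMr ?exprn_gt0//.
  by move: h1; rewrite ler_pdivrMr// [e * _]mulrC.
pose cell (l : nat) : set R := `[- L + l%:R * de, - L + l.+1%:R * de[%classic.
exists m0, (fun k t => \1_(cell k `&` ibox L) t), (2 / de); split.
- by rewrite divr_ge0// ltW.
- by move=> k; apply: bsup_indic; [exact: measurable_itv|exact: measurable_ibox].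
move=> f g bf bg g0 lip.
have ind_le (A : set R) t : \1_A t <= 1 :> R by rewrite indicE; case: (_ \in _).
have bM (A : set R) (h : R -> R) : measurable A -> bsup (ibox L) h -> bsup (ibox L) (fun t => \1_A t * h t).
  move=> mA bh; have cl t : `|\1_A t : R| <= 1 by rewrite ger0_norm.
  have := bsupM bh (measurable_indic mA) cl.
  by rewrite (_ : (fun x => h x * \1_A x) = fun t => \1_A t * h t)//; apply/funext => t; rewrite mulrC.
have mc (l : nat) : measurable (cell l) by exact: measurable_itv.
have eE (k : 'I_m0) : RI l1 (fun t => \1_(cell k) t * f t) =
    RI l1 (fun t => f t * \1_(cell k `&` ibox L) t).
  apply: RI_eq => t; rewrite indicI /=; have [Lt|Lt] := pselect (ibox L t).
    by rewrite [\1_(ibox L) t]indicE mem_set// mulr1 mulrC.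
  by rewrite (bsup_out bf Lt) mulr0 mul0r.
have sumE t : f t ^+ 2 = \sum_(k < m0) \1_(cell k) t * f t ^+ 2.
  rewrite -mulr_suml (sum_cells (- L) m0 de0 t).
  have [Lt|Lt] := pselect (ibox L t); last by rewrite (bsup_out bf Lt) expr0n/= mulr0.
  move: Lt; rewrite /ibox/= in_itv/= => /andP[lo hi]; rewrite lo.
  rewrite (_ : m0%:R * de = W); last by rewrite /de mulrC divfK// gt_eqF.
  by rewrite (_ : (- L + W <= t) = false) ?subr0 ?mul1r//; apply/negbTE; rewrite -ltNge /W; lra.
rewrite (RI_eq l1 sumE) RI_sum; last by move=> k; apply: ig_ibox (bM _ _ (mc k) (bsup_sqr bf)).
have gsum : \sum_(k < m0) RI l1 (fun t => \1_(cell k) t * g t ^+ 2) <= RI l1 (fun t => g t ^+ 2).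
  have ik (k : 'I_m0) := ig_ibox (bM _ _ (mc k) (bsup_sqr bg)).
  rewrite -RI_sum//; apply: RI_le; [exact: ig_sum|exact: ig_ibox (bsup_sqr bg)|].
  move=> t; rewrite -mulr_suml (sum_cells (- L) m0 de0 t) ler_piMl ?sqr_ge0//.
  exact: le_trans (ler_norm _) (ind_diff_le1 _ _ _).
apply: (@le_trans _ _ (\sum_(k < m0) (2 / de * RI l1 (fun t => f t * \1_(cell k `&` ibox L) t) ^+ 2 +
    2 * de ^+ 2 * RI l1 (fun t => \1_(cell k) t * g t ^+ 2)))).
  by apply: ler_sum => k _; rewrite -eE; exact: (poincare_cell (- L) de0 k bf bg g0 lip).
rewrite big_split/= -!mulr_sumr addrC lerD2r.
apply: (@le_trans _ _ (2 * de ^+ 2 * RI l1 (fun t => g t ^+ 2))).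
  by rewrite ler_wpM2l// mulr_ge0 ?sqr_ge0.
by rewrite ler_wpM2r// RI_ge0// => t; exact: sqr_ge0.
Qed.

Lemma L2_box n L (f : 'rV[R]_n -> R) : bsup (box L) f -> L2 (leb n) f.
Proof. by move=> bf; split; [exact: bsup_meas bf|exact: ig_box (bsup_sqr bf)]. Qed.

(* One coordinate at a time: along a line, the function is close to its mean on
   each cell of a fine partition, and the means are functions of one variable less. *)
Lemma rellich_box n L (e : R) : 0 <= L -> 0 < e ->
  exists (I : finType) (E : I -> 'rV[R]_n -> R) (C : R),
  [/\ 0 <= C, forall k, bsup (box L) (E k) & forall phi G, bsup (box L) phi ->
    (forall i, bsup (box L) (G i)) -> (forall i x, 0 <= G i x) -> LW phi G ->
    RI (leb n) (fun x => phi x ^+ 2) <= e * \sum_i RI (leb n) (fun x => G i x ^+ 2) +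
      C * \sum_k RI (leb n) (fun x => phi x * E k x) ^+ 2].
Proof.
move=> L0; elim: n e => [|n IHn] e e0.
  exists unit, (fun _ _ => 1), 1; split => // [_|phi G _ _ _ _].
    split => //; exists 1 => // x; rewrite normr1 mul1r indicE mem_set// => -[].
    by move=> [].
  rewrite big_ord0 mulr0 add0r mul1r (big_pred1 tt); last by case.
  by rewrite !RI_rV0 mulr1.
have e20 : 0 < e / 2 by rewrite divr_gt0.
have [I [E [C [C0 bE HE]]]] := IHn _ e20.
pose B := \sum_k RI (leb n) (fun y => E k y ^+ 2).
have B0 : 0 <= B by apply: sumr_ge0 => k _; exact: RI_sqr_ge0.
(* The error of the one-dimensional inequality will be multiplied by C B, which leaves at most e /
   2. *)
have e10 : 0 < e / (2 * (C * B + 1)) by rewrite divr_gt0// mulr_gt0// ltr_wpDl// mulr_ge0.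
have [m [F [C1 [C10 bF HF]]]] := rellich_line L0 e10.
exists (I * 'I_m)%type, (fun p => tensor (F p.2) (E p.1)), (C * C1); split.
- exact: mulr_ge0.
- by move=> p; exact: bsup_tensor.
move=> phi G bphi bG G0 [lw0 lw].
(* The linear forms of the slices as functions of the first coordinate; [g k] bounds the variation
   of [c k], so that the inequality on a line applies to them. *)
pose c k t := RI (leb n) (fun y => phi (cons (t, y)) * E k y).
pose g k t := RI (leb n) (fun y => G ord0 (cons (t, y)) * `|E k y|).
have b1E (h : 'rV[R]_n.+1 -> R) k t : bsup (box L) h ->
   bsup (box L) (fun y => h (cons (t, y)) * E k y).
  by move=> bh; exact: bsupMM (bsup_consl t bh) (bE k).
have bTE (h : 'rV[R]_n.+1 -> R) (E' : 'rV[R]_n -> R) : bsup (box L) h -> bsup (box L) E' ->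
   bsup (box L) (fun x => h x * E' (rV_uncons x).2).
  move=> bh [mE' [K K0 hE']]; apply: (bsupM (K := K)) => //.
    by apply: (measurableT_comp mE'); apply: (measurableT_comp measurable_snd (@measurable_rV_uncons R n)).
  move=> x; apply: le_trans (hE' _) _; rewrite ler_piMr// indicE; by case: (_ \in _).
have cE h (E' : 'rV[R]_n -> R) : bsup (box L) h -> bsup (box L) E' ->
   bsup (ibox L) (fun t => RI (leb n) (fun y => h (cons (t, y)) * E' y)).
  move=> bh bE'; have [b _ _ _] := RI_cons (bTE _ _ bh bE').
  by move: b; under eq_fun do (under [X in RI _ X]eq_fun do rewrite rV_consK /=).
have bc k : bsup (ibox L) (c k) by exact: cE.
have bg k : bsup (ibox L) (g k) by apply: cE => //; exact: bsup_norm.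
have g0 k t : 0 <= g k t by apply: RI_ge0 => y; rewrite mulr_ge0.
(* The variation of phi along the first axis is integrated against |E k| and the order of
   integration exchanged. *)
have lip k s t : s <= t -> `|c k t - c k s| <= RI l1 (fun r => \1_(`[s, t]%classic) r * g k r).
  move=> st; rewrite /c -RIB; [|exact: ig_box (b1E _ _ _ bphi)|exact: ig_box (b1E _ _ _ bphi)].
  pose H := fun x : 'rV[R]_n.+1 => (\1_(`[s, t]%classic) (rV_uncons x).1 * G ord0 x) * `|E k (rV_uncons x).2|.
  have bH : bsup (box L) H.
    apply: (bTE (fun x => _) (fun y => `|E k y|)); last exact: bsup_norm.
    have cl (x : 'rV[R]_n.+1) : `|\1_(`[s, t]%classic) (rV_uncons x).1 : R| <= 1.
      by rewrite ger0_norm// indicE; case: (_ \in _).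
    have mi : measurable_fun setT (fun x : 'rV[R]_n.+1 => \1_(`[s, t]%classic) (rV_uncons x).1 : R).
      apply: (measurableT_comp (measurable_indic (measurable_itv _))).
      exact: (measurableT_comp measurable_fst (@measurable_rV_uncons R n)).
    have := bsupM (bG ord0) mi cl.
    by rewrite (_ : (fun x => G ord0 x * _) = fun x => \1_(`[s, t]%classic) (rV_uncons x).1 * G ord0 x)//; apply/funext => x; rewrite mulrC.
  have [_ b2 e1 e2] := RI_cons bH.
  have i0 : ig (leb n) (fun y => phi (cons (t, y)) * E k y - phi (cons (s, y)) * E k y).
    by apply: igB; exact: ig_box (b1E _ _ _ bphi).
  apply: le_trans (RI_norm i0) _.
  apply: (@le_trans _ _ (RI (leb n) (fun y => RI l1 (fun r => H (cons (r, y)))))).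
    apply: RI_le; [exact: ig_norm|exact: ig_box b2|] => y.
    rewrite -mulrBl normrM /H; under [X in _ <= RI _ X]eq_fun do rewrite rV_consK /= mulrC.
    rewrite RIZ; last exact: ig_ibox (bsup_itvM _ _ (bsup_consr y (bG ord0))).
    by rewrite mulrC ler_wpM2l//; exact: lw0.
  rewrite -e2 e1 le_eqVlt; apply/orP; left; apply/eqP; apply: RI_eq => r.
  rewrite /g -RIZ; first by apply: RI_eq => y; rewrite /H rV_consK /= mulrA.
  by apply: ig_box (bsupMM (bsup_consl r (bG ord0)) (bsup_norm (bE k))).
have cF k l : RI l1 (fun t => c k t * F l t) = RI (leb n.+1) (fun x => phi x * tensor (F l) (E k) x).
  have [_ _ -> _] := RI_cons (bsupMM bphi (bsup_tensor (bF l) (bE k))).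
  apply: RI_eq => t; rewrite /c mulrC -RIZ; last exact: ig_box (b1E _ _ _ bphi).
  by apply: RI_eq => y; rewrite tensorE; ring.
have g2 k : RI l1 (fun t => g k t ^+ 2) <=
    RI (leb n) (fun y => E k y ^+ 2) * RI (leb n.+1) (fun x => G ord0 x ^+ 2).
  have [b _ -> _] := RI_cons (bsup_sqr (bG ord0)); rewrite -RIZ; last exact: ig_ibox b.
  apply: RI_le; [exact: ig_ibox (bsup_sqr (bg k))|by apply: igZ; exact: ig_ibox b|] => t.
  have := RI_CS (L2_box (bsup_consl t (bG ord0))) (L2_box (bsup_norm (bE k))).
  rewrite -/(g k t) mulrC (RI_eq _ (g := fun y => E k y ^+ 2))// => y.
  by rewrite real_normK// num_real.
have step k : RI l1 (fun t => c k t ^+ 2) <= e / (2 * (C * B + 1)) *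
    (RI (leb n) (fun y => E k y ^+ 2) * RI (leb n.+1) (fun x => G ord0 x ^+ 2)) +
    C1 * \sum_l RI (leb n.+1) (fun x => phi x * tensor (F l) (E k) x) ^+ 2.
  apply: le_trans (HF _ _ (bc k) (bg k) (g0 k) (lip k)) _.
  under eq_bigr do rewrite cF.
  by rewrite lerD2r ler_pM2l.
have [_ sE] := sumRI_cons (fun i => bsup_sqr (bG i)).
have bS : bsup (ibox L) (fun t => \sum_i RI (leb n) (fun y => G (lift ord0 i) (cons (t, y)) ^+ 2)).
  by have [] := sumRI_cons (fun i => bsup_sqr (bG i)).
have ic2 k := ig_ibox (bsup_sqr (bc k)).
have slice : RI (leb n.+1) (fun x => phi x ^+ 2) <=
    e / 2 * RI l1 (fun t => \sum_i RI (leb n) (fun y => G (lift ord0 i) (cons (t, y)) ^+ 2)) +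
    C * \sum_k RI l1 (fun t => c k t ^+ 2).
  have bcs := bsup_sum (fun k => bsup_sqr (bc k)).
  rewrite -(RI_sum ic2) -!RIZ; [|exact: ig_ibox bcs|exact: ig_ibox bS].
  rewrite -RID; [|by apply: igZ; exact: ig_ibox bS|by apply: igZ; exact: ig_ibox bcs].
  apply: (RI_cons_le (bsup_sqr bphi)).
    by apply: bsupD; exact: bsupZ.
  move=> t; exact: HE (bsup_consl t bphi) (fun i => bsup_consl t (bG (lift ord0 i)))
    (fun i y => G0 _ _) (lw t).
apply: le_trans slice _.
set S' := RI l1 (fun t => \sum_i _) in sE *; set S0 := RI (leb n.+1) (fun x => G ord0 x ^+ 2) in g2 step.
have S00 : 0 <= S0 by exact: RI_sqr_ge0.
have S'0 : 0 <= S' by apply: RI_ge0 => t; apply: sumr_ge0 => i _; exact: RI_sqr_ge0.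
have S0E : RI (leb n) (fun y => RI l1 (fun t => G ord0 (cons (t, y)) ^+ 2)) = S0.
  by have [_ _ _] := RI_cons (bsup_sqr (bG ord0)).
rewrite sE S0E.
pose T := \sum_(p : I * 'I_m) RI (leb n.+1) (fun x => phi x * tensor (F p.2) (E p.1) x) ^+ 2.
have sumc : \sum_k RI l1 (fun t => c k t ^+ 2) <= e / (2 * (C * B + 1)) * (B * S0) + C1 * T.
  apply: le_trans (ler_sum _ (fun k _ => step k)) _.
  rewrite big_split/= -!mulr_sumr -mulr_suml -/B /T.
  by rewrite (pair_bigA _ (fun k l => RI (leb n.+1) (fun x => phi x * tensor (F l) (E k) x) ^+ 2)).
have h1 := ler_wpM2l C0 sumc.
have h2 : C * (e / (2 * (C * B + 1)) * (B * S0)) <= e / 2 * S0.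
  have CB : 0 <= C * B by exact: mulr_ge0.
  have -> : C * (e / (2 * (C * B + 1)) * (B * S0)) = (C * B / (C * B + 1)) * (e / 2 * S0).
    by field; rewrite gt_eqF// ltr_wpDl.
  have CB1 : 0 < C * B + 1 by rewrite ltr_wpDl.
  apply: ler_piMl; first by rewrite mulr_ge0 ?(ltW e20).
  by rewrite ler_pdivrMr// mul1r lerDl.
have h3 : 0 <= e / 2 * S' by rewrite mulr_ge0 ?(ltW e20).
have h4 : C * \sum_k RI l1 (fun t => c k t ^+ 2) <= e / 2 * S0 + C * C1 * T.
  by apply: le_trans h1 _; rewrite mulrDr -[C * C1 * T]mulrA lerD2r.
apply: (@le_trans _ _ (e / 2 * S' + (e / 2 * S0 + C * C1 * T))); first by rewrite lerD2l.
rewrite addrA; apply: lerD; last exact: lexx.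
by rewrite mulrDr addrC; apply: lerD; rewrite ler_wpM2r// ler_pdivrMr// ler_peMr ?(ltW e0)// ler1n.
Qed.

End lines.

(** * Sobolev inequality *)

Section sobolev_inequality.
Context (R : realType).
Local Notation leb n := (lebesgue_rV R n).

Lemma powR_half_sqr (x : R) : 0 <= x -> (x ^+ 2) `^ 2^-1 = x.
Proof. by move=> x0; rewrite -powR_mulrn// -powRrM mulfV ?powRr1. Qed.

(* Gagliardo-Nirenberg for a^gamma. *)
Lemma sobolev_box n L (r gamma : R) : 0 <= L -> 1 < gamma ->
  gamma * gn_exp R n = r -> 2 * (gamma - 1) < r ->
  exists2 C : R, 0 <= C & forall (a : 'rV[R]_n.+2 -> R) g, bsup (box L) a ->
    (forall x, 0 <= a x) ->
    (forall i, bsup (box L) (g i)) -> (forall i x, 0 <= g i x) ->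
    LW (fun x => a x `^ gamma) (fun i x => gamma * a x `^ (gamma - 1) * g i x) ->
    RI (leb n.+2) (fun x => a x `^ r) `^ (2 / r) <=
    C * \sum_i RI (leb n.+2) (fun x => g i x ^+ 2).
Proof.
move=> L0 g1 gr g2; have e0 := gn_exp_gt0 R n; set e := gn_exp R n in gr e0.
have gam0 : 0 < gamma by lra.
have r0 : 0 < r by rewrite -gr mulr_gt0.
(* The exponent for interpolating the integral of a^(2 (gamma - 1)) between the measure of the box
   and the integral of a^r. *)
pose th := 1 - 2 * (gamma - 1) / r.
have thE : 1 - th = 2 * (gamma - 1) / r by rewrite /th; lra.
have th01 : 0 < th < 1.
  have q1 : 2 * (gamma - 1) / r < 1 by rewrite ltr_pdivrMr// mul1r.
  have q0 : 0 < 2 * (gamma - 1) / r by rewrite divr_gt0//; lra.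
  by rewrite /th; apply/andP; split; lra.
have /andP[th0 th1] := th01.
pose K := RI (leb n.+2) (\1_(@box R n.+2 L)) `^ th.
have K0 : 0 <= K by exact: powR_ge0.
exists ((gamma * n.+2%:R) ^+ 2 * K) => [|a g ba a0 bg g0 lw].
  by rewrite mulr_ge0 ?sqr_ge0.
have bchi : bsup (@box R n.+2 L) (\1_(@box R n.+2 L) : _ -> R).
  split; first exact: measurable_indic (@measurable_box R n.+2 L).
  by exists 1 => // x; rewrite mul1r ger0_norm.
set I := RI (leb n.+2) (fun x => a x `^ r); set D := \sum_i _.
have I0 : 0 <= I by apply: RI_ge0 => x; exact: powR_ge0.
have D0 : 0 <= D by apply: sumr_ge0 => i _; exact: RI_sqr_ge0.
have [Iz|In] := eqVneq I 0.
  have r2 : 2 / r != 0 by rewrite gt_eqF// divr_gt0.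
  by rewrite Iz (powR0 r2); apply: (mulr_ge0 (mulr_ge0 (sqr_ge0 _) K0) D0).
have Ip : 0 < I by rewrite lt_def In.
have bar : bsup (@box R n.+2 L) (fun x => a x `^ r) by exact: bsup_powR.
have bag : bsup (@box R n.+2 L) (fun x => a x `^ (gamma - 1)) by apply: bsup_powR => //; lra.
pose P := RI (leb n.+2) (fun x => a x `^ (gamma - 1) ^+ 2).
have P0 : 0 <= P by exact: RI_sqr_ge0.
have PK : P <= K * I `^ (1 - th).
  have i0 (x : 'rV[R]_n.+2) : 0 <= \1_(box L) x :> R by [].
  have [_] := RI_interp th01 i0 (fun x => powR_ge0 (a x) r)
    (ig_box bchi) (ig_box bar).
  rewrite (RI_eq _ (g := fun x => a x `^ (gamma - 1) ^+ 2))// => x.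
  rewrite -powR_mulrn ?powR_ge0// -!powRrM thE (_ : r * _ = (gamma - 1) * 2); last by field; rewrite gt_eqF.
  rewrite indicE; case: (boolP (x \in box L)) => [_|xL]; first by rewrite powR1 mul1r.
  have -> : a x = 0 by apply: (bsup_out ba) => h; move/negP : xL; apply; rewrite inE.
  have p0 : 0 < (gamma - 1) * 2 by lra.
  by rewrite [0 `^ ((gamma - 1) * 2)]powR0 ?mulr0// gt_eqF.
have bG i : bsup (@box R n.+2 L) (fun x => gamma * a x `^ (gamma - 1) * g i x).
  by apply: bsupMM => //; exact: bsupZ.
have G0 i x : 0 <= gamma * a x `^ (gamma - 1) * g i x.
  by rewrite !mulr_ge0 ?powR_ge0 ?(ltW gam0).
have bag' : bsup (@box R n.+2 L) (fun x => a x `^ gamma) by exact: bsup_powR.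
have [_ gn] := gagliardo_nirenberg L0 bag' (fun x => powR_ge0 _ _) bG G0 lw.
have X i : RI (leb n.+2) (fun x => gamma * a x `^ (gamma - 1) * g i x) <= gamma * (P * D) `^ 2^-1.
  rewrite (RI_eq _ (g := fun x => gamma * (a x `^ (gamma - 1) * g i x))); last by move=> x; rewrite mulrA.
  rewrite RIZ; last exact: ig_box (bsupMM bag (bg i)).
  have A0 : 0 <= RI (leb n.+2) (fun x => a x `^ (gamma - 1) * g i x).
    by apply: RI_ge0 => x; rewrite mulr_ge0 ?powR_ge0.
  rewrite ler_pM2l// -(powR_half_sqr A0).
  apply: ge0_ler_powR; rewrite ?nnegrE ?sqr_ge0 ?(mulr_ge0 P0 D0)//.
  apply: le_trans (RI_CS (L2_box bag) (L2_box (bg i))) _.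
  rewrite ler_wpM2l// /D (bigD1 i)//= lerDl sumr_ge0// => j _; exact: RI_sqr_ge0.
have S : \sum_i RI (leb n.+2) (fun x => gamma * a x `^ (gamma - 1) * g i x) <=
    gamma * n.+2%:R * (P * D) `^ 2^-1.
  apply: le_trans (ler_sum _ (fun i _ => X i)) _.
  by rewrite sumr_const card_ord [gamma * n.+2%:R]mulrC -mulrA mulr_natl.
have Ie : I `^ (2 / e) <= (gamma * n.+2%:R) ^+ 2 * (P * D).
  have -> : I = RI (leb n.+2) (fun x => (a x `^ gamma) `^ e).
    by apply: RI_eq => x; rewrite -powRrM gr.
  apply: (@le_trans _ _ (((gamma * n.+2%:R * (P * D) `^ 2^-1) `^ e) `^ (2 / e))).
    apply: ge0_ler_powR; rewrite ?nnegrE ?powR_ge0 ?divr_ge0 ?(ltW e0)//.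
      by apply: RI_ge0 => x; exact: powR_ge0.
    apply: le_trans gn _; apply: ge0_ler_powR; rewrite ?nnegrE ?(ltW e0)//.
      by apply: sumr_ge0 => i _; apply: RI_ge0.
    by rewrite !mulr_ge0 ?powR_ge0 ?(ltW gam0).
  rewrite -powRrM (_ : e * _ = 2%:R); last by field; rewrite gt_eqF.
  have PD := mulr_ge0 P0 D0.
  have sq : (P * D) `^ 2^-1 ^+ 2 = P * D.
    by rewrite -powR_mulrn ?powR_ge0// -powRrM mulVf// powRr1.
  rewrite powR_mulrn; first by rewrite exprMn sq.
  by rewrite mulr_ge0 ?powR_ge0// mulr_ge0 ?(ltW gam0).
have Q : 0 < I `^ (1 - th) by exact: powR_gt0.
(* The factor I^(1 - th), positive here, is divided out of both sides; the exponent that remains is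
   2 / e - (1 - th) = 2 / r. *)
rewrite -(ler_pM2r Q) -powRD ?In ?implybT// thE.
rewrite (_ : 2 / r + 2 * (gamma - 1) / r = 2 / e); last first.
  by rewrite -gr; field; rewrite !gt_eqF.
apply: le_trans Ie _; rewrite -thE.
have -> : (gamma * n.+2%:R) ^+ 2 * K * D * I `^ (1 - th) =
  (gamma * n.+2%:R) ^+ 2 * (K * I `^ (1 - th) * D) by ring.
by apply: (ler_wpM2l (sqr_ge0 _)); exact: ler_wpM2r.
Qed.

End sobolev_inequality.

(** * Smooth functions *)

Section directional.
Context (R : realType) (N : nat).
Local Notation rV := 'rV[R]_N.
Implicit Types (f g phi : rV -> R) (x v : rV).

Lemma line_quotient f x v (t : R) :
  (fun h : R => h^-1 *: (((fun s : R => f (x + s *: v)) \o shift t) (h *: 1) - f (x + t *: v))) =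
  (fun h : R => h^-1 *: ((f \o shift (x + t *: v)) (h *: v) - f (x + t *: v))).
Proof.
apply/funext => h; congr (_ *: (_ - _)); rewrite /= /shift /=; congr f.
by rewrite [h *: 1]mulr1 scalerDl addrCA.
Qed.

Lemma is_derive_line f x v (t : R) : derivable f (x + t *: v) v ->
  is_derive t 1 (fun s : R => f (x + s *: v)) ('D_v f (x + t *: v)).
Proof.
by move=> df; split; rewrite /derivable /derive line_quotient.
Qed.

Lemma line_is_derive f x v (l : R) : is_derive (0 : R) 1 (fun s : R => f (x + s *: v)) l ->
  derivable f x v /\ 'D_v f x = l.
Proof.
move=> [d e]; have := line_quotient f x v 0; rewrite scale0r addr0 => q.
by move: d e; rewrite /derivable /derive scale0r addr0 q.
Qed.

(** Restriction to a line reduces this to one variable, so [f] only needs a derivative in the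
    direction [v]. *)
Lemma derive_comp1 (F : R -> R) (l : R) f x v : derivable f x v -> is_derive (f x) 1 F l ->
  derivable (fun y => F (f y)) x v /\ 'D_v (fun y => F (f y)) x = l * 'D_v f x.
Proof.
move=> df dF; apply: line_is_derive.
have df0 : derivable f (x + 0 *: v) v by rewrite scale0r addr0.
have d1 := is_derive_line df0.
have dF0 : is_derive (f (x + (0 : R) *: v)) 1 F l by rewrite scale0r addr0.
have := @is_derive1_comp R F (fun s : R => f (x + s *: v)) 0 _ _ dF0 d1.
by rewrite scale0r addr0.
Qed.

Lemma is_derive_continuous (F : R -> R) (l : R -> R) : (forall s : R, is_derive s 1 F (l s)) -> continuous F.
Proof.
move=> dF s; apply: differentiable_continuous; apply/derivable1_diffP.
by have [] := dF s.
Qed.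

Definition smooth f := forall k, Ck k f.

Lemma smooth_continuous f : smooth f -> continuous f.
Proof. by move=> /(_ 0%N)[]. Qed.

Lemma smooth_derivable f : smooth f -> forall i x, derivable f x (e_ i).
Proof. by move=> /(_ 1%N)[_ h] i; have [] := h i. Qed.

Lemma smooth_derive f i : smooth f -> smooth ('D_(e_ i) f).
Proof. by move=> sf k; have [_ /(_ i)[]] := sf k.+1. Qed.

(** Induction on the order of differentiation for all members of S at once. *)
Lemma smooth_of_stable (S : set (rV -> R)) :
  (forall f, S f -> continuous f /\
    forall i, (forall x, derivable f x (e_ i)) /\ S ('D_(e_ i) f)) ->
  forall f, S f -> smooth f.
Proof.
move=> HS f Sf k; elim: k f Sf => [|k IHk] f /HS[cf df]; first by [].
by split => // i; have [d1 Sd] := df i; split => //; exact: IHk.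
Qed.

(* Smoothness of a function is proved by exhibiting a family B whose first order
   partial derivatives are polynomials in members of B. *)
Inductive smooth_alg (B : set (rV -> R)) : set (rV -> R) :=
| SA_base f : B f -> smooth_alg B f
| SA_cst c : smooth_alg B (fun=> c)
| SA_add f g : smooth_alg B f -> smooth_alg B g -> smooth_alg B (fun x => f x + g x)
| SA_mul f g : smooth_alg B f -> smooth_alg B g -> smooth_alg B (fun x => f x * g x).

Lemma smooth_algP (B : set (rV -> R)) :
  (forall f, B f -> continuous f /\
    forall i, (forall x, derivable f x (e_ i)) /\ smooth_alg B ('D_(e_ i) f)) ->
  forall f, smooth_alg B f -> smooth f.
Proof.
move=> HB; apply: smooth_of_stable => f; elim=> {f}[f /HB//|c|f g _ [cf df] _ [cg dg]|f g sf [cf df] sg [cg dg]].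
- split=> [|i]; first by move=> x; exact: cst_continuous.
  split=> [x|]; first exact: derivable_cst.
  rewrite (_ : 'D_(e_ i) _ = fun=> 0); first exact: SA_cst.
  by apply/funext => x; exact: derive_cst.
- split=> [x|i]; first by apply: continuousD; [exact: cf|exact: cg].
  have [d1 S1] := df i; have [d2 S2] := dg i.
  split=> [x|]; first exact: derivableD.
  rewrite (_ : 'D_(e_ i) _ = fun x => 'D_(e_ i) f x + 'D_(e_ i) g x); first exact: SA_add.
  by apply/funext => x; exact: deriveD.
- split=> [x|i]; first by apply: continuousM; [exact: cf|exact: cg].
  have [d1 S1] := df i; have [d2 S2] := dg i.
  split=> [x|]; first exact: derivableM.
  rewrite (_ : 'D_(e_ i) _ = fun x => f x * 'D_(e_ i) g x + g x * 'D_(e_ i) f x).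
    by apply: SA_add; apply: SA_mul.
  by apply/funext => x; exact: deriveM.
Qed.

Lemma smooth_alg_smooth f : smooth_alg smooth f -> smooth f.
Proof.
apply: smooth_algP => {}f sf; split; first exact: smooth_continuous.
by move=> i; split=> [x|]; [exact: smooth_derivable|apply: SA_base; exact: smooth_derive].
Qed.

Lemma smoothD f g : smooth f -> smooth g -> smooth (fun x => f x + g x).
Proof. by move=> sf sg; apply: smooth_alg_smooth; apply: SA_add; exact: SA_base. Qed.

Lemma smoothM f g : smooth f -> smooth g -> smooth (fun x => f x * g x).
Proof. by move=> sf sg; apply: smooth_alg_smooth; apply: SA_mul; exact: SA_base. Qed.

Lemma smooth_cst (c : R) : smooth (fun=> c).
Proof. by apply: smooth_alg_smooth; exact: SA_cst. Qed.

Lemma smoothZ (c : R) f : smooth f -> smooth (fun x => c * f x).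
Proof. by move=> sf; apply: smoothM => //; exact: smooth_cst. Qed.

Lemma is_derive_logistic n (k s : R) : is_derive s 1 (logistic n k)
  (n.+1%:R ^+ 2 * (logistic n k s * (1 + - 1 * logistic n k s))).
Proof.
have dk : is_derive s 1 (fun t => - kink n k t) (- n.+1%:R ^+ 2).
  rewrite (_ : (fun t => _) = (fun t : R => - n.+1%:R ^+ 2 * t + (n.+1%:R ^+ 2 * k + n.+1%:R))); last first.
    by apply/funext => t; rewrite /kink; ring.
  have h := is_deriveD (is_deriveZ (- n.+1%:R ^+ 2) (is_derive_id s (1 : R)))
    (is_derive_cst (n.+1%:R ^+ 2 * k + n.+1%:R) s (1 : R)).
  by move: h; rewrite addr0 [_ *: 1]mulr1.
have de := @is_derive1_comp R (@expR R) (fun t => - kink n k t) s _ _ (is_derive_expR _) dk.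
have d1 := is_deriveD (is_derive_cst (1 : R) s 1) de.
have nz : (cst 1 + (@expR R \o (fun t => - kink n k t))) s != 0 by rewrite gt_eqF// ltr_pwDl// expR_ge0.
have dv := is_deriveV nz d1.
rewrite (_ : _ * _ = - (1 + expR (- kink n k s)) ^- 2 *: (0 + expR (- kink n k s) * - n.+1%:R ^+ 2)).
  exact: dv.
by rewrite /GRing.scale /logistic/= add0r; field.
Qed.

Lemma is_derive_softplus n (k s : R) : is_derive s 1 (softplus n k) (logistic n k s).
Proof.
have dk : is_derive s 1 (kink n k) (n.+1%:R ^+ 2).
  rewrite (_ : kink n k = (fun t : R => n.+1%:R ^+ 2 * t + (- (n.+1%:R ^+ 2) * k - n.+1%:R))); last first.
    by apply/funext => t; rewrite /kink; ring.
  have h := is_deriveD (is_deriveZ (n.+1%:R ^+ 2) (is_derive_id s (1 : R)))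
    (is_derive_cst (- (n.+1%:R ^+ 2) * k - n.+1%:R) s (1 : R)).
  by move: h; rewrite addr0 [_ *: 1]mulr1.
have de := @is_derive1_comp R (@expR R) (kink n k) s _ _ (is_derive_expR _) dk.
have d1 := is_deriveD (is_derive_cst (1 : R) s 1) de.
have pz : 0 < 1 + expR (kink n k s) by rewrite ltr_pwDl// expR_ge0.
have dl := @is_derive1_comp R (@ln R) _ s _ _ (is_derive1_ln pz) d1.
have db := is_deriveB dl (is_derive_cst (ln (1 + expR (kink n k 0))) s (1 : R)).
have dz := is_deriveZ (n.+1%:R ^- 2) db.
rewrite (_ : softplus n k = n.+1%:R ^- 2 \*: (@ln R \o (cst 1 + (@expR R \o kink n k)) - cst (ln (1 + expR (kink n k 0))))).
  rewrite (_ : logistic n k s = n.+1%:R ^- 2 *: ((1 + expR (kink n k s))^-1 * (0 + expR (kink n k s) * n.+1%:R ^+ 2) - 0)).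
    exact: dz.
  rewrite /GRing.scale /logistic/= subr0 add0r expRN; field.
  by rewrite !gt_eqF ?expR_gt0//= [_ + 1]addrC.
by apply/funext => t; rewrite /softplus mulrC.
Qed.

(** The derivative of [softplus] is [logistic], and that of [logistic] is a polynomial in
    [logistic]; together with the smooth functions they form a family to which [smooth_algP]
    applies. *)
Lemma smooth_softplus n (k : R) phi : smooth phi -> smooth (fun x => softplus n k (phi x)).
Proof.
move=> sphi; pose B : set (rV -> R) := smooth `|` [set fun x => softplus n k (phi x)]
  `|` [set fun x => logistic n k (phi x)].
apply: (@smooth_algP B); last by apply: SA_base; left; right.
have cphi := smooth_continuous sphi.
have Bphi i : smooth_alg B ('D_(e_ i) phi) by apply: SA_base; left; left; exact: smooth_derive.
have Blog : smooth_alg B (fun x => logistic n k (phi x)) by apply: SA_base; right.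
move=> f [[sf|->]|->].
- split; first exact: smooth_continuous.
  move=> i; split=> [x|]; first exact: smooth_derivable.
  by apply: SA_base; left; left; exact: smooth_derive.
- have d i x := derive_comp1 (@smooth_derivable phi sphi i x) (is_derive_softplus n k (phi x)).
  split=> [x|i].
    apply: (continuous_comp (cphi x)); exact: (is_derive_continuous (is_derive_softplus n k)).
  split=> [x|]; first by have [] := d i x.
  rewrite (_ : 'D_(e_ i) _ = fun x => logistic n k (phi x) * 'D_(e_ i) phi x); first exact: SA_mul.
  by apply/funext => x; have [] := d i x.
- have d i x := derive_comp1 (@smooth_derivable phi sphi i x) (is_derive_logistic n k (phi x)).
  split=> [x|i].
    apply: (continuous_comp (cphi x)); exact: (is_derive_continuous (is_derive_logistic n k)).
  split=> [x|]; first by have [] := d i x.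
  rewrite (_ : 'D_(e_ i) _ = fun x => n.+1%:R ^+ 2 * (logistic n k (phi x) * (1 + - 1 * logistic n k (phi x))) * 'D_(e_ i) phi x).
    apply: SA_mul => //; apply: SA_mul; first exact: SA_cst.
    apply: SA_mul => //; apply: SA_add; first exact: SA_cst.
    by apply: SA_mul => //; exact: SA_cst.
  by apply/funext => x; have [] := d i x.
Qed.

End directional.

(** * Calculus in one variable and flat functions *)

Section one_variable.
Context (R : realType).
Implicit Types (F f : R -> R) (s t : R).
Local Notation l1 := (@lebesgue_measure R).

Lemma is_derive_near F f t (l : R) : (\near t, F t = f t) -> is_derive t (1 : R) F l -> is_derive t (1 : R) f l.
Proof.
move=> n [d e]; split; first exact: near_eq_derivable n d.
by rewrite -(@near_eq_derive R _ _ F f t 1 n).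
Qed.

Lemma is_derive_flat F (M : R) : (forall h : R, `|h| <= 1 -> `|F h| <= M * h ^+ 2) -> is_derive (0 : R) 1 F 0.
Proof.
move=> hF; have F0 : F 0 = 0.
  by apply/eqP; rewrite -normr_le0; apply: le_trans (hF 0 _) _; rewrite ?normr0// expr0n mulr0.
have cv : (fun h => h^-1 *: (F (h *: 1 + 0) - F 0)) @ 0^' --> (0 : R).
  apply/cvgrPdist_le => e e0.
  have e1 : 0 < Num.min 1 (e / (`|M| + 1)).
    by rewrite lt_min ltr01 divr_gt0// ltr_wpDl.
  have n1 : \forall h \near (0 : R)^', `|h| <= Num.min 1 (e / (`|M| + 1)).
    apply: nbhs_dnbhs; apply/nbhs_ballP; exists (Num.min 1 (e / (`|M| + 1))) => //= h.
    by rewrite /ball/= sub0r normrN => /ltW.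
  have nz : \forall h \near (0 : R)^', h != 0 by exact: nbhs_dnbhs_neq.
  apply: filterS2 n1 nz => h; rewrite le_min => /andP[h1 h2] h0.
  rewrite sub0r normrN F0 subr0 addr0 -[h *: 1]/(h * 1) mulr1 normrZ normfV.
  rewrite ler_pdivrMl ?normr_gt0//; apply: le_trans (hF _ h1) _.
  rewrite -(real_normK (num_real h)) expr2 mulrCA ler_pM2l ?normr_gt0//.
  apply: (@le_trans _ _ ((`|M| + 1) * `|h|)).
    by rewrite ler_wpM2r//; have := ler_norm M; lra.
  by rewrite mulrC -ler_pdivlMr// ltr_wpDl.
split; first exact: (cvgP _ cv).
exact: (cvg_lim _ cv).
Qed.

Lemma abs_powR s (p : R) : `|s| `^ p = (s ^+ 2) `^ (p / 2).
Proof.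
rewrite -(real_normK (num_real s)) -powR_mulrn// -powRrM.
by congr (_ `^ _); field.
Qed.

(** The derivative of |s|^p for p > 2, in a form that is visibly continuous at 0. *)
Definition abspow' (p s : R) := p * (s * `|s| `^ (p - 2)).

Lemma is_derive_abspow (p s : R) : 2 < p -> is_derive s 1 (fun t => `|t| `^ p) (abspow' p s).
Proof.
move=> p2; have [->|s0] := eqVneq s 0.
  rewrite (_ : abspow' p 0 = 0); last by rewrite /abspow' mul0r mulr0.
  apply: (@is_derive_flat _ 1) => h h1; rewrite mul1r ger0_norm ?powR_ge0//.
  have [->|h0] := eqVneq h 0; first by rewrite normr0 powR0 ?sqr_ge0// gt_eqF//; lra.
  rewrite -(real_normK (num_real h)) -powR_mulrn//; apply: ger_powR; last lra.
  by rewrite normr_gt0 h0.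
have s2 : 0 < s ^+ 2 by rewrite exprn_even_gt0.
rewrite (_ : (fun t => `|t| `^ p) = (fun x : R => x `^ (p / 2)) \o (fun t : R => t ^+ 2)); last first.
  by apply/funext => t; exact: abs_powR.
have := @is_derive1_comp R (fun x : R => x `^ (p / 2)) (fun t => t ^+ 2) s _ _ (is_derive1_powR _ s2) (is_derive_sqr s).
suff -> : p / 2 * (s ^+ 2) `^ (p / 2 - 1) * (2 * s) = abspow' p s by [].
rewrite /abspow' abs_powR (_ : (p - 2) / 2 = p / 2 - 1); last by field.
by field.
Qed.

Lemma abspow'_norm (p s : R) : 2 < p -> `|abspow' p s| = p * `|s| `^ (p - 1).
Proof.
move=> p2; rewrite /abspow' normrM gtr0_norm; last lra.
rewrite normrM [`|_ `^ _|]ger0_norm ?powR_ge0//; congr (_ * _).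
have p1 : 0 < p - 1 by lra.
by have := mulr_powRB1 (normr_ge0 s) p1; rewrite (_ : p - 1 - 1 = p - 2)//; ring.
Qed.

Lemma continuous_abspow' (p : R) : 2 < p -> continuous (abspow' p).
Proof.
move=> p2 s; have [->|s0] := eqVneq s 0; last first.
  have s2 : 0 < s ^+ 2 by rewrite exprn_even_gt0.
  rewrite /continuous_at (_ : abspow' p = fun t : R => p * (t * (t ^+ 2) `^ ((p - 2) / 2))); last first.
    by apply/funext => t; rewrite /abspow' abs_powR.
  apply: cvgMr; apply: cvgM; first exact: cvg_id.
  have d := @is_derive1_comp R (fun x : R => x `^ ((p - 2) / 2)) (fun t => t ^+ 2) s _ _ (is_derive1_powR _ s2) (is_derive_sqr s).
  have [/derivable1_diffP dd _] := d; exact: (differentiable_continuous dd).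
rewrite /continuous_at (_ : abspow' p 0 = 0); last by rewrite /abspow' mul0r mulr0.
apply/cvgrPdist_le => e e0.
have e1 : 0 < Num.min 1 (e / p) by rewrite lt_min ltr01 divr_gt0//; lra.
apply/nbhs_ballP; exists (Num.min 1 (e / p)) => //= h.
rewrite /ball/= !sub0r !normrN abspow'_norm// lt_min => /andP[h1 h2].
have p0 : 0 < p by lra.
rewrite -ler_pdivlMl// mulrC; apply: le_trans (ltW h2).
have [->|h0] := eqVneq h 0; first by rewrite normr0 powR0// gt_eqF//; lra.
apply: ge1r_powR; last lra.
by rewrite normr_gt0 h0 ltW.
Qed.

Lemma ftc_itv F f s t : s <= t -> (forall r : R, is_derive r 1 F (f r)) -> continuous f ->
  ig l1 (fun r => \1_(`[s, t]%classic) r * f r) /\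
  RI l1 (fun r => \1_(`[s, t]%classic) r * f r) = F t - F s.
Proof.
move=> st dF cf; have mi : measurable (`[s, t]%classic : set R) by exact: measurable_itv.
have e0 : (fun r => \1_(`[s, t]%classic) r * f r) = f \_ `[s, t]%classic.
  by apply/funext => r; rewrite patchE indicE; case: (_ \in _); rewrite ?mul1r ?mul0r.
have cF := is_derive_continuous dF.
have ii : l1.-integrable `[s, t]%classic (EFin \o f).
  apply: continuous_compact_integrable; first exact: segment_compact.
  exact: continuous_subspaceT.
split.
  rewrite e0 ig_def (_ : EFin \o _ = (EFin \o f) \_ `[s, t]%classic).
    by rewrite -integrable_mkcond.
  by apply/funext => r; rewrite /= !patchE; case: ifP.
rewrite e0 RI_def -Rintegral_mkcond; move: st; rewrite le_eqVlt => /predU1P[->|st].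
  by rewrite set_itv1 /Rintegral integral_set1 subrr.
rewrite /Rintegral (@continuous_FTC2 R f F)//.
- exact: continuous_subspaceT.
- split=> [r _||]; first by have [] := dF r.
  + by apply: cvg_at_right_filter; exact: cF.
  + by apply: cvg_at_left_filter; exact: cF.
- by move=> r _; rewrite derive1E; have [_ ->] := dF r.
Qed.

Lemma ftc_le F f g L s t : s <= t -> (forall r : R, is_derive r 1 F (f r)) -> continuous f ->
  bsup (ibox L) g -> (forall r, `|f r| <= g r) ->
  `|F t - F s| <= RI l1 (fun r => \1_(`[s, t]%classic) r * g r).
Proof.
move=> st dF cf bg fg; have [i1 <-] := ftc_itv st dF cf.
apply: le_trans (RI_norm i1) _; apply: RI_le; [exact: ig_norm|exact: ig_ibox (bsup_itvM _ _ bg)|].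
by move=> r; rewrite normrM ger0_norm// ler_wpM2l.
Qed.

Lemma ftc_zero F f L : (forall r : R, is_derive r 1 F (f r)) -> continuous f ->
  (forall r, ~ ibox L r -> F r = 0) -> bsup (ibox L) f -> RI l1 f = 0.
Proof.
move=> dF cf F0 bf; have [L0|L0] := leP 0 L; last first.
  rewrite (RI_eq _ (g := fun=> 0)) ?RI0// => r; apply: (bsup_out bf).
  by rewrite /ibox/= in_itv/= => /andP[h1 h2]; lra.
(* Enlarging the interval by 1 puts both ends outside the support of F. *)
have st : - (L + 1) <= L + 1 by lra.
have [_] := ftc_itv st dF cf.
rewrite !F0 ?subrr; try by rewrite /ibox/= in_itv/= => /andP[h1 h2]; lra.
move=> <-; apply: RI_eq => r; rewrite indicE.
have [h|h] := boolP (r \in `[- (L + 1), L + 1]%classic); first by rewrite mul1r.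
rewrite mul0r; apply: (bsup_out bf) => hr; move/negP : h; apply; rewrite inE.
by move: hr; rewrite /ibox/= !in_itv/= => /andP[h1 h2]; apply/andP; split; lra.
Qed.

(* The derivative of t^-m e^(-1/t) is a combination of two members of the family. *)
Definition flat (m : nat) (t : R) : R := if 0 < t then t^-1 ^+ m * expR (- t^-1) else 0.

Lemma flat_le m : exists M : R, forall h : R, `|flat m h| <= M * h ^+ 2.
Proof.
exists (m.+2%:R ^+ m.+2) => h; rewrite /flat; case: ifPn => [h0|_]; last first.
  by rewrite normr0; apply: mulr_ge0; [exact: exprn_ge0|exact: sqr_ge0].
have hi : 0 < h^-1 by rewrite invr_gt0.
rewrite ger0_norm; last by rewrite mulr_ge0 ?expR_ge0// exprn_ge0// ltW.
(* The power m + 2 of e^x >= x at x = 1 / (h (m + 2)); it leaves the factor h^2 after division by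
   h^m. *)
have key : (h^-1 / m.+2%:R) ^+ m.+2 <= expR h^-1.
  have -> : expR h^-1 = expR (h^-1 / m.+2%:R) ^+ m.+2.
    by rewrite -expRM_natl mulrC divfK// pnatr_eq0.
  have x0 : 0 <= h^-1 / m.+2%:R by rewrite divr_ge0// ltW.
  apply: lerXn2r; rewrite ?nnegrE ?expR_ge0//.
  by apply: le_trans (expR_ge1Dx _); rewrite lerDr.
rewrite expRN ler_pdivrMr ?expR_gt0//.
have -> : h^-1 ^+ m = m.+2%:R ^+ m.+2 * h ^+ 2 * (h^-1 / m.+2%:R) ^+ m.+2.
  have p0 : m.+2%:R != 0 :> R by rewrite pnatr_eq0.
  have hn := lt0r_neq0 h0; move: (m.+2%:R : R) p0 => c p0.
  rewrite expr_div_n (exprS h^-1) (exprS h^-1 m).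
  have := expf_neq0 m.+2 p0; move: (c ^+ m.+2) (h^-1 ^+ m) => a b a0.
  by field; rewrite hn a0.
by apply: (ler_wpM2l _ key); apply: mulr_ge0; [exact: exprn_ge0|exact: sqr_ge0].
Qed.

Lemma is_derive_flat_fun m t : is_derive t 1 (flat m) (- m%:R * flat m.+1 t + flat m.+2 t).
Proof.
have [t0|t0|->] := ltgtP t 0.
- have -> : - m%:R * flat m.+1 t + flat m.+2 t = 0 by rewrite /flat (lt_gtF t0) mulr0 addr0.
  apply: (@is_derive_near (cst 0)).
  near=> s; rewrite /flat ifF//; apply/negbTE; rewrite -leNgt ltW//.
  by near: s; exact: lt_nbhsl.
- have tn : t != 0 by rewrite gt_eqF.
  pose G := (fun s : R => s^-1) ^+ m * (@expR R \o (- (fun s : R => s^-1))).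
  have GE s : G s = s^-1 ^+ m * expR (- s^-1).
    by rewrite /G /=; congr (_ * _); elim: (m) => // k IHk; rewrite exprS exprS -IHk.
  apply: (@is_derive_near G).
    near=> s; rewrite GE /flat ifT//; near: s; exact: lt_nbhsr.
  have dV : is_derive t 1 (fun s : R => s^-1) (- t ^- 2 * 1).
    have := is_deriveV tn (is_derive_id t (1 : R)); exact.
  have dN := is_deriveN dV.
  have dE := @is_derive1_comp R (@expR R) _ t _ _ (is_derive_expR _) dN.
  have dX := is_deriveX m dV.
  have dM := is_deriveM dX dE.
  suff -> : - m%:R * flat m.+1 t + flat m.+2 t =
    ((fun s : R => s^-1) ^+ m) t *: (expR (- t^-1) * - (- t ^- 2 * 1)) +
    expR (- t^-1) *: ((m%:R * t^-1 ^+ m.-1) *: (- t ^- 2 * 1)) by exact: dM.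
  have -> : ((fun s : R => s^-1) ^+ m) t = t^-1 ^+ m.
    by elim: (m) => // k IHk; rewrite exprS exprS -IHk.
  rewrite /flat t0 /GRing.scale/= -exprVn.
  case: (m) => [|k]; rewrite ?succnK !exprS; ring.
- have [M hM] := flat_le m.
  have -> : - m%:R * flat m.+1 0 + flat m.+2 0 = 0 :> R by rewrite /flat ltxx mulr0 addr0.
  by apply: (@is_derive_flat _ M) => h _; exact: hM.
Unshelve. all: by end_near. Qed.

End one_variable.

(** * Test functions on a domain *)

Section restricted_measure.
Context d (T : measurableType d) (R : realType).
Variables (mu : {measure set T -> \bar R}) (D : set T) (mD : measurable D)
  (Doo : (mu D < +oo)%E).

Local Notation nu := (mfrestr mD Doo).

(** The restricted measure lives on the whole space and does not charge the complement of [D], so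
    the abstract theory can be applied without mentioning [D]. *)
Lemma ae_mfrestr (P : T -> Prop) :
  {ae nu, forall x, P x} <-> {ae mu, forall x, D x -> P x}.
Proof.
split=> [[A [mA A0 PA]]|[A [mA A0 PA]]].
  exists (A `&` D); split => //; first exact: measurableI.
  by move=> x /= /not_implyP[Dx nP]; split => //; exact: PA.
exists (A `|` ~` D); split => /=; first exact/measurableU/measurableC.
  rewrite /mfrestr /mrestr setIUl setICl setU0; apply: subset_measure0 A0 => //.
  exact: measurableI.
move=> x /= nP; have [Dx|] := pselect (D x); [left|by right].
by apply: PA => /= /(_ Dx).
Qed.

Lemma ge0_integral_mfrestr (f : T -> \bar R) : measurable_fun setT f ->
  (forall x, 0 <= f x)%E -> (\int[nu]_x f x = \int[mu]_(x in D) f x)%E.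
Proof.
move=> mf f0; rewrite (@ge0_negligible_integral _ _ _ nu setT (~` D)) => //.
- rewrite setTD setCK; apply: eq_measure_integral => A mA AD.
  by rewrite /= /mfrestr /mrestr setIidl.
- exact: measurableC.
- by rewrite /= /mfrestr /mrestr setICl.
Qed.

Lemma integral_mfrestr (f : T -> \bar R) : measurable_fun setT f ->
  (\int[nu]_x f x = \int[mu]_(x in D) f x)%E.
Proof.
move=> mf; rewrite [LHS]integralE [RHS]integralE; congr (_ - _)%E.
  by rewrite ge0_integral_mfrestr//; exact: measurable_funepos.
by rewrite ge0_integral_mfrestr//; exact: measurable_funeneg.
Qed.

Lemma RI_mfrestr (f : T -> R) : measurable_fun setT f ->
  RI nu f = \int[mu]_(x in D) f x.
Proof. by move=> mf; rewrite /RI /Rintegral integral_mfrestr//; exact/measurable_EFinP. Qed.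

Lemma ig_mfrestr (f : T -> R) : measurable_fun setT f ->
  ig nu f <-> mu.-integrable D (EFin \o f).
Proof.
move=> mf; have mfE : measurable_fun setT (EFin \o f) by exact/measurable_EFinP.
split=> /integrableP[_ h]; apply/integrableP; split => //.
- exact: measurable_funTS.
- by rewrite -ge0_integral_mfrestr//; exact: measurableT_comp.
- by rewrite ge0_integral_mfrestr//; exact: measurableT_comp.
Qed.

Lemma RI_mfrestr_patch (f : T -> R) : measurable_fun setT f ->
  RI nu f = RI mu (fun x => \1_D x * f x).
Proof.
move=> mf; rewrite RI_mfrestr// /RI [RHS](_ : _ = \int[mu]_x (f \_ D) x).
  rewrite /Rintegral integral_mkcond; apply: congr1; apply: eq_integral => x _.
  by rewrite !patchE; case: ifP.
congr fine; apply: eq_integral => x _; congr EFin.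
by rewrite indicE patchE; case: ifP; rewrite ?mul1r ?mul0r.
Qed.

End restricted_measure.

(** * Boxes, open sets and measurability in R^n *)

Section rV_topology.
Context (R : realType) (n : nat).
Local Notation rV := 'rV[R]_n.
Local Notation leb := (lebesgue_rV R n).
Implicit Types (a b x : rV) (U : set rV).

Definition obox a b : set rV := [set x | forall i, a 0 i < x 0 i < b 0 i].
Definition cbox a b : set rV := [set x | forall i, a 0 i <= x 0 i <= b 0 i].

Lemma obox_cbox a b : obox a b `<=` cbox a b.
Proof. by move=> x h i; have /andP[/ltW -> /ltW ->] := h i. Qed.

Lemma measurable_obox a b : measurable (obox a b).
Proof.
rewrite (_ : obox a b = [set x : rV | forall i, `]a 0 i, b 0 i[%classic (x 0 i)]).
  apply: (@measurable_rect R n (fun i => `]a 0 i, b 0 i[%classic)) => i.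
  exact: measurable_itv.
by apply/seteqP; split=> x h i; have := h i; rewrite /= in_itv.
Qed.

Lemma compact_cbox a b : compact (cbox a b).
Proof.
rewrite (_ : cbox a b = [set x : rV | forall i, `[a 0 i, b 0 i]%classic (x 0 i)]).
  apply: (@rV_compact _ n (fun i => `[a 0 i, b 0 i]%classic)) => i.
  exact: segment_compact.
by apply/seteqP; split=> x h i; have := h i; rewrite /= in_itv.
Qed.

Definition rat_rV (p : 'rV[rat]_n) : rV := map_mx (ratr : rat -> R) p.

Lemma ball_coord (x : rV) (e : R) (y : rV) : 0 < e -> (forall i, `|x 0 i - y 0 i| < e) -> ball x e y.
Proof. by move=> e0 h; split => // i j; rewrite (ord1 i); exact: h. Qed.

(** The closed box is also kept inside [U], because it will carry the support of a test function;
    rational corners give countably many boxes. *)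
Lemma open_rat_box U x : open U -> U x ->
  exists p : 'rV[rat]_n * 'rV[rat]_n,
    obox (rat_rV p.1) (rat_rV p.2) x /\ cbox (rat_rV p.1) (rat_rV p.2) `<=` U.
Proof.
move=> oU Ux; have /nbhs_ballP[e /= e0 eU] : nbhs x U by exact: open_nbhs_nbhs.
have /choice[r hr] (i : 'I_n) : exists r : rat * rat,
    x 0 i - e < ratr r.1 < x 0 i /\ x 0 i < ratr r.2 < x 0 i + e.
  have h1 : x 0 i - e < x 0 i by rewrite ltrBlDr ltrDl.
  have h2 : x 0 i < x 0 i + e by rewrite ltrDl.
  have [r] := rat_in_itvoo h1; have [s] := rat_in_itvoo h2.
  by rewrite !in_itv /= => ? ?; exists (r, s).
exists (\row_i (r i).1, \row_i (r i).2); split.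
  by move=> i; rewrite /rat_rV !mxE; have [/andP[_ ->] /andP[->]] := hr i.
move=> y hy; apply: eU; apply: ball_coord => // i.
have := hy i; rewrite /rat_rV !mxE; have [/andP[h1 _] /andP[_ h2]] := hr i.
move=> /andP[h3 h4]; rewrite ltr_norml; apply/andP; split; lra.
Qed.

Lemma open_rat_cover U : open U -> U = \bigcup_(p : 'rV[rat]_n * 'rV[rat]_n)
  (if `[< cbox (rat_rV p.1) (rat_rV p.2) `<=` U >] then obox (rat_rV p.1) (rat_rV p.2) else set0).
Proof.
move=> oU; apply/seteqP; split=> [x Ux|x [p _]].
  have [p [px pU]] := open_rat_box oU Ux.
  by exists p => //; case: ifPn => // /negP; apply; apply/asboolP.
by case: ifPn => // /asboolP pU /obox_cbox; exact: pU.
Qed.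

(** An open set is a countable union of rational open boxes, which belong to the product
    sigma-algebra. *)
Lemma measurable_open U : open U -> measurable U.
Proof.
move=> /open_rat_cover ->; apply: countable_bigcupT_measurable.
  exact: countableP.
by move=> p; case: ifP => // _; exact: measurable_obox.
Qed.

Lemma meas_continuous (f : rV -> R) : continuous f -> measurable_fun [set: rV] f.
Proof.
move=> /continuousP cf; apply: (measurability _ (RGenOpens.measurableE R)).
move=> _ [_ [a [b ->] <-]]; rewrite setTI; apply: measurable_open.
exact/cf/interval_open.
Qed.

Lemma rV_coord_le_norm x i : `|x 0 i| <= `|x|.
Proof. by rewrite [leRHS]/Num.norm /= mx_normrE; apply/bigmax_geP; right => /=; exists (0, i). Qed.

Lemma bounded_sub_box U : bounded_set U -> exists2 L : R, 0 <= L & U `<=` box L.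
Proof.
move=> [M [Mr hM]]; exists (`|M| + 1); first by rewrite addr_ge0.
move=> x Ux i; rewrite /ibox /= in_itv /= -ler_norml.
apply: le_trans (rV_coord_le_norm x i) _; apply: hM => //.
by rewrite (le_lt_trans (ler_norm M))// ltrDl.
Qed.

Lemma continuous_coord (i : 'I_n) : continuous (fun x : rV => x 0 i).
Proof. exact: coord_continuous. Qed.

End rV_topology.

Section test_functions.
Context (R : realType) (N : nat).
Local Notation rV := 'rV[R]_N.
Local Notation leb := (lebesgue_rV R N).
Implicit Types (U : set rV) (phi psi : rV -> R).

Lemma Cc_intro U phi (K : set rV) : smooth phi -> compact K -> K `<=` U ->
  (forall x, phi x != 0 -> K x) -> Cc_infty U phi.
Proof.
move=> sphi cK KU phiK.
have clK : closed K by apply: compact_closed => //; exact: norm_hausdorff.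
have sub : closure [set x | phi x != 0] `<=` K.
  by rewrite [X in _ `<=` X](closure_id K).1//; apply: closureS.
split => //; last exact: subset_trans sub KU.
by apply: (subclosed_compact _ cK sub); exact: closed_closure.
Qed.

Lemma Cc_elim U phi : Cc_infty U phi -> exists2 K : set rV, compact K &
  [/\ K `<=` U, forall x, ~ K x -> phi x = 0 &
      forall i x, ~ K x -> 'D_(e_ i) phi x = 0].
Proof.
move=> [_ cK KU]; exists (closure [set x | phi x != 0]) => //.
have h0 x : ~ closure [set x | phi x != 0] x -> phi x = 0.
  by move=> nx; apply/eqP/negPn/negP => p0; apply: nx; exact: subset_closure.
split => // i x nx.
have opn : open (~` closure [set x | phi x != 0]) by exact/closed_openC/closed_closure.
rewrite (@near_eq_derive R _ _ phi (cst 0)) ?derive_cst//.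
have : nbhs x (~` closure [set x | phi x != 0]) by exact: open_nbhs_nbhs.
by apply: filterS => y; exact: h0.
Qed.

Lemma Cc_smooth U phi : Cc_infty U phi -> smooth phi.
Proof. by case. Qed.

Lemma Cc_derive U phi i : Cc_infty U phi -> Cc_infty U ('D_(e_ i) phi).
Proof.
move=> h; have [K cK [KU _ d0]] := Cc_elim h.
apply: (@Cc_intro _ _ K) => //; first exact: smooth_derive (Cc_smooth h).
by move=> x; apply: contra_neqP => /d0 ->.
Qed.

Lemma Cc_lin U phi psi (a : R) : Cc_infty U phi -> Cc_infty U psi ->
  Cc_infty U (fun x => phi x + a * psi x).
Proof.
move=> h h'; have [K cK [KU p0 _]] := Cc_elim h; have [K' cK' [KU' p0' _]] := Cc_elim h'.
apply: (@Cc_intro _ _ (K `|` K')).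
- by apply: smoothD; [exact: Cc_smooth h|apply: smoothZ; exact: Cc_smooth h'].
- exact: compactU.
- by move=> x [/KU|/KU'].
- move=> x; apply: contra_neqP => /not_orP[/p0 -> /p0' ->].
  by rewrite mulr0 addr0.
Qed.

Lemma Cc_mull U phi psi : smooth phi -> Cc_infty U psi -> Cc_infty U (fun x => phi x * psi x).
Proof.
move=> sphi h; have [K cK [KU p0 _]] := Cc_elim h.
apply: (@Cc_intro _ _ K) => //; first by apply: smoothM => //; exact: Cc_smooth h.
by move=> x; apply: contra_neqP => /p0 ->; rewrite mulr0.
Qed.

Lemma Cc_0 U : Cc_infty U (fun=> 0).
Proof.
apply: (@Cc_intro _ _ set0) => //; [exact: smooth_cst|exact: compact0|].
by move=> x; rewrite eqxx.
Qed.

Lemma Cc_softplus U n (k : R) phi : Cc_infty U phi -> Cc_infty U (fun x => softplus n k (phi x)).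
Proof.
move=> h; have [K cK [KU p0 _]] := Cc_elim h.
apply: (@Cc_intro _ _ K) => //; first by apply: smooth_softplus; exact: Cc_smooth h.
by move=> x; apply: contra_neqP => /p0 ->; rewrite softplus0.
Qed.

Lemma Cc_bsup U B phi : measurable B -> U `<=` B -> Cc_infty U phi -> bsup B phi.
Proof.
move=> mB UB h; have [K cK [KU p0 _]] := Cc_elim h.
have cphi := smooth_continuous (Cc_smooth h).
split; first exact: meas_continuous.
have [M [Mr hM]] : bounded_set (phi @` K).
  by apply/compact_bounded/continuous_compact => //; apply: continuous_subspaceT => x.
exists (`|M| + 1) => [|x]; first by rewrite addr_ge0.
have [Kx|/p0 ->] := pselect (K x); last by rewrite normr0 mulr_ge0 ?addr_ge0.
rewrite indicE mem_set ?mulr1; last exact/UB/KU.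
by apply: hM; [rewrite (le_lt_trans (ler_norm M))// ltrDl|exists x].
Qed.

Lemma grad_lin phi psi (a : R) : smooth phi -> smooth psi ->
  grad (fun x => phi x + a * psi x) = fun x => grad phi x + a *: grad psi x.
Proof.
move=> sphi spsi; apply/funext => x; apply/rowP => i; rewrite !mxE.
have d1 := @smooth_derivable _ _ phi sphi i x.
have d2 := @smooth_derivable _ _ psi spsi i x.
have d3 : derivable (a *: psi) x (e_ i) by exact: derivableZ.
by have := deriveD d1 d3; rewrite (deriveZ a d2); exact.
Qed.

Lemma grad_softplus n (k : R) phi : smooth phi ->
  grad (fun x => softplus n k (phi x)) = fun x => logistic n k (phi x) *: grad phi x.
Proof.
move=> sphi; apply/funext => x; apply/rowP => i; rewrite !mxE.
have d1 := @smooth_derivable _ _ phi sphi i x.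
by have [_ ->] := derive_comp1 d1 (is_derive_softplus n k (phi x)).
Qed.

Lemma derive_mul phi psi i x : smooth phi -> smooth psi ->
  'D_(e_ i) (fun x => phi x * psi x) x = phi x * 'D_(e_ i) psi x + psi x * 'D_(e_ i) phi x.
Proof.
move=> sphi spsi.
have d1 := @smooth_derivable _ _ phi sphi i x.
have d2 := @smooth_derivable _ _ psi spsi i x.
exact: deriveM.
Qed.

Lemma box_line (L : R) i (x : rV) (r : R) :
  box L (x + r *: e_ i) -> ibox (L + `|x 0 i|) r.
Proof.
move=> /(_ i); rewrite /ibox/= !mxE !in_itv/= !eqxx mulr1 => /andP[h1 h2].
have := ler_norm (x 0 i); have := ler_norm (- x 0 i); rewrite normrN => h3 h4.
by apply/andP; split; lra.
Qed.

Lemma continuous_line phi (x v : rV) : continuous phi -> continuous (fun r : R => phi (x + r *: v)).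
Proof.
move=> cphi r; apply: (@continuous_comp _ _ _ (fun r : R => x + r *: v) phi); last exact: cphi.
by apply: continuousD; [exact: cst_continuous|exact: scalel_continuous].
Qed.

Lemma bsup_line (L : R) phi i (x : rV) : bsup (box L) phi ->
  bsup (ibox (L + `|x 0 i|)) (fun r => phi (x + r *: e_ i)).
Proof.
move=> [mphi [M M0 h]]; split.
  apply: measurableT_comp => //; apply: measurable_fun_rV => j.
  under eq_fun do rewrite !mxE.
  by apply: measurable_funD => //; exact: measurable_funM.
exists M => // r; apply: le_trans (h _) _; rewrite ler_wpM2l// !indicE.
have [/set_mem/box_line/mem_set ->|//] := boolP (_ \in box L).
by rewrite lexx.
Qed.

Lemma Cc_integral_derive (L : R) U phi i : 0 <= L -> U `<=` box L -> Cc_infty U phi ->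
  RI leb ('D_(e_ i) phi) = 0.
Proof.
move=> L0 UL h.
have bD := Cc_bsup (measurable_box L) UL (Cc_derive i h).
have b := Cc_bsup (measurable_box L) UL h.
have sphi := Cc_smooth h.
apply: (@RI_zero_lines R N L _ i bD) => x.
apply: (@ftc_zero R (fun r => phi (x + r *: e_ i)) _ (L + `|x 0 i|)).
- by move=> r; apply: is_derive_line; exact: smooth_derivable.
- exact: continuous_line (smooth_continuous (smooth_derive i sphi)).
- move=> r nr; apply: (bsup_out b) => bx; apply: nr; exact: (box_line bx).
- exact: (@bsup_line L ('D_(e_ i) phi) i x bD).
Qed.

End test_functions.

Section lines_of_test_functions.
Context (R : realType) (N : nat).
Local Notation rV := 'rV[R]_N.
Implicit Types (U : set rV) (phi psi : rV -> R).

Lemma LW_test (L : R) U phi : 0 <= L -> U `<=` box L -> Cc_infty U phi ->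
  LW phi (fun i x => `|'D_(e_ i) phi x|).
Proof.
move=> L0 UL h; have sphi := Cc_smooth h; apply: LW_of_lines => i x s t st.
have bD := Cc_bsup (measurable_box L) UL (Cc_derive i h).
apply: (@ftc_le R (fun r => phi (x + r *: e_ i)) (fun r => 'D_(e_ i) phi (x + r *: e_ i)) _
  (L + `|x 0 i|)) => //.
- by move=> r; apply: is_derive_line; exact: smooth_derivable.
- exact: continuous_line (smooth_continuous (smooth_derive i sphi)).
- exact: (@bsup_line _ _ L (fun y => `|'D_(e_ i) phi y|) i x (bsup_norm bD)).
Qed.

Lemma bsup_pow_derive (L : R) U phi i (p : R) : 2 < p -> U `<=` box L -> Cc_infty U phi ->
  bsup (box L) (fun x => p * `|phi x| `^ (p - 1) * `|'D_(e_ i) phi x|).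
Proof.
move=> p2 UL h; have b := Cc_bsup (measurable_box L) UL h.
have bD := Cc_bsup (measurable_box L) UL (Cc_derive i h).
apply: bsupMM; last exact: bsup_norm.
by apply/bsupZ/bsup_powR => //; [lra|exact: bsup_norm].
Qed.

Lemma LW_test_pow (L : R) U phi (p : R) : 0 <= L -> U `<=` box L -> Cc_infty U phi -> 2 < p ->
  LW (fun x => `|phi x| `^ p) (fun i x => p * `|phi x| `^ (p - 1) * `|'D_(e_ i) phi x|).
Proof.
move=> L0 UL h p2; have sphi := Cc_smooth h; apply: LW_of_lines => i x s t st.
apply: (@ftc_le R (fun r => `|phi (x + r *: e_ i)| `^ p)
  (fun r => abspow' p (phi (x + r *: e_ i)) * 'D_(e_ i) phi (x + r *: e_ i)) _
  (L + `|x 0 i|)) => //.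
- move=> r.
  have d1 := is_derive_line (@smooth_derivable _ _ phi sphi i (x + r *: e_ i)).
  have d2 := is_derive_abspow (phi (x + r *: e_ i)) p2.
  exact: (is_derive1_comp (f := fun t : R => `|t| `^ p) (g := fun s : R => phi (x + s *: e_ i))).
- have c1 := @continuous_line _ _ _ x (e_ i) (smooth_continuous (smooth_derive i sphi)).
  have c2 := @continuous_line _ _ _ x (e_ i) (smooth_continuous sphi).
  have c3 : continuous (fun r : R => abspow' p (phi (x + r *: e_ i))).
    move=> r; apply: (@continuous_comp _ _ _ (fun r : R => phi (x + r *: e_ i)) (abspow' p)).
      exact: c2.
    exact: continuous_abspow'.
  by move=> r; exact: (continuousM (c3 r) (c1 r)).
- exact: (@bsup_line _ _ L (fun y => p * `|phi y| `^ (p - 1) * `|'D_(e_ i) phi y|) i x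
    (bsup_pow_derive i p2 UL h)).
- by move=> r; rewrite normrM abspow'_norm.
Qed.

End lines_of_test_functions.

(** * Verification of the abstract hypotheses for test functions on a bounded domain *)

Section energy_space_on_domain.
Context (R : realType) (N : nat).
Local Notation rV := 'rV[R]_N.
Local Notation leb := (lebesgue_rV R N).
Variables (Om : set rV) (mOm : measurable Om) (Omoo : (leb Om < +oo)%E).
Variables (L : R) (L0 : 0 <= L) (OmL : Om `<=` box L).
Implicit Types (phi : rV -> R) (psi : rV -> rV).

Definition test_pair phi psi := Cc_infty Om phi /\ psi = grad phi.

Local Notation nu := (mfrestr mOm Omoo).
Local Notation T0 := test_pair.

Lemma RI_test_patch (f : rV -> R) : measurable_fun setT f -> (forall x, ~ Om x -> f x = 0) ->
  RI nu f = RI leb f.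
Proof.
move=> mf f0; rewrite RI_mfrestr_patch//; apply: RI_eq => x; rewrite indicE.
have [|/negP nx] := boolP (x \in Om); first by rewrite mul1r.
by rewrite f0 ?mul0r// => Ox; apply: nx; rewrite inE.
Qed.

Lemma L2_bsup (f : rV -> R) : bsup (box L) f -> L2 nu f.
Proof.
move=> [mf [M M0 h]]; apply: (@L2_bounded _ _ _ _ M) => // x; apply: le_trans (h x) _.
by rewrite ler_piMr// indicE; case: (_ \in _).
Qed.

Lemma test_out phi x : Cc_infty Om phi -> ~ Om x -> phi x = 0.
Proof.
by move=> h nx; have [K cK [KU p0 _]] := Cc_elim h; apply: p0 => /KU.
Qed.

Lemma energy_core_test : energy_core nu T0.
Proof.
split.
- move=> phi psi [h ->]; split; first exact: L2_bsup (Cc_bsup (measurable_box L) OmL h).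
  move=> i; apply: (@L2_ext _ _ _ nu ('D_(e_ i) phi)) => [x|]; first by rewrite mxE.
  exact: L2_bsup (Cc_bsup (measurable_box L) OmL (Cc_derive i h)).
- move=> a phi psi phi' psi' [h ->] [h' ->]; split; first exact: Cc_lin.
  by rewrite grad_lin//; [exact: Cc_smooth h|exact: Cc_smooth h'].
- split; first exact: Cc_0.
  by apply/funext => x; apply/rowP => i; rewrite !mxE derive_cst.
- move=> n k phi psi [h ->]; split; first exact: Cc_softplus.
  by rewrite grad_softplus//; exact: Cc_smooth h.
Qed.

Lemma nrm2_test phi : Cc_infty Om phi ->
  nrm2 nu (grad phi) = \sum_i RI leb (fun x => `|'D_(e_ i) phi x| ^+ 2).
Proof.
move=> h; have bD i := Cc_bsup (measurable_box L) OmL (Cc_derive i h).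
rewrite /nrm2 (RI_eq _ (g := fun x => \sum_i 'D_(e_ i) phi x ^+ 2)); last first.
  by move=> x; rewrite /dotp; apply: eq_bigr => i _; rewrite !mxE expr2.
rewrite RI_sum => [|i]; last by have [] := L2_bsup (bD i).
apply: eq_bigr => i _; rewrite RI_test_patch.
- by apply: RI_eq => x; rewrite real_normK// num_real.
- by apply: measurable_funX; exact: bsup_meas (bD i).
- by move=> x nx; rewrite (test_out (Cc_derive i h) nx) expr0n.
Qed.

Lemma rellich_test : rellich nu T0.
Proof.
move=> e e0; have [I [E [C [C0 bE H]]]] := @rellich_box R N L e L0 e0.
exists #|I|, (fun k => E (enum_val k)), C; split => // [k|phi psi [h ->]].
  exact: L2_bsup.
have b := Cc_bsup (measurable_box L) OmL h.
have bD i := Cc_bsup (measurable_box L) OmL (Cc_derive i h).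
rewrite RI_test_patch; last 2 first.
- by apply: measurable_funX; exact: bsup_meas b.
- by move=> x nx; rewrite (test_out h nx) expr0n.
rewrite nrm2_test//; have := H phi (fun i x => `|'D_(e_ i) phi x|) b (fun i => bsup_norm (bD i))
  (fun i x => normr_ge0 _) (LW_test L0 OmL h).
rewrite (eq_bigr (fun k => RI nu (fun x => phi x * E k x) ^+ 2)) => [|k _].
  by rewrite (big_enum_val (fun k => RI nu (fun x => phi x * E k x) ^+ 2)).
rewrite RI_test_patch//; first by apply: measurable_funM; [exact: bsup_meas b|exact: bsup_meas (bE k)].
by move=> x nx; rewrite (test_out h nx) mul0r.
Qed.

End energy_space_on_domain.

Section sobolev_on_domain.
Context (R : realType) (n : nat).
Local Notation rV := 'rV[R]_n.+2.
Local Notation leb := (lebesgue_rV R n.+2).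
Variables (Om : set rV) (mOm : measurable Om) (Omoo : (leb Om < +oo)%E).
Variables (L : R) (L0 : 0 <= L) (OmL : Om `<=` box L).

Local Notation nu := (mfrestr mOm Omoo).
Local Notation T0 := (test_pair Om).

(* With r = m + e, m the larger of 2 q' and 2 N / (N - 1): since q > N / 2 there is
   room below 2 N / (N - 2), and gamma = r (N - 1) / N exceeds 2. *)
Lemma sobolev_exponent (q : R) : n.+2%:R / 2 < q ->
  exists r : R, [/\ 2 * (q / (q - 1)) < r, 2 < r / gn_exp R n & 2 * (r / gn_exp R n - 1) < r].
Proof.
rewrite /gn_exp -(natr1 n.+1) -(natr1 n); move: (ler0n R n); move: (n%:R : R) => a a0 hq.
have q1 : 0 < q - 1 by lra.
pose m := Num.max (2 * (q / (q - 1))) (2 * (a + 1 + 1) / (a + 1)).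
have ma : m * a < 2 * (a + 1 + 1).
  have key1 : 2 * (q / (q - 1)) * a < 2 * (a + 1 + 1).
    rewrite -mulrA ltr_pM2l// mulrAC ltr_pdivrMr//; nra.
  have key2 : 2 * (a + 1 + 1) / (a + 1) * a < 2 * (a + 1 + 1).
    rewrite mulrAC ltr_pdivrMr; last lra.
    by rewrite ltr_pM2l; lra.
  by rewrite /m; have [_|_] := leP (2 * (q / (q - 1))) (2 * (a + 1 + 1) / (a + 1)).
pose e := (2 * (a + 1 + 1) - m * a) / (2 * (a + 1)).
have e0 : 0 < e by rewrite divr_gt0//; lra.
have ea : e * a < 2 * (a + 1 + 1) - m * a.
  rewrite mulrAC ltr_pdivrMr; last lra.
  have [h1 h2] : 0 < 2 * (a + 1 + 1) - m * a /\ a < 2 * (a + 1) by split; lra.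
  by rewrite ltr_pM2l.
have m1 : 2 * (q / (q - 1)) <= m by rewrite /m le_max lexx.
have m2 : 2 * (a + 1 + 1) / (a + 1) <= m by rewrite /m le_max lexx orbT.
exists (m + e); split; first lra.
  rewrite ltr_pdivlMr; last by rewrite divr_gt0; lra.
  by rewrite mulrA; lra.
rewrite invf_div mulrA.
have -> : 2 * ((m + e) * (a + 1) / (a + 1 + 1) - 1) = (2 * (m + e) * (a + 1) - 2 * (a + 1 + 1)) / (a + 1 + 1).
  by field; lra.
rewrite ltr_pdivrMr; last lra.
have : (m + e) * a < 2 * (a + 1 + 1) by rewrite mulrDl; lra.
by move=> h; lra.
Qed.

(** Hoelder's inequality separates the weight, in L^q, from the integral of |phi|^(2 q') over A,
    with q' the conjugate exponent. Since 2 q' < r, interpolation between the indicator of A and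
    |phi|^r yields the power th of the mass, hence sigma = th / q', and the Sobolev inequality with
    exponent r concludes. *)
Lemma sobolev_weight_test (q : R) (V : rV -> R) : n.+2%:R / 2 < q -> measurable_fun setT V ->
  (forall x, 1 <= V x) -> ig nu (fun x => V x `^ q) ->
  exists2 sigma : R, 0 < sigma & exists2 C : R, 0 <= C & sobolev_weight nu T0 V sigma C.
Proof.
move=> hq mV V1 iV; have V0 x : 0 <= V x by apply: le_trans (V1 x).
have q1 : 1 < q.
  apply: le_lt_trans hq; rewrite ler_pdivlMr// mul1r ler_nat//.
have [r [r1 r2 r3]] := sobolev_exponent hq.
have g0 := gn_exp_gt0 R n.
have gr : r / gn_exp R n * gn_exp R n = r by rewrite mulfVK// gt_eqF.
have g1 : 1 < r / gn_exp R n by lra.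
have [C C0 HC] := sobolev_box L0 g1 gr r3.
pose q' := q / (q - 1).
have q'1 : 1 < q' by rewrite ltr_pdivlMr; lra.
have q'i : 0 <= q'^-1 by rewrite invr_ge0; lra.
have r0 : 0 < r by rewrite -/q' in r1; lra.
pose th := 1 - 2 * q' / r.
have th01 : 0 < th < 1.
  have h1 : 0 < 2 * q' / r by rewrite divr_gt0//; lra.
  have h2 : 2 * q' / r < 1 by rewrite ltr_pdivrMr// mul1r.
  by apply/andP; split; rewrite /th; lra.
have /andP[th0 th1] := th01.
have q0 : 0 < q by lra.
have t01 : 0 < q^-1 < 1 by rewrite invr_gt0 q0 invf_lt1.
have rn0 := lt0r_neq0 r0; have q'n0 : q' != 0 by rewrite gt_eqF//; lra.
have e3 : 2 * q' / r / q' = 2 / r by field; rewrite rn0.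
have e4 : r * (2 * q' / r) = 2 * q' by field.
have q'E : 1 - q^-1 = q'^-1 by rewrite /q' invf_div; field; lra.
exists (th / q'); first by rewrite divr_gt0//; lra.
exists (RI nu (fun x => V x `^ q) `^ q^-1 * C); first by rewrite mulr_ge0// powR_ge0.
move=> A mA phi psi [h ->].
have b := Cc_bsup (measurable_box L) OmL h.
have bD i := Cc_bsup (measurable_box L) OmL (Cc_derive i h).
have ba := bsup_norm b.
have a0 x : 0 <= `|phi x| by [].
have igb f : bsup (box L) f -> ig nu f.
  move=> bf; have [_ _] := bf; have [mf [M M0 hM]] := bf.
  apply: (ig_le mf _ (ig_cst nu M)) => x; apply: le_trans (hM x) _.
  by rewrite ler_piMr// indicE; case: (_ \in _).
have iA : ig nu (\1_A : rV -> R).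
  apply: (ig_le _ _ (ig_cst nu 1)); first exact: measurable_indic.
  by move=> x; rewrite indicE; case: (_ \in _); rewrite ?normr1 ?normr0.
have interp B : measurable B -> ig nu (fun x => \1_B x * (V x * phi x ^+ 2)) /\
    RI nu (fun x => \1_B x * (V x * phi x ^+ 2)) <=
    RI nu (fun x => V x `^ q) `^ q^-1 * RI nu (fun x => \1_B x * `|phi x| `^ (2 * q')) `^ q'^-1.
  move=> mB.
  have i2 : ig nu (fun x => \1_B x * `|phi x| `^ (2 * q')).
    apply: igb; rewrite (_ : (fun x => _) = (fun x => `|phi x| `^ (2 * q') * \1_B x)); last first.
      by apply/funext => x; rewrite mulrC.
    apply: (@bsupM _ _ _ 1).
    - by apply: bsup_powR => //; lra.
    - exact: measurable_indic.
    - by move=> x; rewrite indicE; case: (_ \in _); rewrite ?normr1 ?normr0.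
  have := RI_interp t01 (fun x => powR_ge0 (V x) q) (fun x => mulr_ge0 _ (powR_ge0 _ _)) iV i2.
  rewrite q'E (_ : (fun x => _ * _) = (fun x => \1_B x * (V x * phi x ^+ 2))).
    by apply => x; rewrite indicE.
  apply/funext => x; rewrite -powRrM mulfV ?powRr1//; last by lra.
  rewrite indicE; case: (_ \in _).
    rewrite !mul1r -powRrM -mulrA mulfV ?mulr1; last by lra.
    by rewrite powR_mulrn// real_normK// num_real.
  by rewrite !mul0r powR0 ?mulr0// invr_eq0; lra.
split.
  have [i _] := interp setT measurableT; apply: ig_eq i => x.
  by rewrite indicE in_setT mul1r.
have [_ /le_trans] := interp A mA; apply.
have ir : ig nu (fun x => `|phi x| `^ r) by apply: igb; exact: bsup_powR.
have := RI_interp th01 (fun x => _ : 0 <= \1_A x) (fun x => powR_ge0 `|phi x| r) iA ir.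
have thE : 1 - th = 2 * q' / r by rewrite /th; lra.
rewrite thE RI_indic// (_ : (fun x => _ * _) = (fun x => \1_A x * `|phi x| `^ (2 * q'))); last first.
  apply/funext => x; rewrite -powRrM e4.
  by rewrite indicE; case: (_ \in _); rewrite ?powR1// powR0// lt0r_neq0.
case=> [x|_ le2]; first by rewrite indicE.
have := HC (fun x => `|phi x|) (fun i x => `|'D_(e_ i) phi x|) ba a0 (fun i => bsup_norm (bD i))
  (fun i x => normr_ge0 _) (LW_test_pow L0 OmL h r2).
rewrite -(nrm2_test mOm Omoo OmL h) => le3.
rewrite -[leRHS]mulrA mulrAC -!mulrA; apply: ler_wpM2l; first exact: powR_ge0.
have le4 : RI nu (fun x => \1_A x * `|phi x| `^ (2 * q')) `^ q'^-1 <=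
    (mass nu A `^ th * RI nu (fun x => `|phi x| `^ r) `^ (2 * q' / r)) `^ q'^-1.
  apply: ge0_ler_powR => //; rewrite nnegrE ?mulr_ge0 ?powR_ge0//.
  by apply: RI_ge0 => x; rewrite mulr_ge0 ?powR_ge0// indicE.
apply: (le_trans le4); rewrite powRM ?powR_ge0// -!powRrM.
rewrite e3.
rewrite [X in _ <= _ * X]mulrC; apply: ler_wpM2l; first exact: powR_ge0.
rewrite (RI_test_patch mOm Omoo); first exact: le3.
- by apply: bsup_meas; apply: (@bsup_powR _ _ _ (box L)).
- by move=> x nx; rewrite (test_out h nx) normr0 powR0// gt_eqF.
Qed.

End sobolev_on_domain.

(** * Fundamental lemma of the calculus of variations *)

Lemma RI_dct_zero d (T : measurableType d) (R : realType) (nu : {measure set T -> \bar R})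
    (f_ : nat -> T -> R) (f g : T -> R) :
  (forall n, measurable_fun setT (f_ n)) -> measurable_fun setT f ->
  {ae nu, forall x, f_ ^~ x @ \oo --> f x} -> ig nu g ->
  (forall n x, `|f_ n x| <= g x) -> (forall n, RI nu (f_ n) = 0) -> RI nu f = 0.
Proof.
move=> mf_ mf ff gi fg f0; have [_] := RI_dct mf_ mf ff gi fg.
rewrite [X in X @ \oo](_ : _ = fun=> 0); last exact/funext.
by move=> h; exact: (cvg_unique (@norm_hausdorff _ R) h (cvg_cst _)).
Qed.

Section bump.
Context (R : realType) (N : nat).
Local Notation rV := 'rV[R]_N.
Implicit Types (x a b : rV) (U : set rV).

Definition affine_coord (i : 'I_N) (s c : R) x : R := s * x 0 i + c.

Lemma derive_affine_coord i s c j x :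
  derivable (affine_coord i s c) x (e_ j) /\ 'D_(e_ j) (affine_coord i s c) x = s * (e_ j : rV) 0 i.
Proof.
apply: line_is_derive.
rewrite (_ : (fun t : R => _) = (fun t : R => s * (e_ j : rV) 0 i * t + (s * x 0 i + c))); last first.
  by apply/funext => t; rewrite /affine_coord !mxE; ring.
have h := is_deriveD (is_deriveZ (s * (e_ j : rV) 0 i) (is_derive_id (0 : R) (1 : R)))
  (is_derive_cst (s * x 0 i + c) (0 : R) (1 : R)).
by apply: is_derive_eq h _; rewrite addr0 [_ *: _]mulr1.
Qed.

Lemma continuous_affine_coord i s c : continuous (affine_coord i s c).
Proof.
have h : continuous (fun x : rV => s * x 0 i).
  by move=> x; apply: continuousM; [exact: cst_continuous|exact: continuous_coord].
by move=> x; apply: (continuousD (h x)); exact: cst_continuous.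
Qed.

Lemma continuous_flat m : continuous (flat m : R -> R).
Proof. exact: is_derive_continuous (is_derive_flat_fun m). Qed.

Lemma smooth_flat_affine m i s c : smooth (fun x => flat m (affine_coord i s c x)).
Proof.
pose B : set (rV -> R) := [set f | exists k, f = fun x => flat k (affine_coord i s c x)].
apply: (@smooth_algP _ _ B); last by apply: SA_base; exists m.
have Bk k : smooth_alg B (fun x => flat k (affine_coord i s c x)) by apply: SA_base; exists k.
move=> _ [k ->]; split=> [x|j].
  by apply: (continuous_comp (@continuous_affine_coord i s c x)); exact: continuous_flat.
have dj x := derive_comp1 (derive_affine_coord i s c j x).1
  (is_derive_flat_fun k (affine_coord i s c x)).
split=> [x|]; first by have [] := dj x.
rewrite (_ : 'D_(e_ j) _ = fun x => (- k%:R * flat k.+1 (affine_coord i s c x) +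
  flat k.+2 (affine_coord i s c x)) * (s * (e_ j : rV) 0 i)); last first.
  by apply/funext => x; have [_ ->] := dj x; rewrite (derive_affine_coord i s c j x).2.
apply: SA_mul; last exact: SA_cst.
by apply: SA_add => //; apply: SA_mul => //; exact: SA_cst.
Qed.

Lemma smooth_prod (I : finType) (F : I -> rV -> R) : (forall i, smooth (F i)) ->
  smooth (fun x => \prod_i F i x).
Proof.
move=> sF; elim: (index_enum I) => [|i r IHr].
  rewrite (_ : (fun x => _) = fun=> 1); first exact: smooth_cst.
  by apply/funext => x; rewrite big_nil.
rewrite (_ : (fun x => _) = fun x => F i x * \prod_(j <- r) F j x); first exact: smoothM.
by apply/funext => x; rewrite big_cons.
Qed.

(** Each factor is e^(-1/t) at the distance t from a face, extended by 0. The function is positive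
    exactly on the open box, which is how the indicator of the box is recovered. *)
Definition bump a b x : R :=
  \prod_i (flat 0 (affine_coord i 1 (- a 0 i) x) * flat 0 (affine_coord i (- 1) (b 0 i) x)).

Lemma flat_ge0 m t : 0 <= flat m t :> R.
Proof.
rewrite /flat; case: ifPn => // t0.
by rewrite mulr_ge0 ?expR_ge0// exprn_ge0// invr_ge0 ltW.
Qed.

Lemma flat0_gt0 t : (0 < flat 0 t :> R) = (0 < t).
Proof.
rewrite /flat; case: ifPn => t0; last by rewrite ltxx.
by rewrite expr0 mul1r expR_gt0.
Qed.

Lemma bump_ge0 a b x : 0 <= bump a b x.
Proof. by apply: prodr_ge0 => i _; rewrite mulr_ge0 ?flat_ge0. Qed.

Lemma bump_gt0 a b x : 0 < bump a b x <-> obox a b x.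
Proof.
split=> [h i|h].
  have : 0 < flat 0 (affine_coord i 1 (- a 0 i) x) * flat 0 (affine_coord i (- 1) (b 0 i) x).
    rewrite lt_neqAle mulr_ge0 ?flat_ge0// andbT eq_sym; apply/negP => /eqP e.
    by move: h; rewrite /bump (bigD1 i)//= e mul0r ltxx.
  rewrite lt_neqAle eq_sym mulf_eq0 negb_or => /andP[/andP[h1 h2] _].
  have := flat_ge0 0 (affine_coord i 1 (- a 0 i) x); rewrite le_eqVlt eq_sym (negPf h1)/=.
  have := flat_ge0 0 (affine_coord i (- 1) (b 0 i) x); rewrite le_eqVlt eq_sym (negPf h2)/=.
  by rewrite !flat0_gt0 /affine_coord => h3 h4; apply/andP; split; lra.
apply: prodr_gt0 => i _; have /andP[h1 h2] := h i.
by rewrite mulr_gt0// flat0_gt0 /affine_coord; lra.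
Qed.

Lemma bump_test U a b : cbox a b `<=` U -> Cc_infty U (bump a b).
Proof.
move=> abU; apply: (@Cc_intro _ _ _ _ (cbox a b)) => //; last first.
- move=> x nz; apply: obox_cbox; apply/bump_gt0.
  by rewrite lt_neqAle eq_sym nz bump_ge0.
- exact: compact_cbox.
- by apply: smooth_prod => i; apply: smoothM; exact: smooth_flat_affine.
Qed.

Lemma reluB_small (c t : R) : 0 < c -> c < t -> relu 0 t - relu c t = c.
Proof.
move=> c0 ct; rewrite /relu subr0 oppr0 maxxx (max_l (_ : 0 <= t)); last lra.
by rewrite (max_l (_ : 0 <= t - c)) ?(max_r (_ : - c <= 0)); lra.
Qed.

Lemma reluB_le (c t : R) : 0 < c -> 0 <= t -> `|relu 0 t - relu c t| <= c.
Proof.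
move=> c0 t0; rewrite /relu subr0 oppr0 maxxx subr0 (max_l t0) (max_r (_ : - c <= 0)); last lra.
by rewrite subr0 ler_norml; have [h|h] := leP (t - c) 0; apply/andP; split; lra.
Qed.

Lemma cvg_relu_indic (t : R) : 0 <= t ->
  (fun k => k.+1%:R * (relu 0 t - relu k.+1%:R^-1 t)) @ \oo --> ((0 < t)%R%:R : R).
Proof.
move=> t0; have [t0'|t0'] := ltrP 0 t; last first.
  have -> : t = 0 by apply/eqP; rewrite eq_le t0 t0'.
  rewrite (_ : (fun k => _) = fun=> 0); first exact: cvg_cst.
  apply/funext => k; rewrite /relu !subr0 oppr0 maxxx sub0r.
  by rewrite sub0r subrr subr0 oppr0 mulr0.
apply: cvg_near_cst; have := @cvg_inv_nat R => /cvgrPdist_lt /(_ t t0').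
apply: filterS => k; rewrite sub0r normrN gtr0_norm ?invr_gt0// => kt.
by rewrite reluB_small ?invr_gt0// mulfV.
Qed.

End bump.

Section boxes_generate.
Context (R : realType) (N : nat).
Local Notation rV := 'rV[R]_N.

Definition oboxes : set (set rV) := [set A | exists a b, A = obox a b].

(** The inclusion of closed boxes keeps an intersection with an arbitrary box inside the domain as
    soon as one of the two boxes is. *)
Lemma oboxI (a b a' b' : rV) : exists a'' b'' : rV,
  obox a b `&` obox a' b' = obox a'' b'' /\ cbox a'' b'' `<=` cbox a' b'.
Proof.
exists (\row_i Num.max (a 0 i) (a' 0 i)), (\row_i Num.min (b 0 i) (b' 0 i)).
split; last first.
  move=> x h i; have := h i; rewrite !mxE ge_max le_min.
  by move=> /andP[/andP[_ ->] /andP[_ ->]].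
apply/seteqP; split=> [x [h h'] i|x h].
  by rewrite !mxE gt_max lt_min; have /andP[-> ->] := h i; have /andP[-> ->] := h' i.
split=> i; have := h i; rewrite !mxE gt_max lt_min => /andP[/andP[h1 h2] /andP[h3 h4]].
  by rewrite h1 h3.
by rewrite h2 h4.
Qed.

Lemma oboxesI : setI_closed oboxes.
Proof.
move=> _ _ [a [b ->]] [a' [b' ->]].
by have [a'' [b'' [-> _]]] := oboxI a b a' b'; exists a'', b''.
Qed.

Lemma measurable_oboxes : @measurable _ rV `<=` <<s oboxes >>.
Proof.
apply: smallest_sub; first exact: smallest_sigma_algebra.
rewrite -bigcup_seq; apply: bigcup_sub => i _.
suff h : measurable_fun [set: g_sigma_algebraType oboxes] (fun x : rV => x 0 i).
  by move=> _ [B mB <-]; exact: h.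
apply: (measurability _ (RGenOpens.measurableE R)).
move=> _ [_ [a [b ->] <-]]; rewrite setTI.
rewrite (_ : _ @^-1` _ = \bigcup_(k : nat) obox (\row_j if j == i then a else - k%:R)
   (\row_j if j == i then b else k%:R)).
  apply: bigcupT_measurable => k; apply: sub_sigma_algebra.
  by eexists; eexists.
apply/seteqP; split=> [x|x [k _] /(_ i)]; last by rewrite !mxE eqxx /= in_itv/=.
rewrite /= in_itv/= => h; pose k := Num.truncn `|x|; exists k.+1 => // j.
rewrite !mxE; case: ifPn => [/eqP ->//|_].
have : `|x 0 j| < k.+1%:R by apply: le_lt_trans (rV_coord_le_norm x j) _; exact: truncnS_gt.
by rewrite ltr_norml.
Qed.

End boxes_generate.

Section du_bois_reymond.
Context (R : realType) (N : nat).
Local Notation rV := 'rV[R]_N.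
Local Notation leb := (lebesgue_rV R N).
Variables (Om : set rV) (oOm : open Om) (mOm : measurable Om) (Omoo : (leb Om < +oo)%E).
Local Notation nu := (mfrestr mOm Omoo).

Variables (f : rV -> R) (fi : ig nu f).
Hypothesis f0 : forall phi, Cc_infty Om phi -> RI nu (fun x => f x * phi x) = 0.

Let mf : measurable_fun setT f := ig_meas fi.

(* The indicator of the open box is the limit of min (k bump) 1, itself a limit of
   combinations of softplus functions of the bump. *)
Lemma dbr_box (a b : rV) : cbox a b `<=` Om -> RI nu (fun x => f x * \1_(obox a b) x) = 0.
Proof.
move=> abO; have tb := bump_test abO; set be := bump a b in tb.
have mbe : measurable_fun setT be by exact: meas_continuous (smooth_continuous (Cc_smooth tb)).
have [K [K0 bK]] : exists K, 0 <= K /\ forall x, `|be x| <= K.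
  have [_ [K K0 hK]] := Cc_bsup measurableT (subsetT _) tb.
  by exists K; split => // x; apply: le_trans (hK x) _; rewrite indicT mulr1.
have be0 x : 0 <= be x by exact: bump_ge0.
have rel k : 0 <= k -> RI nu (fun x => f x * relu k (be x)) = 0.
  move=> k0; have ml n : measurable_fun setT (fun x => f x * softplus n k (be x)).
    apply: measurable_funM => //.
    exact: meas_continuous (smooth_continuous (Cc_smooth (Cc_softplus n k tb))).
  have mr : measurable_fun setT (fun x => f x * relu k (be x)).
    apply: measurable_funM => //; apply: measurable_funB => //.
    by apply: measurable_maxr => //; exact: measurable_funB.
  apply: (RI_dct_zero ml mr _ (igZ K (ig_norm fi))) => [|n x|n].
  - by apply: aeW => x; apply: cvgMr; exact: cvg_softplus.
  - rewrite normrM mulrC ler_wpM2r//; exact: le_trans (softplus_le _ _ _) (bK x).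
  - by apply: f0; exact: Cc_softplus.
have mr k : measurable_fun setT (fun x => relu k (be x)).
  by apply: measurable_funB => //; apply: measurable_maxr => //; exact: measurable_funB.
have irel k : ig nu (fun x => f x * relu k (be x)).
  apply: (ig_le _ _ (igZ K (ig_norm fi))); first exact: measurable_funM.
  move=> x; rewrite normrM mulrC ler_wpM2r//; apply: le_trans (bK x).
  by have := relu_lip k (be x) 0; rewrite /relu subr0 sub0r subrr !subr0.
pose s (n : nat) x := f x * (n.+1%:R * (relu 0 (be x) - relu n.+1%:R^-1 (be x))).
have ms n : measurable_fun setT (s n).
  apply: measurable_funM => //; apply: measurable_funM => //; exact: measurable_funB.
have m1 : measurable_fun setT (fun x => f x * \1_(obox a b) x).
  by apply: measurable_funM => //; apply: measurable_indic; exact: measurable_obox.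
apply: (RI_dct_zero ms m1 _ (ig_norm fi)) => [|n x|n].
- apply: aeW => x; apply: cvgMr; have := cvg_relu_indic (be0 x).
  rewrite indicE; suff -> : (0 < be x) = (x \in obox a b) by [].
  by apply/idP/idP; [move=> /bump_gt0 h; rewrite inE|rewrite inE => /bump_gt0].
- rewrite /s normrM ler_piMr//.
  have n0 : 0 < n.+1%:R :> R by [].
  have c0 : 0 < n.+1%:R^-1 :> R by rewrite invr_gt0.
  rewrite normrM (ger0_norm (ltW n0)).
  apply: le_trans (ler_wpM2l (ltW n0) (reluB_le c0 (be0 x))) _.
  by rewrite mulfV// gt_eqF.
- rewrite (RI_eq _ (g := fun x => n.+1%:R *
    (f x * relu 0 (be x) - f x * relu n.+1%:R^-1 (be x)))) => [|x]; last by rewrite /s; ring.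
  by rewrite RIZ ?RIB ?rel ?subrr ?mulr0//; exact: igB.
Qed.

(** Dynkin's argument: the sets A with this property form a lambda-system, and the open boxes are
    stable under intersection and generate the sigma-algebra. *)
Lemma dbr_set (a b : rV) A : cbox a b `<=` Om -> measurable A ->
  RI nu (fun x => f x * \1_(A `&` obox a b) x) = 0.
Proof.
move=> abO mA; pose H : set (set rV) :=
  [set A | measurable A /\ RI nu (fun x => f x * \1_(A `&` obox a b) x) = 0].
suff HA : @measurable _ rV `<=` H by have [] := HA _ mA.
have mU := measurable_obox a b.
have i1 B : measurable B -> ig nu (fun x => f x * \1_(B `&` obox a b) x).
  move=> mB; have m1 : measurable_fun setT (\1_(B `&` obox a b) : rV -> R).
    exact/measurable_indic/measurableI.
  apply: (ig_le _ _ (ig_norm fi)); first exact: measurable_funM.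
  by move=> x; rewrite normrM ler_piMr// indicE; case: (_ \in _); rewrite ?normr1 ?normr0.
apply: subset_trans (@measurable_oboxes R N) _.
apply: (lambda_system_subset (@oboxesI R N)) => //.
- split => //.
  + split => //; rewrite setTI; exact: dbr_box.
  + move=> B B' sub [mB HB] [mB' HB']; split; first exact: measurableD.
    rewrite (RI_eq _ (g := fun x => f x * \1_(B `&` obox a b) x - f x * \1_(B' `&` obox a b) x)).
      by rewrite RIB ?HB ?HB' ?subrr//; exact: i1.
    move=> x; rewrite -mulrBr; congr (_ * _); rewrite !indicE [x \in (_ `\` _) `&` _]in_setI in_setD !in_setI.
    case: (x \in obox a b); last by rewrite !andbF subrr.
    rewrite !andbT; have [|_] := boolP (x \in B'); last by rewrite andbT subr0.
    by rewrite inE => /sub/mem_set ->; rewrite andbF subrr.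
  + move=> F ndF HF; have mF : measurable (\bigcup_k F k).
      by apply: bigcupT_measurable => k; have [] := HF k.
    split => //; apply: (@RI_dct_zero _ _ _ nu (fun k x => f x * \1_(F k `&` obox a b) x)
      (fun x => f x * \1_((\bigcup_k F k) `&` obox a b) x) (fun x => `|f x|)).
    * by move=> k; have [mFk _] := HF k; exact: ig_meas (i1 _ mFk).
    * exact: ig_meas (i1 _ mF).
    * apply: aeW => x; apply: cvgMr; apply: cvg_near_cst.
      have [[k _ Fk]|nF] := pselect ((\bigcup_k F k) x).
        exists k => // m /= km; rewrite !indicE !in_setI.
        have -> : (x \in F m) by apply: mem_set; move: Fk; exact/subsetPset/ndF.
        by have -> : (x \in \bigcup_k F k) by apply: mem_set; exists k.
      exists 0%N => // m _; rewrite !indicE !in_setI (memNset nF) memNset//.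
      by move=> Fm; apply: nF; exists m.
    * exact: ig_norm.
    * by move=> k x; rewrite normrM ler_piMr// indicE; case: (_ \in _); rewrite ?normr1 ?normr0.
    * by move=> k; have [] := HF k.
- move=> _ [a' [b' ->]]; split; first exact: measurable_obox.
  have [a'' [b'' [-> sub]]] := oboxI a' b' a b.
  exact: dbr_box (subset_trans sub abO).
Qed.

(** On a box, the set where f > 0 and then the set where - f > 0 may be taken as A, which gives f =
    0 almost everywhere there. Countably many rational boxes cover the domain. *)
Lemma dbr : {ae nu, forall x, f x = 0}.
Proof.
have box0 (a b : rV) : cbox a b `<=` Om -> {ae nu, forall x, obox a b x -> f x = 0}.
  move=> abO.
  have sgn (g : rV -> R) : (forall A, measurable A -> RI nu (fun x => g x * \1_(A `&` obox a b) x) = 0) ->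
      ig nu g -> {ae nu, forall x, obox a b x -> g x <= 0}.
    move=> h ig_; have mA : measurable [set x | 0 < g x].
      have := ig_meas ig_ measurableT (measurable_itv `]0, +oo[); rewrite setTI.
      by congr measurable; apply/seteqP; split=> x; rewrite /= in_itv/= andbT.
    have mU := measurableI _ _ mA (measurable_obox a b).
    have g0 x : 0 <= g x * \1_([set x | 0 < g x] `&` obox a b) x.
      rewrite indicI /= !indicE; have [|_] := boolP (x \in _); last by rewrite mul0r mulr0.
      by rewrite inE /= => gx; rewrite mul1r mulr_ge0// ltW.
    have i1 : ig nu (fun x => g x * \1_([set x | 0 < g x] `&` obox a b) x).
      apply: (ig_le _ _ (ig_norm ig_)).
        by apply: measurable_funM; [exact: ig_meas ig_|exact: measurable_indic].
      by move=> x; rewrite normrM ler_piMr// indicE; case: (_ \in _); rewrite ?normr1 ?normr0.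
    have := RI_eq0 g0 i1 (h _ mA); apply: filterS => x e ox; rewrite leNgt; apply/negP => gx; move: e.
    by rewrite indicE mem_set// mulr1 => e; rewrite e ltxx in gx.
  have h1 := sgn f (fun A => dbr_set abO) fi.
  have h2 : {ae nu, forall x, obox a b x -> - f x <= 0}.
    apply: sgn (igN fi) => A mA; rewrite (RI_eq _ (g := fun x => -1 * (f x * \1_(A `&` obox a b) x))).
      rewrite RIZ ?dbr_set ?mulr0//; apply: (ig_le _ _ (ig_norm fi)).
        by apply: measurable_funM => //; apply/measurable_indic/measurableI => //; exact: measurable_obox.
      by move=> x; rewrite normrM ler_piMr// indicE; case: (_ \in _); rewrite ?normr1 ?normr0.
    by move=> x; ring.
  apply: filterS2 h1 h2 => x h1 h2 ox; apply/eqP; rewrite eq_le h1//=.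
  by rewrite -oppr_le0 h2.
(* The boxes are enumerated by natural numbers, since a countable intersection of almost everywhere
   statements is available over nat. *)
have cov k : {ae nu, forall x, forall p : 'rV[rat]_N * 'rV[rat]_N, unpickle k = Some p ->
    cbox (rat_rV R p.1) (rat_rV R p.2) `<=` Om -> obox (rat_rV R p.1) (rat_rV R p.2) x -> f x = 0}.
  case e : (unpickle k) => [p|]; last by apply: aeW => x p.
  have [s|ns] := pselect (cbox (rat_rV R p.1) (rat_rV R p.2) `<=` Om).
    by have := box0 _ _ s; apply: filterS => x h _ [<-] _.
  by apply: aeW => x _ [<-].
have /ae_foralln h := cov.
apply/ae_mfrestr; move/ae_mfrestr : h; apply: filterS => x h Ox.
have [p [px pO]] := open_rat_box oOm Ox.
exact: (h Ox (pickle p) p (pickleK p)).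
Qed.

End du_bois_reymond.

(** * Sobolev space of the domain *)

Section Lebesgue_spaces.
Context d (T : measurableType d) (R : realType) (mu : {measure set T -> \bar R}).
Implicit Types (f : T -> R).

Lemma Lfun_powP f (r : R) : 1 <= r ->
  (f \in Lfun mu r%:E) <-> measurable_fun setT f /\ ig mu (fun x => `|f x| `^ r).
Proof.
move=> r1; split=> [h|[mf /integrableP[_ fi]]].
  split; last exact: Lfun_integrable.
  by move: h; rewrite inE/= => /andP[]; rewrite inE.
apply/andP; split; rewrite inE//= /finite_norm unlock /Lnorm poweR_lty//.
move: fi; congr (_ < _)%E; apply: eq_integral => x _.
by rewrite /= ger0_norm// powR_ge0.
Qed.

Lemma Lfun2P f : (f \in Lfun mu 2%:E) <-> L2 mu f.
Proof.
have e : (fun x => `|f x| `^ 2) = (fun x => f x ^+ 2).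
  by apply/funext => x; rewrite powR_mulrn// real_normK// num_real.
by rewrite Lfun_powP ?ler1n// e.
Qed.

Lemma Lfun_inftyP f : (f \in Lfun mu +oo%E) <->
  measurable_fun setT f /\ exists M : R, {ae mu, forall x, `|f x| <= M}.
Proof.
split=> [/andP[]|[mf [M fM]]].
  rewrite !inE /= => mf; rewrite /finite_norm unlock /Lnorm.
  case: ifPn => [mu0 h|].
    split => //; have /ess_supP fs := lexx (ess_sup mu (abse \o (EFin \o f))).
    exists (fine (ess_sup mu (abse \o (EFin \o f)))); apply: filterS fs => x /= fx.
    rewrite -lee_fin fineK// ge0_fin_numE//; exact: le_trans fx.
  (* The whole space is null here, and any bound holds almost everywhere. *)
  rewrite -leNgt => mu0 _; split => //; exists 0.
  exists setT; split => //; apply/eqP; rewrite eq_le mu0 measure_ge0//.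
apply/andP; split; rewrite inE//= /finite_norm unlock /Lnorm; case: ifPn => // _.
apply: (@le_lt_trans _ _ M%:E); last exact: ltry.
by apply/ess_supP; apply: filterS fM => x /=; rewrite lee_fin.
Qed.

End Lebesgue_spaces.

Lemma L2_ig1 d (T : measurableType d) (R : realType) (nu : {finite_measure set T -> \bar R})
  (u : T -> R) : L2 nu u -> ig nu u.
Proof.
move=> u2; have c2 : L2 nu (fun=> 1) by apply: (@L2_bounded _ _ _ _ 1) => // x; rewrite normr1.
by have := L2_mul u2 c2; apply: ig_eq => x; rewrite mulr1.
Qed.

Section sobolev_bridge.
Context (R : realType) (N : nat).
Local Notation rV := 'rV[R]_N.
Local Notation leb := (lebesgue_rV R N).
Variables (Om : set rV) (oOm : open Om) (mOm : measurable Om) (Omoo : (leb Om < +oo)%E).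
Variables (L : R) (L0 : 0 <= L) (OmL : Om `<=` box L).
Implicit Types (u v phi : rV -> R) (p g : rV -> rV).

Local Notation nu := (mfrestr mOm Omoo).
Local Notation T0 := (test_pair Om).
Local Notation meas := (measurable_fun [set: rV]).

Let core := energy_core_test mOm Omoo OmL.

Lemma restrE u x : Om x -> (u \_ Om) x = u x.
Proof. by move=> Ox; rewrite patchE mem_set. Qed.

Lemma restr_out u x : ~ Om x -> (u \_ Om) x = 0.
Proof. by move=> Ox; rewrite patchE memNset. Qed.

Lemma meas_restr u : meas u -> meas (u \_ Om).
Proof. by move=> mu; apply/(measurable_restrictT _ mOm); exact: measurable_funTS. Qed.

Lemma Rint_restr u v : meas v -> (forall x, Om x -> u x = v x) ->
  \int[leb]_(x in Om) u x = RI nu v.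
Proof.
move=> mv uv; rewrite RI_mfrestr//; apply: eq_Rintegral => x; rewrite inE.
exact: uv.
Qed.

Lemma Eint_restr u v : ig nu v -> (forall x, Om x -> u x = v x) ->
  (\int[leb]_(x in Om) (u x)%:E = (RI nu v)%:E)%E.
Proof.
move=> vi uv; have mv : measurable_fun setT (EFin \o v) by exact: measurable_int vi.
rewrite RIE// (integral_mfrestr mOm Omoo mv).
by apply: eq_integral => x; rewrite inE => Ox; rewrite uv.
Qed.

Lemma ae_restr (P : rV -> Prop) : (forall x, Om x -> P x) -> {ae nu, forall x, P x}.
Proof. by move=> h; apply/ae_mfrestr; apply: aeW. Qed.

Lemma ig_restr_out u : meas u -> (forall x, ~ Om x -> u x = 0) -> ig nu u <-> ig leb u.
Proof.
move=> mu u0; rewrite ig_mfrestr// /ig integrable_mkcond//.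
suff -> : (EFin \o u) \_ Om = EFin \o u by [].
apply/funext => x; rewrite patchE; case: ifPn => // /negP nx /=.
by rewrite u0// => Ox; apply: nx; rewrite inE.
Qed.

Lemma Lp2P u : Lp Om 2%:E u <-> L2 nu (u \_ Om).
Proof.
rewrite /Lp /= Lfun2P /L2; split=> -[mu ui]; split => //.
  apply/ig_restr_out => //; first exact: measurable_funX.
  by move=> x nx; rewrite restr_out// expr0n.
apply/ig_restr_out => //; first exact: measurable_funX.
by move=> x nx; rewrite restr_out// expr0n.
Qed.

Lemma Lp_inftyP u : Lp Om +oo%E u <->
  meas (u \_ Om) /\ exists M : R, {ae nu, forall x, `|(u \_ Om) x| <= M}.
Proof.
rewrite /Lp /= Lfun_inftyP; split=> -[mu [M uM]]; split => //.
  by exists M; apply/ae_mfrestr; apply: filterS uM.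
exists `|M|; move/ae_mfrestr : uM; apply: filterS => x h.
have [/h Ox|nx] := pselect (Om x); first exact: le_trans Ox (ler_norm _).
by rewrite restr_out// normr0.
Qed.

Definition restrv p : rV -> rV := fun x => \row_i ((fun y => p y 0 i) \_ Om) x.

Lemma restrvE p x : Om x -> restrv p x = p x.
Proof. by move=> Ox; apply/rowP => i; rewrite mxE restrE. Qed.

Definition weak_pair u p := L2v nu p /\ forall i phi, Cc_infty Om phi ->
  RI nu (fun x => u x * 'D_(e_ i) phi x) = - RI nu (fun x => p x 0 i * phi x).

Lemma test_meas phi : Cc_infty Om phi -> meas phi.
Proof. by move=> h; exact: meas_continuous (smooth_continuous (Cc_smooth h)). Qed.

Lemma test_L2 phi : Cc_infty Om phi -> L2 nu phi.
Proof. by move=> h; exact: L2_bsup (Cc_bsup (measurable_box L) OmL h). Qed.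

Lemma is_weak_gradP u p : Lp Om 2%:E u -> is_weak_grad Om u p <-> weak_pair (u \_ Om) (restrv p).
Proof.
move=> /Lp2P [mu _].
have e1 i phi : Cc_infty Om phi -> \int[leb]_(x in Om) (u x * 'D_(e_ i) phi x) =
    RI nu (fun x => (u \_ Om) x * 'D_(e_ i) phi x).
  move=> h; apply: Rint_restr => [|x Ox]; last by rewrite restrE.
  by apply: measurable_funM => //; exact: test_meas (Cc_derive i h).
have e2 i phi : meas ((fun y => p y 0 i) \_ Om) -> Cc_infty Om phi ->
    \int[leb]_(x in Om) (p x 0 i * phi x) = RI nu (fun x => restrv p x 0 i * phi x).
  move=> mp h; apply: Rint_restr => [|x Ox]; last by rewrite restrvE.
  apply: measurable_funM; last exact: test_meas.
  by under eq_fun do rewrite mxE.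
have e3 i : Lp Om 2%:E (fun x => p x 0 i) <-> L2 nu (fun x => restrv p x 0 i).
  rewrite Lp2P; split; apply: L2_ext => x; by rewrite mxE.
split=> [h|[h1 h2] i].
  split=> [i|i phi tphi]; first by have [/e3] := h i.
  have [/Lp2P[mp _] /(_ phi tphi)] := h i.
  by rewrite e1// e2.
split=> [|phi tphi]; first exact/e3.
have /e3/Lp2P[mp _] := h1 i.
by rewrite e1// e2//; exact: h2.
Qed.

Lemma test_parts i phi psi : Cc_infty Om phi -> Cc_infty Om psi ->
  RI nu (fun x => psi x * 'D_(e_ i) phi x) = - RI nu (fun x => grad psi x 0 i * phi x).
Proof.
move=> h h'; have sphi := Cc_smooth h; have spsi := Cc_smooth h'.
have h2 := Cc_mull spsi h.
have := Cc_integral_derive i L0 OmL h2.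
have i1 : ig nu (fun x => psi x * 'D_(e_ i) phi x).
  by apply: L2_mul; [exact: test_L2|exact: test_L2 (Cc_derive i h)].
have i2 : ig nu (fun x => phi x * 'D_(e_ i) psi x).
  by apply: L2_mul; [exact: test_L2|exact: test_L2 (Cc_derive i h')].
rewrite -(RI_test_patch mOm Omoo); last 2 first.
- exact: test_meas (Cc_derive i h2).
- by move=> x nx; rewrite (test_out (Cc_derive i h2) nx).
rewrite (RI_eq _ (fun x => derive_mul i x spsi sphi)) RID// => /eqP; rewrite addr_eq0 => /eqP ->.
by congr (- _); apply: RI_eq => x; rewrite mxE mulrC.
Qed.

(** Integration by parts holds for test functions. The defect for (u, g) is therefore an integral of
    the approximation error against fixed functions, and its square is shown to be at most any e >
    0. *)
Lemma H0_weak_pair u g : H0 nu T0 u g -> weak_pair u g.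
Proof.
move=> ug; have [u2 g2 app] := ug; split => // i phi tphi.
set D := 'D_(e_ i) phi; have D2 : L2 nu D := test_L2 (Cc_derive i tphi).
have phi2 := test_L2 tphi.
apply/eqP; rewrite -addr_eq0; apply/eqP.
set c := _ + _; suff : c ^+ 2 <= 0.
  by move=> c0; apply/eqP; rewrite -sqrf_eq0 eq_le c0 sqr_ge0.
set A := RI nu (fun x => D x ^+ 2); set B := RI nu (fun x => phi x ^+ 2).
have A0 : 0 <= A by exact: RI_sqr_ge0.
have B0 : 0 <= B by exact: RI_sqr_ge0.
apply/ler_addgt0Pr => e e0; rewrite add0r.
(* By the Cauchy-Schwarz inequality the squared defect is at most 2 (A + B) times the squared
   distance. *)
have d0 : 0 < e / (2 * (A + B + 1)) by rewrite divr_gt0//; lra.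
have [psi [_ [[tpsi ->] le]]] := app _ d0.
have psi2 := test_L2 tpsi; have Dpsi2 := test_L2 (Cc_derive i tpsi).
have dp2 : L2 nu (fun x => grad psi x 0 i) by apply: L2_ext Dpsi2 => x; rewrite mxE.
have d1 := L2B u2 psi2; have d2 := L2B (g2 i) dp2.
have cE : c = RI nu (fun x => (u x - psi x) * D x) +
    RI nu (fun x => (g x 0 i - grad psi x 0 i) * phi x).
  rewrite (RI_eq _ (g := fun x => u x * D x - psi x * D x)) => [|x]; last exact: mulrBl.
  rewrite [X in _ = _ + X](RI_eq _ (g := fun x => g x 0 i * phi x - grad psi x 0 i * phi x))
    => [|x]; last exact: mulrBl.
  rewrite !RIB; try exact: L2_mul.
  by rewrite (test_parts i tphi tpsi) /c; ring.
have := RI_CS d1 D2; have := RI_CS d2 phi2; rewrite -/A -/B.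
have s1 := RI_sqr_ge0 nu (fun x => u x - psi x).
have s2 := RI_sqr_ge0 nu (fun x => g x 0 i - grad psi x 0 i).
have s3 : RI nu (fun x => (g x 0 i - grad psi x 0 i) ^+ 2) <= nrm2 nu (fun x => g x - grad psi x).
  apply: RI_le; [by case: d2|exact: (L2v_dot (L2vB g2 (core_L2 core (conj tpsi erefl)).2)
    (L2vB g2 (core_L2 core (conj tpsi erefl)).2))|].
  by move=> x; have := dotp_coord (g x - grad psi x) i; rewrite !mxE.
move: le; rewrite /dist2 cE.
move: s1 s2 s3; set a := RI nu (fun x => (u x - psi x) ^+ 2).
set b := RI nu (fun x => (g x 0 i - _) ^+ 2).
set X := RI nu (fun x => (u x - psi x) * D x).
set Y := RI nu (fun x => (g x 0 i - _) * phi x).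
move: (nrm2 _ _) => m s1 s2 s3 le cs2 cs1.
have key : 2 * (A + B + 1) * (a + m) <= e.
  by move: le; rewrite ler_pdivlMr 1?mulrC//; lra.
have sq : (X + Y) ^+ 2 <= 2 * X ^+ 2 + 2 * Y ^+ 2 by have := sqr_ge0 (X - Y); lra.
apply: le_trans sq _; apply: le_trans key.
have h1 : 0 <= a * B by exact: mulr_ge0.
have h2 : 0 <= (m - b) * B by rewrite mulr_ge0// subr_ge0.
have h3 : 0 <= m * A by rewrite mulr_ge0// (le_trans s2).
lra.
Qed.

(** This makes the gradient chosen by [wgrad] interchangeable with any other, coordinate by
    coordinate through [dbr]. *)
Lemma weak_pair_unique u p g : weak_pair u p -> weak_pair u g -> {ae nu, forall x, p x = g x}.
Proof.
move=> [p2 hp] [g2 hg].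
have h i : {ae nu, forall x, p x 0 i - g x 0 i = 0}.
  apply: (@dbr R N Om oOm mOm Omoo (fun x => p x 0 i - g x 0 i)).
    exact: L2_ig1 (L2B (p2 i) (g2 i)).
  move=> phi tphi; rewrite (RI_eq _ (g := fun x => p x 0 i * phi x - g x 0 i * phi x)) => [|x]; last exact: mulrBl.
  rewrite RIB; [|by apply: L2_mul => //; exact: test_L2..].
  by have := hp i phi tphi; rewrite hg// => /oppr_inj ->; rewrite subrr.
have : {ae nu, forall x, forall i, p x 0 i - g x 0 i = 0} by apply: filter_forall.
apply: filterS => x hx; apply/rowP => i.
by apply/eqP; rewrite -subr_eq0 hx.
Qed.

Lemma H1_wgrad u : H1 Om u -> weak_pair (u \_ Om) (restrv (wgrad Om u)).
Proof. by move=> [u2 [g ug]]; apply/is_weak_gradP => //; by apply: xgetPex; exists g. Qed.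

Lemma H10_dist u p phi : L2 nu (u \_ Om) -> L2v nu (restrv p) -> Cc_infty Om phi ->
  (\int[leb]_(x in Om) ((u x - phi x) ^+ 2 +
     dotp (p x - grad phi x) (p x - grad phi x))%:E =
   (dist2 nu (u \_ Om) (restrv p) phi (grad phi))%:E)%E.
Proof.
move=> u2 p2 h; have [phi2 dphi2] := core_L2 core (conj h erefl : T0 phi (grad phi)).
have i1 := (L2B u2 phi2).2; have i2 := L2v_dot (L2vB p2 dphi2) (L2vB p2 dphi2).
rewrite /dist2 /nrm2 -RID//; apply: Eint_restr => [|x Ox]; first exact: igD.
by rewrite restrE// restrvE.
Qed.

Lemma H10_H0 u : H10 Om u -> H0 nu T0 (u \_ Om) (restrv (wgrad Om u)).
Proof.
move=> [h1 [phi [tphi cv]]]; have [p2 _] := H1_wgrad h1.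
have u2 : L2 nu (u \_ Om) by case: h1 => /Lp2P.
split => // e e0; move: cv => /fine_cvgP[_] /cvgrPdist_le /(_ e e0) [m _ /(_ m (leqnn m))] /=.
rewrite H10_dist// sub0r normrN ger0_norm ?dist2_ge0// => le.
by exists (phi m), (grad (phi m)).
Qed.

(** By uniqueness [wgrad] agrees almost everywhere with [g] on the domain, so test functions that
    approximate the pair (u, g) also approximate [u] in the sense of [H10]. *)
Lemma H0_H10 u g : H0 nu T0 u g ->
  H10 Om u /\ {ae nu, forall x, restrv (wgrad Om u) x = g x}.
Proof.
move=> ug; have [u2 g2 _] := ug.
have mru : meas (u \_ Om) by exact: meas_restr u2.1.
have rg i : meas (fun x => restrv g x 0 i).
  by under eq_fun do rewrite mxE; exact: meas_restr (g2 i).1.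
have ug' : H0 nu T0 (u \_ Om) (restrv g).
  apply: H0_ae ug => //; first by apply: ae_restr => x Ox; rewrite restrE.
  by apply: ae_restr => x Ox; rewrite restrvE.
have lu : Lp Om 2%:E u by apply/Lp2P; exact: H0_L2 ug'.
have wg := H0_weak_pair ug'.
have h1 : H1 Om u by split => //; exists g; apply/is_weak_gradP.
have uni : {ae nu, forall x, restrv (wgrad Om u) x = restrv g x}.
  exact: weak_pair_unique (H1_wgrad h1) wg.
have uni' : {ae nu, forall x, restrv (wgrad Om u) x = g x}.
  have : {ae nu, forall x, restrv g x = g x} by apply: ae_restr => x Ox; rewrite restrvE.
  by apply: filterS2 uni => x -> ->.
split => //; split => //.
have [_ _ app] := ug'.
have /choice[phi tphi] (m : nat) : exists f : rV -> R, Cc_infty Om f /\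
    dist2 nu (u \_ Om) (restrv g) f (grad f) <= m.+1%:R^-1.
  have m0 : 0 < m.+1%:R^-1 :> R by rewrite invr_gt0.
  by have [f [_ [[tf ->] le]]] := app _ m0; exists f.
exists phi; split => [m|]; first by have [] := tphi m.
have p2 := (H1_wgrad h1).1; have u2' := H0_L2 ug'; have g2' := H0_L2v ug'.
rewrite (_ : (fun m => _) = (fun m => (dist2 nu (u \_ Om) (restrv g) (phi m) (grad (phi m)))%:E)).
  apply: cvg_EFinn; apply: (@squeeze_cvgr _ _ _ _ (fun=> 0) (fun m => m.+1%:R^-1)).
  - by apply: nearW => m; have [_ ->] := tphi m; rewrite dist2_ge0.
  - exact: cvg_cst.
  - exact: cvg_inv_nat.
apply/funext => m; have [tm _] := tphi m; rewrite H10_dist//; congr EFin.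
rewrite /dist2 /nrm2; congr (_ + _).
have [_ dphi2] := core_L2 core (conj tm erefl : T0 (phi m) (grad (phi m))).
apply: RI_ae.
- by apply: ig_meas; apply: L2v_dot; exact: L2vB.
- by apply: ig_meas; apply: L2v_dot; exact: L2vB.
- by apply: filterS uni => x ->.
Qed.

Lemma dotp_restr u v : H10 Om u -> H10 Om v ->
  \int[leb]_(x in Om) dotp (wgrad Om u x) (wgrad Om v x) =
  RI nu (fun x => dotp (restrv (wgrad Om u) x) (restrv (wgrad Om v) x)).
Proof.
move=> [hu _] [hv _]; have [p2 _] := H1_wgrad hu; have [p2' _] := H1_wgrad hv.
apply: Rint_restr => [|x Ox]; last by rewrite !restrvE.
exact: ig_meas (L2v_dot p2 p2').
Qed.

Lemma H10_normE u : H10 Om u -> H10_norm Om u = Num.sqrt (nrm2 nu (restrv (wgrad Om u))).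
Proof. by move=> hu; rewrite /H10_norm dotp_restr. Qed.

End sobolev_bridge.

(** * The Dirichlet problem *)

Section dirichlet_problem.
Context (R : realType) (n : nat).
Local Notation rV := 'rV[R]_n.+2.
Local Notation leb := (lebesgue_rV R n.+2).
Variables (Om : set rV) (oOm : open Om) (mOm : measurable Om) (Omoo : (leb Om < +oo)%E).
Variables (L : R) (L0 : 0 <= L) (OmL : Om `<=` box L).
Variables (q : R) (hq : n.+2%:R / 2 < q) (d h : rV -> R).
Hypotheses (hd : Lp Om q%:E d) (hh : Lp Om q%:E h).
Variables (mu : R) (mu0 : 0 < mu).
Hypothesis hd0 : {ae leb, forall x, Om x -> 0 <= d x}.
Implicit Types (u v w phi : rV -> R) (g eta : rV -> rV).

Local Notation nu := (mfrestr mOm Omoo).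
Local Notation T0 := (test_pair Om).
Local Notation meas := (measurable_fun [set: rV]).

Let core := energy_core_test mOm Omoo OmL.
Let rel : rellich nu T0 := rellich_test mOm Omoo L0 OmL.

Let q1 : 1 < q.
Proof. by apply: le_lt_trans hq; rewrite ler_pdivlMr// mul1r ler_nat. Qed.

(** Representatives for which the abstract hypotheses hold at every point: both are measurable on
    the whole space and vanish off the domain, and [dhat] is nonnegative everywhere. [V] dominates
    both and is at least 1, so that it controls the L2 norm as well. *)
Let hhat := h \_ Om.
Let dhat x := Num.max ((d \_ Om) x) 0.
Let V x := 1 + `|hhat x| + dhat x.

Let Lq_restr u : Lp Om q%:E u -> meas (u \_ Om) /\ ig nu (fun x => `|(u \_ Om) x| `^ q).
Proof.
move=> /(Lfun_powP _ _ (ltW q1))[mu_ ui]; split; first exact: mu_.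
apply/ig_restr_out; last exact: ui.
  by apply: meas_powR; exact: measurableT_comp.
by move=> x nx; rewrite restr_out// normr0 powR0// gt_eqF// (lt_trans ltr01 q1).
Qed.

Let mh : meas hhat. Proof. by have [] := Lq_restr hh. Qed.
Let md : meas dhat. Proof. by apply: measurable_maxr => //; have [] := Lq_restr hd. Qed.
Let d0 x : 0 <= dhat x. Proof. by rewrite /dhat le_max lexx orbT. Qed.
Let V1 x : 1 <= V x. Proof. by rewrite /V -addrA lerDl addr_ge0. Qed.
Let hV x : `|hhat x| <= V x.
Proof. by rewrite /V; have := d0 x; have := normr_ge0 (hhat x); lra. Qed.
Let dV x : dhat x <= V x.
Proof. by rewrite /V; have := d0 x; have := normr_ge0 (hhat x); lra. Qed.
Let mV : meas V.
Proof.
apply: measurable_funD => //; apply: measurable_funD => //.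
exact: measurableT_comp.
Qed.

Let dd x : dhat x <= `|(d \_ Om) x|.
Proof. by rewrite /dhat ge_max ler_norm normr_ge0. Qed.

Let iVq : ig nu (fun x => V x `^ q).
Proof.
have [_ i1] := Lq_restr hh; have [_ i2] := Lq_restr hd.
apply: (ig_le _ _ (igZ (3 `^ q) (igD (ig_cst nu 1) (igD i1 i2)))).
  exact: meas_powR.
move=> x; rewrite ger0_norm ?powR_ge0//.
have q0 : 0 <= q by rewrite ltW// (lt_trans ltr01 q1).
set a := `|hhat x|; set b := `|(d \_ Om) x|.
have a0 : 0 <= a by exact: normr_ge0.
have b0 : 0 <= b by exact: normr_ge0.
have Vle : V x <= 3 * Num.max 1 (Num.max a b).
  have := dd x; rewrite /V -/a -/b.
  have [h1|h1] := leP a b; have [h2|h2] := leP 1 _; lra.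
have V0 : 0 <= V x by apply: le_trans (V1 x).
apply: (@le_trans _ _ ((3 * Num.max 1 (Num.max a b)) `^ q)).
  by apply: ge0_ler_powR; rewrite ?nnegrE// (le_trans V0).
rewrite powRM ?le_max ?ler01//; apply: ler_wpM2l; first exact: powR_ge0.
have := powR_ge0 a q; have := powR_ge0 b q => pb pa.
have p1 : 1 `^ q = 1 :> R by rewrite powR1.
have [h1|h1] := leP a b; have [h2|h2] := leP 1 _; rewrite ?p1; lra.
Qed.

Let iV : ig nu V.
Proof.
apply: (ig_le mV _ iVq) => x; rewrite ger0_norm ?(le_trans ler01)//.
by rewrite -[leLHS]powRr1 ?(le_trans ler01)//; apply: ler_powR => //; exact: ltW.
Qed.

Let dhat_ae : {ae nu, forall x, dhat x = d x}.
Proof.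
apply/ae_mfrestr; apply: filterS hd0 => x h0 Ox; rewrite /dhat restrE//.
by rewrite max_l// h0.
Qed.

Let rhs d' h' u g phi x := (- d' x * u x + mu * dotp (g x) (g x) + h' x) * phi x.

Let meas_rhs u g phi : meas u -> L2v nu g -> meas phi -> meas (rhs dhat hhat u g phi).
Proof.
move=> mu_ g2 mphi; apply: measurable_funM => //; apply: measurable_funD => //.
apply: measurable_funD; first by apply: measurable_funM => //; exact: measurableT_comp.
by apply: measurable_funM => //; exact: ig_meas (L2v_dot g2 g2).
Qed.

Let rhs_bridge u phi u' g' phi' : H10 Om u -> H10 Om phi ->
  meas u' -> L2v nu g' -> meas phi' ->
  {ae nu, forall x, (u \_ Om) x = u' x} -> {ae nu, forall x, restrv Om (wgrad Om u) x = g' x} ->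
  {ae nu, forall x, (phi \_ Om) x = phi' x} ->
  \int[leb]_(x in Om) ((- d x * u x + mu * dotp (wgrad Om u x) (wgrad Om u x) + h x) * phi x) =
  RI nu (rhs dhat hhat u' g' phi').
Proof.
move=> hu hphi mu' g'2 mphi' e1 e2 e3.
have [u2 p2 _] := H10_H0 mOm Omoo OmL hu.
have [phi2 _ _] := H10_H0 mOm Omoo OmL hphi.
have mdr : meas (d \_ Om) by have [] := Lq_restr hd.
have m1 : meas (rhs (d \_ Om) hhat (u \_ Om) (restrv Om (wgrad Om u)) (phi \_ Om)).
  apply: measurable_funM; last by case: phi2.
  apply: measurable_funD => //; apply: measurable_funD.
    by apply: measurable_funM; [exact: measurableT_comp|case: u2].
  by apply: measurable_funM => //; exact: ig_meas (L2v_dot p2 p2).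
rewrite (Rint_restr mOm Omoo m1) => [|x Ox]; last by rewrite /rhs /hhat !restrE// restrvE.
apply: RI_ae => //; first exact: meas_rhs.
have e4 : {ae nu, forall x, (d \_ Om) x = dhat x}.
  have r1 : {ae nu, forall x, (d \_ Om) x = d x} by apply: ae_restr => x Ox; rewrite restrE.
  by apply: filterS2 r1 dhat_ae => x -> ->.
have e12 : {ae nu, forall x, (u \_ Om) x = u' x /\ restrv Om (wgrad Om u) x = g' x}.
  by apply: filterS2 e1 e2.
have e34 : {ae nu, forall x, (phi \_ Om) x = phi' x /\ (d \_ Om) x = dhat x}.
  by apply: filterS2 e3 e4.
by apply: filterS2 e12 e34 => x [h1 h2] [h3 h4]; rewrite /rhs h1 h2 h3 h4.
Qed.

(** An essentially bounded function equals its clamp almost everywhere, so the clamp is an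
    everywhere bounded representative with the same gradient. *)
Let truncated u : H10 Om u -> Lp Om +oo%E u -> exists u', [/\
  H0 nu T0 u' (restrv Om (wgrad Om u)), exists M, bounded_by M u' &
  {ae nu, forall x, (u \_ Om) x = u' x}].
Proof.
move=> hu /(Lp_inftyP mOm Omoo)[mru [M uM]]; have ug := H10_H0 mOm Omoo OmL hu.
have nM : - `|M| <= `|M| by rewrite -subr_ge0 opprK addr_ge0.
exists (fun x => clamp (- `|M|) `|M| ((u \_ Om) x)).
have e : {ae nu, forall x, (u \_ Om) x = clamp (- `|M|) `|M| ((u \_ Om) x)}.
  apply: filterS uM => x; rewrite ler_norml => /andP[h1 h2].
  have := ler_norm M; have := ler_norm (- M); rewrite normrN => h3 h4.
  by rewrite /clamp max_l ?min_l//; lra.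
split => //; last first.
  by exists `|M| => x; rewrite ler_norml; exact: clamp_itv.
apply: (H0_ae core _ _ e _ ug).
- by apply: measurable_minr => //; exact: measurable_maxr.
- by move=> i; have [] := H0_L2v ug i.
- exact: aeW.
Qed.

Lemma weak_sol_of_solution u : is_solution Om d h mu u ->
  exists u' g', weak_sol nu T0 hhat dhat mu u' g'.
Proof.
move=> [hu bu sol]; have [u' [u'g b' ae']] := truncated hu bu.
exists u', (restrv Om (wgrad Om u)); split => // phi eta pe [M pM].
have [hphi gphi] := H0_H10 oOm L0 OmL pe.
have mphi : meas phi by have [] := H0_L2 pe.
have bphi : Lp Om +oo%E phi.
  apply/(Lp_inftyP mOm Omoo); split; first exact: meas_restr.
  by exists M; apply: ae_restr => x Ox; rewrite restrE.
have := sol phi hphi bphi; rewrite (dotp_restr mOm Omoo hu hphi).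
rewrite (@rhs_bridge u phi u' (restrv Om (wgrad Om u)) phi) //; last 4 first.
- by have [] := H0_L2 u'g.
- exact: H0_L2v u'g.
- exact: aeW.
- by apply: ae_restr => x Ox; rewrite restrE.
move=> <-; apply: RI_ae.
- exact: ig_meas (L2v_dot (H0_L2v u'g) (H0_L2v pe)).
- by apply: ig_meas (L2v_dot (H0_L2v u'g) _); have [[]] := H10_H0 mOm Omoo OmL hphi.
- by apply: filterS gphi => x ->.
Qed.

Lemma solution_of_weak_sol u g : weak_sol nu T0 hhat dhat mu u g -> is_solution Om d h mu u.
Proof.
move=> [ug [M uM] sol]; have [hu gu] := H0_H10 oOm L0 OmL ug.
have mu_ : meas u by have [] := H0_L2 ug.
split => //.
  apply/(Lp_inftyP mOm Omoo); split; first exact: meas_restr.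
  by exists M; apply: ae_restr => x Ox; rewrite restrE.
move=> phi hphi bphi; have [phi' [phi'g b' ae']] := truncated hphi bphi.
rewrite (dotp_restr mOm Omoo hu hphi).
rewrite (@rhs_bridge u phi u g phi') //; last 3 first.
- exact: H0_L2v ug.
- by have [] := H0_L2 phi'g.
- by apply: ae_restr => x Ox; rewrite restrE.
rewrite -[RHS](sol _ _ phi'g b'); apply: RI_ae.
- by apply: ig_meas (L2v_dot _ (H0_L2v phi'g)); have [] := H10_H0 mOm Omoo OmL hu.
- exact: ig_meas (L2v_dot (H0_L2v ug) (H0_L2v phi'g)).
- by apply: filterS gu => x ->.
Qed.

Section with_weight.
Variables (sigma C : R) (sigma0 : 0 < sigma) (C0 : 0 <= C).
Hypothesis sw : sobolev_weight nu T0 V sigma C.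

Let quad w g := nrm2 nu g - mu * RI nu (fun x => hhat x * w x ^+ 2).

Let ig_pot w g : H0 nu T0 w g -> ig nu (fun x => hhat x * w x ^+ 2).
Proof.
move=> wg; have w2 := H0_L2w core sw V1 iV C0 wg.
by have := L2w_mul mh hV w2 w2; apply: ig_eq => x; rewrite expr2.
Qed.

Let value w : H10 Om w ->
  (\int[leb]_(x in Om) (dotp (wgrad Om w x) (wgrad Om w x) - mu * h x * w x ^+ 2)%:E =
   (quad (w \_ Om) (restrv Om (wgrad Om w)))%:E)%E.
Proof.
move=> hw; have wg := H10_H0 mOm Omoo OmL hw.
have i1 := L2v_dot (H0_L2v wg) (H0_L2v wg); have i2 := igZ mu (ig_pot wg).
rewrite /quad /nrm2 -RIZ ?(ig_pot wg)// -RIB//; apply: Eint_restr => [|x Ox]; first exact: igB.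
by rewrite restrvE// /hhat !restrE// mulrA.
Qed.

(** On functions of norm 1 the coercive bound is the constant c, so c bounds the infimum from below;
    an empty [W_] is covered, its infimum being +oo. *)
Lemma m_gt0_of_coercive (c : R) : 0 < c ->
  (forall w g, H0 nu T0 w g -> {ae nu, forall x, dhat x * w x = 0} -> c * nrm2 nu g <= quad w g) ->
  (0 < m_ Om d h mu)%E.
Proof.
move=> c0 co; apply: (@lt_le_trans _ _ c%:E); first by rewrite lte_fin.
apply: le_ereal_inf_tmp => _ [w [hw dw nw] <-]; rewrite value// lee_fin.
have wg := H10_H0 mOm Omoo OmL hw.
have n1 : nrm2 nu (restrv Om (wgrad Om w)) = 1.
  move: nw; rewrite (H10_normE mOm Omoo hw) => /(congr1 (fun s => s ^+ 2)).
  by rewrite sqr_sqrtr ?nrm2_ge0// expr1n.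
have := co _ _ wg; rewrite n1 mulr1; apply.
have e1 : {ae nu, forall x, d x * w x = 0} by apply/ae_mfrestr.
have e2 : {ae nu, forall x, (w \_ Om) x = w x} by apply: ae_restr => x Ox; rewrite restrE.
have e3 : {ae nu, forall x, dhat x = d x /\ (w \_ Om) x = w x} by apply: filterS2 dhat_ae e2.
by apply: filterS2 e1 e3 => x e [-> ->].
Qed.

(** The quadratic form is homogeneous of degree 2: dividing [w] by the square root of its energy
    gives a member of [W_], whose value is at least m_d. *)
Lemma quad_gt0_of_m w g : (0 < m_ Om d h mu)%E -> H0 nu T0 w g ->
  {ae nu, forall x, dhat x * w x = 0} -> 0 < nrm2 nu g -> 0 < quad w g.
Proof.
move=> m0 wg dw n0; set s := Num.sqrt (nrm2 nu g).
have s0 : 0 < s by rewrite sqrtr_gt0.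
have s2 : s ^+ 2 = nrm2 nu g by rewrite sqr_sqrtr// ltW.
have wg' := H0_Z core s^-1 wg.
have [hw' gw'] := H0_H10 oOm L0 OmL wg'.
set w' := (fun x => s^-1 * w x) in wg' hw' gw'.
have mw : meas w by have [] := H0_L2 wg.
have g2 := H0_L2v wg.
have nE : nrm2 nu (restrv Om (wgrad Om w')) = 1.
  rewrite /nrm2 (RI_ae _ _ (_ : {ae nu, forall x, _ = s^-1 ^+ 2 * dotp (g x) (g x)})).
  - rewrite RIZ; last exact: L2v_dot.
    by rewrite -/(nrm2 nu g) -s2 exprVn mulVf// sqrf_eq0 gt_eqF.
  - by have [_ p2 _] := H10_H0 mOm Omoo OmL hw'; exact: ig_meas (L2v_dot p2 p2).
  - by apply: measurable_funM => //; apply: ig_meas; exact: L2v_dot.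
  - by apply: filterS gw' => x ->; rewrite dotpZl dotpZr expr2 mulrA.
have W' : W_ Om d w'.
  split => //; last by rewrite (H10_normE mOm Omoo hw') nE sqrtr1.
  apply/ae_mfrestr; apply: filterS2 dw dhat_ae => x + <-.
  by rewrite /w' mulrCA => ->; rewrite mulr0.
have : (0 < (quad (w' \_ Om) (restrv Om (wgrad Om w')))%:E)%E.
  by rewrite -value//; apply: lt_le_trans m0 _; apply: ereal_inf_lbound; exists w'.
rewrite lte_fin /quad nE.
have -> : RI nu (fun x => hhat x * (w' \_ Om) x ^+ 2) = s^-1 ^+ 2 * RI nu (fun x => hhat x * w x ^+ 2).
  rewrite -RIZ ?(ig_pot wg)//; apply: RI_ae.
  - apply: measurable_funM => //; apply: measurable_funX; apply: meas_restr => //.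
    exact: measurable_funM.
  - by apply: measurable_funM => //; apply: measurable_funM => //; exact: measurable_funX.
  - by apply: ae_restr => x Ox; rewrite restrE// /w'; ring.
move=> Q; rewrite -s2; have := mulr_gt0 (exprn_gt0 2 s0) Q.
rewrite mulrBr mulr1; congr (_ < _ - _).
rewrite mulrCA; congr (_ * _).
by rewrite mulrA -exprMn mulfV ?expr1n ?mul1r// gt_eqF.
Qed.

Lemma solvable_iff_m_gt0 : (exists u, is_solution Om d h mu u) <-> (0 < m_ Om d h mu)%E.
Proof.
split=> [[u /weak_sol_of_solution[u' [g' sol]]]|m0].
  have [c c0 co] := weak_sol_coercive core sw V1 iV C0 sigma0 mu0 mh hV md sol.
  exact: m_gt0_of_coercive c0 co.
have [u [g sol]] := weak_sol_of_kernel_pos core rel sw V1 iV C0 sigma0 mu0 mh hV md d0 dV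
  (fun w g wg dw n0 => quad_gt0_of_m m0 wg dw n0).
by exists u; exact: solution_of_weak_sol sol.
Qed.

End with_weight.

Lemma dirichlet_solvable_iff : (exists u, is_solution Om d h mu u) <-> (0 < m_ Om d h mu)%E.
Proof.
have [sigma sigma0 [C C0 sw]] := sobolev_weight_test L0 OmL hq mV V1 iVq.
exact: (solvable_iff_m_gt0 sigma0 C0 sw).
Qed.

End dirichlet_problem.

Theorem theorem1p1 (R : realType) (N : nat) (hN : (2 <= N)%N)
  (Omega : set 'rV[R]_N)
  (hdom : domain Omega) (hbounded : bounded_set Omega)
  (hlip : boundary_C01 Omega)
  (q : R) (hq : N%:R / 2 < q)
  (d h : 'rV[R]_N -> R)
  (hd : Lp Omega q%:E d) (hh : Lp Omega q%:E h)
  (mu : R) (hmu : 0 < mu)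
  (hd0 : {ae lebesgue_rV R N, forall x, Omega x -> 0 <= d x}) :
  (exists u, is_solution Omega d h mu u) <-> (0 < m_ Omega d h mu)%E.
Proof.
case: N hN Omega hdom hbounded hlip hq d h hd hh hd0 => [|[|n]]// _ Om [_ oOm _] bOm _ hq d h hd hh hd0.
have mOm := measurable_open oOm.
have [L L0 OmL] := bounded_sub_box bOm.
have Omoo : (lebesgue_rV R n.+2 Om < +oo)%E.
  apply: (@le_lt_trans _ _ (lebesgue_rV R n.+2 (box L))); last exact: box_lty.
  by apply: le_measure => //; rewrite inE//; exact: measurable_box.
exact: (dirichlet_solvable_iff oOm mOm Omoo L0 OmL hq hd hh hmu hd0).
Qed.
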